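(* Let $\mathcal{A}$ be a computable Archimedean real closed ordered field, and let $K$ be the class of Archimedean real closed ordered fields. (1) If the transcendence degree of $\mathcal{A}$ (over $\mathbb{Q}$) is $0$, i.e. $\mathcal{A}$ is isomorphic to the ordered field of real algebraic numbers, then $I(\mathcal{A})$ is $m$-complete $\Pi^0_2$ within $K$. (2) If the transcendence degree is finite but not $0$, then $I(\mathcal{A})$ is $m$-complete $d$-$\Sigma^0_2$ within $K$. (3) If the transcendence degree is infinite, then $I(\mathcal{A})$ is $m$-complete $\Pi^0_3$ within $K$.
   Context: Structures have universes contained in $\omega$ and are identified with their atomic diagrams; $\mathcal{A}$ is computable if its atomic diagram $D(\mathcal{A})$ is computable. An index for a computable structure $\mathcal{A}$ is a number $a$ such that the $a$-th unary partial computable function equals $\chi_{D(\mathcal{A})}$. $I(\mathcal{A})$ is the set of indices of computable structures isomorphic to $\mathcal{A}$; $I(K)$ is the set of indices of computable members of $K$. For a complexity class $\Gamma$, $I(\mathcal{A})$ is $\Gamma$ within $K$ if $I(\mathcal{A})=R\cap I(K)$ for some $R\in\Gamma$, and $m$-complete $\Gamma$ within $K$ if moreover for every $S\in\Gamma$ there is a computable $f:\omega\to I(K)$ with $n\in S$ iff $f(n)\in I(\mathcal{A})$. A set is $d$-$\Sigma^0_2$ if it has the form $S_1-S_2$ with $S_1,S_2\in\Sigma^0_2$. *)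

(* Defs.v *)
From HB Require Import structures.
From mathcomp Require Import all_boot all_order all_algebra.
From mathcomp Require Import mpoly.
Set Implicit Arguments. Unset Strict Implicit. Unset Printing Implicit Defensive.
Import Order.TTheory GRing.Theory Num.Theory.

Inductive prf : Type :=
| PZero
| PSucc
| PProj of nat
| PComp of prf & list prf
| PRec of prf & prf
| PMu of prf.

Inductive eval : prf -> seq nat -> nat -> Prop :=
| ev_zero l : eval PZero l 0
| ev_succ x l : eval PSucc (x :: l) x.+1
| ev_proj i l : eval (PProj i) l (nth 0 l i)
| ev_comp f gs l ys y :
    evals gs l ys -> eval f ys y -> eval (PComp f gs) l y
| ev_rec0 f g l y : eval f l y -> eval (PRec f g) (0 :: l) y
| ev_recS f g n l z y :
    eval (PRec f g) (n :: l) z -> eval g (n :: z :: l) y ->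
    eval (PRec f g) (n.+1 :: l) y
| ev_mu f l n :
    eval f (n :: l) 0 ->
    (forall m, m < n -> exists k, eval f (m :: l) k.+1) ->
    eval (PMu f) l n
with evals : seq prf -> seq nat -> seq nat -> Prop :=
| evs_nil l : evals [::] l [::]
| evs_cons g gs l y ys : eval g l y -> evals gs l ys -> evals (g :: gs) l (y :: ys).

Fixpoint prf_enc (p : prf) : GenTree.tree nat :=
  match p with
  | PZero => GenTree.Node 0 [::]
  | PSucc => GenTree.Node 1 [::]
  | PProj i => GenTree.Node 2 [:: GenTree.Leaf i]
  | PComp f gs => GenTree.Node 3 (prf_enc f :: map prf_enc gs)
  | PRec f g => GenTree.Node 4 [:: prf_enc f; prf_enc g]
  | PMu f => GenTree.Node 5 [:: prf_enc f]
  end.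

(* Acceptable numbering: e is an index of the code p iff e = pickle (prf_enc p);
   numbers that are not codes index the empty function.
   [phi e n y] means: the e-th unary partial computable function converges on n
   with value y. *)
Definition phi (e n y : nat) : Prop :=
  exists p : prf, pickle (prf_enc p) = e /\ eval p [:: n] y.

Definition computable_fun (f : nat -> nat) : Prop :=
  exists e, forall n, phi e n (f n).

Definition computable_rel (P : seq nat -> Prop) : Prop :=
  exists p : prf, forall l, (P l -> eval p l 1) /\ (~ P l -> eval p l 0).

(* Sig k P : P is Sigma^0_k;  Pi^0_k relations are complements of Sigma^0_k. *)
Fixpoint Sig (k : nat) (P : seq nat -> Prop) : Prop :=
  match k with
  | 0 => computable_rel P
  | k'.+1 => exists Q : seq nat -> Prop,
      Sig k' (fun l => ~ Q l) /\ forall l, P l <-> exists x, Q (x :: l)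
  end.

Definition Sigma0 (k : nat) (S : nat -> Prop) : Prop :=
  exists P, Sig k P /\ forall n, S n <-> P [:: n].

Definition Pi0 (k : nat) (S : nat -> Prop) : Prop := Sigma0 k (fun n => ~ S n).

Definition dSigma2 (S : nat -> Prop) : Prop :=
  exists S1 S2, Sigma0 2 S1 /\ Sigma0 2 S2 /\ forall n, S n <-> (S1 n /\ ~ S2 n).

Record nstruct := NStruct {
  ndom : nat -> Prop;
  nzero : nat; none : nat;
  nadd : nat -> nat -> nat; nmul : nat -> nat -> nat; nopp : nat -> nat;
  nle : nat -> nat -> Prop }.

Definition wf_struct (M : nstruct) : Prop :=
  ndom M (nzero M) /\ ndom M (none M) /\
  (forall x y, ndom M x -> ndom M y -> ndom M (nadd M x y)) /\
  (forall x y, ndom M x -> ndom M y -> ndom M (nmul M x y)) /\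
  (forall x, ndom M x -> ndom M (nopp M x)).

Inductive term := TC of nat | T0 | T1 | TAdd of term & term
                | TMul of term & term | TOpp of term.
Inductive atom := AEq of term & term | ALe of term & term.
Inductive literal := LPos of atom | LNeg of atom.

Fixpoint term_enc (t : term) : GenTree.tree nat :=
  match t with
  | TC n => GenTree.Node 0 [:: GenTree.Leaf n]
  | T0 => GenTree.Node 1 [::]
  | T1 => GenTree.Node 2 [::]
  | TAdd t u => GenTree.Node 3 [:: term_enc t; term_enc u]
  | TMul t u => GenTree.Node 4 [:: term_enc t; term_enc u]
  | TOpp t => GenTree.Node 5 [:: term_enc t]
  end.
Definition atom_enc (a : atom) : GenTree.tree nat :=
  match a with
  | AEq t u => GenTree.Node 0 [:: term_enc t; term_enc u]
  | ALe t u => GenTree.Node 1 [:: term_enc t; term_enc u]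
  end.
Definition literal_enc (l : literal) : GenTree.tree nat :=
  match l with
  | LPos a => GenTree.Node 0 [:: atom_enc a]
  | LNeg a => GenTree.Node 1 [:: atom_enc a]
  end.
Definition literal_code (l : literal) : nat := pickle (literal_enc l).

Fixpoint term_consts_in (M : nstruct) (t : term) : Prop :=
  match t with
  | TC n => ndom M n
  | T0 | T1 => True
  | TAdd t u | TMul t u => term_consts_in M t /\ term_consts_in M u
  | TOpp t => term_consts_in M t
  end.
Definition atom_consts_in M (a : atom) : Prop :=
  match a with AEq t u | ALe t u => term_consts_in M t /\ term_consts_in M u end.
Definition literal_consts_in M (l : literal) : Prop :=
  match l with LPos a | LNeg a => atom_consts_in M a end.

Fixpoint teval (M : nstruct) (t : term) : nat :=
  match t with
  | TC n => n
  | T0 => nzero M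
  | T1 => none M
  | TAdd t u => nadd M (teval M t) (teval M u)
  | TMul t u => nmul M (teval M t) (teval M u)
  | TOpp t => nopp M (teval M t)
  end.
Definition atom_holds M (a : atom) : Prop :=
  match a with
  | AEq t u => teval M t = teval M u
  | ALe t u => nle M (teval M t) (teval M u)
  end.
Definition literal_holds M (l : literal) : Prop :=
  match l with LPos a => atom_holds M a | LNeg a => ~ atom_holds M a end.

Definition diagram (M : nstruct) (c : nat) : Prop :=
  exists l, literal_code l = c /\ literal_consts_in M l /\ literal_holds M l.

Definition index_of (a : nat) (M : nstruct) : Prop :=
  forall c, (diagram M c -> phi a c 1) /\ (~ diagram M c -> phi a c 0).

Local Open Scope ring_scope.

Definition iso_to (M : nstruct) (R : rcfType) : Prop :=
  exists f : nat -> R,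
    (forall x y, ndom M x -> ndom M y -> f x = f y -> x = y) /\
    (forall r : R, exists x, ndom M x /\ f x = r) /\
    f (nzero M) = 0 /\ f (none M) = 1 /\
    (forall x y, ndom M x -> ndom M y -> f (nadd M x y) = f x + f y) /\
    (forall x y, ndom M x -> ndom M y -> f (nmul M x y) = f x * f y) /\
    (forall x, ndom M x -> f (nopp M x) = - f x) /\
    (forall x y, ndom M x -> ndom M y -> (nle M x y <-> f x <= f y)).

Definition archimedean (R : rcfType) : Prop := forall x : R, exists n : nat, x <= n%:R.

Definition Iset (R : rcfType) (a : nat) : Prop :=
  exists M, wf_struct M /\ index_of a M /\ iso_to M R.

Definition IK (a : nat) : Prop :=
  exists M, wf_struct M /\ index_of a M /\ exists R : rcfType, archimedean R /\ iso_to M R.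

Definition in_class_within (G : (nat -> Prop) -> Prop) (IA IKs : nat -> Prop) :=
  exists Rs, G Rs /\ forall a, IA a <-> (Rs a /\ IKs a).

Definition m_complete_within (G : (nat -> Prop) -> Prop) (IA IKs : nat -> Prop) :=
  in_class_within G IA IKs /\
  forall S, G S -> exists f, computable_fun f /\ (forall n, IKs (f n)) /\
                       forall n, S n <-> IA (f n).

Definition alg_indep (R : rcfType) (n : nat) (x : 'I_n -> R) : Prop :=
  forall p : {mpoly rat[n]}, mmap (fun q : rat => ratr q) x p = 0 -> p = 0.

Definition trdeg_eq (R : rcfType) (n : nat) : Prop :=
  (exists x : 'I_n -> R, alg_indep x) /\ ~ (exists x : 'I_n.+1 -> R, alg_indep x).

Definition trdeg_infinite (R : rcfType) : Prop :=
  forall n, exists x : 'I_n -> R, alg_indep x.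

(* Main.v *)
Require Import Defs.
From HB Require Import structures.
From mathcomp Require Import all_boot all_order all_algebra.
From mathcomp Require Import mpoly.
From mathcomp Require Import boolp classical_sets reals Rstruct complex zify ring lra.
Set Implicit Arguments. Unset Strict Implicit. Unset Printing Implicit Defensive.
Import Order.TTheory GRing.Theory Num.Theory.

(* An Archimedean real closed field embeds uniquely in the reals, and two of them are isomorphic
   iff they have the same image [S], a subfield that is relatively algebraically closed ([racl]).
   So [Iset R] is the set of indices of presentations of a fixed [S].

   Upper bounds.  That an element of one presentation and one of another are different reals is
   an r.e. relation (their rational cuts differ), and so is "[y] is algebraic over [xs]".  Hence
   "same image" is Pi3 in general; if [S] is the closure of an independent tuple of length [n],
   it says that some tuple has the same cuts (Sigma2) and that no tuple of length [n + 1] is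
   independent (Pi2), the first condition being empty for [n = 0].

   Lower bounds.  Given an increasing r.e. chain of relatively closed subfields [Fs k] of a
   computable one and Sigma2 predicates [T n k], one builds, uniformly in [n], a presentation of
   the union of the [Fs k] with [T n j] for all [j < k].  Whenever the current witness for
   [T n k] is refuted, all elements promised outside [Fs k] are moved into it without changing the
   finite diagram decided so far, which is possible because a relatively closed subfield of the
   reals realises every finite diagram of a tuple of reals, the elements already in it being kept
   fixed ([transfer]).
   The chains are S < C (transcendence degree 0), acl(x_1..x_(n-1)) < S < C (degree n > 0), and
   the closures of longer and longer finite sets (infinite degree), where C is a computable proper
   extension of S ([extension]): it is generated from S and a real [tau] outside S, obtained by
   diagonalization, by fixed points of contracting polynomials, which makes all values computable
   reals, and equality of names is r.e. because the ring of names modulo provable equality turns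
   out to be integral over S(tau) and reduced. *)

(** * Computable functions on coded data *)

(** Only strict inequality of reals can be confirmed from approximations, and this shapes
    everything. Equality has to be confirmed by other means: inside a presentation by its own
    diagram, in the extension by formal proofs from ring laws, the tables of [S] and fixed-point
    equations. Algebraic reals are adjoined as fixed points because approximating these asks for no
    sign test: contraction refines any bound, and smallness of the coefficients, which guarantees
    the fixed point, is a condition that can be confirmed. Algorithms are rarely written. What has
    to be enumerated (evaluation of programs, values of terms, bounds, formal equalities, algebraic
    closure) is generated by axioms and binary rules, and [RE_clos] applies. Functions are extracted
    by search from enumerable relations that are classically total ([RE_choice]), and decidability
    comes from enumerating a set and its complement. Trees are handled as strings whose list code is
    their [pickle]. *)

Definition lcomp (k : nat) (F : seq nat -> nat) :=
  exists p, forall l, size l = k -> eval p l (F l).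

Lemma lcomp_ext k F G : (forall l, size l = k -> F l = G l) -> lcomp k F -> lcomp k G.
Proof. by move=> e [p hp]; exists p => l hl; rewrite -e //; apply: hp. Qed.

Lemma lcomp_proj k i : lcomp k (fun l => nth 0 l i).
Proof. by exists (PProj i) => l _; constructor. Qed.

Lemma lcomp_list k (gs : seq (seq nat -> nat)) :
  (forall i, i < size gs -> lcomp k (nth (fun=> 0) gs i)) ->
  exists ps, forall l, size l = k -> evals ps l (map (@^~ l) gs).
Proof.
elim: gs => [|g gs IH] h; first by exists [::] => l _; constructor.
have [|ps hps] := IH; first by move=> i hi; apply: (h i.+1).
have [p hp] := h 0 isT.
by exists (p :: ps) => l hl; constructor; [apply: hp | apply: hps].
Qed.

Lemma lcomp_comp k G (gs : seq (seq nat -> nat)) :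
  lcomp (size gs) G -> (forall i, i < size gs -> lcomp k (nth (fun=> 0) gs i)) ->
  lcomp k (fun l => G (map (@^~ l) gs)).
Proof.
move=> [p hp] /lcomp_list [ps hps]; exists (PComp p ps) => l hl.
by apply: ev_comp (hps _ hl) _; apply: hp; rewrite size_map.
Qed.

Lemma lcomp_comp1 k G F : lcomp 1 (fun l => G (nth 0 l 0)) -> lcomp k F ->
  lcomp k (fun l => G (F l)).
Proof. by move=> hG hF; apply: (@lcomp_comp k _ [:: F] hG) => -[|i] //. Qed.

Lemma lcomp_comp2 k G F1 F2 : lcomp 2 (fun l => G (nth 0 l 0) (nth 0 l 1)) ->
  lcomp k F1 -> lcomp k F2 -> lcomp k (fun l => G (F1 l) (F2 l)).
Proof. by move=> hG h1 h2; apply: (@lcomp_comp k _ [:: F1; F2] hG) => -[|[|i]] //. Qed.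

Lemma lcomp_succ k F : lcomp k F -> lcomp k (fun l => (F l).+1).
Proof.
move=> h; apply: (@lcomp_comp1 k S F) => //.
by exists PSucc => -[|x []] //= _; constructor.
Qed.

Lemma lcomp_const k n : lcomp k (fun=> n).
Proof.
elim: n => [|n IH]; last exact: lcomp_succ.
by exists PZero => l _; constructor.
Qed.

Lemma lcomp_rec k A B : lcomp k A -> lcomp k.+2 B ->
  lcomp k.+1 (fun l => iteri (head 0 l) (fun n r => B [:: n, r & behead l]) (A (behead l))).
Proof.
move=> [p hp] [q hq]; exists (PRec p q) => -[|n l] //= [hl].
elim: n => [|n IH] /=; first by constructor; apply: hp.
by apply: (ev_recS IH); apply: hq; rewrite /= hl.
Qed.

Lemma lcomp_rec2 A B : lcomp 1 (fun l => A (nth 0 l 0)) ->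
  lcomp 3 (fun l => B (nth 0 l 0) (nth 0 l 1) (nth 0 l 2)) ->
  lcomp 2 (fun l => iteri (nth 0 l 1) (fun n r => B n r (nth 0 l 0)) (A (nth 0 l 0))).
Proof.
move=> hA hB; have h := lcomp_rec hA hB.
have := @lcomp_comp2 2 (fun a b => iteri a (fun n r => B n r b) (A b)) _ _ _ (lcomp_proj 2 1) (lcomp_proj 2 0).
by apply; apply: lcomp_ext h => -[|a [|b []]].
Qed.

Lemma lcomp_rec1 a B :
  lcomp 2 (fun l => B (nth 0 l 0) (nth 0 l 1)) ->
  lcomp 1 (fun l => iteri (nth 0 l 0) B a).
Proof.
move=> hB; have h := lcomp_rec (lcomp_const 0 a) hB.
by apply: lcomp_ext h => -[|x []].
Qed.

Lemma lcomp_mu k B (m : seq nat -> nat) : lcomp k.+1 B ->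
  (forall l, size l = k -> B (m l :: l) = 0 /\ forall i, i < m l -> B (i :: l) <> 0) ->
  lcomp k m.
Proof.
move=> [p hp] h; exists (PMu p) => l hl; have [h0 h1] := h l hl.
constructor; first by rewrite -h0; apply: hp; rewrite /= hl.
move=> i hi; exists (B (i :: l)).-1; rewrite prednK; last by move/h1: hi; case: (B _).
by apply: hp; rewrite /= hl.
Qed.

Lemma lcomp_pred k F : lcomp k F -> lcomp k (fun l => (F l).-1).
Proof.
apply: (lcomp_comp1 (G := predn)).
have h := @lcomp_rec1 0 (fun n r => n) (lcomp_proj 2 0).
by apply: lcomp_ext h => -[|[|n] []].
Qed.

Lemma lcomp_add k F G : lcomp k F -> lcomp k G -> lcomp k (fun l => F l + G l).
Proof.
apply: lcomp_comp2.
have h := @lcomp_rec2 id (fun n r _ => r.+1) (lcomp_proj 1 0) (lcomp_succ (lcomp_proj 3 1)).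
apply: lcomp_ext h => -[|a [|b []]] //= _.
by elim: b => [|b /= ->]; rewrite ?addn0 ?addnS.
Qed.

Lemma lcomp_sub k F G : lcomp k F -> lcomp k G -> lcomp k (fun l => F l - G l).
Proof.
apply: lcomp_comp2.
have h := @lcomp_rec2 id (fun n r _ => r.-1) (lcomp_proj 1 0) (lcomp_pred (lcomp_proj 3 1)).
apply: lcomp_ext h => -[|a [|b []]] //= _.
by elim: b => [|b /= ->]; rewrite ?subn0 ?subnS.
Qed.

Lemma lcomp_mul k F G : lcomp k F -> lcomp k G -> lcomp k (fun l => F l * G l).
Proof.
apply: lcomp_comp2.
have h := @lcomp_rec2 (fun=> 0) (fun n r a => r + a) (lcomp_const 1 0)
  (lcomp_add (lcomp_proj 3 1) (lcomp_proj 3 2)).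
apply: lcomp_ext h => -[|a [|b []]] //= _.
by elim: b => [|b /= ->]; rewrite ?muln0 ?mulnSr.
Qed.

Lemma lcomp_exp2 k F : lcomp k F -> lcomp k (fun l => 2 ^ F l).
Proof.
apply: (lcomp_comp1 (G := fun n => 2 ^ n)).
have h := @lcomp_rec1 1 (fun n r => r + r) (lcomp_add (lcomp_proj 2 1) (lcomp_proj 2 1)).
apply: lcomp_ext h => -[|a []] //= _.
by elim: a => [|b /= ->] //; rewrite expnS mul2n -addnn.
Qed.

(** The quotient is the least [i] with [F l < (i + 1) * G l], found by unbounded search. The
    candidate [i] is put in front of the arguments, hence the shift of [F] and [G] to the tail of
    the list. *)
Lemma lcomp_div k F G : (forall l, size l = k -> 0 < G l) ->
  lcomp k F -> lcomp k G -> lcomp k (fun l => F l %/ G l).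
Proof.
move=> hpos hF hG.
pose H l := (F (behead l)).+1 - (nth 0 l 0).+1 * G (behead l).
have shift E : lcomp k E -> lcomp k.+1 (fun l => E (behead l)).
  move=> hE; pose gs := [seq (fun l : seq nat => nth 0 l i) | i <- iota 1 k].
  have sg : size gs = k by rewrite size_map size_iota.
  have := @lcomp_comp k.+1 E gs; rewrite sg => /(_ hE) [i hi|p hp].
    by rewrite (nth_map 0) ?size_iota // ; apply: lcomp_proj.
  exists p => -[|x l] //= [hl]; have := hp (x :: l); rewrite /= hl => /(_ erefl).
  suff -> : [seq h (x :: l) | h <- gs] = l by [].
  rewrite -map_comp; apply: (@eq_from_nth _ 0); rewrite size_map size_iota // => i hi.
  by rewrite (nth_map 0) ?size_iota //= nth_iota.
apply: (@lcomp_mu k H).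
  apply: lcomp_sub; first by apply: lcomp_succ; apply: shift.
  by apply: lcomp_mul; [apply: lcomp_succ; apply: lcomp_proj | apply: shift].
move=> l hl; rewrite /H /=; have h0 := hpos l hl; split.
  by apply/eqP; rewrite subn_eq0 ltn_ceil.
move=> i hi; apply/eqP; rewrite subn_eq0 -ltnNge ltnS.
by apply: leq_trans (leq_divM (F l) (G l)); rewrite leq_mul2r hi orbT.
Qed.

(** [CodeSeq.code] maps [x :: s] to [2 ^ x * (2 * code s + 1)]; this is the same formula, made to
    start at 0. The code of a nonempty list is thus the successor of the code of the pair (head,
    tail), and the coding agrees with the one behind [pickle]. *)
Definition npair x y := (2 ^ x * y.*2.+1).-1.

Lemma npairE x y : (npair x y).+1 = 2 ^ x * y.*2.+1.
Proof. by rewrite prednK // muln_gt0 expn_gt0. Qed.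

Definition np1 n := head 0 (CodeSeq.decode n.+1).
Definition np2 n := CodeSeq.code (behead (CodeSeq.decode n.+1)).

Lemma npairK1 x y : np1 (npair x y) = x.
Proof.
by rewrite /np1 npairE -{1}[y]CodeSeq.decodeK -[2 ^ x * _]/(CodeSeq.code (x :: _)) CodeSeq.codeK.
Qed.

Lemma npairK2 x y : np2 (npair x y) = y.
Proof.
by rewrite /np2 npairE -{1}[y]CodeSeq.decodeK -[2 ^ x * _]/(CodeSeq.code (x :: _))
  CodeSeq.codeK /= CodeSeq.decodeK.
Qed.

Lemma np_ex n : exists x y, n = npair x y.
Proof.
case E: (CodeSeq.decode n.+1) => [|x s].
  by have := CodeSeq.decodeK n.+1; rewrite E.
exists x, (CodeSeq.code s); apply: succn_inj; rewrite npairE.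
by rewrite -[LHS]CodeSeq.decodeK E.
Qed.

Lemma npK n : npair (np1 n) (np2 n) = n.
Proof. by have [x [y ->]] := np_ex n; rewrite npairK1 npairK2. Qed.

Lemma lcomp_npair k F G : lcomp k F -> lcomp k G -> lcomp k (fun l => npair (F l) (G l)).
Proof.
move=> hF hG; apply: lcomp_pred; apply: lcomp_mul; first exact: lcomp_exp2.
apply: lcomp_succ; apply: lcomp_ext (lcomp_add hG hG) => l _; exact: addnn.
Qed.

(** [np1 n] is the exponent of 2 in [n + 1], the least [i] such that [2 ^ (i + 1)] does not divide
    [n + 1]; [H] vanishes exactly when the remainder is positive. *)
Lemma lcomp_np1 k F : lcomp k F -> lcomp k (fun l => np1 (F l)).
Proof.
apply: lcomp_comp1.
pose q l := (nth 0 l 1).+1 %/ 2 ^ (nth 0 l 0).+1.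
pose H l := 1 - ((nth 0 l 1).+1 - q l * 2 ^ (nth 0 l 0).+1).
have hp : lcomp 2 (fun l => 2 ^ (nth 0 l 0).+1).
  by apply: lcomp_exp2; apply: lcomp_succ; apply: lcomp_proj.
apply: (@lcomp_mu 1 H).
  apply: lcomp_sub; first exact: lcomp_const.
  apply: lcomp_sub; first by apply: lcomp_succ; apply: lcomp_proj.
  apply: lcomp_mul => //; apply: (lcomp_div (F := fun l => (nth 0 l 1).+1)) => //.
    by move=> l' _; rewrite expn_gt0.
  by apply: lcomp_succ; apply: lcomp_proj.
have hH i n : (H [:: i; n] == 0) = ~~ (2 ^ i.+1 %| n.+1).
  rewrite /H /q /= subn_eq0 subn_gt0.
  by rewrite {2}(divn_eq n.+1 (2 ^ i.+1)) -[X in X < _]addn0 ltn_add2l lt0n.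
case=> [|n []] //= _; have [x [y ->]] := np_ex n; rewrite npairK1; split.
  apply/eqP; rewrite hH npairE expnSr dvdn_pmul2l ?expn_gt0 //.
  by rewrite dvdn2 /= odd_double.
move=> i hi; apply/eqP; rewrite hH negbK npairE.
by apply: dvdn_mulr; rewrite dvdn_exp2l.
Qed.

Lemma lcomp_np2 k F : lcomp k F -> lcomp k (fun l => np2 (F l)).
Proof.
apply: lcomp_comp1.
have h : lcomp 1 (fun l => ((nth 0 l 0).+1 %/ 2 ^ np1 (nth 0 l 0)) %/ 2).
  apply: lcomp_div => //; last exact: lcomp_const.
  apply: lcomp_div => [l _||]; rewrite ?expn_gt0 //; first by apply: lcomp_succ; apply: lcomp_proj.
  by apply: lcomp_exp2; apply: lcomp_np1; apply: lcomp_proj.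
apply: lcomp_ext h => l _; have [x [y ->]] := np_ex (nth 0 l 0).
by rewrite npairE npairK1 npairK2 mulKn ?expn_gt0 // -addn1 -muln2 divnMDl // addn0.
Qed.

(** Both cancellation laws are asked for: a coding is a bijection with the numbers. Every number
    then decodes, no test for valid codes ever arises, and searching through a type is searching
    through the numbers. *)
Class cod (T : Type) := Cod { enc : T -> nat; dec : nat -> T;
  encK : cancel enc dec; decK : cancel dec enc }.

#[export] Instance cod_nat : cod nat := @Cod nat id id (fun=> erefl) (fun=> erefl).

Section CodPair.
Context {T U : Type} {cT : cod T} {cU : cod U}.
Definition pair_enc (x : T * U) := npair (enc x.1) (enc x.2).
Definition pair_dec n : T * U := (dec (np1 n), dec (np2 n)).
Lemma pair_encK : cancel pair_enc pair_dec.
Proof. by case=> x y; rewrite /pair_dec npairK1 npairK2 !encK. Qed.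
Lemma pair_decK : cancel pair_dec pair_enc.
Proof. by move=> n; rewrite /pair_enc /= !decK npK. Qed.
#[export] Instance cod_pair : cod (T * U) := Cod pair_encK pair_decK.
Definition seq_enc (s : seq T) := CodeSeq.code (map enc s).
Definition seq_dec n : seq T := map dec (CodeSeq.decode n).
Lemma seq_encK : cancel seq_enc seq_dec.
Proof. by move=> s; rewrite /seq_dec CodeSeq.codeK mapK //; apply: encK. Qed.
Lemma seq_decK : cancel seq_dec seq_enc.
Proof. by move=> n; rewrite /seq_enc mapK ?CodeSeq.decodeK //; apply: decK. Qed.
#[export] Instance cod_seq : cod (seq T) := Cod seq_encK seq_decK.
End CodPair.
#[export] Existing Instance cod_pair.
#[export] Existing Instance cod_seq.

Definition computable {T U : Type} {cT : cod T} {cU : cod U} (f : T -> U) :=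
  lcomp 1 (fun l => enc (f (dec (nth 0 l 0)))).

Lemma comp_ext {T} {cT : cod T} {U} {cU : cod U} (f g : T -> U) : f =1 g -> computable f -> computable g.
Proof. by move=> e; apply: lcomp_ext => l _; rewrite e. Qed.

Lemma comp_id {T} {cT : cod T} : computable (fun x : T => x).
Proof. by apply: lcomp_ext (lcomp_proj 1 0) => l _; rewrite decK. Qed.

Lemma comp_app {T} {cT : cod T} {U} {cU : cod U} {V} {cV : cod V} (g : U -> V) (f : T -> U) : computable g -> computable f -> computable (fun x => g (f x)).
Proof.
move=> hg hf; apply: lcomp_ext (lcomp_comp1 (G := fun n => enc (g (dec n))) hg hf) => l _.
by rewrite encK.
Qed.

Lemma comp_const {T} {cT : cod T} {U} {cU : cod U} (u : U) : computable (fun _ : T => u).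
Proof. exact: lcomp_const. Qed.

Lemma comp_pair {T} {cT : cod T} {U} {cU : cod U} {V} {cV : cod V} (f : T -> U) (g : T -> V) : computable f -> computable g -> computable (fun x => (f x, g x)).
Proof. by move=> hf hg; apply: lcomp_npair. Qed.

Lemma comp_fst {T} {cT : cod T} {U} {cU : cod U} {V} {cV : cod V} (f : T -> U * V) : computable f -> computable (fun x => (f x).1).
Proof.
move=> /lcomp_np1; apply: lcomp_ext => l _.
by rewrite -[in RHS](pair_encK (f _)) /= decK.
Qed.

Lemma comp_snd {T} {cT : cod T} {U} {cU : cod U} {V} {cV : cod V} (f : T -> U * V) : computable f -> computable (fun x => (f x).2).
Proof.
move=> /lcomp_np2; apply: lcomp_ext => l _.
by rewrite -[in RHS](pair_encK (f _)) /= decK.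
Qed.

Lemma comp_enc {T} {cT : cod T} {U} {cU : cod U} (f : T -> U) : computable f -> computable (fun x => enc (f x)).
Proof. by []. Qed.

Lemma comp_dec {T} {cT : cod T} {U} {cU : cod U} (f : T -> nat) : computable f -> computable (fun x => dec (f x) : U).
Proof. by apply: lcomp_ext => l _ /=; rewrite decK. Qed.

Lemma comp_S {T} {cT : cod T} (f : T -> nat) : computable f -> computable (fun x => (f x).+1).
Proof. exact: lcomp_succ. Qed.
Lemma comp_P {T} {cT : cod T} (f : T -> nat) : computable f -> computable (fun x => (f x).-1).
Proof. exact: lcomp_pred. Qed.
Lemma comp_add {T} {cT : cod T} (f g : T -> nat) : computable f -> computable g -> computable (fun x => f x + g x).
Proof. exact: lcomp_add. Qed.
Lemma comp_sub {T} {cT : cod T} (f g : T -> nat) : computable f -> computable g -> computable (fun x => f x - g x).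
Proof. exact: lcomp_sub. Qed.
Lemma comp_mul {T} {cT : cod T} (f g : T -> nat) : computable f -> computable g -> computable (fun x => f x * g x).
Proof. exact: lcomp_mul. Qed.

Lemma comp_iteri {T} {cT : cod T} {U} {cU : cod U} (n : T -> nat) (b : T -> nat -> U -> U) (a : T -> U) :
  computable n -> computable (fun y : T * (nat * U) => b y.1 y.2.1 y.2.2) -> computable a ->
  computable (fun x => iteri (n x) (b x) (a x)).
Proof.
move=> hn hb ha.
have hB : lcomp 3 (fun l => enc (b (dec (nth 0 l 2)) (nth 0 l 0) (dec (nth 0 l 1)))).
  have h : lcomp 3 (fun l => npair (nth 0 l 2) (npair (nth 0 l 0) (nth 0 l 1))).
    by do !apply: lcomp_npair; apply: lcomp_proj.
  apply: lcomp_ext (lcomp_comp1 (G := fun n => enc (b (dec n : T * (nat * U)).1 (dec n : T * (nat * U)).2.1 (dec n : T * (nat * U)).2.2)) hb h) => l _.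
  by rewrite /dec /= /pair_dec /= !(npairK1, npairK2).
have h := lcomp_comp2 (G := fun x m => iteri m (fun k r => enc (b (dec x) k (dec r))) (enc (a (dec x))))
  (lcomp_rec2 (A := fun x => enc (a (dec x))) (B := fun k r x => enc (b (dec x) k (dec r))) ha hB) (lcomp_proj 1 0) hn.
apply: lcomp_ext h => l _ /=.
by elim: (n _) => //= k ->; rewrite encK.
Qed.

Lemma comp_mu {T} {cT : cod T} (P : T -> nat -> nat) :
  computable (fun y : T * nat => P y.1 y.2) -> (forall x, exists n, P x n = 0) ->
  exists2 f : T -> nat, computable f & forall x, P x (f x) = 0.
Proof.
move=> hP hex.
have hex' x : exists n, P x n == 0 by have [n /eqP] := hex x; exists n.
exists (fun x => ex_minn (hex' x)); last by move=> x; case: ex_minnP => m /eqP.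
apply: (@lcomp_mu 1 (fun l => P (dec (nth 0 l 1)) (nth 0 l 0))).
  have h : lcomp 2 (fun l => npair (nth 0 l 1) (nth 0 l 0)).
    by apply: lcomp_npair; apply: lcomp_proj.
  apply: lcomp_ext (lcomp_comp1 (G := fun n => P (dec n : T * nat).1 (dec n : T * nat).2) hP h) => l _.
  by rewrite /dec /= /pair_dec /= !(npairK1, npairK2).
move=> l _ /=; case: ex_minnP => m /eqP h1 h2; split=> // i hi /eqP /h2.
by rewrite leqNgt hi.
Qed.

Lemma comp_iter (T U : Type) {cT : cod T} {cU : cod U} (n : T -> nat) (b : T -> U -> U) (a : T -> U) :
  computable n -> computable (fun y : T * U => b y.1 y.2) -> computable a ->
  computable (fun x => iter (n x) (b x) (a x)).
Proof.
move=> hn hb ha; apply: (comp_ext (f := fun x => iteri (n x) (fun _ => b x) (a x))).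
  by move=> x; elim: (n x) => //= k ->.
apply: comp_iteri => //; apply: (comp_app (g := fun y : T * U => b y.1 y.2)
  (f := fun y : T * (nat * U) => (y.1, y.2.2))) => //.
by apply: comp_pair; do ?apply: comp_snd; do ?apply: comp_fst; apply: comp_id.
Qed.

(** * Decidable and enumerable predicates *)

Definition decid {T} {cT : cod T} (P : T -> Prop) :=
  exists2 f : T -> nat, computable f & forall x, P x <-> f x = 0.

Definition RE {T} {cT : cod T} (P : T -> Prop) :=
  exists2 Q : T -> nat -> Prop, decid (fun y : T * nat => Q y.1 y.2)
    & forall x, P x <-> exists n, Q x n.

Lemma comp_app2 {T} {cT : cod T} {U} {cU : cod U} {V} {cV : cod V} {W} {cW : cod W} (h : U -> V -> W) (f : T -> U) (g : T -> V) :
  computable (fun y : U * V => h y.1 y.2) -> computable f -> computable g -> computable (fun x => h (f x) (g x)).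
Proof.
by move=> hh hf hg; apply: (comp_app (g := fun y : U * V => h y.1 y.2) hh (comp_pair hf hg)).
Qed.

Lemma comp_app3 {T} {cT : cod T} {U} {cU : cod U} {V} {cV : cod V} {W} {cW : cod W} {X} {cX : cod X} (h : U -> V -> W -> X) (f : T -> U) (g : T -> V) (k : T -> W) :
  computable (fun y : U * V * W => h y.1.1 y.1.2 y.2) -> computable f -> computable g -> computable k ->
  computable (fun x => h (f x) (g x) (k x)).
Proof.
move=> hh hf hg hk.
by apply: (comp_app (g := fun y : U * V * W => h y.1.1 y.1.2 y.2) hh (comp_pair (comp_pair hf hg) hk)).
Qed.

Lemma decid_ext {T} {cT : cod T} (P Q : T -> Prop) : (forall x, P x <-> Q x) -> decid P -> decid Q.
Proof. by move=> e [f hf h]; exists f => // x; rewrite -e. Qed.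

Lemma RE_ext {T} {cT : cod T} (P Q : T -> Prop) : (forall x, P x <-> Q x) -> RE P -> RE Q.
Proof. by move=> e [f hf h]; exists f => // x; rewrite -e. Qed.

Lemma decid_app1 {T} {cT : cod T} {U} {cU : cod U} (P : U -> Prop) (f : T -> U) : decid P -> computable f -> decid (fun x => P (f x)).
Proof. by move=> [g hg h] hf; exists (fun x => g (f x)) => //; apply: comp_app. Qed.

Lemma decid_true {T} {cT : cod T} : decid (fun _ : T => True).
Proof. by exists (fun=> 0) => //; apply: comp_const. Qed.

Lemma decid_and {T} {cT : cod T} (P Q : T -> Prop) : decid P -> decid Q -> decid (fun x => P x /\ Q x).
Proof.
move=> [f hf h] [g hg h']; exists (fun x => f x + g x); first exact: comp_add.
by move=> x; rewrite h h'; lia.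
Qed.

Lemma decid_not {T} {cT : cod T} (P : T -> Prop) : decid P -> decid (fun x => ~ P x).
Proof.
move=> [f hf h]; exists (fun x => 1 - f x).
  by apply: comp_sub => //; apply: comp_const.
by move=> x; rewrite h; lia.
Qed.

Lemma decid_or {T} {cT : cod T} (P Q : T -> Prop) : decid P -> decid Q -> decid (fun x => P x \/ Q x).
Proof.
move=> [f hf h] [g hg h']; exists (fun x => f x * g x); first exact: comp_mul.
by move=> x; rewrite h h'; nia.
Qed.

Lemma decid_imp {T} {cT : cod T} (P Q : T -> Prop) : decid P -> decid Q -> decid (fun x => P x -> Q x).
Proof.
move=> hP hQ; apply: decid_ext (decid_or (decid_not hP) hQ) => x.
by split=> [[]//|h]; case: (pselect (P x)) => p; [right; apply: h | left].
Qed.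

Lemma decid_iff {T} {cT : cod T} (P Q : T -> Prop) : decid P -> decid Q -> decid (fun x => P x <-> Q x).
Proof. by move=> hP hQ; apply: decid_and; apply: decid_imp. Qed.

Lemma decid_eq {T} {cT : cod T} {U} {cU : cod U} (f g : T -> U) : computable f -> computable g -> decid (fun x => f x = g x).
Proof.
move=> hf hg; exists (fun x => (enc (f x) - enc (g x)) + (enc (g x) - enc (f x))).
  by apply: comp_add; apply: comp_sub; apply: comp_enc.
move=> x; split=> [->|h]; first by rewrite subnn.
by apply: (can_inj encK); lia.
Qed.

Lemma decid_leq {T} {cT : cod T} (f g : T -> nat) : computable f -> computable g -> decid (fun x => is_true (f x <= g x)).
Proof. by move=> hf hg; exists (fun x => f x - g x) => [|x]; [exact: comp_sub | lia]. Qed.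

Lemma comp_if {T} {cT : cod T} {U} {cU : cod U} (P : T -> Prop) (f g : T -> U) : decid P -> computable f -> computable g ->
  computable (fun x => if `[< P x >] then f x else g x).
Proof.
move=> [h ch hh] hf hg.
have : computable (fun x => iter (h x) (fun=> g x) (f x)).
  by apply: comp_iter => //; apply: (comp_app (g := g)) => //; apply: comp_fst; apply: comp_id.
apply: comp_ext => x; case: asboolP => [/hh -> //|/hh].
by case: (h x).
Qed.

Lemma comp_ifb {T} {cT : cod T} {U} {cU : cod U} (P : T -> bool) (f g : T -> U) : decid (fun x => is_true (P x)) -> computable f -> computable g ->
  computable (fun x => if P x then f x else g x).
Proof.
by move=> hP hf hg; apply: comp_ext (comp_if hP hf hg) => x; rewrite asboolb.
Qed.

Lemma decid_ball {T} {cT : cod T} (n : T -> nat) (P : T -> nat -> Prop) :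
  computable n -> decid (fun y : T * nat => P y.1 y.2) ->
  decid (fun x => forall i, i < n x -> P x i).
Proof.
move=> hn [f hf h]; exists (fun x => iteri (n x) (fun i r => r + f (x, i)) 0).
  apply: comp_iteri => //; last exact: comp_const.
  apply: comp_add; first by do 2!apply: comp_snd; apply: comp_id.
  apply: (comp_app (g := f)) => //; apply: comp_pair; first by apply: comp_fst; apply: comp_id.
  by apply: comp_fst; apply: comp_snd; apply: comp_id.
move=> x; elim: (n x) => [|k IH] //=; split.
  by move=> H; rewrite (IH.1 _) ?add0n; [apply/(h (x, k)); apply: H | move=> i hi; apply: H; apply: ltnW].
move=> H i; rewrite ltnS leq_eqVlt => /orP [/eqP ->|]; first by apply/(h (x, k)); lia.
by apply: (IH.2 _); lia.
Qed.

Lemma decid_bex {T} {cT : cod T} (n : T -> nat) (P : T -> nat -> Prop) :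
  computable n -> decid (fun y : T * nat => P y.1 y.2) ->
  decid (fun x => exists2 i, i < n x & P x i).
Proof.
move=> hn hP; have h := decid_not (decid_ball (P := fun x i => ~ P x i) hn (decid_not hP)).
apply: decid_ext h => x; split=> [H|[i hi p] H]; last exact: (H i hi).
by apply: contrapT => H'; apply: H => i hi p; apply: H'; exists i.
Qed.

Lemma decid_app2 {T} {cT : cod T} {U} {cU : cod U} {V} {cV : cod V} (P : U -> V -> Prop) (f : T -> U) (g : T -> V) :
  decid (fun y : U * V => P y.1 y.2) -> computable f -> computable g -> decid (fun x => P (f x) (g x)).
Proof. by move=> hP hf hg; apply: decid_app1 hP (comp_pair hf hg). Qed.

Lemma decid_app3 {T} {cT : cod T} {U} {cU : cod U} {V} {cV : cod V} {W} {cW : cod W} (P : U -> V -> W -> Prop) (f : T -> U) (g : T -> V) (h : T -> W) :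
  decid (fun y : U * V * W => P y.1.1 y.1.2 y.2) -> computable f -> computable g -> computable h ->
  decid (fun x => P (f x) (g x) (h x)).
Proof. by move=> hP hf hg hh; apply: decid_app1 hP (comp_pair (comp_pair hf hg) hh). Qed.

Lemma decid_app4 {T} {cT : cod T} {U} {cU : cod U} {V} {cV : cod V} {W} {cW : cod W} {X} {cX : cod X} (P : U -> V -> W -> X -> Prop) (f : T -> U) (g : T -> V) (h : T -> W) (k : T -> X) :
  decid (fun y : U * V * W * X => P y.1.1.1 y.1.1.2 y.1.2 y.2) -> computable f -> computable g -> computable h -> computable k ->
  decid (fun x => P (f x) (g x) (h x) (k x)).
Proof. by move=> hP hf hg hh hk; apply: decid_app1 hP (comp_pair (comp_pair (comp_pair hf hg) hh) hk). Qed.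

Lemma RE_dec {T} {cT : cod T} (P : T -> Prop) : decid P -> RE P.
Proof.
move=> hP; exists (fun x _ => P x); first by apply: decid_app1 hP (comp_fst (comp_id)).
by move=> x; split=> [|[]//]; exists 0.
Qed.

Lemma RE_app1 {T} {cT : cod T} {U} {cU : cod U} (P : U -> Prop) (f : T -> U) : RE P -> computable f -> RE (fun x => P (f x)).
Proof.
move=> [Q hQ h] hf; exists (fun x n => Q (f x) n) => //.
apply: (decid_app2 hQ); last by apply: comp_snd; apply: comp_id.
by apply: (comp_app (g := f)) => //; apply: comp_fst; apply: comp_id.
Qed.

Lemma RE_app2 {T} {cT : cod T} {U} {cU : cod U} {V} {cV : cod V} (P : U -> V -> Prop) (f : T -> U) (g : T -> V) :
  RE (fun y : U * V => P y.1 y.2) -> computable f -> computable g -> RE (fun x => P (f x) (g x)).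
Proof. by move=> hP hf hg; apply: RE_app1 hP (comp_pair hf hg). Qed.

Lemma RE_app3 {T} {cT : cod T} {U} {cU : cod U} {V} {cV : cod V} {W} {cW : cod W} (P : U -> V -> W -> Prop) (f : T -> U) (g : T -> V) (h : T -> W) :
  RE (fun y : U * V * W => P y.1.1 y.1.2 y.2) -> computable f -> computable g -> computable h ->
  RE (fun x => P (f x) (g x) (h x)).
Proof. by move=> hP hf hg hh; apply: RE_app1 hP (comp_pair (comp_pair hf hg) hh). Qed.

Lemma RE_app4 {T} {cT : cod T} {U} {cU : cod U} {V} {cV : cod V} {W} {cW : cod W} {X} {cX : cod X} (P : U -> V -> W -> X -> Prop) (f : T -> U) (g : T -> V) (h : T -> W) (k : T -> X) :
  RE (fun y : U * V * W * X => P y.1.1.1 y.1.1.2 y.1.2 y.2) -> computable f -> computable g -> computable h -> computable k ->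
  RE (fun x => P (f x) (g x) (h x) (k x)).
Proof. by move=> hP hf hg hh hk; apply: RE_app1 hP (comp_pair (comp_pair (comp_pair hf hg) hh) hk). Qed.

Lemma RE_ex {T} {cT : cod T} {U} {cU : cod U} (P : T -> U -> Prop) : RE (fun y : T * U => P y.1 y.2) -> RE (fun x => exists y, P x y).
Proof.
move=> [Q hQ h].
exists (fun x n => Q (x, (dec n : U * nat).1) (dec n : U * nat).2).
  have hd : computable (fun x : T * nat => dec x.2 : U * nat).
    by apply: comp_dec; apply: comp_snd; apply: comp_id.
  apply: (decid_app2 hQ); last exact: comp_snd.
  by apply: comp_pair; [apply: comp_fst; apply: comp_id | exact: comp_fst].
move=> x; split=> [[y /(h (x, y)) [n hn]]|[n hn]].
  by exists (enc (y, n)); rewrite encK.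
by exists (dec n : U * nat).1; apply/(h (x, _)); exists (dec n : U * nat).2.
Qed.

Lemma RE_and {T} {cT : cod T} (P Q : T -> Prop) : RE P -> RE Q -> RE (fun x => P x /\ Q x).
Proof.
move=> [A hA h] [B hB h'].
exists (fun x n => A x (dec n : nat * nat).1 /\ B x (dec n : nat * nat).2).
  have hd : computable (fun x : T * nat => dec x.2 : nat * nat).
    by apply: comp_dec; apply: comp_snd; apply: comp_id.
  have h1 : computable (fun x : T * nat => x.1) by apply: comp_fst; apply: comp_id.
  apply: decid_and; [apply: (decid_app2 hA) | apply: (decid_app2 hB)] => //; by [exact: comp_fst|exact: comp_snd].
move=> x; rewrite h h'; split=> [[[n hn] [m hm]]|[n [h1 h2]]]; last by split; [exists (dec n : nat * nat).1 | exists (dec n : nat * nat).2].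
by exists (enc (n, m)); rewrite encK.
Qed.

Lemma RE_or {T} {cT : cod T} (P Q : T -> Prop) : RE P -> RE Q -> RE (fun x => P x \/ Q x).
Proof.
move=> [A hA h] [B hB h']; exists (fun x n => A x n \/ B x n); first exact: decid_or.
move=> x; rewrite h h'; split=> [[[n hn]|[n hn]]|[n [hn|hn]]]; first by exists n; left.
- by exists n; right.
- by left; exists n.
by right; exists n.
Qed.

(** Dovetailing: search for the code of a pair made of a value and a step that confirms it. Most
    nontrivial computable functions below come from here: an enumerable relation describes the
    acceptable values, and their existence is proved classically. *)
Lemma RE_choice {T} {cT : cod T} {U} {cU : cod U} (P : T -> U -> Prop) : RE (fun y : T * U => P y.1 y.2) ->
  (forall x, exists y, P x y) -> exists2 f : T -> U, computable f & forall x, P x (f x).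
Proof.
move=> [Q [q cq hq] h] hex.
have [||g hg hg'] := @comp_mu T _ (fun x n => q ((x, (dec n : U * nat).1), (dec n : U * nat).2)).
- have hd : computable (fun x : T * nat => dec x.2 : U * nat).
    by apply: comp_dec; apply: comp_snd; apply: comp_id.
  apply: (comp_app (g := q)) => //; apply: comp_pair; last exact: comp_snd.
  by apply: comp_pair; [apply: comp_fst; apply: comp_id | exact: comp_fst].
- move=> x; have [y /(h (x, y)) [n /(hq (_, n)) hn]] := hex x.
  by exists (enc (y, n)); rewrite encK.
exists (fun x => (dec (g x) : U * nat).1); first by apply: comp_fst; apply: comp_dec.
by move=> x; apply/(h (x, _)); exists (dec (g x) : U * nat).2; apply/(hq (_, _)).
Qed.

Lemma comp_of_graph {T} {cT : cod T} {U} {cU : cod U} (f : T -> U) : RE (fun y : T * U => y.2 = f y.1) -> computable f.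
Proof.
move=> h; have [|g hg hg'] := RE_choice (P := fun x y => y = f x) h; first by move=> x; exists (f x).
exact: comp_ext hg.
Qed.

(** Post's theorem: the answer 0 or 1 is the one confirmed first, found by [RE_choice]. *)
Lemma decid_of_RE (T : Type) {cT : cod T} (P : T -> Prop) :
  RE P -> RE (fun x => ~ P x) -> decid P.
Proof.
move=> hP hN; have [|x|f hf h] := RE_choice (U := nat) (P := fun x y => (P x /\ y = 0) \/ (~ P x /\ y = 1)).
- have h1 : computable (fun x : T * nat => x.1) by apply: comp_fst; apply: comp_id.
  have h2 : computable (fun x : T * nat => x.2) by apply: comp_snd; apply: comp_id.
  apply: RE_or; apply: RE_and; try by [exact: (RE_app1 hP h1)|exact: (RE_app1 hN h1)];
    by apply: RE_dec; apply: decid_eq => //; apply: comp_const.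
- by case: (pselect (P x)) => p; [exists 0; left | exists 1; right].
by exists f => // x; case: (h x) => -[p ->].
Qed.

(** * Functions on coded lists *)

Lemma enc_cons {T} {cT : cod T} (x : T) s : enc (x :: s) = (npair (enc x) (enc s)).+1.
Proof. by rewrite npairE. Qed.

Lemma comp_cons {T} {cT : cod T} {U} {cU : cod U} (f : T -> U) (g : T -> seq U) : computable f -> computable g -> computable (fun x => f x :: g x).
Proof.
move=> hf hg; have : computable (fun x => (npair (enc (f x)) (enc (g x))).+1).
  by apply: lcomp_succ; apply: lcomp_npair.
by apply: lcomp_ext => l _; rewrite enc_cons.
Qed.

(** By [enc_cons], the predecessor of the code of a nonempty list decodes to the pair (head,
    tail). *)
Lemma comp_match {T} {cT : cod T} {U} {cU : cod U} {V} {cV : cod V} (s : T -> seq U) (a : T -> V) (h : T -> U -> seq U -> V) :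
  computable s -> computable a -> computable (fun y : T * U * seq U => h y.1.1 y.1.2 y.2) ->
  computable (fun x => if s x is y :: s' then h x y s' else a x).
Proof.
move=> hs ha hh.
have hd : computable (fun x => dec (enc (s x)).-1 : U * seq U) by apply: comp_dec; apply: comp_P.
have : computable (fun x => if `[< enc (s x) = 0 >] then a x else
   h x (dec (enc (s x)).-1 : U * seq U).1 (dec (enc (s x)).-1 : U * seq U).2).
  apply: comp_if => //; first by apply: decid_eq => //; apply: comp_const.
  by apply: (comp_app3 hh); [exact: comp_id | exact: comp_fst | exact: comp_snd].
apply: comp_ext => x; case: (s x) => [|y s']; first by case: asboolP.
case: asboolP => [|_]; first by rewrite enc_cons.
have -> : (enc (y :: s')).-1 = enc (y, s') by rewrite enc_cons.
by rewrite encK.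
Qed.

Lemma comp_behead {T} {cT : cod T} {U} {cU : cod U} (s : T -> seq U) : computable s -> computable (fun x => behead (s x)).
Proof.
move=> hs; apply: (comp_ext (f := fun x => if s x is _ :: s' then s' else [::])).
  by move=> x; case: (s x).
by apply: comp_match => //; [exact: comp_const | apply: comp_snd; exact: comp_id].
Qed.

Lemma comp_head {T} {cT : cod T} {U} {cU : cod U} (s : T -> seq U) (u : U) : computable s -> computable (fun x => head u (s x)).
Proof.
move=> hs; apply: (comp_ext (f := fun x => if s x is y :: _ then y else u)).
  by move=> x; case: (s x).
by apply: comp_match => //; [exact: comp_const | apply: comp_snd; apply: comp_fst; exact: comp_id].
Qed.

Lemma comp_drop {T} {cT : cod T} {U} {cU : cod U} (n : T -> nat) (s : T -> seq U) : computable n -> computable s -> computable (fun x => drop (n x) (s x)).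
Proof.
move=> hn hs; apply: (comp_ext (f := fun x => iter (n x) behead (s x))).
  by move=> x; elim: (n x) => [|k /= ->]; rewrite ?drop0 // -drop1 drop_drop.
by apply: comp_iter => //; apply: comp_behead; apply: comp_snd; apply: comp_id.
Qed.

Lemma comp_nth {T} {cT : cod T} {U} {cU : cod U} (u : U) (s : T -> seq U) (n : T -> nat) : computable s -> computable n -> computable (fun x => nth u (s x) (n x)).
Proof.
move=> hs hn; apply: (comp_ext (f := fun x => head u (drop (n x) (s x)))).
  by move=> x; rewrite -nth0 nth_drop addn0.
by apply: comp_head; apply: comp_drop.
Qed.

(** The graph is decidable: [n] is the size when dropping [n] elements empties the list and dropping
    one fewer does not. *)
Lemma comp_size {T} {cT : cod T} {U} {cU : cod U} (s : T -> seq U) : computable s -> computable (fun x => size (s x)).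
Proof.
move=> hs; apply: comp_of_graph; apply: RE_dec.
have h2 : computable (fun y : T * nat => y.2) by apply: comp_snd; apply: comp_id.
have h1 : computable (fun y : T * nat => s y.1) by apply: (comp_app (g := s)) => //; apply: comp_fst; apply: comp_id.
have : decid (fun y : T * nat => drop y.2 (s y.1) = [::] /\ (y.2 = 0 \/ drop y.2.-1 (s y.1) <> [::])).
  apply: decid_and; first by apply: decid_eq; [apply: comp_drop | apply: comp_const].
  apply: decid_or; first by apply: decid_eq => //; apply: comp_const.
  by apply: decid_not; apply: decid_eq; [apply: comp_drop => //; apply: comp_P | apply: comp_const].
apply: decid_ext => -[x n] /=; have hnil k : drop k (s x) = [::] <-> size (s x) <= k.
  by split=> [/(congr1 size)|/drop_oversize //]; rewrite size_drop /=; lia.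
by rewrite !hnil; lia.
Qed.

Lemma comp_foldr {T} {cT : cod T} {U} {cU : cod U} {V} {cV : cod V} (s : T -> seq U) (h : T -> U -> V -> V) (a : T -> V) :
  computable s -> computable (fun y : T * U * V => h y.1.1 y.1.2 y.2) -> computable a ->
  computable (fun x => foldr (h x) (a x) (s x)).
Proof.
move=> hs hh ha.
(* After [k] rounds the accumulator is the fold over the last [k] elements. *)
pose step x (k : nat) (r : V) := if drop (size (s x) - k.+1) (s x) is y :: _ then h x y r else r.
have : computable (fun x => iteri (size (s x)) (step x) (a x)).
  apply: comp_iteri => //; first exact: comp_size.
  have h1 : computable (fun y : T * (nat * V) => s y.1).
    by apply: (comp_app (g := s)) => //; apply: comp_fst; apply: comp_id.
  apply: comp_match.
  - apply: comp_drop => //; apply: comp_sub; first exact: comp_size.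
    by apply: comp_S; apply: comp_fst; apply: comp_snd; apply: comp_id.
  - by do 2!apply: comp_snd; apply: comp_id.
  - apply: (comp_app3 hh).
    + by do 3!apply: comp_fst; apply: comp_id.
    + by apply: comp_snd; apply: comp_fst; apply: comp_id.
    + by do 2!apply: comp_snd; do 2!apply: comp_fst; apply: comp_id.
apply: comp_ext => x.
suff H k : k <= size (s x) -> iteri k (step x) (a x) = foldr (h x) (a x) (drop (size (s x) - k) (s x)).
  by rewrite H // subnn drop0.
elim: k => [|k IH] hk /=; first by rewrite subn0 drop_size.
rewrite (IH (ltnW hk)) /step.
case E: (drop _ _) => [|y s']; last first.
  by rewrite /= -[s']/(behead (y :: s')) -E -drop1 drop_drop add1n -subSn // subSS.
by have := congr1 size E; rewrite size_drop /=; lia.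
Qed.

Lemma comp_cat {T} {cT : cod T} {U} {cU : cod U} (f g : T -> seq U) : computable f -> computable g -> computable (fun x => f x ++ g x).
Proof.
move=> hf hg; apply: (comp_ext (f := fun x => foldr (fun u r => u :: r) (g x) (f x))).
  by move=> x; elim: (f x) => //= y s ->.
apply: comp_foldr => //; apply: comp_cons; last by apply: comp_snd; apply: comp_id.
by apply: comp_snd; apply: comp_fst; apply: comp_id.
Qed.

Lemma comp_map {T} {cT : cod T} {U} {cU : cod U} {V} {cV : cod V} (s : T -> seq U) (h : T -> U -> V) :
  computable s -> computable (fun y : T * U => h y.1 y.2) -> computable (fun x => map (h x) (s x)).
Proof.
move=> hs hh; apply: (comp_ext (f := fun x => foldr (fun u r => h x u :: r) [::] (s x))).
  by move=> x; elim: (s x) => //= y s' ->.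
apply: comp_foldr => //; last exact: comp_const.
apply: comp_cons; last by apply: comp_snd; apply: comp_id.
apply: (comp_app2 hh); first by do 2!apply: comp_fst; apply: comp_id.
by apply: comp_snd; apply: comp_fst; apply: comp_id.
Qed.

(** The witnesses for the finitely many [i] are gathered in one list [w], which leaves a decidable
    matrix under the bounded quantifier. *)
Lemma RE_ball {T} {cT : cod T} (n : T -> nat) (P : T -> nat -> Prop) :
  computable n -> RE (fun y : T * nat => P y.1 y.2) -> RE (fun x => forall i, i < n x -> P x i).
Proof.
move=> hn [Q hQ h]; have c1 := @comp_id T _.
have : RE (fun x => exists w : seq nat, forall i, i < n x -> Q (x, i) (nth 0 w i)).
  apply: RE_ex; apply: RE_dec; apply: decid_ball.
    by apply: (comp_app (g := n)) => //; apply: comp_fst; apply: comp_id.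
  apply: (decid_app2 hQ).
    by apply: comp_pair; [do 2!apply: comp_fst; apply: comp_id | apply: comp_snd; apply: comp_id].
  apply: comp_nth; last by apply: comp_snd; apply: comp_id.
  by apply: comp_snd; apply: comp_fst; apply: comp_id.
apply: RE_ext => x; split=> [[w hw] i hi|H].
  by apply/(h (x, i)); exists (nth 0 w i); apply: hw.
have H' i : exists m, i < n x -> Q (x, i) m.
  case: (ltnP i (n x)) => hi; last by exists 0.
  by have [m hm] := (h (x, i)).1 (H i hi); exists m.
have [f hf] := choice H'; exists (mkseq f (n x)) => i hi.
by rewrite nth_mkseq //; apply: hf.
Qed.

#[global] Arguments enc : simpl never.
#[global] Arguments dec : simpl never.

Lemma comp_rcons {T} {cT : cod T} {U} {cU : cod U} (f : T -> seq U) (g : T -> U) :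
  computable f -> computable g -> computable (fun x => rcons (f x) (g x)).
Proof.
move=> hf hg; apply: (comp_ext (f := fun x => f x ++ [:: g x])); first by move=> x; rewrite cats1.
by apply: comp_cat => //; apply: comp_cons => //; apply: comp_const.
Qed.

Lemma decid_eqb {T} {cT : cod T} (f g : T -> nat) : computable f -> computable g ->
  decid (fun x => is_true (f x == g x)).
Proof. by move=> hf hg; apply: decid_ext (decid_eq hf hg) => x; split=> /eqP. Qed.

Lemma decid_andb {T} {cT : cod T} (P Q : T -> bool) : decid (fun x => is_true (P x)) ->
  decid (fun x => is_true (Q x)) -> decid (fun x => is_true (P x && Q x)).
Proof. by move=> hP hQ; apply: decid_ext (decid_and hP hQ) => x; split=> /andP. Qed.

(* Syntax-directed proofs of computability, decidability and enumerability *)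
Create HintDb comp.
Ltac known := solve [ assumption | solve [auto 3 with comp nocore] ].
(** A head symbol applied to computable arguments. If no fact is known about it as a function of all
    of them, a constant first argument is taken as a parameter and the partial application is looked
    up. *)
Ltac comp_atom :=
  lazymatch goal with
  | |- computable (fun x => ?h0 (@?f x) (@?g x) (@?h x)) =>
     first [ apply: (comp_app3 (h := h0) (f := f) (g := g) (k := h)); first known
           | lazymatch f with (fun _ => ?c) => apply: (comp_app2 (h := (h0 c)) (f := g) (g := h)); first known end ]
  | |- computable (fun x => ?h0 (@?f x) (@?g x)) =>
     first [ apply: (comp_app2 (h := h0) (f := f) (g := g)); first known
           | lazymatch f with (fun _ => ?c) => apply: (comp_app (g := (h0 c)) (f := g)); first known end ]
  | |- computable (fun x => ?h0 (@?f x)) =>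
     apply: (comp_app (g := h0) (f := f)); first known
  end.
Ltac decid_atom :=
  lazymatch goal with
  | |- decid (fun x => ?P (@?f x) (@?g x) (@?h x) (@?k x)) =>
     first [ apply: (decid_app4 (P := P) (f := f) (g := g) (h := h) (k := k)); first known
           | lazymatch f with (fun _ => ?c) => apply: (decid_app3 (P := (P c)) (f := g) (g := h) (h := k)); first known end ]
  | |- decid (fun x => ?P (@?f x) (@?g x) (@?h x)) =>
     first [ apply: (decid_app3 (P := P) (f := f) (g := g) (h := h)); first known
           | lazymatch f with (fun _ => ?c) => apply: (decid_app2 (P := (P c)) (f := g) (g := h)); first known end ]
  | |- decid (fun x => ?P (@?f x) (@?g x)) =>
     first [ apply: (decid_app2 (P := P) (f := f) (g := g)); first known
           | lazymatch f with (fun _ => ?c) => apply: (decid_app1 (P := (P c)) (f := g)); first known end ]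
  | |- decid (fun x => ?P (@?f x)) =>
     apply: (decid_app1 (P := P) (f := f)); first known
  end.
Ltac comp_step :=
  lazymatch goal with
  | |- computable (fun x => x) => exact: comp_id
  | |- computable (fun _ => ?c) => exact: (comp_const c)
  | |- computable fst => exact: (comp_fst comp_id)
  | |- computable snd => exact: (comp_snd comp_id)
  | |- computable size => exact: (comp_size comp_id)
  | |- computable S => exact: (comp_S comp_id)
  | |- computable (fun x => pair _ _) => apply: comp_pair
  | |- computable (fun x => fst _) => apply: comp_fst
  | |- computable (fun x => snd _) => apply: comp_snd
  | |- computable (fun x => S _) => apply: comp_S
  | |- computable (fun x => predn _) => apply: comp_P
  | |- computable (fun x => addn _ _) => apply: comp_add
  | |- computable (fun x => subn _ _) => apply: comp_sub
  | |- computable (fun x => muln _ _) => apply: comp_mul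
  | |- computable (fun x => cons _ _) => apply: comp_cons
  | |- computable (fun x => cat _ _) => apply: comp_cat
  | |- computable (fun x => rcons _ _) => apply: comp_rcons
  | |- computable (fun x => nth _ _ _) => apply: comp_nth
  | |- computable (fun x => size _) => apply: comp_size
  | |- computable (fun x => map _ _) => apply: comp_map
  | |- computable (fun x => foldr _ _ _) => apply: comp_foldr
  | |- computable (fun x => iteri _ _ _) => apply: comp_iteri
  | |- computable (fun x => iter _ _ _) => apply: comp_iter
  | |- computable (fun x => enc _) => apply: comp_enc
  | |- computable (fun x => dec _) => apply: comp_dec
  | |- computable (fun x => if `[< _ >] then _ else _) => apply: comp_if
  | |- computable (fun x => if _ then _ else _) => apply: comp_ifb
  | |- computable _ => first [ comp_atom | known ]
  end.
Ltac decid_step :=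
  lazymatch goal with
  | |- decid (fun x => True) => exact: decid_true
  | |- decid (fun x => and _ _) => apply: decid_and
  | |- decid (fun x => or _ _) => apply: decid_or
  | |- decid (fun x => not _) => apply: decid_not
  | |- decid (fun x => iff _ _) => apply: decid_iff
  | |- decid (fun x => is_true _) => first [apply: decid_leq | apply: decid_eqb | apply: decid_andb | known]
  | |- decid (fun x => _ = _) => apply: decid_eq
  | |- decid (fun x => forall i, is_true (i < _) -> _) => apply: decid_ball
  | |- decid (fun x => exists2 i, is_true (i < _) & _) => apply: decid_bex
  | |- decid (fun x => @?P x -> @?Q x) => apply: (decid_imp (P := P) (Q := Q))
  | |- decid _ => first [ decid_atom | known ]
  end.
Ltac RE_atom :=
  lazymatch goal with
  | |- RE (fun x => ?P (@?f x) (@?g x) (@?h x) (@?k x)) =>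
     first [ apply: (RE_app4 (P := P) (f := f) (g := g) (h := h) (k := k)); first known
           | lazymatch f with (fun _ => ?c) => apply: (RE_app3 (P := (P c)) (f := g) (g := h) (h := k)); first known end ]
  | |- RE (fun x => ?P (@?f x) (@?g x) (@?h x)) =>
     first [ apply: (RE_app3 (P := P) (f := f) (g := g) (h := h)); first known
           | lazymatch f with (fun _ => ?c) => apply: (RE_app2 (P := (P c)) (f := g) (g := h)); first known end ]
  | |- RE (fun x => ?P (@?f x) (@?g x)) =>
     first [ apply: (RE_app2 (P := P) (f := f) (g := g)); first known
           | lazymatch f with (fun _ => ?c) => apply: (RE_app1 (P := (P c)) (f := g)); first known end ]
  | |- RE (fun x => ?P (@?f x)) =>
     apply: (RE_app1 (P := P) (f := f)); first known
  end.
Ltac RE_step :=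
  lazymatch goal with
  | |- RE (fun x => and _ _) => apply: RE_and
  | |- RE (fun x => or _ _) => apply: RE_or
  | |- RE (fun x => ex _) => apply: RE_ex
  | |- RE (fun x => not _) => apply: RE_dec
  | |- RE (fun x => _ = _) => apply: RE_dec
  | |- RE (fun x => is_true _) => apply: RE_dec
  | |- RE (fun x => forall i, is_true (i < _) -> _) => apply: RE_ball
  | |- RE _ => first [ known | RE_atom | apply: RE_dec; decid_step ]
  end.
Ltac ctac := repeat (first [assumption | comp_step | decid_step | RE_step]).

(** The common shape of the inductive definitions that have to be enumerable. Rules have two
    premises; a rule that has only one is applied to the same derivation twice. *)
Inductive clos (T : Type) (ax : T -> Prop) (r : T -> T -> T -> Prop) : T -> Prop :=
| clos_ax x : ax x -> clos ax r x
| clos_r x a b : r x a b -> clos ax r a -> clos ax r b -> clos ax r x.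

Section REclos.
Variables (E T : Type) (cE : cod E) (cT : cod T) (ax : E -> T -> Prop) (r : E -> T -> T -> T -> Prop).

Let x0 : T := dec 0.
Let just e d i := ax e (nth x0 d i) \/
  exists j, exists k, (is_true (i < j) /\ is_true (j < size d)) /\
   (is_true (i < k) /\ is_true (k < size d)) /\ r e (nth x0 d i) (nth x0 d j) (nth x0 d k).

(** A derivation is a list in which every entry is justified by later ones, the conclusion coming
    first. Being such a list is enumerable, hence so is derivability. *)
Lemma RE_clos : RE (fun y : E * T => ax y.1 y.2) ->
  RE (fun y : E * T * T * T => r y.1.1.1 y.1.1.2 y.1.2 y.2) ->
  RE (fun y : E * T => clos (ax y.1) (r y.1) y.2).
Proof.
move=> hax hr.
have hj : RE (fun y : E * seq T * nat => just y.1.1 y.1.2 y.2) by rewrite /just; ctac.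
have : RE (fun y : E * T => exists d, (is_true (0 < size d) /\ nth x0 d 0 = y.2) /\
    forall i, i < size d -> just y.1 d i) by ctac.
apply: RE_ext => -[e x] /=; split.
  move=> [d [[h0 <-] hd]].
  (* Entries refer to later ones only, hence the induction on the distance to the end of the
     list. *)
  suff H n : forall i, size d <= i + n -> i < size d -> clos (ax e) (r e) (nth x0 d i).
    by apply: (H (size d)); rewrite ?add0n.
  elim: n => [|n IH] i h1 h2; first by lia.
  case: (hd i h2) => [|[j [k [[h3 h4] [[h5 h6] h7]]]]]; first exact: clos_ax.
  by apply: clos_r h7 _ _; apply: IH => //; lia.
have just_cat d1 d2 i : i < size d1 -> just e d1 i -> just e (d1 ++ d2) i.
  move=> hi [h|[j [k [[h3 h4] [[h5 h6] h7]]]]]; first by left; rewrite nth_cat hi.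
  right; exists j, k; rewrite size_cat !nth_cat hi h4 h6; split=> //; first by lia.
  by split=> //; lia.
have just_shift d1 d2 i : just e d2 i -> just e (d1 ++ d2) (size d1 + i).
  have e1 m : nth x0 (d1 ++ d2) (size d1 + m) = nth x0 d2 m.
    by rewrite nth_cat ltnNge leq_addr /= addKn.
  move=> [h|[j [k [[h3 h4] [[h5 h6] h7]]]]]; first by left; rewrite e1.
  right; exists (size d1 + j), (size d1 + k); rewrite size_cat !ltn_add2l !e1.
  by rewrite h3 h4 h5 h6.
elim=> {x} [x hx|x a b h _ [d1 [[s1 n1] H1]] _ [d2 [[s2 n2] H2]]].
  by exists [:: x]; split=> // -[|i] //= _; left.
exists ([:: x] ++ (d1 ++ d2)); split=> // -[|i] /= hi.
  right; exists 1, (size d1).+1; rewrite /= size_cat nth_cat s1 n1 nth_cat ltnn subnn n2.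
  by split; [lia | split => //; lia].
rewrite -[i.+1]/(size [:: x] + i) -[x :: _]/([:: x] ++ _); apply: (just_shift [:: x]).
move: hi; rewrite /= size_cat ltnS => hi.
case: (ltnP i (size d1)) => h1; first by apply: just_cat => //; apply: H1.
by rewrite -(subnKC h1); apply: just_shift; apply: H2; lia.
Qed.

End REclos.

(** Course-of-values recursion: [G e n t] may consult the table [t] of the answers for [D e] below
    [n], 1 standing for true. *)
Lemma decid_cov (E : Type) (cE : cod E) (D : E -> nat -> Prop) (G : E -> nat -> seq nat -> Prop) :
  decid (fun y : E * nat * seq nat => G y.1.1 y.1.2 y.2) ->
  (forall e n t, size t = n -> (forall i, i < n -> (nth 0 t i = 1 <-> D e i)) -> (D e n <-> G e n t)) ->
  decid (fun y : E * nat => D y.1 y.2).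
Proof.
move=> hG h.
pose tab e n := iteri n (fun i t => rcons t (if `[< G e i t >] then 1 else 0)) [::].
have htab : computable (fun y : E * nat => tab y.1 y.2).
  by rewrite /tab; ctac.
have : decid (fun y : E * nat => G y.1 y.2 (tab y.1 y.2)) by ctac.
apply: decid_ext => -[e n] /=.
suff H : size (tab e n) = n /\ forall i, i < n -> (nth 0 (tab e n) i = 1 <-> D e i).
  by rewrite (h e n (tab e n)); [| apply H.. ].
elim: n => [|n [s1 IH]]; first by split.
rewrite /tab /= -/(tab e n) size_rcons s1; split=> // i.
rewrite ltnS leq_eqVlt nth_rcons s1 => /orP [/eqP ->|hi]; last by rewrite hi; apply: IH.
by rewrite ltnn eqxx (h e n (tab e n)) //; case: asboolP.
Qed.

(** * Enumerability of the universal function *)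

Lemma enc_inj {T} {cT : cod T} : injective (enc (T := T)).
Proof. exact: (can_inj encK). Qed.

Section PrfInd.
Variable P : prf -> Prop.
Hypotheses (h0 : P PZero) (h1 : P PSucc) (h2 : forall i, P (PProj i))
  (h3 : forall f gs, P f -> (forall i, i < size gs -> P (nth PZero gs i)) -> P (PComp f gs))
  (h4 : forall f g, P f -> P g -> P (PRec f g)) (h5 : forall f, P f -> P (PMu f)).
(** The programs under [PComp] form a list, for which the generated principle gives no hypothesis;
    the inner fixpoint walks through it. *)
Fixpoint prf_ind' (p : prf) : P p :=
  match p with
  | PZero => h0 | PSucc => h1 | PProj i => h2 i
  | PComp f gs => h3 (prf_ind' f)
      ((fix all (gs : seq prf) : forall i, i < size gs -> P (nth PZero gs i) :=
        match gs return forall i, i < size gs -> P (nth PZero gs i) with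
        | [::] => fun i hi => False_ind _ (notF hi)
        | g :: gs' => fun i => match i return i < size (g :: gs') -> P (nth PZero (g :: gs') i) with
            | 0 => fun _ => prf_ind' g | j.+1 => fun hj => all gs' j hj end
        end) gs)
  | PRec f g => h4 (prf_ind' f) (prf_ind' g)
  | PMu f => h5 (prf_ind' f)
  end.
End PrfInd.

Lemma prf_enc_inj : injective prf_enc.
Proof.
elim/prf_ind' => [||i|f gs IHf IHgs|f g IHf IHg|f IHf] [||j|f' gs'|f' g'|f'] //= [].
- by move=> ->.
- move=> /IHf -> e; congr PComp.
  elim: gs gs' IHgs e => [|g gs IH] [|g' gs'] //= h [e1 e2]; congr cons; first exact: (h 0).
  by apply: IH => // i hi; apply: (h i.+1).
- by move=> /IHf -> /IHg ->.
by move=> /IHf ->.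
Qed.

Section EvalInd.
Variables (P : prf -> seq nat -> nat -> Prop) (Q : seq prf -> seq nat -> seq nat -> Prop).
Hypotheses (h0 : forall l, P PZero l 0) (h1 : forall x l, P PSucc (x :: l) x.+1)
  (h2 : forall i l, P (PProj i) l (nth 0 l i))
  (h3 : forall f gs l ys y, Q gs l ys -> P f ys y -> P (PComp f gs) l y)
  (h4 : forall f g l y, P f l y -> P (PRec f g) (0 :: l) y)
  (h5 : forall f g n l z y, P (PRec f g) (n :: l) z -> P g [:: n, z & l] y ->
     P (PRec f g) (n.+1 :: l) y)
  (h6 : forall f l n, P f (n :: l) 0 -> (forall m, m < n -> exists k, P f (m :: l) k.+1) ->
     P (PMu f) l n)
  (h7 : forall l, Q [::] l [::])
  (h8 : forall g gs l y ys, P g l y -> Q gs l ys -> Q (g :: gs) l (y :: ys)).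
(** Written by hand because the premises of [ev_mu] about smaller arguments hide an evaluation under
    [exists k]; the recursive call is made on the witness. *)
Fixpoint eval_ind' p l y (e : eval p l y) : P p l y :=
  match e with
  | ev_zero l => h0 l | ev_succ x l => h1 x l | ev_proj i l => h2 i l
  | ev_comp f gs l ys y a b => h3 (evals_ind' a) (eval_ind' b)
  | ev_rec0 f g l y a => h4 g (eval_ind' a)
  | ev_recS f g n l z y a b => h5 (eval_ind' a) (eval_ind' b)
  | ev_mu f l n a b => h6 (eval_ind' a)
      (fun m hm => let: ex_intro k hk := b m hm in ex_intro _ k (eval_ind' hk))
  end
with evals_ind' gs l ys (e : evals gs l ys) : Q gs l ys :=
  match e with
  | evs_nil l => h7 l
  | evs_cons g gs l y ys a b => h8 (eval_ind' a) (evals_ind' b)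
  end.
End EvalInd.

Lemma eval_det p l y y' : eval p l y -> eval p l y' -> y = y'.
Proof.
move=> h; move: h y'.
apply: (@eval_ind' (fun p l y => forall y', eval p l y' -> y = y')
  (fun gs l ys => forall ys', evals gs l ys' -> ys = ys')).
- by move=> l' y' h; inversion h.
- by move=> x l' y' h; inversion h.
- by move=> i l' y' h; inversion h.
- by move=> f gs l' ys y1 IH1 IH2 y' h; inversion h; subst;
  match goal with H : evals _ _ _ |- _ => apply: IH2; rewrite (IH1 _ H) end.
- by move=> f g l' y1 IH y' h; inversion h; subst; apply: IH.
- move=> f g n l' z y1 IH1 IH2 y' h; inversion h; subst.
  by match goal with H : eval (PRec _ _) _ _, H' : eval g _ _ |- _ =>
    apply: IH2; rewrite (IH1 _ H) end.
- move=> f l' n IH1 IH2 y' h; inversion h as [| | | | | |? ? ? Ha Hb]; subst.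
  case: (ltngtP n y') => // hn.
    by have [k /IH1] := Hb n hn.
  by have [k /(_ _ Ha)] := IH2 _ hn.
- by move=> l' ys' h; inversion h.
- by move=> g gs l' y1 ys IH1 IH2 ys' h; inversion h as [|? ? ? ? ? Ha Hb]; subst; rewrite (IH1 _ Ha) (IH2 _ Hb).
Qed.

Lemma phi_det e n y y' : phi e n y -> phi e n y' -> y = y'.
Proof.
move=> [p [hp h]] [q [hq h']]; apply: (eval_det h); suff -> : p = q by [].
by apply: prf_enc_inj; apply: (pcan_inj pickleK); rewrite hp hq.
Qed.

(** * Programs as strings of numbers *)

Definition syl n := pickle (inl n : nat + nat).
Definition syr n := pickle (inr n : nat + nat).
(** The string whose list code is [pickle t]: a node gives an opening letter with its label, the
    strings of its children, and a closing letter. Indices are thereby built and analysed by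
    concatenation of lists, without trees as coded data. *)
Definition str (t : GenTree.tree nat) := map pickle (GenTree.encode t).
Definition strs (ts : seq (GenTree.tree nat)) := flatten (map str ts).

Lemma pickle_str t : pickle t = enc (str t).
Proof. by rewrite /enc /= /seq_enc map_id. Qed.

Lemma str_inj : injective str.
Proof. by move=> t u e; apply: (pcan_inj pickleK); rewrite !pickle_str e. Qed.

Lemma str_node k ts : str (GenTree.Node k ts) = syl k.+1 :: strs ts ++ [:: syl 0].
Proof.
rewrite /str /= map_rcons -cats1 /strs map_flatten -map_comp; congr (_ :: _ ++ _).
Qed.

Lemma strs_cons t ts : strs (t :: ts) = str t ++ strs ts.
Proof. by []. Qed.

Lemma strs_nil : strs [::] = [::].
Proof. by []. Qed.

Lemma comp_syl : computable syl.
Proof. by apply: (comp_ext (f := fun n : nat => enc [:: enc [:: n]; 0])) => //; ctac. Qed.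
Lemma comp_syr : computable syr.
Proof. by apply: (comp_ext (f := fun n : nat => enc [:: 0; enc [:: n]])) => //; ctac. Qed.
#[export] Hint Resolve comp_syl comp_syr : comp.

Definition node k (w : seq nat) := syl k.+1 :: w ++ [:: syl 0].

Lemma strE k ts : str (GenTree.Node k ts) = node k (strs ts).
Proof. exact: str_node. Qed.

Lemma comp_node : computable (fun y : nat * seq nat => node y.1 y.2).
Proof. by rewrite /node; ctac. Qed.
#[export] Hint Resolve comp_node : comp.

Definition pstr p := str (prf_enc p).
Definition pstrs gs := strs (map prf_enc gs).

Lemma pstr_inj : injective pstr.
Proof. by move=> p q /str_inj /prf_enc_inj. Qed.

Lemma pstrE p : pstr p = match p with
  | PZero => node 0 [::] | PSucc => node 1 [::] | PProj i => node 2 [:: syr i]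
  | PComp f gs => node 3 (pstr f ++ pstrs gs) | PRec f g => node 4 (pstr f ++ pstr g)
  | PMu f => node 5 (pstr f) end.
Proof.
case: p => [||i|f gs|f g|f]; rewrite /pstr strE ?strs_cons ?strs_nil ?cats0 //.
Qed.

(* Judgements about program strings, by tag: 0 valid program, 1 evaluation, 2 evaluation of a
   list of programs (the values being coded), 3 positive values below a bound, 4 valid list of
   programs, 5 evaluation of a primitive recursion given by its two components. *)
Definition judg := (nat * seq (seq nat) * seq nat * nat)%type.

Definition jax (j : judg) : Prop :=
  j = (0, [:: node 0 [::]], [::], 0) \/ j = (0, [:: node 1 [::]], [::], 0) \/
  (exists i, j = (0, [:: node 2 [:: syr i]], [::], 0)) \/ j = (4, [:: [::]], [::], 0) \/
  (exists l, j = (1, [:: node 0 [::]], l, 0)) \/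
  (exists x, exists l, j = (1, [:: node 1 [::]], x :: l, x.+1)) \/
  (exists i, exists l, j = (1, [:: node 2 [:: syr i]], l, nth 0 l i)) \/
  (exists l, j = (2, [:: [::]], l, enc ([::] : seq nat))).

Definition jrule (j a b : judg) : Prop :=
  (exists v, exists w, a = (0, [:: v], [::], 0) /\ b = (4, [:: w], [::], 0) /\
     (j = (4, [:: v ++ w], [::], 0) \/ j = (0, [:: node 3 (v ++ w)], [::], 0))) \/
  (exists v, exists w, a = (0, [:: v], [::], 0) /\ b = (0, [:: w], [::], 0) /\
     (j = (0, [:: node 4 (v ++ w)], [::], 0) \/ j = (0, [:: node 5 v], [::], 0) \/
      exists l, j = (3, [:: v], l, 0))) \/
  (exists v, exists w, exists l, exists y, exists ys : seq nat,
     a = (1, [:: v], l, y) /\ b = (2, [:: w], l, enc ys) /\ j = (2, [:: v ++ w], l, enc (y :: ys))) \/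
  (exists v, exists w, exists l, exists y, exists ys : seq nat,
     a = (2, [:: w], l, enc ys) /\ b = (1, [:: v], ys, y) /\ j = (1, [:: node 3 (v ++ w)], l, y)) \/
  (exists v, exists w, exists l, exists y,
     a = (1, [:: v], l, y) /\ b = (0, [:: w], [::], 0) /\ j = (5, [:: v; w], 0 :: l, y)) \/
  (exists v, exists w, exists l, exists y, exists n, exists z,
     a = (5, [:: v; w], n :: l, z) /\ b = (1, [:: w], [:: n, z & l], y) /\
     j = (5, [:: v; w], n.+1 :: l, y)) \/
  (exists v, exists w, exists l, exists y,
     a = (5, [:: v; w], l, y) /\ j = (1, [:: node 4 (v ++ w)], l, y)) \/
  (exists v, exists l, exists n, exists k, a = (3, [:: v], l, n) /\ b = (1, [:: v], n :: l, k) /\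
     ((k = 0 /\ j = (1, [:: node 5 v], l, n)) \/ (k <> 0 /\ j = (3, [:: v], l, n.+1)))).

Definition jsem (j : judg) : Prop :=
  let: (t, ws, l, y) := j in
  match t, ws with
  | 0, [:: w] => exists p, pstr p = w
  | 1, [:: w] => exists p, pstr p = w /\ eval p l y
  | 2, [:: w] => exists gs ys, pstrs gs = w /\ enc ys = y /\ evals gs l ys
  | 3, [:: w] => exists p, pstr p = w /\ forall m, m < y -> exists k, eval p (m :: l) k.+1
  | 4, [:: w] => exists gs, pstrs gs = w
  | 5, [:: v; w] => exists p q, [/\ pstr p = v, pstr q = w & eval (PRec p q) l y]
  | _, _ => False
  end.

(** Injectivity of [pstr] makes the rules sound: two premises about the same string speak of the
    same program. *)
Lemma clos_sem j : clos jax jrule j -> jsem j.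
Proof.
elim=> {j} [j|j a b h _ IHa _ IHb].
  case=> [->|[->|[[i ->]|[->|[[l ->]|[[x [l ->]]|[[i [l ->]]|[l ->]]]]]]]] /=.
  - by exists PZero; rewrite pstrE.
  - by exists PSucc; rewrite pstrE.
  - by exists (PProj i); rewrite pstrE.
  - by exists [::].
  - by exists PZero; rewrite pstrE; split=> //; constructor.
  - by exists PSucc; rewrite pstrE; split=> //; constructor.
  - by exists (PProj i); rewrite pstrE; split=> //; constructor.
  - by exists [::], [::]; split=> //; split=> //; constructor.
case: h IHa IHb => [[v [w [-> [-> [->|->]]]]]|[[v [w [-> [-> [->|[->|[l ->]]]]]]]|[|]]] /=.
- by move=> [p <-] [gs <-]; exists (p :: gs).
- by move=> [p <-] [gs <-]; exists (PComp p gs); rewrite pstrE.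
- by move=> [p <-] [q <-]; exists (PRec p q); rewrite pstrE.
- by move=> [p <-] _; exists (PMu p); rewrite pstrE.
- by move=> [p <-] _; exists p.
- move=> [v [w [l [y [ys [-> [-> ->]]]]]]] /= [p [<- h1]] [gs [zs [e1 [e2 h2]]]].
  rewrite -e1 -(enc_inj e2).
  by exists (p :: gs), (y :: zs); split=> //; split=> //; constructor.
move=> [[v [w [l [y [ys [-> [-> ->]]]]]]]|[|]] /=.
- move=> [gs [zs [e1 [e2 h2]]]] [p [e3 h1]]; rewrite -e1 -e3.
  have e := enc_inj e2; subst zs.
  by exists (PComp p gs); rewrite [LHS]pstrE; split=> //; apply: ev_comp h2 h1.
- move=> [v [w [l [y [-> [-> ->]]]]]] /= [p [<- h1]] [q <-].
  by exists p, q; split=> //; constructor.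
move=> [[v [w [l [y [n [z [-> [-> ->]]]]]]]]|[|]] /=.
- move=> [p [q [<- <- h1]]] [q' [/pstr_inj -> h2]].
  by exists p, q; split=> //; apply: ev_recS h1 h2.
- move=> [v [w [l [y [-> ->]]]]] /= [p [q [<- <- h1]]] _.
  by exists (PRec p q); rewrite [LHS]pstrE.
move=> [v [l [n [k [-> [-> [[k0 ->]|[k0 ->]]]]]]]] /= [p [<- h1]] [q [/pstr_inj -> h2]].
- by exists (PMu p); rewrite [LHS]pstrE; split=> //; apply: ev_mu h1; rewrite -k0.
- exists p; split=> // m; rewrite ltnS leq_eqVlt => /orP [/eqP ->|]; last exact: h1.
  by exists k.-1; rewrite prednK // lt0n; apply/eqP.
Qed.

Lemma clos_valid p : clos jax jrule (0, [:: pstr p], [::], 0).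
Proof.
elim/prf_ind': p => [||i|f gs IHf IHgs|f g IHf IHg|f IHf]; rewrite pstrE.
- by apply: clos_ax; left.
- by apply: clos_ax; right; left.
- by apply: clos_ax; do 2!right; left; exists i.
- have h : clos jax jrule (4, [:: pstrs gs], [::], 0).
    elim: gs IHgs => [|g gs IH] H; first by apply: clos_ax; do 3!right; left.
    have H1 : forall i, i < size gs -> clos jax jrule (0, [:: pstr (nth PZero gs i)], [::], 0).
      by move=> i hi; apply: (H i.+1).
    apply: clos_r (H 0 isT) (IH H1); left; exists (pstr g), (pstrs gs); do 2!split=> //.
    by left.
  by apply: clos_r IHf h; left; exists (pstr f), (pstrs gs); do 2!split=> //; right.
- by apply: clos_r IHf IHg; right; left; exists (pstr f), (pstr g); do 2!split=> //; left.
- by apply: (clos_r _ IHf IHf); right; left; exists (pstr f), (pstr f); do 2!split=> //; right; left.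
Qed.

Lemma clos_eval p l y : eval p l y -> clos jax jrule (1, [:: pstr p], l, y).
Proof.
(* For a primitive recursion the judgement of tag 5 is carried along, because the next round needs
   the two components separately. *)
pose Pr p l y := clos jax jrule (1, [:: pstr p], l, y) /\
  if p is PRec f g then clos jax jrule (5, [:: pstr f; pstr g], l, y) else True.
move=> h; suff: Pr p l y by case.
move: h; apply: (@eval_ind' Pr (fun gs l ys => clos jax jrule (2, [:: pstrs gs], l, enc ys)));
  rewrite /Pr => {p l y}.
- by move=> l; split=> //; apply: clos_ax; do 4!right; left; exists l; rewrite pstrE.
- by move=> x l; split=> //; apply: clos_ax; do 5!right; left; exists x, l; rewrite pstrE.
- by move=> i l; split=> //; apply: clos_ax; do 6!right; left; exists i, l; rewrite pstrE.
- move=> f gs l ys y h1 [h2 _]; split=> //; apply: clos_r h1 h2; do 3!right; left.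
  by exists (pstr f), (pstrs gs), l, y, ys; rewrite [pstr (PComp _ _)]pstrE.
- move=> f g l y [h1 _].
  have h : clos jax jrule (5, [:: pstr f; pstr g], 0 :: l, y).
    apply: clos_r h1 (clos_valid g); do 4!right; left.
    by exists (pstr f), (pstr g), l, y.
  split=> //; apply: (clos_r _ h h); do 6!right; left.
  by exists (pstr f), (pstr g), (0 :: l), y; rewrite [pstr (PRec _ _)]pstrE.
- move=> f g n l z y [_ h1] [h2 _].
  have h : clos jax jrule (5, [:: pstr f; pstr g], n.+1 :: l, y).
    by apply: clos_r h1 h2; do 5!right; left; exists (pstr f), (pstr g), l, y, n, z.
  split=> //; apply: (clos_r _ h h); do 6!right; left.
  by exists (pstr f), (pstr g), (n.+1 :: l), y; rewrite [pstr (PRec _ _)]pstrE.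
- move=> f l n [h1 _] h2; split=> //.
  have h m : m <= n -> clos jax jrule (3, [:: pstr f], l, m).
    elim: m => [|m IH] hm.
      apply: clos_r (clos_valid f) (clos_valid f); right; left.
      by exists (pstr f), (pstr f); do 2!split=> //; do 2!right; exists l.
    have [k [hk _]] := h2 m hm; apply: clos_r (IH (ltnW hm)) hk; do 7!right.
    by exists (pstr f), l, m, k.+1; do 2!split=> //; right.
  apply: clos_r (h n (leqnn n)) h1; do 7!right.
  by exists (pstr f), l, n, 0; do 2!split=> //; left; rewrite [pstr (PMu _)]pstrE.
- by move=> l; apply: clos_ax; do 7!right; exists l.
- move=> g gs l y ys [h1 _] h2; apply: clos_r h1 h2; do 2!right; left.
  by exists (pstr g), (pstrs gs), l, y, ys.
Qed.

(** Convergence is derivability of a judgement of tag 1 about the string decoded from the index, so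
    the universal function is enumerable without a universal program being written. *)
Lemma RE_phi : RE (fun y : nat * nat * nat => phi y.1.1 y.1.2 y.2).
Proof.
have hc : RE (fun y : nat * judg => clos jax jrule y.2).
  apply: (RE_clos (ax := fun=> jax) (r := fun=> jrule)).
    by rewrite /jax; ctac.
  by rewrite /jrule; ctac.
have : RE (fun y : nat * nat * nat => clos jax jrule (1, [:: dec y.1.1], [:: y.1.2], y.2)).
  by apply: (RE_app1 (f := fun y : nat * nat * nat => (0, ((1, [:: dec y.1.1], [:: y.1.2], y.2) : judg))) hc); ctac.
apply: RE_ext => -[[e n] y] /=; split=> [/clos_sem [p [hp h]]|[p [<- h]]].
  by exists p; split=> //; rewrite pickle_str -[str _]/(pstr p) hp decK.
by rewrite pickle_str encK; apply: clos_eval.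
Qed.

(** * Indices and the arithmetical hierarchy *)

#[export] Hint Resolve RE_phi : comp.

Lemma pstrs_nil : pstrs [::] = [::].
Proof. by []. Qed.

Lemma pstrs_cons g gs : pstrs (g :: gs) = pstr g ++ pstrs gs.
Proof. by []. Qed.

Lemma computableP (f : nat -> nat) : computable f -> computable_fun f.
Proof.
move=> [p hp]; exists (pickle (prf_enc p)) => n; exists p; split=> //.
exact: (hp [:: n]).
Qed.

(** The specialised program feeds [p] with the pairing of a constant program and a projection. Its
    index is computable in [n] because the string of the constant program is obtained by [n]
    iterations. *)
Theorem smn (F : nat * nat -> nat) : computable F ->
  exists2 f, computable_fun f & forall n c, phi (f n) c (F (n, c)).
Proof.
move=> [p hp].
have [q hq] := lcomp_npair (lcomp_proj 2 0) (lcomp_proj 2 1).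
pose cst n := iter n (fun p => PComp PSucc [:: p]) PZero.
have hc n l : eval (cst n) l n.
  elim: n => [|n IH] /=; first by constructor.
  by apply: (ev_comp (ys := [:: n])); [do 2!constructor=> // | constructor].
pose prg n := PComp p [:: PComp q [:: cst n; PProj 0]].
exists (fun n => pickle (prf_enc (prg n))); last first.
  move=> n c; exists (prg n); split=> //.
  have h : eval p [:: npair n c] (F (n, c)).
    by have := hp [:: npair n c] erefl; rewrite /= (encK (n, c)).
  apply: (ev_comp (ys := [:: npair n c])); last exact: h.
  constructor; last by constructor.
  apply: (ev_comp (ys := [:: n; c])); last exact: (hq [:: n; c]).
  by constructor=> //; constructor; [exact: (ev_proj 0 [:: c]) | constructor].
apply: computableP; have hw : forall n, pstr (cst n) = iter n (fun w => node 3 (node 1 [::] ++ w)) (node 0 [::]).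
  elim=> [|n IH] /=; rewrite pstrE //; congr (node 3 _).
  by rewrite pstrE -IH /pstrs /strs /= cats0.
pose w1 := pstr p; pose w2 := pstr q.
apply: (comp_ext (f := fun n : nat => enc (node 3 (w1 ++ node 3 (w2 ++
   iter n (fun w => node 3 (node 1 [::] ++ w)) (node 0 [::]) ++ node 2 [:: syr 0]))))); last by ctac.
move=> n; rewrite pickle_str; congr enc; rewrite -/(pstr (prg n)) /prg (pstrE (PComp p _)).
by rewrite pstrs_cons pstrs_nil cats0 (pstrE (PComp q _)) !pstrs_cons pstrs_nil cats0 hw (pstrE (PProj 0)).
Qed.

(** * Sigma2 and Sigma3 predicates on coded types *)

Definition Sig2 {T} {cT : cod T} (P : T -> Prop) :=
  exists2 Q : T -> nat -> nat -> Prop, decid (fun y : T * nat * nat => Q y.1.1 y.1.2 y.2)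
    & forall x, P x <-> exists u, forall v, Q x u v.

Definition Sig3 {T} {cT : cod T} (P : T -> Prop) :=
  exists2 Q : T -> nat -> nat -> nat -> Prop,
    decid (fun y : T * nat * nat * nat => Q y.1.1.1 y.1.1.2 y.1.2 y.2)
    & forall x, P x <-> exists u, forall v, exists w, Q x u v w.

Lemma computable_rel_decid {T} {cT : cod T} (R : seq nat -> Prop) (f : T -> seq nat) :
  computable_rel R -> forall k, (forall x, size (f x) = k) -> computable f -> decid (fun x => R (f x)).
Proof.
move=> [p hp] k hk hf.
have h : lcomp k (fun l => if `[< R l >] then 1 else 0).
  by exists p => l _; case: asboolP => h; [apply (hp l).1 | apply (hp l).2].
have hc : computable (fun x => if `[< R (f x) >] then 1 else 0).
  pose gs := [seq (fun l : seq nat => nth 0 (f (@dec T cT (nth 0 l 0))) i) | i <- iota 0 k].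
  have sg : size gs = k by rewrite size_map size_iota.
  have hg i : i < size gs -> lcomp 1 (nth (fun=> 0) gs i).
    rewrite sg => hi; rewrite (nth_map 0) ?size_iota // nth_iota //.
    have : computable (fun x => nth 0 (f x) i) by ctac.
    by [].
  have h' := lcomp_comp (G := fun l => if `[< R l >] then 1 else 0) _ hg.
  rewrite sg in h'; apply: lcomp_ext (h' h) => l _.
  have -> : [seq g l | g <- gs] = f (dec (nth 0 l 0)).
    rewrite -map_comp; apply: (@eq_from_nth _ 0); rewrite size_map size_iota ?hk // => i hi.
    by rewrite (nth_map 0) ?size_iota //= nth_iota.
  by [].
exists (fun x => 1 - (if `[< R (f x) >] then 1 else 0)); first by ctac.
by move=> x; case: asboolP.
Qed.

(** [computable_rel] concerns lists of all lengths, whereas [lcomp] controls a program only on lists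
    of length [k]. Projections return 0 beyond the end, so the input is first cut or padded to
    length [k] by projections. *)
Lemma decid_computable_rel {T} {cT : cod T} (R : T -> Prop) (f : seq nat -> T) k :
  lcomp k (fun l => enc (f l)) -> (forall l, f l = f (take k (l ++ nseq k 0))) ->
  decid R -> computable_rel (fun l => R (f l)).
Proof.
move=> [q hq] ht [g hg hR].
have [p hp] : computable (fun x => 1 - g x) by ctac.
exists (PComp p [:: PComp q [seq PProj i | i <- iota 0 k]]) => l.
have hl : eval (PComp p [:: PComp q [seq PProj i | i <- iota 0 k]]) l (1 - g (f l)).
  pose l' := take k (l ++ nseq k 0).
  have sl : size l' = k by rewrite size_take size_cat size_nseq; case: ifP; lia.
  have h : eval p [:: enc (f l)] (1 - g (f l)).
    by have := hp [:: @enc T cT (f l)] erefl; rewrite /= (encK (f l)).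
  apply: (ev_comp (ys := [:: enc (f l)])); last exact: h.
  constructor; last by constructor.
  apply: (ev_comp (ys := l')); last by rewrite ht; apply: hq.
  have -> : l' = [seq nth 0 l i | i <- iota 0 k].
    apply: (@eq_from_nth _ 0); rewrite ?size_map ?size_iota // sl => i hi.
    rewrite (nth_map 0) ?size_iota // nth_iota // add0n nth_take //.
    by rewrite nth_cat; case: ltnP => // h1; rewrite nth_nseq nth_default //; case: ifP.
  by elim: (iota 0 k) => [|i s IH] /=; do ?constructor.
split=> h; first by have := (hR _).1 h => e; rewrite e in hl.
case E: (g (f l)) hl => [|m] hl; first by case: h; apply/hR.
exact: hl.
Qed.

Lemma Sig2P (S : nat -> Prop) : Sig2 S <-> Sigma0 2 S.
Proof.
split=> [[Q hQ h]|[P [[Q [[Q' [hQ' h1]] h2]] hP]]].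
  exists (fun l => exists u, forall v, Q (nth 0 l 0) u v); split=> //.
  exists (fun l => forall v, Q (nth 0 l 1) (nth 0 l 0) v); split=> //.
  exists (fun l => ~ Q (nth 0 l 2) (nth 0 l 1) (nth 0 l 0)); split; last first.
    by move=> l; rewrite /= -existsNP.
  apply: (decid_computable_rel (R := fun y : nat * nat * nat => ~ ~ Q y.1.1 y.1.2 y.2)
    (f := fun l => (nth 0 l 2, nth 0 l 1, nth 0 l 0)) (k := 3)); last by do 2!apply: decid_not.
  - by do !apply: lcomp_npair; apply: lcomp_proj.
  - move=> l; have e i : i < 3 -> nth 0 (take 3 (l ++ nseq 3 0)) i = nth 0 l i.
      move=> hi; rewrite nth_take // nth_cat; case: ltnP => // h1.
      by rewrite nth_nseq nth_default //; case: ifP.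
    by rewrite !e.
exists (fun n x y => ~ Q' [:: y; x; n]).
  by apply: (computable_rel_decid (f := fun y : nat * nat * nat => [:: y.2; y.1.2; y.1.1]) hQ' (k := 3)) => //; ctac.
move=> n; rewrite hP h2; split=> -[x hx]; exists x.
  by move=> y hy; have := (h1 [:: x; n]).2; apply=> //; exists y.
by apply: contrapT => /(h1 [:: x; n]).1 [y]; apply: hx.
Qed.

Lemma Sig3P (S : nat -> Prop) : Sig3 S <-> Sigma0 3 S.
Proof.
split=> [[Q hQ h]|[P [[Q [[Q' [[Q'' [hQ' h0]] h1]] h2]] hP]]].
  exists (fun l => exists u, forall v, exists w, Q (nth 0 l 0) u v w); split=> //.
  exists (fun l => forall v, exists w, Q (nth 0 l 1) (nth 0 l 0) v w); split=> //.
  exists (fun l => ~ exists w, Q (nth 0 l 2) (nth 0 l 1) (nth 0 l 0) w); split; last first.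
    by move=> l; rewrite /= -existsNP.
  exists (fun l => Q (nth 0 l 3) (nth 0 l 2) (nth 0 l 1) (nth 0 l 0)); split; last first.
    by move=> l /=; rewrite notK.
  apply: (decid_computable_rel (R := fun y : nat * nat * nat * nat => ~ Q y.1.1.1 y.1.1.2 y.1.2 y.2)
    (f := fun l => (nth 0 l 3, nth 0 l 2, nth 0 l 1, nth 0 l 0)) (k := 4)); last exact: decid_not.
  - by do !apply: lcomp_npair; apply: lcomp_proj.
  - move=> l; have e i : i < 4 -> nth 0 (take 4 (l ++ nseq 4 0)) i = nth 0 l i.
      move=> hi; rewrite nth_take // nth_cat; case: ltnP => // h1.
      by rewrite nth_nseq nth_default //; case: ifP.
    by rewrite !e.
exists (fun n x y z => Q'' [:: z; y; x; n]).
  apply: decid_ext; last first.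
    apply: decid_not; apply: (computable_rel_decid (f := fun y : nat * nat * nat * nat => [:: y.2; y.1.2; y.1.1.2; y.1.1.1]) hQ' (k := 4)) => //; ctac.
  by move=> y /=; rewrite notK.
move=> n; rewrite hP h2; split=> -[x hx]; exists x.
  move=> y; apply/(h0 [:: y; x; n]) => hy; have := (h1 [:: x; n]).2; apply=> //; by exists y.
apply: contrapT => /(h1 [:: x; n]).1 [y hy].
by have /(h0 [:: y; x; n]) := hx y; apply.
Qed.

Lemma Sig2_ext {T} {cT : cod T} (P Q : T -> Prop) : (forall x, P x <-> Q x) -> Sig2 P -> Sig2 Q.
Proof. by move=> e [f hf h]; exists f => // x; rewrite -e. Qed.

Lemma Sig2_RE {T} {cT : cod T} (P : T -> Prop) : RE P -> Sig2 P.
Proof.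
move=> [Q hQ h]; exists (fun x u _ => Q x u); first by ctac.
by move=> x; rewrite h; split=> -[u hu]; exists u => //; apply: hu 0.
Qed.

Lemma Sig2_coRE {T} {cT : cod T} (P : T -> Prop) : RE P -> Sig2 (fun x => ~ P x).
Proof.
move=> [Q hQ h]; exists (fun x _ v => ~ Q x v); first by ctac.
by move=> x; rewrite h; split=> [hn|[u hu] [v /hu]] //; exists 0 => v hv; apply: hn; exists v.
Qed.

Lemma Sig2_and {T} {cT : cod T} (P Q : T -> Prop) : Sig2 P -> Sig2 Q -> Sig2 (fun x => P x /\ Q x).
Proof.
move=> [A hA h] [B hB h'].
exists (fun x u v => A x (dec u : nat * nat).1 v /\ B x (dec u : nat * nat).2 v); first by ctac.
move=> x; rewrite h h'; split=> [[[u hu] [u' hu']]|[u hu]].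
  by exists (enc (u, u')) => v; rewrite encK.
by split; [exists (dec u : nat * nat).1 => v; case: (hu v) | exists (dec u : nat * nat).2 => v; case: (hu v)].
Qed.

Lemma Sig2_ex {T U} {cT : cod T} {cU : cod U} (P : T -> U -> Prop) :
  Sig2 (fun y : T * U => P y.1 y.2) -> Sig2 (fun x => exists y, P x y).
Proof.
move=> [A hA h].
exists (fun x u v => A (x, (dec u : U * nat).1) (dec u : U * nat).2 v); first by ctac.
move=> x; split=> [[y /(h (x, y)) [u hu]]|[u hu]].
  by exists (enc (y, u)) => v; rewrite encK.
by exists (dec u : U * nat).1; apply/(h (x, _)); exists (dec u : U * nat).2.
Qed.

(** A Pi3 set is given through its complement ([Pi0]); the universal quantification of a Sigma2
    predicate is the form that occurs below. *)
Lemma Sig3_of_Sig2 {T U} {cT : cod T} {cU : cod U} (P : T -> U -> Prop) :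
  Sig2 (fun y : T * U => P y.1 y.2) -> Sig3 (fun x => ~ forall y, P x y).
Proof.
move=> [Q hQ h]; exists (fun x y u v => ~ Q (x, dec y) u v); first by ctac.
move=> x; rewrite -existsNP; split=> [[y hy]|[y hy]].
  exists (enc y) => u; rewrite encK; apply: contrapT => hn; apply: hy; apply/(h (x, y)).
  by exists u => v; apply: contrapT => hv; apply: hn; exists v.
exists (dec y) => /(h (x, dec y)) [u hu]; have [v] := hy u; apply; exact: hu.
Qed.

(** * Strings and codes of terms and literals *)

Definition tstr t := str (term_enc t).
Lemma tstrE t : tstr t = match t with
  | TC n => node 0 [:: syr n] | T0 => node 1 [::] | T1 => node 2 [::]
  | TAdd t u => node 3 (tstr t ++ tstr u) | TMul t u => node 4 (tstr t ++ tstr u)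
  | TOpp t => node 5 (tstr t) end.
Proof. by case: t => [n|||t u|t u|t]; rewrite /tstr strE ?strs_cons ?strs_nil ?cats0. Qed.

Definition atstr (k : nat) (v w : seq nat) := node k (v ++ w).
Definition litcode (b k : nat) (v w : seq nat) := enc (node b (atstr k v w)).
Lemma literal_codeE l : literal_code l = match l with
  | LPos (AEq t u) => litcode 0 0 (tstr t) (tstr u) | LPos (ALe t u) => litcode 0 1 (tstr t) (tstr u)
  | LNeg (AEq t u) => litcode 1 0 (tstr t) (tstr u) | LNeg (ALe t u) => litcode 1 1 (tstr t) (tstr u) end.
Proof.
by case: l => -[] t u; rewrite /literal_code pickle_str strE ?strs_cons ?strs_nil ?cats0 strE
  ?strs_cons ?strs_nil ?cats0.
Qed.

Fixpoint num k := if k is j.+1 then TAdd T1 (num j) else T0.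

Lemma comp_num : computable (fun k => tstr (num k)).
Proof.
apply: (comp_ext (f := fun k => iter k (fun w => node 3 (node 2 [::] ++ w)) (node 1 [::]))); last by ctac.
elim=> [|k IH]; first by rewrite tstrE.
by rewrite [RHS](tstrE (TAdd T1 (num k))) (tstrE T1) -IH.
Qed.
#[export] Hint Resolve comp_num : comp.

Lemma comp_TC : computable (fun n => tstr (TC n)).
Proof. by apply: (comp_ext (f := fun n => node 0 [:: syr n])) => [n|]; [rewrite tstrE | ctac]. Qed.
#[export] Hint Resolve comp_TC : comp.

(** * Archimedean real closed fields inside the reals *)

Local Open Scope ring_scope.
Notation RR := Rdefinitions.R.

Definition subf (S : RR -> Prop) := [/\ S 1, (forall x y, S x -> S y -> S (x - y)),
  (forall x y, S x -> S y -> S (x * y)) & forall x, S x -> S x^-1].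

(** Roots are taken in the reals. For subfields of the reals this amounts to being real closed:
    [racl_type] gives one direction and [range_racl] the other. *)
Definition racl (S : RR -> Prop) :=
  subf S /\ forall p : {poly RR}, (forall i, S p`_i) -> p != 0 -> forall x, root p x -> S x.

Definition asb (S : RR -> Prop) : {pred RR} := fun x => `[< S x >].

Definition subR (S : RR -> Prop) (hS : subf S) := {x : RR | x \in asb S}.

Section SubType.
Variables (S : RR -> Prop) (hS : subf S).
Notation T := (subR hS).

HB.instance Definition _ := SubChoice.on T.

Lemma subR_divring : divring_closed (asb S).
Proof.
case: hS => h1 hB hM hV; split=> [|x y|x y]; rewrite !unfold_in; first exact/asboolP.
- by move=> /asboolP hx /asboolP hy; apply/asboolP; apply: hB.
- by move=> /asboolP hx /asboolP hy; apply/asboolP; apply: hM => //; apply: hV.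
Qed.
HB.instance Definition _ := GRing.SubChoice_isSubIntegralDomain.Build RR (asb S) T subR_divring.
HB.instance Definition _ := [SubIntegralDomain_isSubField of T by <:].

Definition subR_le (x y : T) := (val x <= val y).
Definition subR_lt (x y : T) := (val x < val y).
Definition subR_norm (x : T) : T := if subR_le 0 x then x else - x.

Lemma subR_le0_add x y : subR_le 0 x -> subR_le 0 y -> subR_le 0 (x + y).
Proof. by rewrite /subR_le rmorph0 rmorphD; apply: addr_ge0. Qed.
Lemma subR_le0_mul x y : subR_le 0 x -> subR_le 0 y -> subR_le 0 (x * y).
Proof. by rewrite /subR_le rmorph0 rmorphM; apply: mulr_ge0. Qed.
Lemma subR_le0_anti x : subR_le 0 x -> subR_le x 0 -> x = 0.
Proof.
by rewrite /subR_le rmorph0 => h1 h2; apply: val_inj; rewrite rmorph0; apply/le_anti/andP.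
Qed.
Lemma subR_sub_ge0 x y : subR_le 0 (y - x) = subR_le x y.
Proof. by rewrite /subR_le rmorph0 rmorphB subr_ge0. Qed.
Lemma subR_le0_total x : subR_le 0 x || subR_le x 0.
Proof. by rewrite /subR_le rmorph0 le_total. Qed.
Lemma subR_normN x : subR_norm (- x) = subR_norm x.
Proof.
rewrite /subR_norm /subR_le rmorph0 rmorphN /= oppr_ge0 opprK.
by case: (ltgtP 0 (val x)) => // h; apply: val_inj; rewrite rmorphN /= -h oppr0.
Qed.
Lemma subR_ge0_norm x : subR_le 0 x -> subR_norm x = x.
Proof. by rewrite /subR_norm => ->. Qed.
Lemma subR_lt_def x y : subR_lt x y = (y != x) && subR_le x y.
Proof. by rewrite /subR_lt lt_def (inj_eq val_inj). Qed.
HB.instance Definition _ := Num.IntegralDomain_isLeReal.Build T subR_le0_add subR_le0_mul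
  subR_le0_anti subR_sub_ge0 subR_le0_total subR_normN subR_ge0_norm subR_lt_def.

Lemma subRP x : S x -> exists y : T, val y = x.
Proof. by move=> /asboolP hx; exists (Sub (x : RR) hx). Qed.

Lemma subR_in (y : T) : S (val y).
Proof. exact/asboolP/(valP y). Qed.

End SubType.

Lemma poly_lift (F : nzRingType) (j : {rmorphism F -> RR}) (p : {poly RR}) :
  (forall i, exists y, j y = p`_i) -> exists q, map_poly j q = p.
Proof.
move=> /choice [f hf]; exists (\poly_(i < size p) f i); apply/polyP => i.
rewrite coef_map /= coef_poly; case: ltnP => h; first exact: hf.
by rewrite nth_default //; apply: rmorph0.
Qed.

(** The same type under a new name, with the closure under roots in its parameter, so that the real
    closed structure can be attached to it. *)
Definition subRc (S : RR -> Prop) (h : racl S) := subR (proj1 h).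
Section RcType.
Variables (S : RR -> Prop) (h : racl S).
HB.instance Definition _ := Num.RealField.on (subRc h).

Lemma subRc_closed : Num.real_closed_axiom (subRc h).
Proof.
move=> p a b hab /andP [ha hb]; pose q := map_poly (val : subR (proj1 h) -> RR) p.
(* The root is found in the reals by the intermediate value theorem; closure under roots then brings
   it back into [S]. *)
have [||x hx rx] := @poly_ivt RR q (val a) (val b) => //.
  by rewrite !horner_map; apply/andP.
case: (eqVneq p 0) => [->|np]; first by exists a; rewrite ?lexx ?root0.
have [] := @subRP S (proj1 h) x.
  apply: (proj2 h) rx; last by rewrite map_poly_eq0.
  by move=> i; rewrite coef_map; apply: subR_in.
move=> y hy; exists y; first by rewrite -hy in hx.
by move: rx; rewrite -hy -(fmorph_root (val : subR (proj1 h) -> RR)).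
Qed.
HB.instance Definition _ := Num.RealField_isClosed.Build (subRc h) subRc_closed.
End RcType.

Lemma RR_arch (x : RR) : exists n : nat, x <= n%:R.
Proof. by exists (Num.trunc x).+1; apply: ltW; apply: truncnS_gt. Qed.

Lemma racl_type S : racl S -> exists (R : rcfType) (j : {rmorphism R -> RR}),
  archimedean R /\ (forall x y, (x <= y) = (j x <= j y)) /\ (forall x, S x <-> exists y, j y = x).
Proof.
move=> h; exists (subRc h), (val : subR (proj1 h) -> RR); split; [|split=> //].
  move=> x; have [n hn] := RR_arch (val (x : subR (proj1 h))); exists n.
  by rewrite -(rmorph_nat (val : subR (proj1 h) -> RR)) in hn.
by move=> x; split=> [/(subRP (proj1 h)) //|[y <-]]; apply: subR_in.
Qed.

Lemma subf_type S : subf S -> exists (F : fieldType) (j : {rmorphism F -> RR}),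
  forall x, S x <-> exists y, j y = x.
Proof.
move=> h; exists (subR h), (val : subR h -> RR) => x.
by split=> [/(subRP h) //|[y <-]]; apply: subR_in.
Qed.

(** * The embedding of an Archimedean field into the reals by rational cuts *)

Section Embedding.
Variables (R : rcfType) (Rarch : archimedean R).

Lemma arch_dense (x y : R) : x < y -> exists q : rat, x < ratr q < y.
Proof.
move=> xy; have [n hn] := Rarch (y - x)^-1.
have dp : 0 < y - x by rewrite subr_gt0.
have n0 : 0 < n%:R :> R by apply: lt_le_trans hn; rewrite invr_gt0.
have hd : 1 < n.+1%:R * (y - x).
  rewrite mulrC -ltr_pdivrMl // mulr1; apply: le_lt_trans hn _.
  by rewrite ltr_nat.
pose N := n.+1; have N0 : 0 < N%:R :> R by rewrite ltr0n.
(* The shift by [M] makes [N * x + M] nonnegative, so that the least natural number [m] above it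
   exceeds it by at most 1; the rational is [(m - M) / N]. *)
have [M hM] := Rarch (- (N%:R * x)).
have ex : exists m : nat, N%:R * x + M%:R < m%:R.
  have [m hm] := Rarch (N%:R * x + M%:R); exists m.+1.
  by apply: le_lt_trans hm _; rewrite ltr_nat.
pose m := ex_minn ex.
have [hm hmin] : N%:R * x + M%:R < m%:R /\ m%:R <= N%:R * x + M%:R + 1.
  rewrite /m; case: ex_minnP => k hk kmin; split=> //.
  case: k hk kmin => [|k] hk kmin; first by move: hM; rewrite -subr_ge0 opprK; lra.
  rewrite -natr1 lerD2r leNgt; apply/negP => /kmin; by rewrite ltnn.
exists ((m%:R - M%:R) / N%:R); rewrite rmorphM fmorphV rmorphB !rmorph_nat.
rewrite ltr_pdivlMr // ltr_pdivrMr //; apply/andP; split; first by rewrite mulrC; lra.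
have : N%:R * (y - x) > 1 by [].
by rewrite mulrBr [y * _]mulrC; lra.
Qed.

Lemma archN (x : R) : exists n : nat, - n%:R <= x.
Proof. by have [n hn] := Rarch (- x); exists n; rewrite lerNl. Qed.

Definition cutr (x : R) : RR := sup [set r | exists q : rat, r = ratr q /\ ratr q < x].

Lemma cutr_has_sup (x : R) : has_sup [set r : RR | exists q : rat, r = ratr q /\ ratr q < x].
Proof.
split.
  have [n hn] := archN x; exists (ratr (- n.+1%:R)); exists (- n.+1%:R); split=> //.
  by apply: lt_le_trans hn; rewrite rmorphN rmorph_nat ltrN2 ltr_nat.
have [n hn] := Rarch x; exists n%:R => _ [q [-> hq]].
rewrite -(ratr_nat RR) ler_rat -(ler_rat R) ratr_nat.
exact: le_trans (ltW hq) hn.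
Qed.

Lemma cutr_lb (x : R) q : ratr q < x -> ratr q <= cutr x.
Proof. by move=> h; apply: ub_le_sup; [case: (cutr_has_sup x) | exists q]. Qed.

Lemma cutr_ub (x : R) q : x < ratr q -> cutr x <= ratr q.
Proof.
move=> h; apply: ge_sup; first by case: (cutr_has_sup x).
by move=> _ [p [-> hp]]; rewrite ler_rat -(ler_rat R) (ltW (lt_trans hp h)).
Qed.

Lemma cutr_uniq (x : R) r : (forall q, ratr q < x -> ratr q <= r) -> (forall q, x < ratr q -> r <= ratr q) ->
  r = cutr x.
Proof.
move=> h1 h2; case: (ltgtP r (cutr x)) => // h.
  have [q] := rat_in_itvoo h; rewrite in_itv /= => /andP [hq1 hq2].
  (* Two rationals are taken because [x] may coincide with the image of the first one. *)
  have [q'] := rat_in_itvoo hq2; rewrite in_itv /= => /andP [hq3 hq4].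
  case: (ltP (ratr q) x) => hx; first by have := h1 _ hx; rewrite leNgt hq1.
  have hx' : x < ratr q' by apply: le_lt_trans hx _; rewrite ltr_rat -(ltr_rat RR).
  by have := cutr_ub hx'; rewrite leNgt hq4.
have [q] := rat_in_itvoo h; rewrite in_itv /= => /andP [hq1 hq2].
have [q'] := rat_in_itvoo hq1; rewrite in_itv /= => /andP [hq3 hq4].
case: (ltP x (ratr q)) => hx; first by have := h2 _ hx; rewrite leNgt hq2.
have hx' : ratr q' < x by apply: lt_le_trans hx; rewrite ltr_rat -(ltr_rat RR).
by have := cutr_lb hx'; rewrite leNgt hq3.
Qed.

Lemma cutrD x y : cutr (x + y) = cutr x + cutr y.
Proof.
apply/esym/cutr_uniq => q hq.
  have [a /andP [h1 h2]] : exists a : rat, ratr q - y < ratr a < x by apply: arch_dense; lra.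
  have hb : ratr (q - a) < y by rewrite rmorphB; lra.
  have := lerD (cutr_lb h2) (cutr_lb hb).
  by rewrite rmorphB /=; lra.
have [a /andP [h1 h2]] : exists a : rat, x < ratr a < ratr q - y by apply: arch_dense; lra.
have hb : y < ratr (q - a) by rewrite rmorphB; lra.
have := lerD (cutr_ub h1) (cutr_ub hb).
by rewrite rmorphB /=; lra.
Qed.

Lemma cutr_rat q : cutr (ratr q) = ratr q.
Proof. by apply/esym/cutr_uniq => p; rewrite ler_rat ltr_rat => /ltW. Qed.

Lemma cutr_lt x y : x < y -> cutr x < cutr y.
Proof.
move=> xy; have [a /andP [h1 h2]] := arch_dense xy; have [b /andP [h3 h4]] := arch_dense h2.
apply: le_lt_trans (cutr_ub h1) _; apply: lt_le_trans (cutr_lb h4).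
by rewrite ltr_rat -(ltr_rat R).
Qed.

Lemma cutr_le x y : (x <= y) = (cutr x <= cutr y).
Proof.
by case: (ltgtP x y) => [/cutr_lt/ltW ->|/cutr_lt h|->]; rewrite ?lexx // leNgt h.
Qed.

Lemma cutr0 : cutr 0 = 0.
Proof. by rewrite -(rmorph0 (@ratr R)) cutr_rat rmorph0. Qed.

(* An additive monotone normalised map into the reals is unique, hence equal to [cutr]; applied
   to [x |-> cutr (x * y) / cutr y] this gives multiplicativity. *)
Lemma additive_cutr (g : R -> RR) : (forall x y, g (x + y) = g x + g y) ->
  (forall x y, x < y -> g x <= g y) -> g 1 = 1 -> forall x, g x = cutr x.
Proof.
move=> gD gle g1.
have g0 : g 0 = 0 by apply: (@addrI _ (g 0)); rewrite -gD !addr0.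
have gN x : g (- x) = - g x by apply: (@addrI _ (g x)); rewrite -gD !subrr.
have gn (n : nat) x : g (n%:R * x) = n%:R * g x.
  elim: n => [|n IH]; first by rewrite !mul0r g0.
  by rewrite -[n.+1]addn1 !natrD !mulrDl gD IH !mul1r.
have gz (n : int) x : g (n%:~R * x) = n%:~R * g x.
  by case: n => n; rewrite ?NegzE ?mulrNz -?pmulrn ?mulNr ?gN gn.
have gq q : g (ratr q) = ratr q.
  have dn : (denq q)%:~R != 0 :> RR by rewrite intr_eq0 denq_neq0.
  have dn' : (denq q)%:~R != 0 :> R by rewrite intr_eq0 denq_neq0.
  apply: (mulfI dn); rewrite -gz /ratr !(mulrCA (denq q)%:~R) !divff // !mulr1.
  by rewrite -[X in g X]mulr1 gz g1 mulr1.
move=> x; apply: cutr_uniq => q h; rewrite -gq; exact: gle.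
Qed.

Lemma cutrM x y : cutr (x * y) = cutr x * cutr y.
Proof.
have iN z : cutr (- z) = - cutr z.
  by apply: (@addrI _ (cutr z)); rewrite -cutrD !subrr cutr0.
have pos z : 0 < z -> cutr (x * z) = cutr x * cutr z.
  move=> z0; have iz : 0 < cutr z by rewrite -cutr0 cutr_lt.
  have nz : cutr z != 0 by rewrite gt_eqF.
  apply: (mulIf (invr_neq0 nz)); rewrite mulfK //.
  apply: (additive_cutr (g := fun x => cutr (x * z) / cutr z)).
  - by move=> a b; rewrite mulrDl cutrD mulrDl.
  - by move=> a b ab; rewrite ler_pM2r ?invr_gt0 // ltW // cutr_lt // ltr_pM2r.
  - by rewrite mul1r divff.
case: (ltgtP 0 y) => [/pos //|y0|<-]; last by rewrite mulr0 cutr0 mulr0.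
by rewrite -[y]opprK mulrN iN pos ?oppr_gt0 // [in RHS]iN mulrN.
Qed.

Lemma cutr_is_additive : additive cutr.
Proof. by move=> x y; apply: (@addIr _ (cutr y)); rewrite subrK -cutrD subrK. Qed.

Lemma cutr_is_multiplicative : monoid_morphism cutr.
Proof. by split=> [|x y]; rewrite ?cutrM // -(rmorph1 (@ratr R)) cutr_rat rmorph1. Qed.

End Embedding.

Lemma arch_embed (R : rcfType) : archimedean R ->
  exists j : {rmorphism R -> RR}, forall x y, (x <= y) = (j x <= j y).
Proof.
move=> h.
pose A := GRing.isZmodMorphism.Build _ _ (@cutr R) (cutr_is_additive h).
pose B := GRing.isMonoidMorphism.Build _ _ (@cutr R) (cutr_is_multiplicative h).
pose j : {rmorphism R -> RR} := HB.pack (@cutr R) A B.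
by exists j => x y; apply: cutr_le.
Qed.

(** * Images of real closed fields in the reals *)

Definition cmap (R : rcfType) (j : {rmorphism R -> RR}) (z : R[i]) : RR[i] := (j (complex.Re z) +i* j (complex.Im z))%C.

Section CMap.
Variables (R : rcfType) (j : {rmorphism R -> RR}).
Lemma cmap_additive : additive (cmap j).
Proof. by move=> [a b] [c d]; rewrite /cmap /= !rmorphB; simpc. Qed.
Lemma cmap_mult : monoid_morphism (cmap j).
Proof.
split=> [|[a b] [c d]]; first by rewrite /cmap /= rmorph1 rmorph0.
by rewrite /cmap /= rmorphB rmorphD !rmorphM; simpc.
Qed.
HB.instance Definition _ := GRing.isZmodMorphism.Build _ _ (cmap j) cmap_additive.
HB.instance Definition _ := GRing.isMonoidMorphism.Build _ _ (cmap j) cmap_mult.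
End CMap.

(** Over [R[i]], which is algebraically closed, the polynomial splits. [cmap] carries the splitting
    to the complex numbers, so a real root of the image polynomial is the image of some [a +i* b],
    and comparing real parts it is [j a]. *)
Lemma range_racl (R : rcfType) (j : {rmorphism R -> RR}) : racl (fun x => exists y, j y = x).
Proof.
split.
  split; first by exists 1; rewrite rmorph1.
  - by move=> _ _ [a <-] [b <-]; exists (a - b); rewrite rmorphB.
  - by move=> _ _ [a <-] [b <-]; exists (a * b); rewrite rmorphM.
  - by move=> _ [a <-]; exists a^-1; rewrite fmorphV.
move=> p hp np x rx; have [q hq] := poly_lift hp.
pose qc := map_poly (real_complex R) q.
have [r hr] := closed_field_poly_normal qc.
have : root (map_poly (cmap j) qc) (real_complex RR x).
  have -> : map_poly (cmap j) qc = map_poly (real_complex RR) p.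
    rewrite -hq -!map_poly_comp; apply: eq_map_poly => a /=.
    by rewrite /cmap /= rmorph0.
  by rewrite fmorph_root.
have lz : lead_coef qc != 0.
  by rewrite lead_coef_eq0 map_poly_eq0; apply: contraNneq np => q0; rewrite -hq q0 rmorph0.
rewrite hr linearZ /= rootZ ?fmorph_eq0 // rmorph_prod /=.
rewrite (eq_bigr (fun z => 'X - (cmap j z)%:P)); last first.
  by move=> z _; rewrite rmorphB /= map_polyX map_polyC.
rewrite -(big_map (cmap j) xpredT (fun a => 'X - a%:P)) root_prod_XsubC => /mapP [[a b] _].
by rewrite /cmap /= => -[-> _]; exists a.
Qed.

(** [iso_to] with the target field replaced by a set of reals, so that presentations of different
    fields can be compared inside one field. *)
Record isoS (M : nstruct) (S : RR -> Prop) (f : nat -> RR) : Prop := IsoS {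
  isoS_inj : forall x y, ndom M x -> ndom M y -> f x = f y -> x = y;
  isoS_in : forall x, ndom M x -> S (f x);
  isoS_onto : forall r, S r -> exists x, ndom M x /\ f x = r;
  isoS_0 : f (nzero M) = 0; isoS_1 : f (none M) = 1;
  isoS_D : forall x y, ndom M x -> ndom M y -> f (nadd M x y) = f x + f y;
  isoS_M : forall x y, ndom M x -> ndom M y -> f (nmul M x y) = f x * f y;
  isoS_N : forall x, ndom M x -> f (nopp M x) = - f x;
  isoS_le : forall x y, ndom M x -> ndom M y -> (nle M x y <-> f x <= f y) }.

Lemma iso_to_isoS M (R : rcfType) (j : {rmorphism R -> RR}) (S : RR -> Prop) :
  (forall x y, (x <= y) = (j x <= j y)) -> (forall x, S x <-> exists y, j y = x) ->
  iso_to M R <-> exists f, isoS M S f.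
Proof.
move=> jle hS; split.
  move=> [f [h1 [h2 [h3 [h4 [h5 [h6 [h7 h8]]]]]]]]; exists (fun x => j (f x)); split.
  - by move=> x y hx hy /fmorph_inj; apply: h1.
  - by move=> x _; apply/hS; exists (f x).
  - by move=> r /hS [y <-]; have [x [hx <-]] := h2 y; exists x.
  - by rewrite h3 rmorph0.
  - by rewrite h4 rmorph1.
  - by move=> x y hx hy; rewrite h5 // rmorphD.
  - by move=> x y hx hy; rewrite h6 // rmorphM.
  - by move=> x hx; rewrite h7 // rmorphN.
  - by move=> x y hx hy; rewrite h8 // jle.
move=> [f hf]; have hj x : exists y, S (f x) -> j y = f x.
  by case: (pselect (S (f x))) => [/[dup] /hS [y hy] _|h]; [exists y | exists 0].
have [g hg] := choice hj.
have g_in x : ndom M x -> j (g x) = f x by move=> hx; apply/hg/(isoS_in hf).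
have ex r : exists x, ndom M x /\ f x = j r by apply: (isoS_onto hf); apply/hS; exists r.
have inj := @fmorph_inj _ _ j.
have S0 : S 0 by apply/hS; exists 0; rewrite rmorph0.
have S1 : S 1 by apply/hS; exists 1; rewrite rmorph1.
have SD a b : S a -> S b -> S (a + b).
  by move=> /hS [x <-] /hS [y <-]; apply/hS; exists (x + y); rewrite rmorphD.
have SM a b : S a -> S b -> S (a * b).
  by move=> /hS [x <-] /hS [y <-]; apply/hS; exists (x * y); rewrite rmorphM.
have SN a : S a -> S (- a).
  by move=> /hS [x <-]; apply/hS; exists (- x); rewrite rmorphN.
exists g; split; [|split; [|split; [|split; [|split; [|split; [|split]]]]]].
- by move=> x y hx hy e; apply: (isoS_inj hf) => //; rewrite -!g_in // e.
- by move=> r; have [x [hx e]] := ex r; exists x; split=> //; apply: inj; rewrite g_in.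
- by apply: inj; rewrite hg (isoS_0 hf) ?rmorph0.
- by apply: inj; rewrite hg (isoS_1 hf) ?rmorph1.
- move=> x y hx hy; apply: inj; rewrite rmorphD (g_in x) // (g_in y) // hg (isoS_D hf) //.
  by apply: SD; apply: (isoS_in hf).
- move=> x y hx hy; apply: inj; rewrite rmorphM (g_in x) // (g_in y) // hg (isoS_M hf) //.
  by apply: SM; apply: (isoS_in hf).
- move=> x hx; apply: inj; rewrite rmorphN (g_in x) // hg (isoS_N hf) //.
  by apply: SN; apply: (isoS_in hf).
- by move=> x y hx hy; rewrite (isoS_le hf) // jle !g_in.
Qed.

Definition idxS (S : RR -> Prop) (a : nat) :=
  exists M f, [/\ wf_struct M, index_of a M & isoS M S f].

Lemma Iset_embed (R : rcfType) (j : {rmorphism R -> RR}) a : (forall x y, (x <= y) = (j x <= j y)) ->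
  Iset R a <-> idxS (fun x => exists y, j y = x) a.
Proof.
move=> jle; split=> [[M [h1 [h2 /(iso_to_isoS _ jle (fun=> iff_refl _)) [f hf]]]]|[M [f [h1 h2 h3]]]].
  by exists M, f.
by exists M; do 2!split=> //; apply/(iso_to_isoS _ jle (fun=> iff_refl _)); exists f.
Qed.

Lemma IKP a : IK a <-> exists2 S, racl S & idxS S a.
Proof.
split=> [[M [h1 [h2 [R [hR hi]]]]]|[S hS [M [f [h1 h2 h3]]]]].
  have [j jle] := arch_embed hR; exists (fun x => exists y, j y = x); first exact: range_racl.
  by apply/(Iset_embed _ jle); exists M.
have [R [j [ha [jle hj]]]] := racl_type hS.
by exists M; do 2!split=> //; exists R; split=> //; apply/(iso_to_isoS _ jle hj); exists f.
Qed.

(** * Indices from numberings *)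

Local Close Scope ring_scope.
(** This and the next inequalities bound the code of a substring by the code of the string, as
    course-of-values recursion on codes requires. *)
Lemma enc_ltn_cons x (s : seq nat) : enc s < enc (x :: s).
Proof. by rewrite enc_cons npairE -[X in X < _]mul1n -addnn; nia. Qed.

Lemma enc_leq_cat (s t : seq nat) : enc s <= enc (s ++ t).
Proof.
elim: s => [|x s IH] //=; rewrite !enc_cons !npairE leq_pmul2l ?expn_gt0 //.
by rewrite ltnS leq_double.
Qed.

Lemma enc_leq_cat2 (s t : seq nat) : enc t <= enc (s ++ t).
Proof. by elim: s => [|x s IH] //=; apply: leq_trans IH (ltnW (enc_ltn_cons _ _)). Qed.

Lemma enc_node k (w : seq nat) : enc w < enc (node k w).
Proof. exact: leq_ltn_trans (enc_leq_cat _ _) (enc_ltn_cons _ _). Qed.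

Lemma enc_mem (s : seq nat) n : n \in s -> n < enc s.
Proof. by have /allP h := CodeSeq.ltn_code s => /h; rewrite /enc /= /seq_enc map_id. Qed.

Lemma syr_gt n : n < syr n.
Proof.
have -> : syr n = enc [:: 0; enc [:: n]] by [].
by apply: (@ltn_trans (enc [:: n])); apply: enc_mem; rewrite !inE eqxx ?orbT.
Qed.

Section Numbering.
Variables (E : Type) (cE : cod E) (nu : E -> nat -> RR) (S : E -> RR -> Prop).
Hypotheses (hS : forall e, subf (S e)) (nuS : forall e r, S e r <-> exists x, nu e x = r).
Local Open Scope ring_scope.
Hypotheses
  (hadd : RE (fun y : E * nat * nat * nat => nu y.1.1.1 y.1.1.2 + nu y.1.1.1 y.1.2 = nu y.1.1.1 y.2))
  (hmul : RE (fun y : E * nat * nat * nat => nu y.1.1.1 y.1.1.2 * nu y.1.1.1 y.1.2 = nu y.1.1.1 y.2))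
  (hlt : RE (fun y : E * nat * nat => nu y.1.1 y.1.2 < nu y.1.1 y.2)).

Lemma num_S0 e : S e 0.
Proof. by have [h1 hB _ _] := hS e; rewrite -(subrr 1); apply: hB. Qed.

Lemma num_SD e x y : S e x -> S e y -> S e (x + y).
Proof.
have [h1 hB _ _] := hS e => hx hy; have hN : S e (- y) by rewrite -[- y]sub0r; apply: hB => //; apply: num_S0.
by rewrite -[y]opprK; apply: hB.
Qed.

(** Equality is expressed by the addition of a zero, itself recognised by [z + z = z]; its
    enumerability then follows from that of addition. *)
Lemma num_eqE e x y : nu e x = nu e y <-> exists z, nu e z + nu e z = nu e z /\ nu e x + nu e z = nu e y.
Proof.
split=> [->|[z [h1 <-]]]; last by move/(canRL (addrK _)): h1; rewrite subrr => ->; rewrite addr0.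
by have [z hz] := (nuS e 0).1 (num_S0 e); exists z; rewrite !hz !addr0.
Qed.

Lemma num_RE_eq : RE (fun y : E * nat * nat => nu y.1.1 y.1.2 = nu y.1.1 y.2).
Proof.
have h : RE (fun y : E * nat * nat =>
    exists z, nu y.1.1 z + nu y.1.1 z = nu y.1.1 z /\ nu y.1.1 y.1.2 + nu y.1.1 z = nu y.1.1 y.2).
  apply: RE_ex; apply: RE_and.
    by apply: (RE_app4 (P := fun e a b c => nu e a + nu e b = nu e c)); ctac.
  by apply: (RE_app4 (P := fun e a b c => nu e a + nu e b = nu e c)); ctac.
by apply: RE_ext h => -[[e x] y] /=; rewrite num_eqE.
Qed.

Lemma num_decid_eq : decid (fun y : E * nat * nat => nu y.1.1 y.1.2 = nu y.1.1 y.2).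
Proof.
apply: decid_of_RE; first exact: num_RE_eq.
have : RE (fun y : E * nat * nat => nu y.1.1 y.1.2 < nu y.1.1 y.2 \/ nu y.1.1 y.2 < nu y.1.1 y.1.2).
  apply: RE_or; first exact: hlt.
  by apply: (RE_app3 (P := fun e a b => is_true (nu e a < nu e b))); ctac.
apply: RE_ext => -[[e x] y] /=.
by case: ltgtP => [h|h|->]; split; rewrite ?ltxx //; (try by case); move=> _; try (by left); try (by right);
  move=> h'; rewrite h' ltxx in h.
Qed.

Lemma num_decid_le : decid (fun y : E * nat * nat => is_true (nu y.1.1 y.1.2 <= nu y.1.1 y.2)).
Proof.
apply: decid_of_RE.
  have : RE (fun y : E * nat * nat => nu y.1.1 y.1.2 < nu y.1.1 y.2 \/ nu y.1.1 y.1.2 = nu y.1.1 y.2).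
    by apply: RE_or; [exact: hlt | exact: num_RE_eq].
  by apply: RE_ext => -[[e x] y] /=; rewrite le_eqVlt; split=> [[->|->]|/orP [/eqP|]];
    rewrite ?eqxx ?orbT //; [right|left].
have : RE (fun y : E * nat * nat => is_true (nu y.1.1 y.2 < nu y.1.1 y.1.2)).
  by apply: (RE_app3 (P := fun e a b => is_true (nu e a < nu e b))); ctac.
by apply: RE_ext => -[[e x] y] /=; rewrite ltNge; split=> /negP.
Qed.

(** The universe consists of least names, so that equal values mean equal elements, as in a
    structure with true equality. *)
Definition num_dom e x := forall y, (y < x)%N -> ~ nu e y = nu e x.

Lemma num_decid_dom : decid (fun y : E * nat => num_dom y.1 y.2).
Proof.
rewrite /num_dom; apply: decid_ball; first by ctac.
by apply: decid_not; apply: (decid_app3 (P := fun e a b => nu e a = nu e b)); [exact: num_decid_eq | ctac..].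
Qed.

Lemma num_name e r : exists x, S e r -> num_dom e x /\ nu e x = r.
Proof.
case: (pselect (S e r)) => [/nuS [x hx]|]; last by exists 0%N.
have ex : exists x, nu e x == r by exists x; apply/eqP.
exists (ex_minn ex) => _; case: ex_minnP => m /eqP <- hm; split=> // y hy e'.
by have := hm y; rewrite e' eqxx => /(_ isT); rewrite leqNgt hy.
Qed.

Definition name e r := sval (cid (num_name e r)).

Lemma nameP e r : S e r -> num_dom e (name e r) /\ nu e (name e r) = r.
Proof. exact: (svalP (cid (num_name e r))). Qed.

Definition numM e : nstruct := {| ndom := num_dom e; nzero := name e 0; none := name e 1;
  nadd := fun x y => name e (nu e x + nu e y); nmul := fun x y => name e (nu e x * nu e y);
  nopp := fun x => name e (- nu e x); nle := fun x y => nu e x <= nu e y |}.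

Lemma nu_in e x : S e (nu e x).
Proof. by apply/nuS; exists x. Qed.

Lemma num_closed e : [/\ S e 0, S e 1, (forall x y, S e (nu e x + nu e y)),
  (forall x y, S e (nu e x * nu e y)) & forall x, S e (- nu e x)].
Proof.
have [h1 hB hM _] := hS e; split=> // *; first exact: num_S0.
- by apply: num_SD; apply: nu_in.
- by apply: hM; apply: nu_in.
- by rewrite -sub0r; apply: hB; [apply: num_S0 | apply: nu_in].
Qed.

Lemma numM_wf e : wf_struct (numM e).
Proof.
have [h0 h1 hD hM hN] := num_closed e.
by split; [|split; [|split; [|split]]] => /= *; apply nameP.
Qed.

Lemma num_dom_inj e x y : num_dom e x -> num_dom e y -> nu e x = nu e y -> x = y.
Proof.
by move=> hx hy eq; case: (ltngtP x y) => // h; [case: (hy _ h) | case: (hx _ h)].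
Qed.

Lemma numM_iso e : isoS (numM e) (S e) (nu e).
Proof.
have [h0 h1 hD hM hN] := num_closed e; split=> /=.
- exact: num_dom_inj.
- by move=> x _; apply: nu_in.
- by move=> r /nameP [h2 h3]; exists (name e r).
- by apply nameP.
- by apply nameP.
- by move=> x y _ _; apply nameP.
- by move=> x y _ _; apply nameP.
- by move=> x _; apply nameP.
- by [].
Qed.

(** * Values of terms and decidability of the diagram *)

Lemma teval_dom e t : term_consts_in (numM e) t -> num_dom e (teval (numM e) t).
Proof.
have [h1 [h2 [h3 [h4 h5]]]] := numM_wf e.
elim: t => [n|||t IHt u IHu|t IHt u IHu|t IHt] //=.
- by move=> [/IHt ht /IHu hu]; apply: h3.
- by move=> [/IHt ht /IHu hu]; apply: h4.
- by move=> /IHt ht; apply: h5.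
Qed.

Definition tv e t := nu e (teval (numM e) t).

Lemma tvE e t : tv e t = match t with TC n => nu e n | T0 => 0 | T1 => 1
  | TAdd t u => tv e t + tv e u | TMul t u => tv e t * tv e u | TOpp t => - tv e t end.
Proof.
have [h0 h1 hD hM hN] := num_closed e.
by case: t => [n|||t u|t u|t] //; rewrite /tv /=; apply nameP.
Qed.

Definition is0 e x := nu e x + nu e x = nu e x.
Lemma is0P e x : is0 e x <-> nu e x = 0.
Proof.
by rewrite /is0; split=> [h|->]; rewrite ?addr0 //; apply: (@addrI _ (nu e x)); rewrite h addr0.
Qed.
Definition is1 e x := nu e x * nu e x = nu e x /\ ~ is0 e x.
Lemma is1P e x : is1 e x <-> nu e x = 1.
Proof.
rewrite /is1 is0P; split=> [[h /eqP n0]|->]; last by rewrite mulr1; split=> //; apply/eqP/oner_neq0.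
by apply: (mulfI n0); rewrite mulr1.
Qed.

Lemma num_decid_is0 : decid (fun y : E * nat => is0 y.1 y.2).
Proof.
apply: decid_of_RE.
  by apply: (RE_app4 (P := fun e a b c => nu e a + nu e b = nu e c)); ctac.
have h : RE (fun y : E * nat => exists z, is0 y.1 z /\ ~ (nu y.1 z = nu y.1 y.2)).
  apply: RE_ex; apply: RE_and; first by apply: (RE_app4 (P := fun e a b c => nu e a + nu e b = nu e c)); ctac.
  apply: RE_dec; apply: decid_not.
  by apply: (decid_app3 (P := fun e a b => nu e a = nu e b)); [exact: num_decid_eq | ctac..].
apply: RE_ext h => -[e x] /=; rewrite is0P; split=> [[z [/is0P -> h]] /esym //|h].
have [z hz] := (nuS e 0).1 (num_S0 e); exists z; rewrite is0P hz; split=> // /esym //.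
Qed.

(** A pair [(w, x)] is derivable when [w] is the string of a term whose value is named by [x]. Here
    [x] may be any name of the value, while constants inside the term must belong to the
    universe. *)
Definition vax e (j : seq nat * nat) :=
  (exists n, exists x, (num_dom e n /\ nu e n = nu e x) /\ j = (node 0 [:: syr n], x)) \/
  (exists x, is0 e x /\ j = (node 1 [::], x)) \/ (exists x, is1 e x /\ j = (node 2 [::], x)).
Definition vrule e (j a b : seq nat * nat) :=
  (nu e a.2 + nu e b.2 = nu e j.2 /\ j.1 = node 3 (a.1 ++ b.1)) \/
  (nu e a.2 * nu e b.2 = nu e j.2 /\ j.1 = node 4 (a.1 ++ b.1)) \/
  (exists z, (is0 e z /\ nu e a.2 + nu e j.2 = nu e z) /\ j.1 = node 5 a.1).
Definition tval e w x := clos (vax e) (vrule e) (w, x).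

Lemma RE_tval : RE (fun y : E * seq nat * nat => tval y.1.1 y.1.2 y.2).
Proof.
have h1 := RE_dec num_decid_dom; have h2 := RE_dec num_decid_is0; have h3 := num_RE_eq.
have h4 : RE (fun y : E * nat => is1 y.1 y.2).
  rewrite /is1; apply: RE_and; first by apply: (RE_app4 (P := fun e a b c => nu e a * nu e b = nu e c)); ctac.
  exact: RE_dec (decid_not num_decid_is0).
have h := @RE_clos E (seq nat * nat) _ _ vax vrule; rewrite /tval.
apply: (RE_app2 (P := fun e j => clos (vax e) (vrule e) j)); [apply: h | ctac..].
- rewrite /vax; apply: RE_or.
    apply: RE_ex; apply: RE_ex; apply: RE_and; last by ctac.
    apply: RE_and; first by ctac.
    by apply: (RE_app3 (P := fun e a b => nu e a = nu e b)); ctac.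
  by ctac.
- rewrite /vrule; apply: RE_or.
    apply: RE_and; last by ctac.
    by apply: (RE_app4 (P := fun e a b c => nu e a + nu e b = nu e c)); ctac.
  apply: RE_or.
    apply: RE_and; last by ctac.
    by apply: (RE_app4 (P := fun e a b c => nu e a * nu e b = nu e c)); ctac.
  apply: RE_ex; apply: RE_and; last by ctac.
  apply: RE_and; first by ctac.
  by apply: (RE_app4 (P := fun e a b c => nu e a + nu e b = nu e c)); ctac.
Qed.

Lemma tvalP e w x : tval e w x <-> exists t, [/\ tstr t = w, term_consts_in (numM e) t & tv e t = nu e x].
Proof.
split.
  suff H j : clos (vax e) (vrule e) j ->
      exists t, [/\ tstr t = j.1, term_consts_in (numM e) t & tv e t = nu e j.2] by apply: H.
  elim=> {j} [j|j a b h _ [t [t1 t2 t3]] _ [u [u1 u2 u3]]].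
    move=> [[n [y [[h1 h2] ->]]]|[[y [/is0P h ->]]|[y [/is1P h ->]]]] /=.
    - by exists (TC n); rewrite tstrE tvE.
    - by exists T0; rewrite tstrE tvE h.
    - by exists T1; rewrite tstrE tvE h.
  case: h => [[h1 ->]|[[h1 ->]|[z [[/is0P h1 h2] ->]]]].
  - by exists (TAdd t u); rewrite tstrE tvE t1 u1 t3 u3.
  - by exists (TMul t u); rewrite tstrE tvE t1 u1 t3 u3.
  - exists (TOpp t); rewrite tstrE tvE t1 t3; split=> //.
    by apply/eqP; rewrite eq_sym -addr_eq0 addrC h2 h1.
move=> [t [<- ht hx]]; elim: t x ht hx => [n|||t IHt u IHu|t IHt u IHu|t IHt] x ht; rewrite tvE => hx; rewrite tstrE.
- by apply: clos_ax; left; exists n, x.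
- by apply: clos_ax; right; left; exists x; rewrite is0P.
- by apply: clos_ax; do 2!right; exists x; rewrite is1P.
- have [ht1 ht2] := ht; apply: clos_r (IHt (teval (numM e) t) ht1 erefl) (IHu (teval (numM e) u) ht2 erefl).
  by left.
- have [ht1 ht2] := ht; apply: clos_r (IHt (teval (numM e) t) ht1 erefl) (IHu (teval (numM e) u) ht2 erefl).
  by right; left.
- have h := IHt (teval (numM e) t) ht erefl; apply: (clos_r _ h h); do 2!right.
  have [z hz] := (nuS e 0).1 (num_S0 e); exists z; rewrite is0P hz; do 2!split=> //=.
  by rewrite -hx -/(tv e t) subrr.
Qed.

Definition tvalid e c := exists t, c = enc (tstr t) /\ term_consts_in (numM e) t.

(** Serves the negative half of the diagram, where numbers that code no literal over the universe
    have to be recognised. Strings of subterms have smaller codes, so the table of earlier answers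
    decides. *)
Lemma decid_tvalid : decid (fun y : E * nat => tvalid y.1 y.2).
Proof.
have hd := num_decid_dom.
apply: (decid_cov (G := fun e c tab =>
  (exists2 n, (n < c)%N & num_dom e n /\ c = enc (node 0 [:: syr n])) \/
  (c = enc (node 1 [::]) \/ c = enc (node 2 [::])) \/
  (exists2 a, (a < c)%N & (exists2 b, (b < c)%N & (nth 0 tab a = 1 /\ nth 0 tab b = 1)%N /\
     (c = enc (node 3 ((dec a : seq nat) ++ dec b)) \/ c = enc (node 4 ((dec a : seq nat) ++ dec b))))
     \/ (nth 0 tab a = 1 /\ c = enc (node 5 (dec a : seq nat)))%N))); first by ctac.
move=> e c tab sz htab; split=> [[t [ec ht]]|].
  rewrite {}ec in sz htab *.
  case: t ht sz htab => [n|||t u|t u|t] ht; [rewrite (tstrE (TC n) : _ = node 0 [:: syr n]) |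
    rewrite (tstrE T0 : _ = node 1 [::]) | rewrite (tstrE T1 : _ = node 2 [::]) |
    rewrite (tstrE (TAdd t u) : _ = node 3 (tstr t ++ tstr u)) |
    rewrite (tstrE (TMul t u) : _ = node 4 (tstr t ++ tstr u)) |
    rewrite (tstrE (TOpp t) : _ = node 5 (tstr t))] => sz htab.
  - left; exists n; last by split.
    apply: ltn_trans (syr_gt n) _; apply: ltn_trans (enc_node _ _).
    by apply: enc_mem; rewrite inE.
  - by right; left; left.
  - by right; left; right.
  - have [ht1 ht2] := ht; do 2!right; have l1 : (enc (tstr t) < enc (node 3 (tstr t ++ tstr u)))%N.
      exact: leq_ltn_trans (enc_leq_cat _ _) (enc_node _ _).
    have l2 : (enc (tstr u) < enc (node 3 (tstr t ++ tstr u)))%N.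
      exact: leq_ltn_trans (enc_leq_cat2 _ _) (enc_node _ _).
    exists (enc (tstr t)); first exact: l1.
    left; exists (enc (tstr u)); first exact: l2.
    split; last exact: or_introl (f_equal2 (fun a b => enc (node 3 (a ++ b))) (esym (encK (tstr t))) (esym (encK (tstr u)))).
    exact: (conj ((htab _ l1).2 (ex_intro _ t (conj erefl ht1))) ((htab _ l2).2 (ex_intro _ u (conj erefl ht2)))).
  - have [ht1 ht2] := ht; do 2!right; have l1 : (enc (tstr t) < enc (node 4 (tstr t ++ tstr u)))%N.
      exact: leq_ltn_trans (enc_leq_cat _ _) (enc_node _ _).
    have l2 : (enc (tstr u) < enc (node 4 (tstr t ++ tstr u)))%N.
      exact: leq_ltn_trans (enc_leq_cat2 _ _) (enc_node _ _).
    exists (enc (tstr t)); first exact: l1.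
    left; exists (enc (tstr u)); first exact: l2.
    split; last exact: or_intror (f_equal2 (fun a b => enc (node 4 (a ++ b))) (esym (encK (tstr t))) (esym (encK (tstr u)))).
    exact: (conj ((htab _ l1).2 (ex_intro _ t (conj erefl ht1))) ((htab _ l2).2 (ex_intro _ u (conj erefl ht2)))).
  - do 2!right; have l1 := enc_node 5 (tstr t).
    exists (enc (tstr t)); first exact: l1.
    right; split; last exact: (f_equal (fun a => enc (node 5 a)) (esym (encK (tstr t)))).
    exact: ((htab _ l1).2 (ex_intro _ t (conj erefl ht))).
move=> [[n _ [h1 ->]]|[[->|->]|[a ha [[b hb [[h1 h2] [->|->]]]|[h1 ->]]]]].
- by exists (TC n); split; [rewrite tstrE |].
- by exists T0; split; [rewrite tstrE |].
- by exists T1; split; [rewrite tstrE |].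
- have [t [-> ht]] := (htab _ ha).1 h1; have [u [-> hu]] := (htab _ hb).1 h2.
  exists (TAdd t u); rewrite (encK (tstr t)) (encK (tstr u)); split; last by split.
  exact: (f_equal enc (esym (tstrE (TAdd t u)))).
- have [t [-> ht]] := (htab _ ha).1 h1; have [u [-> hu]] := (htab _ hb).1 h2.
  exists (TMul t u); rewrite (encK (tstr t)) (encK (tstr u)); split; last by split.
  exact: (f_equal enc (esym (tstrE (TMul t u)))).
- have [t [-> ht]] := (htab _ ha).1 h1; exists (TOpp t); rewrite (encK (tstr t)); split; last by [].
  exact: (f_equal enc (esym (tstrE (TOpp t)))).
Qed.
Local Close Scope ring_scope.

Definition mklit (b k : nat) t u : literal :=
  let a := if k is 0 then AEq t u else ALe t u in if b is 0 then LPos a else LNeg a.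

Lemma mklit_code b k t u : b < 2 -> k < 2 -> literal_code (mklit b k t u) = litcode b k (tstr t) (tstr u).
Proof. by case: b => [|[]] //; case: k => [|[]] // _ _; rewrite literal_codeE. Qed.

Lemma term_enc_inj : injective term_enc.
Proof.
elim=> [n|||t IHt u IHu|t IHt u IHu|t IHt] [m|||t' u'|t' u'|t'] //= [].
- by move=> ->.
- by move=> /IHt -> /IHu ->.
- by move=> /IHt -> /IHu ->.
- by move=> /IHt ->.
Qed.

Lemma literal_code_inj : injective literal_code.
Proof.
move=> l l' /(pcan_inj pickleK); case: l => -[] t u; case: l' => -[] t' u' //= [];
  by move=> /term_enc_inj -> /term_enc_inj ->.
Qed.

Definition litcond e b k x y :=
  (b = 0 /\ k = 0 /\ nu e x = nu e y) \/ (b = 0 /\ k = 1 /\ (nu e x <= nu e y)%R) \/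
  (b = 1 /\ k = 0 /\ ~ nu e x = nu e y) \/ (b = 1 /\ k = 1 /\ ~ (nu e x <= nu e y)%R).

Lemma litcondP e b k t u x y : b < 2 -> k < 2 -> term_consts_in (numM e) t -> term_consts_in (numM e) u ->
  tv e t = nu e x -> tv e u = nu e y ->
  literal_holds (numM e) (mklit b k t u) <-> litcond e b k x y.
Proof.
rewrite /litcond => hb hk ht hu <- <-.
have heq : teval (numM e) t = teval (numM e) u <-> tv e t = tv e u.
  by split=> [h|]; [rewrite /tv h | apply: num_dom_inj; apply: teval_dom].
by case: b hb => [|[]] //; case: k hk => [|[]] // _ _; rewrite /= ?heq /tv; split=> h; (tauto ||
  by case: h => [[? [? ?]]|[[? [? ?]]|[[? [? ?]]|[? [? ?]]]]]).
Qed.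

Lemma mklit_surj l : exists b k t u, [/\ b < 2, k < 2 & l = mklit b k t u].
Proof.
by case: l => -[] t u; [exists 0, 0, t, u | exists 0, 1, t, u | exists 1, 0, t, u | exists 1, 1, t, u].
Qed.

(** The diagram and its complement are both enumerable: names of the values of the two terms are
    searched for and compared, and a number coding no literal over the universe is rejected by a
    bounded search using [tvalid]. *)
Lemma decid_diagram : decid (fun y : E * nat => diagram (numM y.1) y.2).
Proof.
(* Sign and predicate of a literal, the strings of its two terms, and a name for the value of
   each. *)
pose W := (nat * nat * seq nat * seq nat * nat * nat)%type.
have h1 := RE_tval; have h2 := num_decid_eq; have h3 := num_decid_le.
have hc : decid (fun y : E * nat * nat * nat * nat => litcond y.1.1.1.1 y.1.1.1.2 y.1.1.2 y.1.2 y.2).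
  rewrite /litcond; do ?[apply: decid_or | apply: decid_and | apply: decid_not]; try by ctac.
  - by apply: (decid_app3 (P := fun e a b => nu e a = nu e b)); ctac.
  - by apply: (decid_app3 (P := fun e a b => is_true (nu e a <= nu e b)%R)); ctac.
  - by apply: (decid_app3 (P := fun e a b => nu e a = nu e b)); ctac.
  - by apply: (decid_app3 (P := fun e a b => is_true (nu e a <= nu e b)%R)); ctac.
have hcc (f : E * nat * W -> Prop) : (forall y, f y <-> litcond y.1.1 y.2.1.1.1.1.1 y.2.1.1.1.1.2 y.2.1.2 y.2.2) -> decid f.
  move=> hf; apply: (decid_ext (P := fun y : E * nat * W => litcond y.1.1 y.2.1.1.1.1.1 y.2.1.1.1.1.2 y.2.1.2 y.2.2)).
    by move=> y; rewrite hf.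
  by apply: (decid_app1 (f := fun y : E * nat * W => (y.1.1, y.2.1.1.1.1.1, y.2.1.1.1.1.2, y.2.1.2, y.2.2)) hc); ctac.
pose base (y : E * nat * W) :=
   ((is_true (y.2.1.1.1.1.1 < 2) /\ is_true (y.2.1.1.1.1.2 < 2)) /\
    (y.1.2 = litcode y.2.1.1.1.1.1 y.2.1.1.1.1.2 y.2.1.1.1.2 y.2.1.1.2)) /\
    (tval y.1.1 y.2.1.1.1.2 y.2.1.2 /\ tval y.1.1 y.2.1.1.2 y.2.2).
have hb : RE base by rewrite /base /litcode /atstr; ctac.
have baseP y : base y -> exists t u, [/\ y.1.2 = literal_code (mklit y.2.1.1.1.1.1 y.2.1.1.1.1.2 t u),
     literal_consts_in (numM y.1.1) (mklit y.2.1.1.1.1.1 y.2.1.1.1.1.2 t u)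
   & literal_holds (numM y.1.1) (mklit y.2.1.1.1.1.1 y.2.1.1.1.1.2 t u) <->
     litcond y.1.1 y.2.1.1.1.1.1 y.2.1.1.1.1.2 y.2.1.2 y.2.2].
  move: y => [[e c] [[[[[b k] v] w] x] z]] [[[/= hb2 hk2] ec] [/tvalP [t [t1 t2 t3]] /tvalP [u [u1 u2 u3]]]].
  exists t, u; split; first by rewrite mklit_code // t1 u1.
    by rewrite /mklit; case: (b) => [|?]; case: (k).
  exact: litcondP.
have baseE e l : literal_consts_in (numM e) l -> exists w : W, base ((e, literal_code l), w).
  have [b [k [t [u [hb2 hk2 ->]]]]] := mklit_surj l.
  have -> : literal_consts_in (numM e) (mklit b k t u) = (term_consts_in (numM e) t /\ term_consts_in (numM e) u).
    by rewrite /mklit; case: b {hb2} => [|?]; case: k {hk2}.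
  move=> [ht hu]; exists (b, k, tstr t, tstr u, teval (numM e) t, teval (numM e) u).
  rewrite /base /= mklit_code //; do 2!split=> //; apply/tvalP; first by exists t.
  by exists u.
apply: decid_of_RE.
  have : RE (fun y : E * nat => exists w : W, base (y, w) /\ litcond y.1 w.1.1.1.1.1 w.1.1.1.1.2 w.1.2 w.2).
    apply: RE_ex; apply: RE_and; first by apply: (RE_app1 (P := base)); ctac.
    by apply: RE_dec; apply: hcc.
  apply: RE_ext => -[e c] /=; split=> [[w [/baseP [t [u [/= hc1 hc2 hc3]]] hl]]|[l [<- [hl1 hl2]]]].
    exists (mklit w.1.1.1.1.1 w.1.1.1.1.2 t u); split; first exact: (esym hc1).
    by split; [exact: hc2 | apply/hc3].
  have [w hw] := baseE e l hl1; exists w; split=> //.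
  by have [t [u [/literal_code_inj <- _ <-]]] := baseP _ hw.
have hval : RE (fun y : E * nat => ~ exists2 b, is_true (b < 2) & exists2 k, is_true (k < 2) &
   exists2 p, is_true (p < y.2) & exists2 q, is_true (q < y.2) & (tvalid y.1 p /\ tvalid y.1 q) /\
     y.2 = litcode b k (dec p) (dec q)).
  by have h := decid_tvalid; rewrite /litcode /atstr; ctac.
have : RE (fun y : E * nat => (~ exists2 b, is_true (b < 2) & exists2 k, is_true (k < 2) &
   exists2 p, is_true (p < y.2) & exists2 q, is_true (q < y.2) & (tvalid y.1 p /\ tvalid y.1 q) /\
     y.2 = litcode b k (dec p) (dec q)) \/
   exists w : W, base (y, w) /\ ~ litcond y.1 w.1.1.1.1.1 w.1.1.1.1.2 w.1.2 w.2).
  apply: RE_or => //; apply: RE_ex; apply: RE_and; first by apply: (RE_app1 (P := base)); ctac.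
  by apply: RE_dec; apply: decid_not; apply: hcc.
apply: RE_ext => -[e c] /=; split.
  case=> [hn [l [hl1 [hl2 hl3]]]|[w [/baseP [t [u [/= hc1 hc2 hc3]]] hl]] [l [hl1 [hl2 hl3]]]]; last first.
    by apply: hl; apply/hc3; rewrite hc1 in hl1; rewrite -(literal_code_inj hl1).
  apply: hn; have [b [k [t [u [hb2 hk2 el]]]]] := mklit_surj l.
  exists b => //; exists k => //; rewrite -hl1 el mklit_code //.
  have [ht hu] : term_consts_in (numM e) t /\ term_consts_in (numM e) u.
    by move: hl2; rewrite el /mklit; case: (b) => [|?]; case: (k).
  exists (enc (tstr t)).
    apply: leq_ltn_trans (enc_node _ _); apply: leq_trans (ltnW (enc_node k _)); exact: enc_leq_cat.
  exists (enc (tstr u)).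
    apply: leq_ltn_trans (enc_node _ _); apply: leq_trans (ltnW (enc_node k _)); exact: enc_leq_cat2.
  by rewrite !encK; split=> //; split; [exists t | exists u].
move=> hd; case: (pselect (exists l, literal_code l = c /\ literal_consts_in (numM e) l)) => [[l [hl1 hl2]]|hn].
  right; have [w hw] := baseE e l hl2; rewrite hl1 in hw; exists w; split=> // hl.
  have [t [u [/= hc1 hc2 hc3]]] := baseP _ hw.
  apply: hd; exists (mklit w.1.1.1.1.1 w.1.1.1.1.2 t u); split; first exact: (esym hc1).
  by split; [exact: hc2 | apply/hc3].
left=> -[b hb2 [k hk2 [p _ [q _ [[[t [-> ht]] [u [-> hu]]] hc1]]]]]; apply: hn.
exists (mklit b k t u); rewrite mklit_code // hc1 !encK; split=> //.
by rewrite /mklit; case: (b) => [|?]; case: (k).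
Qed.

End Numbering.

Theorem index_of_numbering (nu : nat -> nat -> RR) (S : nat -> RR -> Prop) :
  (forall n, subf (S n)) -> (forall n r, S n r <-> exists x, nu n x = r) ->
  RE (fun y : nat * nat * nat * nat => nu y.1.1.1 y.1.1.2 + nu y.1.1.1 y.1.2 = nu y.1.1.1 y.2)%R ->
  RE (fun y : nat * nat * nat * nat => nu y.1.1.1 y.1.1.2 * nu y.1.1.1 y.1.2 = nu y.1.1.1 y.2)%R ->
  RE (fun y : nat * nat * nat => is_true (nu y.1.1 y.1.2 < nu y.1.1 y.2)%R) ->
  exists2 f, computable_fun f & forall n, idxS (S n) (f n).
Proof.
move=> hS nuS hadd hmul hlt; have hd := decid_diagram hS nuS hadd hmul hlt.
have [|f hf h] := smn (F := fun y => if `[< diagram (numM nuS y.1) y.2 >] then 1 else 0).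
  by ctac.
exists f => // n; exists (numM nuS n), (nu n); split; [exact: numM_wf | | exact: numM_iso].
by move=> c; have := h n c; case: asboolP.
Qed.

(** * Transfer of finite diagrams *)

Local Open Scope ring_scope.
Lemma min_pos (a b : RR) : 0 < a -> 0 < b -> exists2 d, 0 < d & d <= a /\ d <= b.
Proof.
by move=> ha hb; exists (Num.min a b); rewrite ?lt_min ?ha ?hb // !ge_min !lexx orbT.
Qed.

(** Joint continuity in the coefficients and the point. The error of one Horner step has three
    parts, each kept within [eps / 3]; the factor [|c| + 1] bounds [|c'|], the distance being less
    than 1. *)
Lemma horner_rec_near (s : seq RR) (c eps : RR) : 0 < eps ->
  exists2 d, 0 < d & forall s' c', size s' = size s -> (forall i, (i < size s)%N -> `|s'`_i - s`_i| < d) ->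
    `|c' - c| < d -> `|horner_rec s' c' - horner_rec s c| < eps.
Proof.
elim: s eps => [|a s IH] eps e0.
  by exists 1 => // -[|//] c' _ _ _; rewrite /= subrr normr0.
set h := horner_rec s c; pose e1 := eps / (3 * (`|c| + 1)).
have c1 : 0 < `|c| + 1 by apply: ltr_wpDl.
have h1 : 0 < `|h| + 1 by apply: ltr_wpDl.
have e10 : 0 < e1 by rewrite divr_gt0 // mulr_gt0.
have [d1 d10 H] := IH e1 e10.
have [d2 d20 [l1 l2]] := min_pos d10 (ltr01 : 0 < 1 :> RR).
have e30 : 0 < eps / (3 * (`|h| + 1)) by rewrite divr_gt0 // mulr_gt0.
have e31 : 0 < eps / 3 by rewrite divr_gt0.
have [d3 d30 [l3 l4]] := min_pos e30 e31.
have [d d0 [l5 l6]] := min_pos d20 d30.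
exists d => // -[//|a' s'] c' [sz] hs hc /=.
have hh : `|horner_rec s' c' - h| < e1.
  apply: H => // [i hi|]; first by apply: lt_le_trans (hs i.+1 hi) _; lra.
  by apply: lt_le_trans hc _; lra.
set h' := horner_rec s' c' in hh *.
have -> : h' * c' + a' - (h * c + a) = (h' - h) * c' + (h * (c' - c) + (a' - a)) by ring.
apply: le_lt_trans (ler_normD _ _) _; rewrite normrM.
have t1 : `|h' - h| * `|c'| <= eps / 3.
  have cc : `|c'| <= `|c| + 1.
    by rewrite -[c'](subrK c) addrC; apply: le_trans (ler_normD _ _) _; rewrite lerD2l; lra.
  apply: le_trans (_ : e1 * (`|c| + 1) <= _); first by apply: ler_pM => //; apply: ltW.
  by rewrite /e1 invfM mulrA -mulrA mulVf ?gt_eqF // mulr1.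
have t2 : `|h * (c' - c)| < eps / 3.
  rewrite normrM; apply: le_lt_trans (_ : `|h| * d3 < _).
    by apply: ler_wpM2l => //; lra.
  apply: lt_le_trans (_ : (`|h| + 1) * d3 <= _); first by rewrite ltr_pM2r // ltrDl.
  rewrite mulrC; apply: le_trans (_ : eps / (3 * (`|h| + 1)) * (`|h| + 1) <= _).
    by rewrite ler_pM2r.
  by rewrite invfM mulrA -mulrA mulVf ?gt_eqF // mulr1.
have t3 : `|a' - a| < eps / 3 by apply: lt_le_trans (hs 0%N isT) _; lra.
have t4 : `|h * (c' - c) + (a' - a)| < eps / 3 + eps / 3.
  by apply: le_lt_trans (ler_normD _ _) _; apply: ltrD.
lra.
Qed.

(** * Specialisation of finitely many reals into a relatively closed subfield *)

Section Spec.
Import Pdiv.CommonRing Pdiv.RingMonic Pdiv.ComRing.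
Variables (E : RR -> Prop) (hE : racl E).

(* Finitely many elements of [A] can be approximated by ring maps into [E] that fix [E] and kill the
   kernel of [ev]; this survives the adjunction of one generator, as [{poly A}] with value [c],
   because a simple root of a polynomial moves continuously with its coefficients. *)
Definition spec (A : comNzRingType) (ev : {rmorphism A -> RR}) (K : RR -> A) :=
  (forall e, E e -> ev (K e) = e) /\
  forall (zs : seq A) eps, 0 < eps -> exists f : {rmorphism A -> RR},
    [/\ (forall a, E (f a)), (forall a, ev a = 0 -> f a = 0), (forall e, E e -> f (K e) = e)
      & forall z, z \in zs -> `|f z - ev z| < eps].

Lemma spec_base : exists (A : comNzRingType) (ev : {rmorphism A -> RR}) K, @spec A ev K.
Proof.
pose A := subR (proj1 hE); pose ev : {rmorphism A -> RR} := val.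
have hK e : exists a : A, E e -> val a = e.
  by case: (pselect (E e)) => [/(subRP (proj1 hE)) [a ha]|h]; [exists a | exists 0].
have [K HK] := choice hK; exists A, ev, K; split=> // zs eps e0; exists ev; split=> //.
  exact: subR_in.
by move=> z _; rewrite subrr normr0.
Qed.

Section Step.
Variables (A : comNzRingType) (c : RR).

Definition evp (ev : {rmorphism A -> RR}) (x : RR) : {rmorphism {poly A} -> RR} :=
  (horner_eval x \o map_poly ev)%FUN.

Lemma evpE ev x p : evp ev x p = (map_poly ev p).[x].
Proof. by []. Qed.

Lemma near_polys (ev : {rmorphism A -> RR}) x (zs : seq {poly A}) eps : 0 < eps ->
  exists2 d, 0 < d & forall (f : {rmorphism A -> RR}) x', `|x' - x| < d ->
    (forall a, a \in flatten (map (@polyseq _) zs) -> `|f a - ev a| < d) ->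
    forall p, p \in zs -> `|evp f x' p - evp ev x p| < eps.
Proof.
move=> e0; elim: zs => [|p zs [d1 d10 IH]]; first by exists 1.
have [d2 d20 H] := horner_rec_near (map ev p) x e0.
have [d d0 [l1 l2]] := min_pos d10 d20; exists d => // f x' hx hf q.
rewrite inE => /orP [/eqP ->|hq]; last first.
  apply: IH hq => [|a ha]; first exact: lt_le_trans hx l1.
  by apply: lt_le_trans l1; apply: hf; rewrite /= mem_cat ha orbT.
rewrite !evpE !map_polyE !horner_Poly; apply: H; first by rewrite !size_map.
  move=> i; rewrite size_map => hi; rewrite !(nth_map 0) //; apply: lt_le_trans l2; apply: hf.
  by rewrite /= mem_cat mem_nth.
exact: lt_le_trans hx l2.
Qed.

Lemma evp_ker0 (ev f : {rmorphism A -> RR}) x p : (forall a, ev a = 0 -> f a = 0) ->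
  map_poly ev p = 0 -> evp f x p = 0.
Proof.
move=> h p0; rewrite evpE; suff -> : map_poly f p = 0 by rewrite horner0.
apply/polyP => i; rewrite coef0 coef_map; apply: h.
by have := congr1 (fun q : {poly RR} => q`_i) p0; rewrite coef0 coef_map.
Qed.

Variables (ev : {rmorphism A -> RR}) (K : RR -> A).
Hypothesis (hsp : spec ev K).

Let E1 : E 1. Proof. by case: hE => -[]. Qed.
Let EB x y : E x -> E y -> E (x - y). Proof. by case: hE => -[] _ h _ _ _; apply: h. Qed.
Let EM x y : E x -> E y -> E (x * y). Proof. by case: hE => -[] _ _ h _ _; apply: h. Qed.
Let E0 : E 0. Proof. by rewrite -(subrr 1); apply: EB. Qed.
Let EN x : E x -> E (- x). Proof. by rewrite -sub0r; apply: EB. Qed.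
Let ED x y : E x -> E y -> E (x + y). Proof. by move=> hx hy; rewrite -[y]opprK; apply/EB/EN. Qed.

Lemma E_nat n : E n%:R.
Proof. by elim: n => [|n IH] //; rewrite -addn1 natrD; apply: ED. Qed.

Lemma E_rat q : E (ratr q).
Proof.
rewrite /ratr; have Ei (i : int) : E i%:~R.
  by case: i => n; rewrite ?NegzE ?mulrNz; [|apply: EN]; rewrite -pmulrn; apply: E_nat.
by apply: EM => //; case: hE => -[] _ _ _ hV _; apply: hV.
Qed.

Lemma E_dense x eps : 0 < eps -> exists2 y, E y & `|y - x| < eps.
Proof.
move=> e0; have [|q] := @rat_in_itvoo _ (x - eps) (x + eps); first by lra.
rewrite in_itv /= => /andP [h1 h2]; exists (ratr q); first exact: E_rat.
by rewrite ltr_norml; apply/andP; split; lra.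
Qed.

Lemma E_horner (f : {rmorphism A -> RR}) x p : (forall a, E (f a)) -> E x -> E (evp f x p).
Proof.
move=> hf hx; rewrite evpE map_polyE horner_Poly.
by elim: (polyseq p) => //= a s IH; apply: ED => //; apply: EM.
Qed.

Lemma spec_step_const (f : {rmorphism A -> RR}) x e : f (K e) = e -> evp f x (K e)%:P = e.
Proof. by rewrite evpE map_polyC hornerC. Qed.

(** The cofactor of ['X - c] does not vanish at [c], so it has constant sign nearby, and the linear
    factor changes sign. *)
Lemma simple_root_sign (M : {poly RR}) : root M c -> ~~ root M^`() c -> forall d, 0 < d ->
  exists r, [/\ 0 < r, r < d & M.[c - r] * M.[c + r] < 0].
Proof.
move=> /factor_theorem [Q hQ] hM' d d0.
have Qc : Q.[c] != 0.
  by move: hM'; rewrite hQ rootE derivM derivXsubC mulr1 !hornerE /= subrr mulr0 add0r.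
have q0 : 0 < `|Q.[c]| by rewrite normr_gt0.
have [d1 d10 H] := horner_rec_near Q c q0.
have [d2 d20 [l1 l2]] := min_pos d0 d10.
pose r := d2 / 2; have r0 : 0 < r by rewrite divr_gt0.
have rd : r < d2 by rewrite /r ltr_pdivrMr // ltr_pMr // ltr1n.
have near x : `|x - c| < d1 -> 0 < Q.[x] * Q.[c].
  move=> hx; have : `|Q.[x] - Q.[c]| < `|Q.[c]| by apply: H => // i _; rewrite subrr normr0.
  rewrite ltr_norml => /andP [h1 h2].
  case: (ltgtP 0 Q.[c]) => [hp|hn|h0]; last by rewrite -h0 eqxx in Qc.
    by rewrite gtr0_norm // in h1 h2; rewrite mulr_gt0 //; lra.
  by rewrite ltr0_norm // in h1 h2; rewrite nmulr_rgt0 //; lra.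
exists r; split=> //; first exact: lt_le_trans rd l1.
have h1 : 0 < Q.[c - r] * Q.[c].
  by apply: near; rewrite addrAC subrr add0r normrN gtr0_norm //; apply: lt_le_trans rd l2.
have h2 : 0 < Q.[c + r] * Q.[c].
  by apply: near; rewrite addrAC subrr add0r gtr0_norm //; apply: lt_le_trans rd l2.
have h3 : 0 < Q.[c - r] * Q.[c + r].
  have : 0 < (Q.[c - r] * Q.[c]) * (Q.[c + r] * Q.[c]) by apply: mulr_gt0.
  have -> : Q.[c - r] * Q.[c] * (Q.[c + r] * Q.[c]) = (Q.[c - r] * Q.[c + r]) * Q.[c] ^+ 2 by ring.
  by rewrite pmulr_lgt0 // exprn_even_gt0.
rewrite hQ !hornerM !hornerXsubC.
have -> : Q.[c - r] * (c - r - c) * (Q.[c + r] * (c + r - c)) = - ((Q.[c - r] * Q.[c + r]) * r ^+ 2) by ring.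
by rewrite oppr_lt0 mulr_gt0 // exprn_gt0.
Qed.

(** If every polynomial over [A] that vanishes at [c] has zero image, [c] can be replaced by any
    nearby element of [E]. Otherwise a polynomial [m] of least image size has [c] as a simple root,
    and [c] moves to a nearby root of the specialised [m], which is in [E] because [E] is relatively
    closed. *)
Lemma spec_step : spec (evp ev c) (fun e => (K e)%:P).
Proof.
have [hK hf] := hsp; split=> [e he|zs eps e0]; first by apply: spec_step_const; apply: hK.
have [d d0 Hd] := near_polys ev c zs e0.
case: (pselect (exists m : {poly A}, (map_poly ev m).[c] = 0 /\ map_poly ev m != 0)); last first.
  move=> hn; have [c' Ec' hc'] := E_dense c d0.
  have [f [f1 f2 f3 f4]] := hf (flatten (map (@polyseq _) zs)) d d0.
  exists (evp f c'); split.
  - by move=> p; apply: E_horner.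
  - move=> p hp; apply: (evp_ker0 (ev := ev)) => //; apply/eqP; apply: contrapT => /negP np.
    by apply: hn; exists p.
  - by move=> e he; apply: spec_step_const; apply: f3.
  - by move=> p; apply: Hd.
move=> [m0 hm0].
have ex : exists n, `[< exists m : {poly A}, [/\ (map_poly ev m).[c] = 0, map_poly ev m != 0 & size (map_poly ev m) = n] >].
  by exists (size (map_poly ev m0)); apply/asboolP; exists m0; case: hm0.
case: (ex_minnP ex) => n /asboolP [m1 [m1c m1n m1s]] nmin {m0 hm0 ex}.
(* Truncation gives [m] the size of its image. Its leading coefficient then has nonzero value, which
   pseudo-division by [m] relies on. *)
pose m := \poly_(i < n) m1`_i.
have em : map_poly ev m = map_poly ev m1.
  apply/polyP => i; rewrite !coef_map coef_poly; case: ltnP => //= hi.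
  by rewrite rmorph0 -coef_map nth_default // m1s.
have mc : (map_poly ev m).[c] = 0 by rewrite em.
have mn : map_poly ev m != 0 by rewrite em.
have ms : size (map_poly ev m) = n by rewrite em.
have sm : size m = n.
  apply/eqP; rewrite eqn_leq size_poly /= -{1}ms map_polyE; apply: leq_trans (size_Poly _) _.
  by rewrite size_map.
have min p : (map_poly ev p).[c] = 0 -> (size p < n)%N -> map_poly ev p = 0.
  move=> pc ps; apply/eqP; apply: contrapT => /negP pn.
  have : (n <= size (map_poly ev p))%N by apply: nmin; apply/asboolP; exists p.
  rewrite leqNgt => /negP; apply; apply: leq_ltn_trans ps.
  by rewrite map_polyE; apply: leq_trans (size_Poly _) _; rewrite size_map.
have n1 : (1 < n)%N.
  rewrite ltnNge -ms; apply/negP => /size1_polyC h.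
  by move: mc mn; rewrite h hornerC => ->; rewrite polyC0 eqxx.
pose a := lead_coef m; have ea : ev a != 0.
  rewrite /a lead_coefE sm -coef_map -[X in _`_X.-1]ms -lead_coefE lead_coef_eq0 //.
(* The derivative is smaller and has nonzero image in characteristic 0, so by minimality it does not
   vanish at [c]. *)
have M'c : ~~ root (map_poly ev m)^`() c.
  rewrite deriv_map; apply/negP => /rootP h.
  have sz : (size m^`() < n)%N by rewrite -[X in (_ < X)%N]sm lt_size_deriv // -size_poly_gt0 sm ltnW.
  have := min _ h sz; rewrite -deriv_map => /(congr1 (fun q : {poly RR} => q`_n.-2)).
  have e2 : n.-2.+1 = n.-1 by lia.
  have lc : (map_poly ev m)`_n.-1 = lead_coef (map_poly ev m) by rewrite lead_coefE ms.
  rewrite coef0 coef_deriv e2 lc => /eqP; rewrite mulrn_eq0 lead_coef_eq0 (negbTE mn) orbF; lia.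
have [r [r0 rd hr]] := simple_root_sign (introT rootP mc) M'c d0.
pose M := map_poly ev m.
have nz1 : 0 < `|M.[c - r]| by rewrite normr_gt0; apply/eqP => h; move: hr; rewrite -/M h mul0r ltxx.
have nz2 : 0 < `|M.[c + r]| by rewrite normr_gt0; apply/eqP => h; move: hr; rewrite -/M h mulr0 ltxx.
(* The coefficients are approximated well enough for the values at [c - r] and [c + r] to keep their
   opposite signs, and for the leading coefficient to stay nonzero. *)
have [d1 d10 H1] := near_polys ev (c - r) [:: m] nz1.
have [d2 d20 H2] := near_polys ev (c + r) [:: m] nz2.
have ea0 : 0 < `|ev a| by rewrite normr_gt0.
have [d3 d30 [l1 l2]] := min_pos d10 d20.
have [d4 d40 [l3 l4]] := min_pos d30 ea0.
have [d5 d50 [l5 l6]] := min_pos d40 d0.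
have [f [f1 f2 f3 f4]] := hf (a :: flatten (map (@polyseq _) [:: m]) ++ flatten (map (@polyseq _) zs)) d5 d50.
have fa : f a != 0.
  apply/eqP => h; have := f4 a (mem_head _ _); rewrite h sub0r normrN ltNge => /negP; apply.
  by lra.
have g1 : `|evp f (c - r) m - M.[c - r]| < `|M.[c - r]|.
  apply: H1; rewrite ?inE ?subrr ?normr0 // => b hb.
  by apply: lt_le_trans (_ : d5 <= _); [apply: f4; rewrite inE mem_cat hb orbT | lra].
have g2 : `|evp f (c + r) m - M.[c + r]| < `|M.[c + r]|.
  apply: H2; rewrite ?inE ?subrr ?normr0 // => b hb.
  by apply: lt_le_trans (_ : d5 <= _); [apply: f4; rewrite inE mem_cat hb orbT | lra].
rewrite !evpE in g1 g2; pose N := map_poly f m.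
have sg (u v : RR) : `|u - v| < `|v| -> (0 < v /\ 0 < u) \/ (v < 0 /\ u < 0).
  rewrite ltr_norml => /andP [h1 h2]; case: (ltgtP 0 v) => hv.
  - by left; rewrite gtr0_norm // in h1 h2; split=> //; lra.
  - by right; rewrite ltr0_norm // in h1 h2; split=> //; lra.
  - by rewrite -hv normr0 in h1 h2; lra.
have [c' hc' rc'] : exists2 c', c - r <= c' <= c + r & root N c'.
  have hle : c - r <= c + r by lra.
  have [[p1 p2]|[p1 p2]] := sg _ _ g1; have [[p3 p4]|[p3 p4]] := sg _ _ g2.
  - by move: hr; rewrite -/M; nra.
  - have [|x hx] := @poly_ivt RR (- N) _ _ hle; first by rewrite !hornerN !oppr_cp0 !ltW.
    by rewrite rootN; exists x.
  - by have [|x hx rx] := @poly_ivt RR N _ _ hle; [rewrite !ltW | exists x].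
  - by move: hr; rewrite -/M; nra.
have Nn : N != 0.
  apply/eqP => h; have := congr1 (fun q : {poly RR} => q`_n.-1) h.
  by rewrite coef0 coef_map -{1}sm -lead_coefE => /eqP; rewrite (negbTE fa).
have Ec' : E c'.
  by apply: (proj2 hE N) => // i; rewrite coef_map; apply: f1.
exists (evp f c'); split.
- by move=> p; apply: E_horner.
(* By pseudo-division, a power of the leading coefficient times [p] is a multiple of [m] plus a
   remainder smaller than [m]. The remainder vanishes at [c], so its image is zero by minimality,
   and [f] kills it as well. *)
- move=> p hp; have := rdivp_eq m p; rewrite -mul_polyC; set k := rscalp p m => hdiv.
  have mcv : evp ev c m = 0 by [].
  have mfv : evp f c' m = 0 by exact/rootP.
  have hr0 : evp ev c (rmodp p m) = 0.
    by have := congr1 (evp ev c) hdiv; rewrite rmorphD !rmorphM hp mcv !mulr0 add0r => ->.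
  have hr1 : map_poly ev (rmodp p m) = 0.
    by apply: min hr0 _; rewrite -[X in (_ < X)%N]sm ltn_rmodp -size_poly_gt0 sm ltnW.
  have hr2 := evp_ker0 c' f2 hr1.
  have := congr1 (evp f c') hdiv; rewrite rmorphD !rmorphM hr2 addr0 mfv mulr0 => /eqP.
  rewrite mulf_eq0 => /orP [|/eqP //].
  by rewrite evpE map_polyC hornerC /= rmorphXn expf_eq0 => /andP [_]; rewrite (negbTE fa).
- by move=> e he; apply: spec_step_const; apply: f3.
- apply: Hd; first by rewrite ltr_norml; apply/andP; split; move: hc' => /andP []; lra.
  move=> b hb; apply: lt_le_trans l6; apply: f4.
  by rewrite inE mem_cat hb !orbT.
Qed.
End Step.

(** Only the reals outside [E] become variables; those in [E] enter as constants, and this keeps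
    them fixed. *)
Lemma spec_tuple (cs : seq RR) : exists (A : comNzRingType) (ev : {rmorphism A -> RR}) K (al : seq A),
  [/\ spec ev K, map ev al = cs & forall i, (i < size cs)%N -> E cs`_i -> al`_i = K cs`_i].
Proof.
elim: cs => [|c cs [A [ev [K [al [h1 h2 h3]]]]]].
  by have [A [ev [K h]]] := spec_base; exists A, ev, K, [::].
case: (pselect (E c)) => hc.
  exists A, ev, K, (K c :: al); split=> //=; first by rewrite h2 (proj1 h1).
  by case=> [|i] //=; apply: h3.
exists {poly A}, (evp ev c), (fun e => (K e)%:P), ('X :: map polyC al); split=> /=.
- exact: spec_step.
- rewrite -[X in X :: _ = _]/(evp ev c 'X) evpE map_polyX hornerX -map_comp -[in RHS]h2; congr cons.
  by apply: eq_map => a; rewrite -[LHS]/(evp ev c a%:P) evpE map_polyC hornerC.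
- case=> [|i] //= hi; rewrite ltnS in hi; move=> hEi; rewrite (nth_map 0) -?h3 //.
  by rewrite -(size_map ev) h2.
Qed.

(** Each relation is the vanishing or the sign of one of the differences in [Z]. The ring map
    preserves zeros exactly; and since [eps] is at most every nonzero absolute value, it preserves
    signs. *)
Theorem transfer (cs : seq RR) : exists2 ds : seq RR, size ds = size cs &
  forall i, (i < size cs)%N -> [/\ E ds`_i, E cs`_i -> ds`_i = cs`_i &
   forall j k, (j < size cs)%N -> (k < size cs)%N ->
     [/\ (cs`_i + cs`_j = cs`_k <-> ds`_i + ds`_j = ds`_k),
         (cs`_i * cs`_j = cs`_k <-> ds`_i * ds`_j = ds`_k) & (cs`_i < cs`_j) = (ds`_i < ds`_j)]].
Proof.
have [A [ev [K [al [[hK hf] hal hc]]]]] := spec_tuple cs.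
have sz : size al = size cs by rewrite -hal size_map.
have eal i : (i < size cs)%N -> ev al`_i = cs`_i by move=> hi; rewrite -hal (nth_map 0) // sz.
pose n := size cs.
pose zs := [seq al`_x.1.1 + al`_x.1.2 - al`_x.2 | x : 'I_n * 'I_n * 'I_n].
pose zs' := [seq al`_x.1.1 * al`_x.1.2 - al`_x.2 | x : 'I_n * 'I_n * 'I_n].
pose zt := [seq al`_x.1 - al`_x.2 | x : 'I_n * 'I_n].
pose Z := zs ++ zs' ++ zt.
have [eps e0 heps] : exists2 eps : RR, 0 < eps & forall z, z \in Z -> ev z <> 0 -> eps <= `|ev z|.
  elim: (Z) => [|z s [eps e0 IH]]; first by exists 1.
  have [h0|h0] := eqVneq (ev z) 0.
    by exists eps => // y; rewrite inE => /orP [/eqP -> //|]; apply: IH.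
  have [|d d0 [l1 l2]] := @min_pos `|ev z| eps _ e0; first by rewrite normr_gt0.
  exists d => // y; rewrite inE => /orP [/eqP ->|hy /(IH _ hy)] //; lra.
have [f [f1 f2 f3 f4]] := hf Z eps e0.
have fz z : z \in Z -> (ev z = 0 <-> f z = 0) /\ (ev z < 0) = (f z < 0).
  move=> hz; have [h0|/eqP h0] := eqVneq (ev z) 0; first by rewrite h0 (f2 _ h0).
  have := f4 z hz; have := heps z hz h0; set u := f z; set v := ev z => h1 h2.
  have {h2} : `|u - v| < `|v| by apply: lt_le_trans h2 h1.
  rewrite ltr_norml => /andP [h2 h3]; move/eqP: h0; rewrite -/v => h0.
  case: (ltgtP 0 v) => hv; last by rewrite -hv eqxx in h0.
    rewrite gtr0_norm // in h2 h3; have up : 0 < u by lra.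
    by split; [split=> h; lra | apply/esym/negbTE; rewrite -leNgt ltW].
  rewrite ltr0_norm // in h2 h3; have up : u < 0 by lra.
  by split; [split=> h; lra | rewrite up].
exists (map f al); first by rewrite size_map.
have fal i : (i < size cs)%N -> (map f al)`_i = f al`_i by move=> hi; rewrite (nth_map 0) // sz.
move=> i hi; split; first by rewrite fal.
  by move=> he; rewrite fal // hc // f3.
move=> j k hj hk; rewrite !fal // -!eal //.
have m1 : al`_i + al`_j - al`_k \in Z.
  rewrite mem_cat; apply/orP; left; apply/mapP.
  by exists (Ordinal hi, Ordinal hj, Ordinal hk) => //; rewrite mem_enum.
have m2 : al`_i * al`_j - al`_k \in Z.
  rewrite !mem_cat; apply/orP; right; apply/orP; left; apply/mapP.
  by exists (Ordinal hi, Ordinal hj, Ordinal hk) => //; rewrite mem_enum.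
have m3 : al`_i - al`_j \in Z.
  rewrite !mem_cat; apply/orP; right; apply/orP; right; apply/mapP.
  by exists (Ordinal hi, Ordinal hj) => //; rewrite mem_enum.
have [z1 _] := fz _ m1; have [z2 _] := fz _ m2; have [_ z3] := fz _ m3.
have eq0 (x y : RR) : x = y <-> x - y = 0 by split=> [->|/eqP]; rewrite ?subrr // subr_eq0 => /eqP.
rewrite !rmorphB !rmorphD in z1; rewrite !rmorphB !rmorphM in z2; rewrite !rmorphB !subr_lt0 in z3.
by split=> //; [rewrite eq0 z1 -eq0 | rewrite eq0 z2 -eq0].
Qed.
End Spec.

(** * Limits along a chain of subfields *)

Local Close Scope ring_scope.
Section Chain.
Variables (nu : nat -> RR).
Definition addV a b c := (nu a + nu b = nu c)%R.
Definition mulV a b c := (nu a * nu b = nu c)%R.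
Definition ltV a b := is_true (nu a < nu b)%R.
Hypotheses (hadd : decid (fun y : nat * nat * nat => addV y.1.1 y.1.2 y.2))
  (hmul : decid (fun y : nat * nat * nat => mulV y.1.1 y.1.2 y.2))
  (hlt : decid (fun y : nat * nat => ltV y.1 y.2)).
Variables (Q : nat -> nat -> nat -> Prop) (Fs : nat -> RR -> Prop).
Hypotheses (hQ : decid (fun y : nat * nat * nat => Q y.1.1 y.1.2 y.2))
  (hFs : forall k, racl (Fs k)) (Fs_mono : forall k r, Fs k r -> Fs k.+1 r)
  (FsP : forall k r, Fs k r <-> exists x, nu x = r /\ exists m, Q k x m).
Variables (T : nat -> nat -> Prop) (P : nat -> nat -> nat -> nat -> Prop).
Hypotheses (hP : decid (fun y : nat * nat * nat * nat => P y.1.1.1 y.1.1.2 y.1.2 y.2))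
  (TP : forall n k, T n k <-> exists u, forall v, P n k u v).

Lemma Fs_leq j k r : j <= k -> Fs j r -> Fs k r.
Proof.
elim: k => [|k IH]; first by rewrite leqn0 => /eqP ->.
by rewrite leq_eqVlt => /orP [/eqP -> //|/IH h hr]; apply: Fs_mono; apply: h.
Qed.

(** * Candidate witnesses and events *)

Definition refuted n j c s := exists2 v, v < s.+1 & ~ P n j c v.
(** Candidate witnesses for [T n j] are tried in increasing order, each being kept until some [v]
    seen so far refutes it. *)
Definition cand n j s := iteri s (fun t c => if `[< refuted n j c t >] then c.+1 else c) 0.
Definition event n j s := refuted n j (cand n j s) s.

Lemma decid_event : decid (fun y : nat * nat * nat => event y.1.1 y.1.2 y.2).
Proof.
have h : decid (fun y : nat * nat * nat * nat => refuted y.1.1.1 y.1.1.2 y.1.2 y.2) by rewrite /refuted; ctac.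
have hc : computable (fun y : nat * nat * nat => cand y.1.1 y.1.2 y.2).
  by rewrite /cand; ctac.
by rewrite /event; ctac.
Qed.

Lemma candS n j s : cand n j s.+1 = if `[< event n j s >] then (cand n j s).+1 else cand n j s.
Proof. by []. Qed.

Lemma cand_leq n j s t : s <= t -> cand n j s <= cand n j t.
Proof.
elim: t => [|t IH]; first by rewrite leqn0 => /eqP ->.
rewrite leq_eqVlt => /orP [/eqP -> //|/IH h]; apply: leq_trans h _.
by rewrite candS; case: asboolP.
Qed.

(** The candidate never passes a true witness, so if there is one the events cannot be infinitely
    many. Conversely a candidate that is eventually kept forever is refuted by no [v]. *)
Lemma eventP n j : T n j <-> exists s, forall t, s <= t -> ~ event n j t.
Proof.
rewrite TP; split=> [[u hu]|[s hs]].
  have bd s : cand n j s <= u.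
    elim: s => // s IH; rewrite candS; case: asboolP => // -[v _ hv].
    by move: IH; rewrite leq_eqVlt => /orP [/eqP e|//]; case: hv; rewrite e.
  apply: contrapT => hn.
  suff H m : exists s, m <= cand n j s by have [s] := H u.+1; rewrite leqNgt ltnS bd.
  elim: m => [|m [s hs]]; first by exists 0.
  have [t [ht et]] : exists t, s <= t /\ event n j t.
    apply: contrapT => h; apply: hn; exists s => t ht et; apply: h; by exists t.
  exists t.+1; rewrite candS; case: asboolP => // _; apply: leq_ltn_trans hs (_ : _ <= _).
  by rewrite ltnS cand_leq.
exists (cand n j s) => v; apply: contrapT => hv.
have H t : s <= t -> cand n j t = cand n j s.
  elim: t => [|t IH]; first by rewrite leqn0 => /eqP ->.
  rewrite leq_eqVlt => /orP [/eqP -> //|ht]; rewrite candS IH //.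
  by case: asboolP => // /(hs t ht).
apply: (hs (maxn s v)); first by rewrite leq_maxl.
by exists v; [rewrite ltnS leq_maxr | rewrite H // leq_maxl].
Qed.

(* Entries are triples (name, level, witness that the name belongs to the level). *)
Definition entry := (nat * nat * nat)%type.
Definition z0 : entry := (0, 0, 0).
Definition ename (g : seq entry) i := (nth z0 g i).1.1.
Definition lv (g : seq entry) i := (nth z0 g i).1.2.
Definition good (g : seq entry) := forall i, i < size g -> Q (lv g i) (ename g i) (nth z0 g i).2.

Definition same (g g' : seq entry) := forall i, i < size g -> forall j, j < size g -> forall l, l < size g ->
  (addV (ename g i) (ename g j) (ename g l) <-> addV (ename g' i) (ename g' j) (ename g' l)) /\
  (mulV (ename g i) (ename g j) (ename g l) <-> mulV (ename g' i) (ename g' j) (ename g' l)) /\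
  (ltV (ename g i) (ename g j) <-> ltV (ename g' i) (ename g' j)).

Definition move k (g g' : seq entry) := (size g' = size g /\ good g') /\ same g g' /\
  forall i, i < size g -> (lv g i <= k -> nth z0 g' i = nth z0 g i) /\ (~ lv g i <= k -> lv g' i = k).

Lemma move_ex k g : good g -> exists g', move k g g'.
Proof.
move=> hg; pose c i := nu (ename g i); pose cs := mkseq c (size g).
have szc : size cs = size g by rewrite size_mkseq.
have csE i : i < size g -> (cs`_i = c i)%R by move=> hi; rewrite nth_mkseq.
(* Transfer into [Fs k]. Entries of level at most [k] already lie there, the chain being increasing,
   and so keep their values. *)
have [ds szd hd] := transfer (hFs k) cs; rewrite szc in szd hd.
have ent i : exists z : entry, i < size g -> [/\ Q z.1.2 z.1.1 z.2, nu z.1.1 = (ds`_i)%R,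
   (lv g i <= k -> z = nth z0 g i) & ~ lv g i <= k -> z.1.2 = k].
  case: (ltnP i (size g)) => hi; last by exists z0.
  have [hE hfix _] := hd i hi; case: (leqP (lv g i) k) => hl.
    exists (nth z0 g i) => _; split=> //; first exact: hg.
    rewrite hfix ?csE //; apply: Fs_leq hl _; apply/FsP.
    by exists (ename g i); split=> //; exists (nth z0 g i).2; apply: hg.
  by have [x [hx [m hm]]] := (FsP k _).1 hE; exists (x, k, m).
have [z hz] := choice ent; pose g' := mkseq z (size g); exists g'.
have gE i : i < size g -> nth z0 g' i = z i by move=> hi; rewrite nth_mkseq.
have nE i : i < size g -> (nu (ename g' i) = ds`_i)%R by move=> hi; rewrite /ename gE //; case: (hz i hi).
have szg : size g' = size g by rewrite size_mkseq.
split; [split=> // | split].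
- by move=> i; rewrite szg => hi; rewrite /lv /ename gE //; case: (hz i hi).
- move=> i hi j hj l hl; rewrite /addV /mulV /ltV !nE //.
  have [_ _ /(_ j l hj hl) [h1 h2 h3]] := hd i hi; rewrite !csE // in h1 h2 h3.
  by rewrite -h1 -h2 -h3.
- by move=> i hi; rewrite /lv gE //; case: (hz i hi).
Qed.

(** The second component of the decoded pair is ignored; hence every entry is offered again at
    arbitrarily late stages. *)
Definition newent s : entry := (dec s : entry * nat).1.
Arguments newent : simpl never.

Lemma newentE (z : entry) (r : nat) : newent (enc (z, r)) = z.
Proof. by rewrite /newent encK. Qed.

Definition least n s k := (is_true (k < s.+1) /\ event n k s) /\ forall j, j < k -> ~ event n j s.
Definition noevent n s := ~ exists2 k, k < s.+1 & event n k s.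
Definition append s (g g' : seq entry) :=
  (Q (newent s).1.2 (newent s).1.1 (newent s).2 /\ g' = rcons g (newent s)) \/
  (~ Q (newent s).1.2 (newent s).1.1 (newent s).2 /\ g' = g).
(** A decidable specification of the next stage, realised by search. The case of a list that is not
    [good] never occurs in the construction and makes the search total. *)
Definition stepP (x : nat * nat * seq entry) (g' : seq entry) :=
  (~ good x.2 /\ g' = [::]) \/ exists g1, append x.1.2 g1 g' /\
   ((noevent x.1.1 x.1.2 /\ g1 = x.2) \/ exists k, least x.1.1 x.1.2 k /\ move k x.2 g1).

Lemma step_ex : exists2 stp : nat * nat * seq entry -> seq entry, computable stp & forall x, stepP x (stp x).
Proof.
apply: RE_choice.
  have he := decid_event.
  have hg : decid good by rewrite /good /lv /ename; ctac.
  have hs : decid (fun y : seq entry * seq entry => same y.1 y.2) by rewrite /same /ename; ctac.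
  have hm : decid (fun y : nat * seq entry * seq entry => move y.1.1 y.1.2 y.2) by rewrite /move /lv; ctac.
  have ha : decid (fun y : nat * seq entry * seq entry => append y.1.1 y.1.2 y.2) by rewrite /append /newent; ctac.
  by rewrite /stepP /noevent /least; ctac.
move=> [[n s] g]; rewrite /stepP /=; case: (pselect (good g)) => hg; last by exists [::]; left.
have app g1 : exists g', append s g1 g'.
  rewrite /append; case: (pselect (Q (newent s).1.2 (newent s).1.1 (newent s).2)) => h.
    by exists (rcons g1 (newent s)); left.
  by exists g1; right.
case: (pselect (noevent n s)) => hn.
  by have [g' hg'] := app g; exists g'; right; exists g; split=> //; left.
have [k [hk1 hk2]] : exists k, k < s.+1 /\ event n k s.
  by apply: contrapT => h; apply: hn => -[k h1 h2]; apply: h; exists k.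
have ex : exists k, `[< event n k s >] by exists k; apply/asboolP.
case: (ex_minnP ex) => k' /asboolP hk' kmin.
have [g1 hg1] := move_ex k' hg; have [g' hg'] := app g1; exists g'; right; exists g1; split=> //.
right; exists k'; split=> //; split; first by split=> //; apply: leq_ltn_trans hk1; apply: kmin; apply/asboolP.
by move=> j hj /asboolP /kmin; rewrite leqNgt hj.
Qed.

Definition stp := s2val (cid2 step_ex).
Definition st n s := iteri s (fun t g => stp (n, t, g)) [::].

Arguments st : simpl never.

Lemma comp_st : computable (fun y : nat * nat => st y.1 y.2).
Proof. by have h : computable stp := s2valP (cid2 step_ex); rewrite /st; ctac. Qed.

Lemma stS n s : stepP (n, s, st n s) (st n s.+1).
Proof. exact: (s2valP' (cid2 step_ex)). Qed.

Lemma st_good n s : good (st n s).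
Proof.
elim: s => [|s IH] //; case: (stS n s) => [[//]|[g1 [ha hg]]] /=.
have g1g : good g1 by case: hg => [[_ -> //]|[k [_ [[_ h] _]]]].
case: ha => [[hq ->]|[_ -> //]] i; rewrite size_rcons ltnS leq_eqVlt /lv /ename nth_rcons.
by case: ltnP => [hi _|_]; [apply: g1g | rewrite orbF => ->].
Qed.

(** Only the least event acts: bringing the entries down to its level also meets the demands of all
    other events of the stage. *)
Lemma st_step n s : let g := st n s in let g' := st n s.+1 in size g <= size g' /\
  forall i, i < size g -> (lv g' i <= lv g i /\ (lv g' i = lv g i -> nth z0 g' i = nth z0 g i)) /\
  ((forall k, event n k s -> k <= s -> lv g' i <= k) /\
   ((forall k, event n k s -> lv g i <= k) -> nth z0 g' i = nth z0 g i)).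
Proof.
move=> /=; case: (stS n s) => [[/(_ (@st_good n s)) //]|[g1 [ha hg]]] /=.
have [szg1 h1] : size g1 = size (st n s) /\ forall i, i < size g1 -> nth z0 (st n s.+1) i = nth z0 g1 i.
  have -> : size g1 = size (st n s) by case: hg => [[_ ->]|[k [_ [[h _] _]]]].
  split=> // i hi.
  case: ha => [[_ ->]|[_ -> //]]; rewrite nth_rcons.
  suff -> : i < size g1 by [].
  by case: hg => [[_ ->]|[k [_ [[-> _] _]]]].
have szg : size g1 <= size (st n s.+1) by case: ha => [[_ ->]|[_ ->]]; rewrite ?size_rcons.
split; first by rewrite -szg1.
move=> i hi; rewrite /lv h1 ?szg1 //; case: hg => [[hn eg]|[k [[[k1 k2] kl] [_ [_ hm]]]]].
  rewrite eg; split=> //; split=> // k hk ks; case: hn; by exists k.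
have [m1 m2] := hm i hi; case: (leqP (lv (st n s) i) k) => hk.
  rewrite m1 //; split=> //; split=> // k' ek' _; apply: leq_trans hk _.
  by rewrite leqNgt; apply/negP => /kl.
have e : (nth z0 g1 i).1.2 = k by apply: m2; apply/negP; rewrite -ltnNge.
rewrite e; split; first by split; [exact: ltnW | move=> e'; rewrite e' /lv ltnn in hk].
split; first by move=> k' ek' _; rewrite leqNgt; apply/negP => /kl.
by move=> /(_ k k2); rewrite leqNgt /lv hk.
Qed.

Lemma st_same n s : same (st n s) (st n s.+1).
Proof.
case: (stS n s) => [[/(_ (@st_good n s)) //]|[g1 [ha hg]]] /=.
have h1 : same (st n s) g1 by case: hg => [[_ ->]|[k [_ [_ [h _]]]]].
have szg1 : size g1 = size (st n s) by case: hg => [[_ ->]|[k [_ [[h _] _]]]].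
move=> i hi j hj l hl; have := h1 i hi j hj l hl; rewrite /ename.
have e m : m < size (st n s) -> nth z0 (st n s.+1) m = nth z0 g1 m.
  by move=> hm; case: ha => [[_ ->]|[_ -> //]]; rewrite nth_rcons szg1 hm.
by rewrite !e.
Qed.

(** * Limits of the entries *)

Lemma st_size n s t : s <= t -> size (st n s) <= size (st n t).
Proof.
elim: t => [|t IH]; first by rewrite leqn0 => /eqP ->.
by rewrite leq_eqVlt => /orP [/eqP -> //|/IH h]; apply: leq_trans h (proj1 (st_step n t)).
Qed.

Definition lim_at n i s z := forall t, s <= t -> i < size (st n t) /\ nth z0 (st n t) i = z.

(** Induction on the level: it never rises, and an entry changes only when its level drops. *)
Lemma st_lim n i s : i < size (st n s) -> exists t z, s <= t /\ lim_at n i t z.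
Proof.
move: {2}(lv (st n s) i) (leqnn (lv (st n s) i)) => L.
elim: L s => [|L IH] s hL hi.
  exists s, (nth z0 (st n s) i); split=> // t; elim: t => [|t IHt].
    by rewrite leqn0 => /eqP <-.
  rewrite leq_eqVlt => /orP [/eqP <- //|/IHt [h1 h2]].
  have [h3 /(_ i h1) [[h4 h5] _]] := st_step n t; split; first exact: leq_trans h1 h3.
  rewrite h5 //; move: hL h4; rewrite /lv -h2; lia.
case: (pselect (exists t, s <= t /\ lv (st n t) i <= L)) => [[t [h1 h2]]|hn].
  have [|u [z [h3 h4]]] := IH t h2; first exact: leq_trans hi (st_size n h1).
  by exists u, z; split=> //; apply: leq_trans h1 h3.
exists s, (nth z0 (st n s) i); split=> // t; elim: t => [|t IHt].
  by rewrite leqn0 => /eqP <-.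
rewrite leq_eqVlt => /orP [/eqP <- //|hst]; have [h1 h2] := IHt hst.
have [h3 /(_ i h1) [[h4 h5] _]] := st_step n t; split; first exact: leq_trans h1 h3.
rewrite h5 //; apply/eqP; rewrite eqn_leq h4 /=.
have g1 : ~ lv (st n t.+1) i <= L by move=> h; apply: hn; exists t.+1; split=> //; lia.
have g2 : ~ lv (st n s) i <= L by move=> h; apply: hn; exists s.
by move: h2 hL; rewrite /lv => ->; rewrite /lv in g1 g2; lia.
Qed.

Lemma enc_pair_ge {A B} {cA : cod A} {cB : cod B} (a : A) (b : B) : enc b <= enc (a, b).
Proof.
have : (enc (a, b)).+1 = 2 ^ enc a * (enc b).*2.+1 by rewrite -npairE.
have : 0 < 2 ^ enc a by rewrite expn_gt0.
by rewrite -addnn; nia.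
Qed.

Lemma st_new n (z : entry) s0 : Q z.1.2 z.1.1 z.2 -> exists s, s0 <= s /\ exists i, i < size (st n s.+1) /\
  nth z0 (st n s.+1) i = z.
Proof.
move=> hz; exists (enc (z, s0)); split; first exact: enc_pair_ge.
case: (stS n (enc (z, s0))) => [[/(_ (@st_good n _)) //]|[g1 [ha _]]].
rewrite /append newentE in ha; case: ha => [[_ ->]|[/(_ hz) //]].
by exists (size g1); rewrite size_rcons nth_rcons ltnn eqxx.
Qed.

Lemma st_inf n i : exists s, i < size (st n s).
Proof.
have [x [_ [m hm]]] : exists x, nu x = 1%R /\ exists m, Q 0 x m.
  by apply/FsP; case: (hFs 0) => -[].
elim: i => [|i [s hs]].
  have [s [_ [i [hi _]]]] := @st_new n (x, 0, m) 0 hm; exists s.+1; exact: leq_ltn_trans hi.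
have [s1 es1] : exists s1, s1 = enc (((x, 0, m) : entry), s) by exists (enc (((x, 0, m) : entry), s)).
exists s1.+1.
case: (stS n s1) => [[/(_ (@st_good n _)) //]|[g1 [ha hg]]].
have szg1 : size g1 = size (st n s1) by case: hg => [[_ ->]|[k [_ [[h _] _]]]].
have e1 : newent s1 = (x, 0, m) by rewrite es1 newentE.
have {}ha : append s1 g1 (st n s1.+1) := ha.
rewrite /append e1 in ha; case: ha => [[_ ->]|[/(_ hm) //]].
rewrite size_rcons szg1 ltnS; apply: leq_trans hs _; apply: st_size; rewrite es1; exact: enc_pair_ge.
Qed.

Lemma lim_ex n i : exists z, exists s, lim_at n i s z.
Proof. by have [s hs] := st_inf n i; have [t [z [_ h]]] := st_lim hs; exists z, t. Qed.

Definition limz n i := sval (cid (lim_ex n i)).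
Lemma limP n i : exists s, lim_at n i s (limz n i).
Proof. exact: (svalP (cid (lim_ex n i))). Qed.
Definition nuB n i := nu (limz n i).1.1.

Definition Bset n r := exists k, (forall j, j < k -> T n j) /\ Fs k r.

Lemma Bset_racl n : racl (Bset n).
Proof.
have mono k1 k2 : (forall j, j < k1 -> T n j) -> (forall j, j < k2 -> T n j) ->
    (forall j, j < maxn k1 k2 -> T n j).
  by move=> h1 h2 j; rewrite leq_max => /orP [/h1|/h2].
have up k1 k2 x : Fs k1 x -> Fs (maxn k1 k2) x by apply: Fs_leq; rewrite leq_maxl.
have up' k1 k2 x : Fs k2 x -> Fs (maxn k1 k2) x by apply: Fs_leq; rewrite leq_maxr.
split; first split.
- by exists 0; split=> //; case: (hFs 0) => -[].
- move=> x y [k1 [h1 hx]] [k2 [h2 hy]]; exists (maxn k1 k2); split; first exact: mono.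
  by case: (hFs (maxn k1 k2)) => -[_ hB _ _] _; apply: hB; [apply: up | apply: up'].
- move=> x y [k1 [h1 hx]] [k2 [h2 hy]]; exists (maxn k1 k2); split; first exact: mono.
  by case: (hFs (maxn k1 k2)) => -[_ _ hM _] _; apply: hM; [apply: up | apply: up'].
- by move=> x [k [h1 hx]]; exists k; split=> //; case: (hFs k) => -[_ _ _ hV] _; apply: hV.
move=> p hp pn x rx.
have [k [hk Hk]] : exists k, (forall j, j < k -> T n j) /\ forall i, i < size p -> Fs k (p`_i)%R.
  elim: (size p) => [|m [k [hk Hk]]]; first by exists 0.
  have [k' [hk' Hk']] := hp m; exists (maxn k k'); split; first exact: mono.
  by move=> i; rewrite ltnS leq_eqVlt => /orP [/eqP ->|/Hk]; [apply: up' | apply: up].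
exists k; split=> //; case: (hFs k) => -[h1 hB hM hV] /(_ p); apply=> // i.
by case: (ltnP i (size p)) => [/Hk //|hi]; rewrite nth_default // -(subrr 1%R); apply: hB.
Qed.

(** If [T n j] holds for all [j < k], an entry of level [k] offered after the last event below [k]
    is never moved. Conversely, if [T n j] fails, events of [j] recur and bring every level down to
    at most [j], so no limit level exceeds such a [j]. *)
Lemma nuB_image n r : Bset n r <-> exists i, nuB n i = r.
Proof.
split=> [[k [hk /FsP [x [<- [m hm]]]]]|[i <-]].
  have [s0 hs0] : exists s0, forall j, j < k -> forall t, s0 <= t -> ~ event n j t.
    elim: k hk {hm} => [|k IH] hk; first by exists 0.
    have [s1 h1] : exists s1, forall j, j < k -> forall t, s1 <= t -> ~ event n j t.
      by apply: IH => j hj; apply: hk; apply: ltnW.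
    have [s2 h2] := (eventP n k).1 (hk k (ltnSn k)); exists (maxn s1 s2) => j.
    rewrite ltnS leq_eqVlt => /orP [/eqP ->|hj] t; rewrite geq_max => /andP [t1 t2]; [exact: h2 | exact: h1].
  have [s [hs [i [hi ei]]]] := @st_new n (x, k, m) s0 hm.
  have H t : s.+1 <= t -> i < size (st n t) /\ nth z0 (st n t) i = (x, k, m).
    elim: t => // t IH; rewrite leq_eqVlt => /orP [/eqP <- //|ht].
    have [h1 h2] := IH ht; have [h3 /(_ i h1) [_ [_ h4]]] := st_step n t.
    split; first exact: leq_trans h1 h3.
    rewrite h4 // => k' ek'; rewrite /lv h2 /= leqNgt; apply/negP => /hs0 /(_ t) h; apply: h ek'.
    by apply: leq_trans hs _; apply: ltnW.
  have [s2 h2] := limP n i; exists i; rewrite /nuB.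
  have [_ e1] := h2 (maxn s2 s.+1) (leq_maxl _ _); have [_ e2] := H (maxn s2 s.+1) (leq_maxr _ _).
  by rewrite -e1 e2.
have [s hs] := limP n i; set z := limz n i in hs *.
have hz : Q z.1.2 z.1.1 z.2.
  by have [h1 <-] := hs s (leqnn s); apply: (st_good (n := n)).
exists z.1.2; split; last by apply/FsP; exists z.1.1; split=> //; exists z.2.
case: (pselect (exists j, j < z.1.2 /\ ~ T n j)) => [[j [hj nT]]|hn]; last first.
  by move=> j hj; apply: contrapT => nT; apply: hn; exists j.
exfalso; have [t [ht et]] : exists t, maxn s j <= t /\ event n j t.
  apply: contrapT => h; apply: nT; apply/eventP; exists (maxn s j) => t ht et; apply: h; by exists t.
move: ht; rewrite geq_max => /andP [t1 t2]; have [h1 h2] := hs t t1.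
have [_ /(_ i h1) [_ [/(_ j et t2)]]] := st_step n t.
by rewrite /lv; have [_ ->] := hs t.+1 (leq_trans t1 (leqnSn _)); rewrite leqNgt hj.
Qed.

Lemma same_lim n s i j l : i < size (st n s) -> j < size (st n s) -> l < size (st n s) ->
  [/\ (addV (ename (st n s) i) (ename (st n s) j) (ename (st n s) l) <-> (nuB n i + nuB n j = nuB n l)%R),
      (mulV (ename (st n s) i) (ename (st n s) j) (ename (st n s) l) <-> (nuB n i * nuB n j = nuB n l)%R) &
      (ltV (ename (st n s) i) (ename (st n s) j) <-> (nuB n i < nuB n j)%R)].
Proof.
move=> hi hj hl.
have H t : s <= t -> same (st n s) (st n t).
  elim: t => [|t IH]; first by rewrite leqn0 => /eqP ->.
  rewrite leq_eqVlt => /orP [/eqP -> //|ht] a ha b hb c hc.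
  have sz := st_size n (ht : s <= t); have := IH ht a ha b hb c hc.
  have := @st_same n t a (leq_trans ha sz) b (leq_trans hb sz) c (leq_trans hc sz).
  by move=> [-> [-> ->]].
have [s1 h1] := limP n i; have [s2 h2] := limP n j; have [s3 h3] := limP n l.
pose t := maxn s (maxn s1 (maxn s2 s3)).
have [[_ e1] [_ e2]] := (h1 t ltac:(lia), h2 t ltac:(lia)); have [_ e3] := h3 t ltac:(lia).
have [g1 [g2 g3]] := H t ltac:(lia) i hi j hj l hl.
by split; rewrite ?g1 ?g2 ?g3 /addV /mulV /ltV /ename e1 e2 ?e3.
Qed.

(** The limits need not be computable, but relations among entries never change once the entries are
    present. A relation among limits can thus be read at any such stage, which makes it
    enumerable. *)
Theorem chain : exists2 f, computable_fun f & forall n, idxS (Bset n) (f n).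
Proof.
have hst := comp_st.
apply: (index_of_numbering (nu := nuB)).
- by move=> n; case: (Bset_racl n).
- exact: nuB_image.
- have : RE (fun y : nat * nat * nat * nat => exists s,
     ((is_true (y.1.1.2 < size (st y.1.1.1 s)) /\ is_true (y.1.2 < size (st y.1.1.1 s))) /\
      is_true (y.2 < size (st y.1.1.1 s))) /\
     addV (ename (st y.1.1.1 s) y.1.1.2) (ename (st y.1.1.1 s) y.1.2) (ename (st y.1.1.1 s) y.2)).
    by rewrite /ename; ctac.
  apply: RE_ext => -[[[n i] j] l] /=; split=> [[s [[[h1 h2] h3] h]]|h].
    by have [h4 _ _] := same_lim h1 h2 h3; apply/h4.
  have [s hs] := st_inf n (maxn i (maxn j l)); exists s.
  have [h1 [h2 h3]] : i < size (st n s) /\ j < size (st n s) /\ l < size (st n s) by lia.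
  by split=> //; have [h4 _ _] := same_lim h1 h2 h3; apply/h4.
- have : RE (fun y : nat * nat * nat * nat => exists s,
     ((is_true (y.1.1.2 < size (st y.1.1.1 s)) /\ is_true (y.1.2 < size (st y.1.1.1 s))) /\
      is_true (y.2 < size (st y.1.1.1 s))) /\
     mulV (ename (st y.1.1.1 s) y.1.1.2) (ename (st y.1.1.1 s) y.1.2) (ename (st y.1.1.1 s) y.2)).
    by rewrite /ename; ctac.
  apply: RE_ext => -[[[n i] j] l] /=; split=> [[s [[[h1 h2] h3] h]]|h].
    by have [_ h4 _] := same_lim h1 h2 h3; apply/h4.
  have [s hs] := st_inf n (maxn i (maxn j l)); exists s.
  have [h1 [h2 h3]] : i < size (st n s) /\ j < size (st n s) /\ l < size (st n s) by lia.
  by split=> //; have [_ h4 _] := same_lim h1 h2 h3; apply/h4.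
- have : RE (fun y : nat * nat * nat => exists s,
     (is_true (y.1.2 < size (st y.1.1 s)) /\ is_true (y.2 < size (st y.1.1 s))) /\
     ltV (ename (st y.1.1 s) y.1.2) (ename (st y.1.1 s) y.2)).
    by rewrite /ename; ctac.
  apply: RE_ext => -[[n i] j] /=; split=> [[s [[h1 h2] h]]|h].
    by have [_ _ h4] := same_lim h1 h2 h1; apply/h4.
  have [s hs] := st_inf n (maxn i j); exists s.
  have [h1 h2] : i < size (st n s) /\ j < size (st n s) by lia.
  by split=> //; have [_ _ h4] := same_lim h1 h2 h1; apply/h4.
Qed.

End Chain.

(** * A proper computable extension *)

Local Open Scope ring_scope.
Record numbered (S : RR -> Prop) (nu : nat -> RR) : Prop := Numbered {
  nb_racl : racl S;
  nb_im : forall r, S r <-> exists x, nu x = r;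
  nb_add : decid (fun y : nat * nat * nat => addV nu y.1.1 y.1.2 y.2);
  nb_mul : decid (fun y : nat * nat * nat => mulV nu y.1.1 y.1.2 y.2);
  nb_lt : decid (fun y : nat * nat => ltV nu y.1 y.2) }.

Section RaclTheory.
Variables (S : RR -> Prop) (hS : racl S).
Lemma racl1 : S 1. Proof. by case: hS => -[]. Qed.
Lemma raclB x y : S x -> S y -> S (x - y). Proof. by case: hS => -[] _ h _ _ _; apply: h. Qed.
Lemma raclM x y : S x -> S y -> S (x * y). Proof. by case: hS => -[] _ _ h _ _; apply: h. Qed.
Lemma raclV x : S x -> S x^-1. Proof. by case: hS => -[] _ _ _ h _; apply: h. Qed.
Lemma racl0 : S 0. Proof. by rewrite -(subrr 1); apply: raclB; apply: racl1. Qed.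
Lemma raclN x : S x -> S (- x). Proof. by rewrite -sub0r; apply: raclB; apply: racl0. Qed.
Lemma raclD x y : S x -> S y -> S (x + y).
Proof. by move=> hx hy; rewrite -[y]opprK; apply: raclB => //; apply: raclN. Qed.
End RaclTheory.

(* A real outside [S]: nested intervals with endpoints in [S] avoiding all elements of [S]. *)
Section Outside.
Variables (S : RR -> Prop) (nu : nat -> RR) (hn : numbered S nu).

Lemma sadd_ex : exists2 f : nat * nat -> nat, computable f & forall x, nu (f x) = nu x.1 + nu x.2.
Proof.
have h := nb_add hn.
have [|[x y]|f hf h'] := RE_choice (P := fun (x : nat * nat) z => addV nu x.1 x.2 z); first by ctac.
  have [z hz] := (nb_im hn (nu x + nu y)).1 (raclD (nb_racl hn) (proj2 (nb_im hn _) (ex_intro _ x erefl)) (proj2 (nb_im hn _) (ex_intro _ y erefl))).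
  by exists z.
by exists f => // x; rewrite -h'.
Qed.

Lemma smul_ex : exists2 f : nat * nat -> nat, computable f & forall x, nu (f x) = nu x.1 * nu x.2.
Proof.
have h := nb_mul hn.
have [|[x y]|f hf h'] := RE_choice (P := fun (x : nat * nat) z => mulV nu x.1 x.2 z); first by ctac.
  have [z hz] := (nb_im hn (nu x * nu y)).1 (raclM (nb_racl hn) (proj2 (nb_im hn _) (ex_intro _ x erefl)) (proj2 (nb_im hn _) (ex_intro _ y erefl))).
  by exists z.
by exists f => // x; rewrite -h'.
Qed.

Definition sadd x y := s2val (cid2 sadd_ex) (x, y).
Definition smul x y := s2val (cid2 smul_ex) (x, y).
Lemma saddE x y : nu (sadd x y) = nu x + nu y.
Proof. exact: (s2valP' (cid2 sadd_ex)). Qed.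
Lemma smulE x y : nu (smul x y) = nu x * nu y.
Proof. exact: (s2valP' (cid2 smul_ex)). Qed.
Lemma comp_sadd : computable (fun y : nat * nat => sadd y.1 y.2).
Proof. by apply: comp_ext (s2valP (cid2 sadd_ex)) => -[]. Qed.
Lemma comp_smul : computable (fun y : nat * nat => smul y.1 y.2).
Proof. by apply: comp_ext (s2valP (cid2 smul_ex)) => -[]. Qed.

Lemma rname_ex (q : rat) : exists x, nu x = ratr q.
Proof. by apply/(nb_im hn); apply: E_rat (nb_racl hn) _. Qed.
Definition rname q := sval (cid (rname_ex q)).
Lemma rnameE q : nu (rname q) = ratr q.
Proof. exact: (svalP (cid (rname_ex q))). Qed.

Lemma nu_dense x eps : 0 < eps -> exists y, `|nu y - x| < eps.
Proof.
by move=> /(E_dense (nb_racl hn) x) [y /(nb_im hn) [z <-] h]; exists z.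
Qed.

Lemma nu_between (a b : RR) : a < b -> exists y, a < nu y < b.
Proof.
move=> ab; have [|y] := @nu_dense ((a + b) / 2) ((b - a) / 2); first by lra.
by rewrite ltr_norml => /andP [h1 h2]; exists y; apply/andP; split; lra.
Qed.

(** The inequality with [sadd] says, without subtraction or division, that the new interval is less
    than half as long as the old one. The first alternative makes the search total. *)
Definition shrink (x : nat * nat * nat) (y : nat * nat) :=
  ~ ltV nu x.1.1 x.1.2 \/ ((ltV nu x.1.1 y.1 /\ ltV nu y.1 y.2) /\ ltV nu y.2 x.1.2) /\
  (ltV nu (sadd (sadd y.2 y.2) x.1.1) (sadd (sadd y.1 y.1) x.1.2) /\
   (ltV nu x.2 y.1 \/ ltV nu y.2 x.2)).

Lemma shrink_ex : exists2 f, computable f & forall x, shrink x (f x).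
Proof.
have h1 := comp_sadd; have h2 := nb_lt hn.
apply: RE_choice; first by rewrite /shrink; ctac.
move=> [[u v] k]; rewrite /shrink /ltV /=.
case: (ltP (nu u) (nu v)) => uv; last by exists (0, 0)%N; left.
pose m := (nu u + nu v) / 2.
(* The new interval is taken strictly on the side of the midpoint that avoids [nu k]. *)
case: (leP (nu k) m) => hk.
  have [a /andP [a1 a2]] : exists y, m < nu y < nu v by apply: nu_between; rewrite /m; lra.
  have [b /andP [b1 b2]] := nu_between a2.
  exists (a, b); right=> /=; rewrite /m in a1 hk *; rewrite !saddE; split; first by split; [split; lra | lra].
  by split; [lra | left; lra].
have [b /andP [b1 b2]] : exists y, nu u < nu y < m by apply: nu_between; rewrite /m; lra.
have [a /andP [a1 a2]] := nu_between b1.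
exists (a, b); right=> /=; rewrite /m in b2 hk *; rewrite !saddE; split; first by split; [split; lra | lra].
by split; [lra | right; lra].
Qed.

Definition shr := s2val (cid2 shrink_ex).
Definition itv k := iteri k (fun k p => shr (p, k)) (rname 0, rname 1).
Lemma comp_itv : computable itv.
Proof. by have h : computable shr := s2valP (cid2 shrink_ex); rewrite /itv; ctac. Qed.

Lemma itv_lt k : nu (itv k).1 < nu (itv k).2.
Proof.
elim: k => [|k IH]; first by rewrite /= !rnameE rmorph0 rmorph1 ltr01.
have := s2valP' (cid2 shrink_ex) (itv k, k); rewrite -/shr -[shr _]/(itv k.+1) /shrink /ltV.
by case=> [/(_ IH) //|[[[]]]].
Qed.

Lemma itvS k : [/\ nu (itv k).1 < nu (itv k.+1).1, nu (itv k.+1).2 < nu (itv k).2,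
  (nu (itv k.+1).2 - nu (itv k.+1).1) * 2 < nu (itv k).2 - nu (itv k).1 &
  nu k < nu (itv k.+1).1 \/ nu (itv k.+1).2 < nu k].
Proof.
have := s2valP' (cid2 shrink_ex) (itv k, k); rewrite -/shr -[shr _]/(itv k.+1) /shrink /ltV.
set p := itv k.+1; rewrite /= !saddE.
case=> [/(_ (itv_lt k)) //|[[[h1 h2] h3] [h4 h5]]]; split=> //; lra.
Qed.

Lemma itv_mono k m : (k <= m)%N -> nu (itv k).1 <= nu (itv m).1 /\ nu (itv m).2 <= nu (itv k).2.
Proof.
elim: m => [|m IH]; first by rewrite leqn0 => /eqP ->.
rewrite leq_eqVlt => /orP [/eqP -> //|/IH [h1 h2]].
by have [h3 h4 _ _] := itvS m; split; lra.
Qed.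

Definition tau : RR := sup [set r | exists k, r = nu (itv k).1].

Lemma tau_itv k : nu (itv k).1 < tau < nu (itv k).2.
Proof.
have ub m : ubound [set r | exists k, r = nu (itv k).1] (nu (itv m).2).
  move=> _ [j ->]; have [h1 _] := itv_mono (leq_maxl j m); have [_ h2] := itv_mono (leq_maxr j m).
  by have := itv_lt (maxn j m); lra.
have ne : nonempty [set r | exists k, r = nu (itv k).1] by exists (nu (itv 0).1); exists 0%N.
have [h1 h2 _ _] := itvS k; apply/andP; split.
  apply: lt_le_trans h1 _; apply: ub_le_sup; first by exists (nu (itv 0).2).
  by exists k.+1.
by apply: le_lt_trans h2; apply: ge_sup.
Qed.

Lemma tau_notin : ~ S tau.
Proof.
move=> /(nb_im hn) [k hk]; have [_ _ _] := itvS k; rewrite hk.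
by have /andP [h1 h2] := tau_itv k.+1; case; lra.
Qed.

Lemma itv_width eps : 0 < eps -> exists k, nu (itv k).2 - nu (itv k).1 < eps.
Proof.
move=> e0; have H k : (nu (itv k).2 - nu (itv k).1) * k.+1%:R <= 1.
  elim: k => [|k IH]; first by rewrite /= !rnameE rmorph0 rmorph1 subr0 mul1r.
  have [_ _ h _] := itvS k; have l := itv_lt k.+1.
  have : k.+2%:R <= k.+1%:R * 2 :> RR by rewrite -natrM ler_nat; lia.
  have : 0 <= k.+1%:R :> RR by [].
  set w := (nu (itv k.+1).2 - nu (itv k.+1).1) in h *; have w0 : 0 < w by rewrite /w; lra.
  set w' := nu (itv k).2 - _ in h IH *; set a := k.+1%:R in IH *; set b := k.+2%:R; nra.
have [n hn'] := RR_arch eps^-1; exists n.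
have n0 : 0 < n.+1%:R :> RR by rewrite ltr0n.
rewrite -(ltr_pM2r n0); apply: le_lt_trans (H n) _.
rewrite -ltr_pdivrMl // mulr1; apply: le_lt_trans hn' _; by rewrite ltr_nat.
Qed.

Lemma tau_ltP u : nu u < tau <-> exists k, ltV nu u (itv k).1.
Proof.
split=> [h|[k hk]]; last by have /andP [h1 _] := tau_itv k; apply: lt_trans hk h1.
have [|k hk] := @itv_width (tau - nu u); first by lra.
by exists k; rewrite /ltV; have /andP [h1 h2] := tau_itv k; lra.
Qed.

Lemma tau_gtP u : tau < nu u <-> exists k, ltV nu (itv k).2 u.
Proof.
split=> [h|[k hk]]; last by have /andP [_ h1] := tau_itv k; apply: lt_trans h1 hk.
have [|k hk] := @itv_width (nu u - tau); first by lra.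
by exists k; rewrite /ltV; have /andP [h1 h2] := tau_itv k; lra.
Qed.

End Outside.
#[export] Hint Resolve comp_sadd comp_smul comp_itv : comp.

(* Names of reals *)
Local Close Scope ring_scope.
(* [NS 0] names the new real, [NS s.+1] the element of [S] with name [s]; [NF l] names the fixed
   point in [-1, 1] of the polynomial whose coefficients are listed by [l], a list being built
   with [NC] and ended by any other constructor. *)
Inductive nm := NS of nat | NA of nm & nm | NM of nm & nm | NF of nm | NC of nm & nm.

(** The remainder modulo 5 tells the constructors apart; since pairing is a bijection, so is this
    coding. The first argument of the decoder [nmd] is fuel. *)
Fixpoint nme (i : nm) : nat := match i with
  | NS n => n * 5 | NA i j => npair (nme i) (nme j) * 5 + 1 | NM i j => npair (nme i) (nme j) * 5 + 2
  | NF i => nme i * 5 + 3 | NC i j => npair (nme i) (nme j) * 5 + 4 end.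
Fixpoint nmd (f n : nat) : nm := if f is f'.+1 then
  let q := n %/ 5 in
  match n %% 5 with
  | 0 => NS q | 1 => NA (nmd f' (np1 q)) (nmd f' (np2 q)) | 2 => NM (nmd f' (np1 q)) (nmd f' (np2 q))
  | 3 => NF (nmd f' q) | _ => NC (nmd f' (np1 q)) (nmd f' (np2 q)) end
  else NS 0.

Lemma npair_ge x y : x <= npair x y /\ y <= npair x y.
Proof.
have := npairE x y; have := ltn_expl x (ltnSn 1); have : 0 < 2 ^ x by rewrite expn_gt0.
by rewrite -addnn; nia.
Qed.

Lemma nmdK f i : nme i < f -> nmd f (nme i) = i.
Proof.
elim: f i => // f IH [n|i j|i j|i|i j]; rewrite /= ?mulnK // ?modnMl //;
  try rewrite modnMDl divnMDl //= addn0 => h.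
- by have [h1 h2] := npair_ge (nme i) (nme j); rewrite npairK1 npairK2 !IH //; lia.
- by have [h1 h2] := npair_ge (nme i) (nme j); rewrite npairK1 npairK2 !IH //; lia.
- by rewrite IH //; lia.
- by have [h1 h2] := npair_ge (nme i) (nme j); rewrite npairK1 npairK2 !IH //; lia.
Qed.

Lemma nmeK f n : n < f -> nme (nmd f n) = n.
Proof.
elim: f n => // f IH n hn /=; have e := divn_eq n 5; have := ltn_pmod n (isT : 0 < 5).
have [h1 h2] : np1 (n %/ 5) <= n %/ 5 /\ np2 (n %/ 5) <= n %/ 5.
  by have [] := npair_ge (np1 (n %/ 5)) (np2 (n %/ 5)); rewrite npK.
by case: (n %% 5) e => [|[|[|[|[|]]]]] //= e _; rewrite ?IH ?npK //; lia.
Qed.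

Lemma nm_encK : cancel nme (fun n => nmd n.+1 n).
Proof. by move=> i; apply: nmdK. Qed.
Lemma nm_decK : cancel (fun n => nmd n.+1 n) nme.
Proof. by move=> n; apply: nmeK. Qed.
#[export] Instance cod_nm : cod nm := Cod nm_encK nm_decK.

Lemma comp_NS : computable NS.
Proof. by apply: lcomp_ext (lcomp_mul (lcomp_proj 1 0) (lcomp_const 1 5)) => l _. Qed.
Lemma comp_NF : computable NF.
Proof.
apply: lcomp_ext (lcomp_add (lcomp_mul (lcomp_proj 1 0) (lcomp_const 1 5)) (lcomp_const 1 3)) => l _.
by rewrite -{1}(decK (nth 0 l 0)).
Qed.

Lemma comp_nm2 (C : nm -> nm -> nm) k : (forall i j, nme (C i j) = npair (nme i) (nme j) * 5 + k) ->
  computable (fun y : nm * nm => C y.1 y.2).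
Proof.
move=> h; apply: lcomp_ext (lcomp_add (lcomp_mul (lcomp_proj 1 0) (lcomp_const 1 5)) (lcomp_const 1 k)) => l _.
rewrite [RHS]h; congr (_ * 5 + k); exact: (esym (@decK (nm * nm) _ (nth 0 l 0))).
Qed.
Lemma comp_NA : computable (fun y : nm * nm => NA y.1 y.2). Proof. exact: (comp_nm2 (k := 1)). Qed.
Lemma comp_NM : computable (fun y : nm * nm => NM y.1 y.2). Proof. exact: (comp_nm2 (k := 2)). Qed.
Lemma comp_NC : computable (fun y : nm * nm => NC y.1 y.2). Proof. exact: (comp_nm2 (k := 4)). Qed.
#[export] Hint Resolve comp_NS comp_NF comp_NA comp_NM comp_NC : comp.

(** * Fixed points of contracting polynomials *)

Local Open Scope ring_scope.

(** The bound for degree [i] is [e / 8 ^ i]. For [e = 1 / 8] the polynomial maps [-1, 1] into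
    [-1 / 4, 1 / 4] and contracts by a factor 1 / 4, by [smalls_bound]. *)
Fixpoint smalls (s : seq RR) (e : RR) : Prop := if s is a :: s' then `|a| <= e /\ smalls s' (e / 8) else True.

Lemma smalls_bound s e z w : 0 <= e -> smalls s e -> `|z| <= 1 -> `|w| <= 1 ->
  `|horner_rec s z| <= 2 * e /\ `|horner_rec s z - horner_rec s w| <= 2 * e * `|z - w|.
Proof.
move=> e0 hs hz hw; elim: s e e0 hs => [|a s IH] e e0 /=.
  by rewrite subrr normr0; split; rewrite ?mulr_ge0.
move=> [ha hs]; have [|h1 h2] := IH _ _ hs; first by lra.
set p := horner_rec s z in h1 h2 *; set q := horner_rec s w in h2 *.
split.
  apply: le_trans (ler_normD _ _) _; rewrite normrM.
  have : `|p| * `|z| <= 2 * (e / 8) * 1 by apply: ler_pM.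
  lra.
have -> : p * z + a - (q * w + a) = p * (z - w) + (p - q) * w by ring.
apply: le_trans (ler_normD _ _) _; rewrite !normrM.
have t1 : `|p| * `|z - w| <= 2 * (e / 8) * `|z - w| by apply: ler_wpM2r.
have t2 : `|p - q| * `|w| <= 2 * (e / 8) * `|z - w| * 1 by apply: ler_pM.
have : 0 <= e * `|z - w| by apply: mulr_ge0.
lra.
Qed.

(** Existence comes from the intermediate value theorem; contraction serves for uniqueness, in
    [fixp_uniq]. Lists with large coefficients receive a junk value. *)
Lemma fixp_ex s : exists z : RR, smalls s (1 / 8) -> `|z| <= 1 /\ z = horner_rec s z.
Proof.
case: (pselect (smalls s (1 / 8))) => hs; last by exists 0.
have e0 : 0 <= 1 / 8 :> RR by lra.
have [||z /andP [z1 z2] rz] := @poly_ivt RR ('X - Poly s) (-1) 1; first by lra.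
  have n1 : `|-1 : RR| <= 1 by rewrite normrN normr1.
  have n2 : `|1 : RR| <= 1 by rewrite normr1.
  have [h1 _] := smalls_bound e0 hs n1 n1; have [h2 _] := smalls_bound e0 hs n2 n2.
  rewrite !hornerE !horner_Poly; move: h1 h2; rewrite !ler_norml => /andP [h1 h2] /andP [h3 h4].
  by apply/andP; split; lra.
exists z => _; split; first by rewrite ler_norml z1 z2.
by apply/eqP; move: rz; rewrite rootE !hornerE horner_Poly subr_eq0.
Qed.

Definition fixp s := sval (cid (fixp_ex s)).
Lemma fixpP s : smalls s (1 / 8) -> `|fixp s| <= 1 /\ fixp s = horner_rec s (fixp s).
Proof. exact: (svalP (cid (fixp_ex s))). Qed.

Lemma fixp_uniq s z : smalls s (1 / 8) -> `|z| <= 1 -> z = horner_rec s z -> z = fixp s.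
Proof.
move=> hs hz ez; have [hf ef] := fixpP hs; have e0 : 0 <= 1 / 8 :> RR by lra.
have [_] := smalls_bound e0 hs hz hf; rewrite -ez -ef => h.
have : `|z - fixp s| = 0 by have := normr_ge0 (z - fixp s); lra.
by move/eqP; rewrite normr_eq0 subr_eq0 => /eqP.
Qed.

Fixpoint hn_name (z0 : nm) (l z : nm) : nm :=
  if l is NC a l' then NA (NM (hn_name z0 l' z) z) a else z0.

(** Recursion on names is made computable through its graph, which is generated by axioms and one
    rule. *)
Lemma comp_hn z0 : computable (fun y : nm * nm => hn_name z0 y.1 y.2).
Proof.
apply: comp_of_graph.
pose ax (_ : nat) (j : nm * nm * nm) := j.2 = z0 /\
  ((exists n, j.1.1 = NS n) \/ (exists a, exists b, j.1.1 = NA a b \/ j.1.1 = NM a b) \/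
   exists a, j.1.1 = NF a).
pose r (_ : nat) (j a b : nm * nm * nm) := exists c, j.1.1 = NC c a.1.1 /\ j.1.2 = a.1.2 /\
   j.2 = NA (NM a.2 a.1.2) c.
have h : RE (fun y : nat * (nm * nm * nm) => clos (ax y.1) (r y.1) y.2).
  by apply: RE_clos; rewrite /ax /r; ctac.
have : RE (fun y : nm * nm * nm => clos (ax 0%N) (r 0%N) y).
  by apply: (RE_app1 (f := fun y : nm * nm * nm => (0%N, y)) h); ctac.
apply: RE_ext => j; split.
  elim=> {j} [j [e h']|j a b [c [e1 [e2 e3]]] _ IH _ _].
    by rewrite e; case: h' => [[n ->]|[[a [b [->|->]]]|[a ->]]].
  by rewrite e3 e1 e2 IH.
case: j => [[l z] w] /= ->; elim: l => [n|a _ b _|a _ b _|a _|a _ b IH] /=.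
- by apply: clos_ax; split=> //; left; exists n.
- by apply: clos_ax; split=> //; right; left; exists a, b; left.
- by apply: clos_ax; split=> //; right; left; exists a, b; right.
- by apply: clos_ax; split=> //; right; right; exists a.
- by apply: (clos_r _ IH IH); exists a.
Qed.

(** * Interval approximation of names *)

Section Approx.
Variables (S : RR -> Prop) (nu : nat -> RR) (hn : numbered S nu).
Notation sadd := (sadd hn).
Notation smul := (smul hn).
Notation rname := (rname hn).
Notation itv := (itv hn).
Notation tau := (tau hn).
Notation lt' := (ltV nu).

Definition zS := NS (rname 0).+1.
Definition q8 := rname (1 / 8).
Definition m1 := rname (- 1).

Lemma nu_q8 : nu q8 = 1 / 8.
Proof. by rewrite rnameE rmorphM rmorph1 fmorphV rmorph_nat. Qed.
Lemma nu_m1 : nu m1 = - 1.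
Proof. by rewrite rnameE rmorphN rmorph1. Qed.

(** The value of a name and the coefficients it lists are computed together, because the value of
    [NF l] depends on the coefficients listed by [l]. *)
Fixpoint pv (i : nm) : RR * seq RR := match i with
  | NS n => (if n is s.+1 then nu s else tau, [::])
  | NA i j => ((pv i).1 + (pv j).1, [::])
  | NM i j => ((pv i).1 * (pv j).1, [::])
  | NF l => (fixp (pv l).2, [::])
  | NC c l => (0, (pv c).1 :: (pv l).2) end.
Definition nval i := (pv i).1.
Definition pl i := (pv i).2.
Definition hnm l z := hn_name zS l z.

Lemma nval_hn l z : nval (hnm l z) = horner_rec (pl l) (nval z).
Proof.
by elim: l => [n|a _ b _|a _ b _|a _|a _ b IH]; rewrite /nval /= ?rnameE ?rmorph0 // -IH.
Qed.

Lemma comp_hnm : computable (fun y : nm * nm => hnm y.1 y.2).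
Proof. exact: comp_hn. Qed.

(* Judgements: (0, i, u, v) for [nu u < nval i < nu v], and (1, l, e, 0) for the smallness of the
   coefficients listed by [l] with respect to [nu e]. *)
Definition aj := (nat * nm * nat * nat)%type.
Definition aax (j : aj) :=
  (exists s, exists u, exists v, (lt' u s /\ lt' s v) /\ j = (0, NS s.+1, u, v)%N) \/
  (exists k, exists u, exists v, (lt' u (itv k).1 /\ lt' (itv k).2 v) /\ j = (0, NS 0, u, v)%N) \/
  (exists n, exists e, j = (1, NS n, e, 0)%N).
(** Interval arithmetic with endpoints in [S]. For a product, the new endpoints lie strictly outside
    the four products of endpoints. A fixed point starts from [-1, 1] and is refined by evaluating
    its own polynomial on the bounds obtained so far. The second clause is weakening. *)
Definition arule (j a b : aj) :=
  (exists i, exists i', exists u, exists u', exists v, exists v',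
    (a = (0, i, u, v) /\ b = (0, i', u', v'))%N /\
    (j = (0, NA i i', sadd u u', sadd v v')%N \/ exists w, exists w',
      (((lt' w (smul u u') /\ lt' w (smul u v')) /\ (lt' w (smul v u') /\ lt' w (smul v v'))) /\
       ((lt' (smul u u') w' /\ lt' (smul u v') w') /\ (lt' (smul v u') w' /\ lt' (smul v v') w'))) /\
      j = (0, NM i i', w, w')%N)) \/
  (exists i, exists u, exists v, exists u', exists v', (~ lt' u u' /\ ~ lt' v' v) /\
    (a = (0, i, u, v) /\ j = (0, i, u', v'))%N) \/
  (exists c, exists l, exists e, (a = (0, c, smul m1 e, e) /\ b = (1, l, smul q8 e, 0))%N /\ j = (1, NC c l, e, 0)%N) \/
  (exists l, a = (1, l, q8, 0)%N /\ (j = (0, NF l, m1, rname 1)%N \/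
     exists u, exists v, b = (0, hnm l (NF l), u, v)%N /\ j = (0, NF l, u, v)%N)).

Definition appr i u v := clos aax arule (0, i, u, v)%N.
Definition sml l e := clos aax arule (1, l, e, 0)%N.
(** A fixed point is meaningful only if its coefficients are small, a condition that can be
    confirmed but not decided; hence a name counts as valid once some bound for it is derived. *)
Definition valid i := exists u, exists v, appr i u v.

Lemma RE_aj : RE (clos aax arule).
Proof.
have h1 := nb_lt hn; have h2 := comp_hnm; have h3 := comp_sadd hn; have h4 := comp_smul hn; have h5 := comp_itv hn.
have h : RE (fun y : nat * aj => clos aax arule y.2).
  by apply: (RE_clos (ax := fun=> aax) (r := fun=> arule)); [rewrite /aax | rewrite /arule]; ctac;
    apply: (comp_app (g := itv)); ctac.
by apply: (RE_app1 (f := fun j : aj => (0%N, j)) h); ctac.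
Qed.

Lemma RE_appr : RE (fun y : nm * nat * nat => appr y.1.1 y.1.2 y.2).
Proof. by apply: (RE_app1 (P := clos aax arule)); [exact: RE_aj | ctac]. Qed.

Lemma RE_sml : RE (fun y : nm * nat => sml y.1 y.2).
Proof. by apply: (RE_app1 (P := clos aax arule)); [exact: RE_aj | ctac]. Qed.

Lemma RE_valid : RE valid.
Proof. by have h := RE_appr; rewrite /valid; ctac. Qed.

(** A product is affine in each factor, so its extremes over a box are at the corners. *)
Lemma prod_bounds (p q u v x y w w' : RR) : p < x -> x < q -> u < y -> y < v ->
  w < p * u -> w < p * v -> w < q * u -> w < q * v ->
  p * u < w' -> p * v < w' -> q * u < w' -> q * v < w' -> w < x * y /\ x * y < w'.
Proof.
move=> h1 h2 h3 h4 a1 a2 a3 a4 b1 b2 b3 b4.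
have l z : u < z < v -> w < p * z /\ p * z < w' /\ w < q * z /\ q * z < w'.
  move=> /andP [z1 z2]; case: (leP 0 p) => hp; case: (leP 0 q) => hq; do ?split; nra.
have [c1 [c2 [c3 c4]]] := l y (introT andP (conj h3 h4)).
by case: (leP 0 y) => hy; split; nra.
Qed.

Definition asem (j : aj) := let: (t, i, u, v) := j in
  match t with 0%N => nu u < nval i /\ nval i < nu v | _ => smalls (pl i) (nu u) end.

Lemma small_fix l : smalls (pl l) (1 / 8) -> - 1 < nval (NF l) /\ nval (NF l) < 1.
Proof.
move=> h; have [h1 h2] := fixpP h; have e0 : 0 <= 1 / 8 :> RR by lra.
have [] := smalls_bound e0 h h1 h1; rewrite -h2 ler_norml => /andP [h3 h4] _.
by rewrite /nval /=; split; lra.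
Qed.

Lemma clos_asem j : clos aax arule j -> asem j.
Proof.
elim=> {j} [j|j a b h _ IHa _ IHb].
  case=> [[s [u [v [[h1 h2] ->]]]]|[[k [u [v [[h1 h2] ->]]]]|[n [e ->]]]] //.
  by split; [apply/(tau_ltP hn); exists k | apply/(tau_gtP hn); exists k].
case: h IHa IHb => [[i [i' [u [u' [v [v' [[-> ->] [->|[w [w' [H ->]]]]]]]]]]]|[|[|]]] /=.
- by move=> [h1 h2] [h3 h4]; rewrite !saddE /nval /=; split; apply: ltrD.
- move: H; rewrite /ltV !smulE => -[[[a1 a2] [a3 a4]] [[b1 b2] [b3 b4]]] [h1 h2] [h3 h4].
  exact: (prod_bounds h1 h2 h3 h4).
- move=> [i [u [v [u' [v' [[/negP h1 /negP h2] [-> ->]]]]]]] [h3 h4] _; rewrite -!leNgt in h1 h2.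
  by split; [apply: le_lt_trans h3 | apply: lt_le_trans h2].
- move=> [c [l [e [[-> ->] ->]]]] /=; rewrite !smulE nu_m1 nu_q8 mulN1r => -[h1 h2] h3; split.
    by rewrite ler_norml !ltW.
  by rewrite mulrC mul1r in h3.
- move=> [l [-> [->|[u [v [-> ->]]]]]] /=; rewrite nu_q8 => h.
    by move=> _; rewrite nu_m1 rnameE rmorph1; apply: small_fix.
  rewrite nval_hn; have [_ e] := fixpP h; by rewrite {1 2}/nval /= -/(pl l) -e.
Qed.

Lemma apprP i u v : appr i u v -> nu u < nval i /\ nval i < nu v.
Proof. exact: clos_asem. Qed.
Lemma smlP l e : sml l e -> smalls (pl l) (nu e).
Proof. exact: clos_asem. Qed.

(** Inversion of derivations: what a derived judgement tells about the components of its name.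
    Weakening makes this an induction instead of a case analysis. *)
Definition ainv (j : aj) := let: (t, i, u, v) := j in
  match t, i with
  | 0%N, NA a b | 0%N, NM a b => valid a /\ valid b
  | 0%N, NF l => sml l q8
  | 0%N, NC _ _ => False
  | 1%N, NC c l => appr c (smul m1 u) u /\ sml l (smul q8 u)
  | _, _ => True
  end.

Lemma clos_ainv j : clos aax arule j -> ainv j.
Proof.
elim=> {j} [j|j a b h ha IHa hb IHb].
  by case=> [[s [u [v [_ ->]]]]|[[k [u [v [_ ->]]]]|[n [e ->]]]].
case: h ha hb IHa IHb => [[i [i' [u [u' [v [v' [[-> ->] [->|[w [w' [H ->]]]]]]]]]]]|[|[|]]] /=.
- by move=> ha hb _ _; split; [exists u, v | exists u', v'].
- by move=> ha hb _ _; split; [exists u, v | exists u', v'].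
- by move=> [i [u [v [u' [v' [_ [-> ->]]]]]]].
- by move=> [c [l [e [[-> ->] ->]]]].
- by move=> [l [-> [->|[u [v [-> ->]]]]]].
Qed.

Lemma appr_weak i u v u' v' : appr i u v -> nu u' <= nu u -> nu v <= nu v' -> appr i u' v'.
Proof.
move=> h h1 h2; apply: (clos_r _ h h); right; left; exists i, u, v, u', v'; split=> //.
by rewrite /ltV; split; apply/negP; rewrite -leNgt.
Qed.

Lemma appr_add i j u v u' v' : appr i u v -> appr j u' v' -> appr (NA i j) (sadd u u') (sadd v v').
Proof.
move=> h1 h2; apply: clos_r h1 h2; left; exists i, j, u, u', v, v'; split=> //.
by left.
Qed.

Lemma appr_mul i j u v u' v' w w' : appr i u v -> appr j u' v' ->
  nu w < nu u * nu u' -> nu w < nu u * nu v' -> nu w < nu v * nu u' -> nu w < nu v * nu v' ->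
  nu u * nu u' < nu w' -> nu u * nu v' < nu w' -> nu v * nu u' < nu w' -> nu v * nu v' < nu w' ->
  appr (NM i j) w w'.
Proof.
move=> h1 h2 *; apply: clos_r h1 h2; left; exists i, j, u, u', v, v'; split=> //.
by right; exists w, w'; rewrite /ltV !smulE.
Qed.

Lemma appr_S s u v : nu u < nu s -> nu s < nu v -> appr (NS s.+1) u v.
Proof. by move=> h1 h2; apply: clos_ax; left; exists s, u, v. Qed.

(** Bounds can be derived as narrow as desired. By [valid_approx] a single derivable bound already
    implies this. *)
Definition approximable i := forall a b, a < nval i -> nval i < b ->
  exists u, exists v, [/\ appr i u v, a < nu u & nu v < b].

Lemma approximable_S n : approximable (NS n).
Proof.
case: n => [|s] a b; rewrite /nval /= => h1 h2.
  have [u /andP [u1 u2]] := nu_between hn h1; have [v /andP [v1 v2]] := nu_between hn h2.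
  have [k hk] := (tau_ltP hn u).1 u2; have [k' hk'] := (tau_gtP hn v).1 v1.
  exists u, v; split=> //; apply: clos_ax; right; left; exists (maxn k k'), u, v; split=> //.
  have [g1 _] := itv_mono hn (leq_maxl k k'); have [_ g2] := itv_mono hn (leq_maxr k k').
  by split; [apply: lt_le_trans hk g1 | apply: le_lt_trans g2 hk'].
have [u /andP [u1 u2]] := nu_between hn h1; have [v /andP [v1 v2]] := nu_between hn h2.
by exists u, v; split=> //; apply: appr_S.
Qed.

Lemma approximable_A i j : approximable i -> approximable j -> approximable (NA i j).
Proof.
move=> hi hj a b; rewrite /nval /= -/(nval i) -/(nval j) => h1 h2.
have [||d d0 [d1 d2]] := @min_pos ((nval i + nval j - a) / 2) ((b - (nval i + nval j)) / 2); [lra | lra |].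
have [||u [v [g1 g2 g3]]] := hi (nval i - d) (nval i + d); rewrite ?ltrDl ?gtrDl ?oppr_lt0 //.
have [||u' [v' [g4 g5 g6]]] := hj (nval j - d) (nval j + d); rewrite ?ltrDl ?gtrDl ?oppr_lt0 //.
by exists (sadd u u'), (sadd v v'); rewrite !saddE; split; [exact: appr_add | lra..].
Qed.

Lemma approximable_M i j : approximable i -> approximable j -> approximable (NM i j).
Proof.
move=> hi hj a b; rewrite /nval /= -/(nval i) -/(nval j) => h1 h2.
set x := nval i in h1 h2 *; set y := nval j in h1 h2 *.
have [||m m0 [l1 l2]] := @min_pos (x * y - a) (b - x * y); [lra | lra |].
pose K := `|x| + `|y| + 1.
have K1 : 1 <= K by rewrite /K; have := normr_ge0 x; have := normr_ge0 y; lra.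
have K0 : 0 < 2 * K by lra.
(* If both factors are known up to [d <= 1], the error of the product is at most
   [d * (|x| + |y| + 1)], here at most [m / 2]. *)
have [||d d0 [d1 d3]] := @min_pos 1 (m / (2 * K)); [lra | by rewrite divr_gt0 |].
have d2 : d * K <= m / 2 by move: d3; rewrite ler_pdivlMr //; lra.
have [||u [v [g1 g2 g3]]] := hi (x - d) (x + d); rewrite ?ltrDl ?gtrDl ?oppr_lt0 //.
have [||u' [v' [g4 g5 g6]]] := hj (y - d) (y + d); rewrite ?ltrDl ?gtrDl ?oppr_lt0 //.
have [i1 i2] := apprP g1; have [j1 j2] := apprP g4; rewrite -/x -/y in i1 i2 j1 j2.
have near p r : `|p - x| < d -> `|r - y| < d -> `|p * r - x * y| <= m / 2.
  move=> hp hr; have -> : p * r - x * y = (p - x) * (r - y) + ((p - x) * y + x * (r - y)) by ring.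
  apply: le_trans (ler_normD _ _) _; apply: le_trans (lerD (lexx _) (ler_normD _ _)) _.
  rewrite !normrM.
  have t1 : `|p - x| * `|r - y| <= d * 1 by apply: ler_pM => //; lra.
  have t2 : `|p - x| * `|y| <= d * `|y| by apply: ler_wpM2r => //; lra.
  have t3 : `|x| * `|r - y| <= `|x| * d by apply: ler_wpM2l => //; lra.
  move: d2; rewrite /K; lra.
have nu1 : `|nu u - x| < d by rewrite ltr_norml; apply/andP; split; lra.
have nu2 : `|nu v - x| < d by rewrite ltr_norml; apply/andP; split; lra.
have nu3 : `|nu u' - y| < d by rewrite ltr_norml; apply/andP; split; lra.
have nu4 : `|nu v' - y| < d by rewrite ltr_norml; apply/andP; split; lra.
have [w /andP [w1 w2]] : exists w, a < nu w < x * y - m / 2 by apply: (nu_between hn); lra.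
have [w' /andP [w3 w4]] : exists w, x * y + m / 2 < nu w < b by apply: (nu_between hn); lra.
exists w, w'; split=> //.
have := near _ _ nu1 nu3; have := near _ _ nu1 nu4; have := near _ _ nu2 nu3; have := near _ _ nu2 nu4.
rewrite !ler_norml => /andP [s1 s2] /andP [s3 s4] /andP [s5 s6] /andP [s7 s8].
by apply: (appr_mul g1 g4); lra.
Qed.

Fixpoint allc (l : nm) : Prop := if l is NC c l' then approximable c /\ allc l' else True.

Lemma horner_nil (e d : RR) : 0 <= e -> 0 < d -> forall eps, 0 < eps ->
  exists u', exists v', [/\ appr zS u' v', nu v' - nu u' <= 2 * e * d + eps,
    - (4 * e + eps) <= nu u' & nu v' <= 4 * e + eps].
Proof.
move=> e0 d0 eps ep0; have ed : 0 <= e * d by rewrite mulr_ge0 // ltW.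
have zv : nval zS = 0 by rewrite /nval /= rnameE rmorph0.
have [||u' [v' [g1 g2 g3]]] := @approximable_S (rname 0).+1 (- (eps / 2)) (eps / 2).
- by rewrite -/zS zv; lra.
- by rewrite -/zS zv; lra.
by exists u', v'; split=> //; lra.
Qed.

(** The interval form of [smalls_bound]: up to [eps], evaluation multiplies the width of the bounds
    by at most [2 * e], and the computed endpoints, though looser than the values, stay within
    [4 * e]. *)
Lemma horner_approx l e z u v : allc l -> smalls (pl l) e -> 0 <= e -> e <= 1 ->
  appr z u v -> -1 <= nu u -> nu v <= 1 -> forall eps, 0 < eps ->
  exists u', exists v', [/\ appr (hnm l z) u' v', nu v' - nu u' <= 2 * e * (nu v - nu u) + eps,
    - (4 * e + eps) <= nu u' & nu v' <= 4 * e + eps].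
Proof.
move=> hl hs e0 e1 hz hu hv; have [z1 z2] := apprP hz; set d := nu v - nu u.
have d0 : 0 < d by rewrite /d; lra.
have d2 : d <= 2 by rewrite /d; lra.
elim: l e e0 e1 hl hs => [n|? _ ? _|? _ ? _|? _|c _ l IH] e e0 e1 /=; last first.
  move=> [hc hl] [hs1 hs2] eps ep0.
  have [||e' p0 [p1 p2]] := @min_pos (eps / 16) (1 / 16); [lra | lra |].
  have [||p [q [hpq g1 g2 g3]]] := IH (e / 8) _ _ hl hs2 e' p0; [lra | lra |].
  have [q1 q2] := apprP hpq.
  have [||r [s [hrs r1 r2]]] := hc (nval c - e') (nval c + e'); rewrite ?ltrDl ?gtrDl ?oppr_lt0 //.
  rewrite -/(nval c) ler_norml in hs1; move/andP: hs1 => [c1 c2].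
  (* [B] bounds the endpoints found for the inner polynomial, [D] their distance, and [K] the
     distance of each of the four products of endpoints from [nu p * nu u]. *)
  pose B := e / 2 + e'; pose D := e / 4 * d + e'; pose K := B * d + D.
  have B0 : 0 <= B by rewrite /B; lra.
  have ed : 0 <= e * d by rewrite mulr_ge0 // ltW.
  have Bd : B * d <= e / 2 * d + 2 * e' by rewrite /B mulrDl; nra.
  have [w /andP [w1 w2]] : exists w, nu p * nu u - K - e' < nu w < nu p * nu u - K by apply: (nu_between hn); lra.
  have [w' /andP [w3 w4]] : exists w, nu p * nu u + K < nu w < nu p * nu u + K + e' by apply: (nu_between hn); lra.
  have pb : - B <= nu p /\ nu p <= B by rewrite /B; split; lra.
  have qb : - B <= nu q /\ nu q <= B by rewrite /B; split; lra.
  have ub : -1 <= nu u /\ nu u <= 1 by split; lra.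
  have qp : 0 < nu q - nu p by lra.
  have qD : nu q - nu p <= D by rewrite /D; lra.
  have k1 : - (B * d) <= nu p * d /\ nu p * d <= B * d by nra.
  have k2 : - D <= (nu q - nu p) * nu u /\ (nu q - nu p) * nu u <= D by nra.
  have k3 : - (B * d) <= nu q * d /\ nu q * d <= B * d by nra.
  have ev : nu v = nu u + d by rewrite /d; lra.
  have Bd0 : 0 <= B * d by rewrite mulr_ge0 // ltW.
  have D0 : 0 <= D by lra.
  have f2 : nu p * nu v = nu p * nu u + nu p * d by rewrite ev; ring.
  have f3 : nu q * nu u = nu p * nu u + (nu q - nu p) * nu u by ring.
  have f4 : nu q * nu v = nu p * nu u + (nu q - nu p) * nu u + nu q * d by rewrite ev; ring.
  have hm : appr (NM (hnm l z) z) w w'.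
    by apply: (appr_mul hpq hz); rewrite ?f2 ?f3 ?f4 /K in w1 w2 w3 w4 *; lra.
  have pu : - B <= nu p * nu u /\ nu p * nu u <= B by nra.
  exists (sadd w r), (sadd w' s); rewrite !saddE; split; first exact: appr_add.
  - by move: Bd; rewrite /K /D /B in w1 w2 w3 w4 *; lra.
  - have ed2 : e * d <= 2 * e by nra.
    by move: Bd pu; rewrite /K /D /B in w1 w2 w3 w4 *; lra.
  - have ed2 : e * d <= 2 * e by nra.
    by move: Bd pu; rewrite /K /D /B in w1 w2 w3 w4 *; lra.
all: by move=> _ _ eps; apply: horner_nil.
Qed.

(** With [e = 1 / 8], evaluating the polynomial on bounds of width [d] gives width at most
    [d / 4 + eps]; the choice [eps = d / 4] halves the width in each round and keeps the bounds in
    [-1, 1]. *)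
Lemma approximable_F l : allc l -> sml l q8 -> approximable (NF l).
Proof.
move=> hl hs; have hs' := smlP hs; rewrite nu_q8 in hs'.
have H n : exists u, exists v, [/\ appr (NF l) u v, -1 <= nu u, nu v <= 1 & (nu v - nu u) * n.+1%:R <= 2].
  elim: n => [|n [u [v [h1 h2 h3 h4]]]].
    exists m1, (rname 1); rewrite nu_m1 rnameE rmorph1; split=> //; last by lra.
    by apply: (clos_r _ hs hs); do 3!right; exists l; split=> //; left.
  have [x1 x2] := apprP h1; pose d := nu v - nu u.
  have d0 : 0 < d by rewrite /d; lra.
  have d2 : d <= 2 by rewrite /d; lra.
  have [|||u' [v' [g1 g2 g3 g4]]] := @horner_approx l (1 / 8) (NF l) u v hl hs' _ _ h1 h2 h3 (d / 4); [lra | lra | lra |].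
  exists u', v'; split; [|lra|lra|].
    by apply: clos_r hs g1; do 3!right; exists l; split=> //; right; exists u', v'.
  have : n.+2%:R <= n.+1%:R * 2 :> RR by rewrite -natrM ler_nat; lia.
  have : 0 <= n.+2%:R :> RR by [].
  rewrite -/d in g2 h4; set a := n.+1%:R in h4 *; set b := n.+2%:R => b0 ba.
  have : (nu v' - nu u') * b <= (d / 2) * b by apply: ler_wpM2r => //; lra.
  nra.
move=> a b h1 h2; have [||m m0 [l1 l2]] := @min_pos (nval (NF l) - a) (b - nval (NF l)); [lra | lra |].
have [n hn'] := RR_arch (2 / m); have [u [v [g1 g2 g3 g4]]] := H n.
have [x1 x2] := apprP g1; exists u, v.
have w : nu v - nu u < m.
  have n0 : 0 < n.+1%:R :> RR by rewrite ltr0n.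
  rewrite -(ltr_pM2r n0); apply: le_lt_trans g4 _.
  by rewrite -ltr_pdivrMl // mulrC; apply: le_lt_trans hn' _; rewrite ltr_nat.
by split=> //; lra.
Qed.

Lemma valid_approx i : (valid i -> approximable i) /\ forall e, sml i e -> allc i.
Proof.
elim: i => [n|i [IHi _] j [IHj _]|i [IHi _] j [IHj _]|l [_ IHl]|c [IHc _] l [_ IHl]]; split=> //.
- by move=> _; apply: approximable_S.
- by move=> [u [v /clos_ainv [hi hj]]]; apply: approximable_A; [apply: IHi | apply: IHj].
- by move=> [u [v /clos_ainv [hi hj]]]; apply: approximable_M; [apply: IHi | apply: IHj].
- by move=> [u [v /clos_ainv hl]]; apply: approximable_F => //; apply: IHl hl.
- by move=> [u [v /clos_ainv]].
- move=> e /clos_ainv [h1 h2]; split; last exact: IHl h2.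
  by apply: IHc; exists (smul m1 e), e.
Qed.

Lemma validP i : valid i -> approximable i.
Proof. by case: (valid_approx i). Qed.

Lemma valid_of_approximable i : approximable i -> valid i.
Proof.
by move=> h; have [||u [v [h1 _ _]]] := h (nval i - 1) (nval i + 1); [lra | lra | exists u, v].
Qed.

Lemma validS n : valid (NS n).
Proof. exact: (valid_of_approximable (@approximable_S n)). Qed.
Lemma validA i j : valid i -> valid j -> valid (NA i j).
Proof. by move=> /validP hi /validP hj; exact: (valid_of_approximable (approximable_A hi hj)). Qed.
Lemma validM i j : valid i -> valid j -> valid (NM i j).
Proof. by move=> /validP hi /validP hj; exact: (valid_of_approximable (approximable_M hi hj)). Qed.
Lemma validF l : sml l q8 -> valid (NF l).
Proof. by move=> hl; exists m1, (rname 1); apply: (clos_r _ hl hl); do 3!right; exists l; split=> //; left. Qed.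

Definition mkl (cs : seq nm) := foldr NC (NS 0) cs.
Lemma pl_mkl cs : pl (mkl cs) = map nval cs.
Proof. by elim: cs => //= c cs <-. Qed.

(** Valid names have arbitrarily narrow bounds, so strict inequalities between the values are
    eventually confirmed, and smallness is derivable. *)
Lemma smallsl cs e : (forall i, (i < size cs)%N -> valid (nth zS cs i) /\ `|nval (nth zS cs i)| * 8 ^+ i < nu e) -> sml (mkl cs) e.
Proof.
elim: cs e => [|c cs IH] e h; first by apply: clos_ax; do 2!right; exists 0%N, e.
have [/validP hc] := h 0%N isT; rewrite /= expr0 mulr1 ltr_norml => /andP [h1 h2].
have [u [v [a1 a2 a3]]] := hc _ _ h1 h2.
have hc' : appr c (smul m1 e) e by apply: appr_weak a1 _ _; rewrite ?smulE ?nu_m1 ?mulN1r ltW.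
have hl : sml (mkl cs) (smul q8 e).
  apply: IH => i hi; have [h3 h4] := h i.+1 hi; split=> //=.
  by rewrite smulE nu_q8; move: h4; rewrite /= exprS; lra.
by apply: clos_r hc' hl; do 2!right; left; exists c, (mkl cs), e.
Qed.

End Approx.

Arguments nval : simpl never.

(** * Provable equality of names *)

Section EqNames.
Variables (S : RR -> Prop) (nu : nat -> RR) (hn : numbered S nu).
Notation sadd := (sadd hn).
Notation smul := (smul hn).
Notation rname := (rname hn).
Notation zS := (zS hn).
Notation q8 := (q8 hn).
Notation nv := (nval hn).
Notation valid := (valid hn).
Definition oneS := NS (rname 1).+1.
Definition moneS := NS (m1 hn).+1.

(** Commutative ring laws, the tables of sums, products and equalities of [S], and the fixed-point
    equations. With the rules below they prove every true equation between valid names; this is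
    [peq_complete]. *)
Definition eax (j : nm * nm) :=
  j.1 = j.2 \/
  (exists a, exists b, exists c,
    (j = (NA (NA a b) c, NA a (NA b c)) \/ j = (NM (NM a b) c, NM a (NM b c))) \/
    (j = (NM (NA a b) c, NA (NM a c) (NM b c)) \/ j = (NA a b, NA b a)) \/
    (j = (NM a b, NM b a) \/ j = (NA zS a, a)) \/
    (j = (NM oneS a, a) \/ j = (NA a (NM moneS a), zS))) \/
  (exists a, exists b, (j = (NA (NS a.+1) (NS b.+1), NS (sadd a b).+1) \/
     j = (NM (NS a.+1) (NS b.+1), NS (smul a b).+1)) \/
     ((~ ltV nu a b /\ ~ ltV nu b a) /\ j = (NS a.+1, NS b.+1))) \/
  (exists l, sml hn l q8 /\ j = (NF l, hnm hn l (NF l))).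
(** The first clause, that two names equal to a third are equal, gives symmetry and transitivity at
    once. The last one makes the ring of names reduced. *)
Definition erule (j a b : nm * nm) :=
  (a.2 = b.2 /\ j = (a.1, b.1)) \/
  (j = (NA a.1 b.1, NA a.2 b.2) \/ j = (NM a.1 b.1, NM a.2 b.2)) \/
  (exists i, a = (NM i i, zS) /\ j = (i, zS)).
Definition peq i j := clos eax erule (i, j).

Lemma RE_peq : RE (fun y : nm * nm => peq y.1 y.2).
Proof.
have h1 := nb_lt hn; have h2 := comp_hnm hn; have h3 := comp_sadd hn; have h4 := comp_smul hn.
have h5 := RE_sml hn.
have h : RE (fun y : nat * (nm * nm) => clos eax erule y.2).
  apply: (RE_clos (ax := fun=> eax) (r := fun=> erule)); [rewrite /eax | rewrite /erule]; ctac.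
  by apply: (RE_app2 (P := sml hn)); ctac.
by apply: (RE_app1 (f := fun j : nm * nm => (0%N, (j.1, j.2))) h); ctac.
Qed.

Lemma nval_zS : nv zS = 0.
Proof. by rewrite /nval /= rnameE rmorph0. Qed.
Lemma nval_oneS : nv oneS = 1.
Proof. by rewrite /nval /= rnameE rmorph1. Qed.
Lemma nval_moneS : nv moneS = -1.
Proof. by rewrite /nval /= nu_m1. Qed.
Lemma nvalA i j : nv (NA i j) = nv i + nv j. Proof. by []. Qed.
Lemma nvalM i j : nv (NM i j) = nv i * nv j. Proof. by []. Qed.
Lemma nvalS s : nv (NS s.+1) = nu s. Proof. by []. Qed.

Lemma peq_sound i j : peq i j -> nv i = nv j.
Proof.
suff H p : clos eax erule p -> nv p.1 = nv p.2 by exact: (H (i, j)).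
elim=> {p i j} [p|p a b h _ IHa _ IHb].
  case=> [-> //|[[a [b [c]]]|[[a [b]]|[l [/smlP hl ->]]]]] /=.
  - case=> [[|]|[[|]|[[|]|[|]]]] -> /=; rewrite ?(nvalA, nvalM, nval_zS, nval_oneS, nval_moneS); ring.
  - case=> [[|] ->|[[/negP h1 /negP h2] ->]] /=; rewrite ?nvalA ?nvalM !nvalS ?saddE ?smulE //.
    by apply/le_anti/andP; split; rewrite leNgt.
  - by rewrite nu_q8 in hl; have [_ e] := fixpP hl; rewrite nval_hn {1}/nval /= -/(pl hn l) e.
case: h => [[e ->]|[[|] ->|[i [ea ->]]]] /=.
- by rewrite IHa e IHb.
- by rewrite !nvalA IHa IHb.
- by rewrite !nvalM IHa IHb.
- by move: IHa; rewrite ea /= nvalM nval_zS => /eqP; rewrite mulf_eq0 orbb => /eqP.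
Qed.

Lemma peq_refl i : peq i i.
Proof. by apply: clos_ax; left. Qed.
Lemma peq_euclid i j k : peq i k -> peq j k -> peq i j.
Proof. by move=> h1 h2; apply: clos_r h1 h2; left. Qed.
Lemma peq_sym i j : peq i j -> peq j i.
Proof. by move=> h; apply: peq_euclid (peq_refl j) h. Qed.
Lemma peq_trans i j k : peq i j -> peq j k -> peq i k.
Proof. by move=> h1 /peq_sym h2; apply: peq_euclid h1 h2. Qed.
Lemma peq_A i i' j j' : peq i i' -> peq j j' -> peq (NA i j) (NA i' j').
Proof. by move=> h1 h2; apply: clos_r h1 h2; right; left; left. Qed.
Lemma peq_M i i' j j' : peq i i' -> peq j j' -> peq (NM i j) (NM i' j').
Proof. by move=> h1 h2; apply: clos_r h1 h2; right; left; right. Qed.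

Lemma cls_ex i : exists j, valid i -> valid j /\ peq i j /\
  forall k, valid k -> peq i k -> (nme j <= nme k)%N.
Proof.
case: (pselect (valid i)) => hi; last by exists i.
have ex : exists n, `[< exists k, valid k /\ peq i k /\ nme k = n >].
  by exists (nme i); apply/asboolP; exists i; split=> //; split=> //; apply: peq_refl.
case: (ex_minnP ex) => n /asboolP [k [h1 [h2 h3]]] nmin; exists k => _; split=> //; split=> // k' h4 h5.
by rewrite h3; apply: nmin; apply/asboolP; exists k'.
Qed.
Definition cls i := sval (cid (cls_ex i)).
Lemma cls_valid i : valid i -> valid (cls i).
Proof. by move=> h; case: (svalP (cid (cls_ex i)) h). Qed.
Lemma cls_eqn i : valid i -> peq i (cls i).
Proof. by move=> h; case: (svalP (cid (cls_ex i)) h) => _ []. Qed.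
Lemma cls_eq i j : valid i -> valid j -> peq i j -> cls i = cls j.
Proof.
move=> hi hj e; apply: (can_inj nm_encK); apply/eqP; rewrite eqn_leq.
have [h1 [h2 h3]] := svalP (cid (cls_ex i)) hi; have [g1 [g2 g3]] := svalP (cid (cls_ex j)) hj.
rewrite h3 //; last by apply: peq_trans e g2.
by rewrite g3 //; apply: peq_trans (peq_sym e) h2.
Qed.

(* The ring of valid names modulo provable equality; a class is represented by its member of
   least code. *)
Definition ring_pred (n : nat) := `[< valid (dec n) /\ cls (dec n) = dec n >].
Definition B := {n : nat | ring_pred n}.
HB.instance Definition _ := Choice.on B.

Definition rp (x : B) : nm := dec (val x).
Lemma rp_valid x : valid (rp x).
Proof. by have /asboolP [] := valP x. Qed.
Lemma rp_cls x : cls (rp x) = rp x.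
Proof. by have /asboolP [] := valP x. Qed.

Lemma validz : valid zS. Proof. exact: validS. Qed.
Lemma valid1 : valid oneS. Proof. exact: validS. Qed.
Lemma validN1 : valid moneS. Proof. exact: validS. Qed.
Hint Resolve validz valid1 validN1 rp_valid validA validM validS : core.

Lemma mk_subproof i : exists x : B, valid i -> rp x = cls i.
Proof.
have H j : valid j -> cls j = j -> exists x : B, rp x = j.
  move=> h1 h2; have dj : @dec nm cod_nm (nme j) = j by exact: (@encK nm cod_nm j).
  have h : ring_pred (nme j) by apply/asboolP; rewrite dj.
  by exists (Sub (nme j) h); rewrite /rp /= dj.
have cc k : valid k -> cls (cls k) = cls k.
  by move=> hk; apply: cls_eq; [exact: cls_valid | | apply: peq_sym; exact: cls_eqn].
case: (pselect (valid i)) => hi; first by have [x hx] := H _ (cls_valid hi) (cc i hi); exists x.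
by have [x _] := H _ (cls_valid validz) (cc _ validz); exists x => /hi.
Qed.
Definition mk i := sval (cid (mk_subproof i)).
Lemma rp_mk i : valid i -> rp (mk i) = cls i.
Proof. exact: (svalP (cid (mk_subproof i))). Qed.

Lemma rp_inj : injective rp.
Proof. by move=> x y e; apply: val_inj; apply: (can_inj (decK (T := nm))). Qed.
Lemma mkP i j : valid i -> valid j -> (mk i = mk j <-> peq i j).
Proof.
move=> hi hj; split=> [/(congr1 rp)|e]; last by apply: rp_inj; rewrite !rp_mk //; apply: cls_eq.
rewrite !rp_mk // => e; apply: peq_trans (cls_eqn hi) _; rewrite e; apply: peq_sym; exact: cls_eqn.
Qed.
Lemma mk_rp x : mk (rp x) = x.
Proof. by apply: rp_inj; rewrite rp_mk // rp_cls. Qed.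
Lemma rp_mkE i : valid i -> peq (rp (mk i)) i.
Proof. by move=> hi; rewrite rp_mk //; apply: peq_sym; apply: cls_eqn. Qed.

Definition addB x y := mk (NA (rp x) (rp y)).
Definition mulB x y := mk (NM (rp x) (rp y)).
Definition oppB x := mulB (mk moneS) x.

Lemma mkA i j : valid i -> valid j -> mk (NA i j) = addB (mk i) (mk j).
Proof. by move=> hi hj; apply/mkP; auto; apply: peq_A; apply: peq_sym; apply: rp_mkE. Qed.
Lemma mkM i j : valid i -> valid j -> mk (NM i j) = mulB (mk i) (mk j).
Proof. by move=> hi hj; apply/mkP; auto; apply: peq_M; apply: peq_sym; apply: rp_mkE. Qed.

Lemma e_ax a b c : [/\ peq (NA (NA a b) c) (NA a (NA b c)), peq (NM (NM a b) c) (NM a (NM b c)),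
  peq (NM (NA a b) c) (NA (NM a c) (NM b c)) & peq (NA a b) (NA b a)].
Proof. by split; apply: clos_ax; right; left; exists a, b, c; [left; left|left; right|right; left; left|right; left; right]. Qed.
Lemma e_ax' (a b c : nm) : [/\ peq (NM a b) (NM b a), peq (NA zS a) a, peq (NM oneS a) a & peq (NA a (NM moneS a)) zS].
Proof.
by split; apply: clos_ax; right; left; exists a, b, c; right; right;
 [left; left|left; right|right; left|right; right].
Qed.

Lemma addBA : associative addB.
Proof.
move=> x y z; rewrite -[x]mk_rp -[y]mk_rp -[z]mk_rp -!mkA; auto.
by apply/mkP; auto; apply: peq_sym; case: (e_ax (rp x) (rp y) (rp z)).
Qed.
Lemma addBC : commutative addB.
Proof.
move=> x y; rewrite -[x]mk_rp -[y]mk_rp -!mkA; auto.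
by apply/mkP; auto; case: (e_ax (rp x) (rp y) (rp x)).
Qed.
Lemma add0B : left_id (mk zS) addB.
Proof.
move=> x; rewrite -[x]mk_rp -!mkA; auto.
by apply/mkP; auto; case: (e_ax' (rp x) (rp x) (rp x)).
Qed.
Lemma addNB : left_inverse (mk zS) oppB addB.
Proof.
move=> x; rewrite addBC -[x]mk_rp /oppB -mkM -?mkA; auto.
by apply/mkP; auto; case: (e_ax' (rp x) (rp x) (rp x)).
Qed.
Lemma mulBA : associative mulB.
Proof.
move=> x y z; rewrite -[x]mk_rp -[y]mk_rp -[z]mk_rp -!mkM; auto.
by apply/mkP; auto; apply: peq_sym; case: (e_ax (rp x) (rp y) (rp z)).
Qed.
Lemma mulBC : commutative mulB.
Proof.
move=> x y; rewrite -[x]mk_rp -[y]mk_rp -!mkM; auto.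
by apply/mkP; auto; case: (e_ax' (rp x) (rp y) (rp x)).
Qed.
Lemma mul1B : left_id (mk oneS) mulB.
Proof.
move=> x; rewrite -[x]mk_rp -!mkM; [|exact: validS|auto].
by apply/mkP; [apply: validM; [exact: validS | auto] | auto | case: (e_ax' (rp x) (rp x) (rp x))].
Qed.
Lemma mulBDl : left_distributive mulB addB.
Proof.
move=> x y z; rewrite -[x]mk_rp -[y]mk_rp -[z]mk_rp -mkA; auto.
rewrite -!mkM; auto; rewrite -mkA; auto.
by apply/mkP; auto; case: (e_ax (rp x) (rp y) (rp z)).
Qed.
Lemma B1_neq0 : mk oneS != mk zS.
Proof.
apply/eqP => h; have := peq_sound ((mkP valid1 validz).1 h); rewrite nval_oneS nval_zS => /eqP.
by rewrite oner_eq0.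
Qed.
HB.instance Definition _ := GRing.isZmodule.Build B addBA addBC add0B addNB.
HB.instance Definition _ := GRing.Zmodule_isComNzRing.Build B mulBA mulBC mul1B mulBDl B1_neq0.

Definition ev (x : B) := nv (rp x).
Lemma ev_mk i : valid i -> ev (mk i) = nv i.
Proof. by move=> hi; apply: peq_sound; apply: rp_mkE. Qed.
Lemma evD x y : ev (x + y) = ev x + ev y.
Proof. by rewrite -[x + y]/(addB x y) /addB ev_mk; auto. Qed.
Lemma evM x y : ev (x * y) = ev x * ev y.
Proof. by rewrite -[x * y]/(mulB x y) /mulB ev_mk; auto. Qed.
Lemma ev_additive : additive ev.
Proof. by move=> x y; apply: (@addIr _ (ev y)); rewrite subrK -evD subrK. Qed.
Lemma ev_mult : monoid_morphism ev.
Proof. by split=> [|x y]; [rewrite -[1]/(mk oneS) ev_mk ?nval_oneS //; apply: validS | exact: evM]. Qed.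
HB.instance Definition _ := GRing.isZmodMorphism.Build B RR ev ev_additive.
HB.instance Definition _ := GRing.isMonoidMorphism.Build B RR ev ev_mult.

Lemma B_reduced (x : B) : x * x = 0 -> x = 0.
Proof.
rewrite -[x]mk_rp -[_ * _]mkM; auto => /mkP h; apply/mkP; auto.
have {}h : peq (NM (rp x) (rp x)) zS by apply: h; auto.
by apply: (clos_r _ h h); right; right; exists (rp x).
Qed.

Lemma B_reducedX (x : B) n : x ^+ n = 0 -> x = 0.
Proof.
elim: n {-2}n (leqnn n) => [|m IH] [|[|n]] // hn'; rewrite ?expr0 ?expr1 // => h;
  try by move/eqP: h; rewrite oner_eq0.
apply: (IH n.+1 hn'); apply: B_reduced; rewrite -exprD.
have -> : (n.+1 + n.+1 = n.+2 + n)%N by lia.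
by rewrite exprD h mul0r.
Qed.

Fixpoint clist (l : nm) : seq B := if l is NC c l' then mk c :: clist l' else [::].

Lemma valid_sml c l e : sml hn (NC c l) e -> valid c /\ sml hn l (smul q8 e).
Proof. by move=> /clos_ainv [h1 h2]; split=> //; exists (smul (m1 hn) e), e. Qed.

Lemma mk_hnm l e z : valid z -> sml hn l e -> valid (hnm hn l z) /\ mk (hnm hn l z) = (Poly (clist l)).[mk z].
Proof.
rewrite horner_Poly => vz; elim: l e => [n|? _ ? _|? _ ? _|? _|c _ l IH] e; try by split; [exact: validz|].
move=> /valid_sml [vc /IH [v1 e1]]; split; first by apply: validA => //; apply: validM.
by rewrite /= -e1 [LHS]mkA ?mkM //; auto.
Qed.

Lemma mk_F l : sml hn l q8 -> mk (NF l) = mk (hnm hn l (NF l)).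
Proof.
move=> h; have v1 := validF h; have [v2 _] := mk_hnm v1 h.
by apply/mkP => //; apply: clos_ax; do 3!right; exists l.
Qed.

Lemma mkS_D a b : mk (NS (sadd a b).+1) = mk (NS a.+1) + mk (NS b.+1).
Proof.
rewrite -[RHS]mkA; auto; apply/mkP; auto; apply: peq_sym.
by apply: clos_ax; do 2!right; left; exists a, b; left; left.
Qed.
Lemma mkS_M a b : mk (NS (smul a b).+1) = mk (NS a.+1) * mk (NS b.+1).
Proof.
rewrite -[RHS]mkM; auto; apply/mkP; auto; apply: peq_sym.
by apply: clos_ax; do 2!right; left; exists a, b; left; right.
Qed.
Lemma mkS_eq a b : nu a = nu b -> mk (NS a.+1) = mk (NS b.+1).
Proof.
move=> e; apply/mkP; auto; apply: clos_ax; do 2!right; left; exists a, b; right.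
by rewrite /ltV e ltxx.
Qed.

(** * The field generated by [S] and [tau] inside the ring of names *)

Notation SR := (subR (proj1 (nb_racl hn))).
Lemma sname_ex (x : SR) : exists s, nu s = val x.
Proof. by apply/(nb_im hn); exact: subR_in. Qed.
Definition sname (x : SR) := sval (cid (sname_ex x)).
Lemma snameE x : nu (sname x) = val x.
Proof. exact: (svalP (cid (sname_ex x))). Qed.
Definition js (x : SR) : B := mk (NS (sname x).+1).
Lemma js_eq s x : nu s = val x -> js x = mk (NS s.+1).
Proof. by move=> e; apply: mkS_eq; rewrite snameE. Qed.
Lemma js_additive : additive js.
Proof.
move=> x y; apply: (@addIr _ (js y)); rewrite subrK -[LHS]mkS_D.
by apply/esym/js_eq; rewrite saddE !snameE rmorphB /= subrK.
Qed.
Lemma js_mult : monoid_morphism js.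
Proof.
split=> [|x y]; first by apply: js_eq; rewrite rnameE !rmorph1.
by rewrite -[RHS]mkS_M; apply: js_eq; rewrite smulE !snameE rmorphM.
Qed.
HB.instance Definition _ := GRing.isZmodMorphism.Build SR B js js_additive.
HB.instance Definition _ := GRing.isMonoidMorphism.Build SR B js js_mult.
Lemma ev_js x : ev (js x) = val x.
Proof. by rewrite ev_mk ?nvalS ?snameE //; auto. Qed.

Definition TT : B := mk (NS 0).
Lemma ev_TT : ev TT = tau hn.
Proof. by rewrite ev_mk //; auto. Qed.

(** As [tau] lies outside the relatively closed [S], it is a root of no nonzero polynomial over
    [S]. *)
Lemma polyT_inj (p : {poly SR}) : ev (map_poly js p).[TT] = 0 -> p = 0.
Proof.
have -> : ev (map_poly js p).[TT] = (map_poly val p).[tau hn].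
  rewrite -horner_map -map_poly_comp /= ev_TT; congr (_.[_]).
  by apply: eq_map_poly => x /=; rewrite ev_js.
move=> e; apply/eqP; case: eqP => // /eqP p0; exfalso; apply: (@tau_notin _ _ hn).
case: (nb_racl hn) => _; apply; last by apply/rootP; exact: e.
  by move=> i; rewrite coef_map; apply: subR_in.
by rewrite map_poly_eq0_id0 // fmorph_eq0 lead_coef_eq0.
Qed.

(* [1 / x = q (1 + w)] where [q] is an approximate inverse from [S] and [w] is the fixed point of
   [z |-> e z + e], [e = 1 - x q]. *)
Lemma B_unit (x : B) : ev x != 0 -> exists y, x * y = 1.
Proof.
(* The bound is [1 / 8 ^ 2], as required of [e] in its role of coefficient of degree 1. *)
move=> x0; have [|q hq] := @nu_dense _ _ hn (ev x)^-1 (1 / 64 / `|ev x|).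
  by rewrite divr_gt0 ?normr_gt0 //; lra.
pose e := NA oneS (NM moneS (NM (rp x) (NS q.+1))).
have ve : valid e by apply: validA; [exact: validS | apply: validM; [exact: validS | auto]].
have ne : `|nv e| < 1 / 64.
  rewrite !nvalA !nvalM nval_oneS nval_moneS nvalS -/(ev x) mulN1r.
  have -> : 1 + - (ev x * nu q) = - ((nu q - (ev x)^-1) * ev x) by rewrite mulrBl mulVf //; ring.
  by rewrite normrN normrM -ltr_pdivlMr ?normr_gt0.
have hs : sml hn (mkl [:: e; e]) q8.
  by apply: smallsl => -[|[|]] // _; split=> //=; rewrite nu_q8 ?expr0 ?expr1; lra.
have vw := validF hs; set w := NF _ in vw.
have [v2 e2] := mk_hnm vw hs.
have := mk_F hs; rewrite -/w e2 horner_Poly /= mul0r add0r.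
pose Q := mk (NS q.+1).
have -> : mk e = 1 - x * Q.
  have v1 : valid (NM (rp x) (NS q.+1)) by auto.
  rewrite [LHS]mkA; auto; rewrite [X in addB _ X]mkM; auto.
  by rewrite [X in addB _ (mulB _ X)]mkM; auto; rewrite mk_rp.
move=> h; exists (Q * (1 + mk w)).
apply/eqP; rewrite -subr_eq0; apply/eqP.
have -> : x * (Q * (1 + mk w)) - 1 = mk w - ((1 - x * Q) * mk w + (1 - x * Q)) by ring.
by rewrite -h subrr.
Qed.

(** The fractions in [TT] over [S]. Their denominators have nonzero value by [polyT_inj] and are
    therefore units by [B_unit], so these elements form a field isomorphic to S(tau). *)
Definition FFP (x : B) := exists p, exists q : {poly SR}, q != 0 /\
   (map_poly js q).[TT] * x = (map_poly js p).[TT].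
Definition FFpred : {pred B} := fun x => `[< FFP x >].
Definition FF := {x : B | x \in FFpred}.
HB.instance Definition _ := SubChoice.on FF.
Lemma FF_subring : subring_closed FFpred.
Proof.
split=> [|x y|x y]; rewrite !unfold_in.
- by apply/asboolP; exists 1, 1; rewrite oner_eq0 mulr1.
- move=> /asboolP [p [q [q0 e]]] /asboolP [p' [q' [q0' e']]]; apply/asboolP.
  exists (p * q' - p' * q), (q * q'); rewrite mulf_neq0 //; split=> //.
  by rewrite rmorphB !rmorphM !hornerE -e -e'; ring.
- move=> /asboolP [p [q [q0 e]]] /asboolP [p' [q' [q0' e']]]; apply/asboolP.
  exists (p * p'), (q * q'); rewrite mulf_neq0 //; split=> //.
  by rewrite !rmorphM !hornerM -e -e' /=; ring.
Qed.
HB.instance Definition _ := GRing.SubChoice_isSubComNzRing.Build B FFpred FF FF_subring.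

Lemma FFP_in x : FFP x -> exists y : FF, val y = x.
Proof. by move=> /asboolP h; exists (Sub (x : B) h). Qed.
Lemma FF_P (y : FF) : FFP (val y).
Proof. exact/asboolP/(valP y). Qed.

Lemma ev_polyT (p : {poly SR}) : p != 0 -> ev (map_poly js p).[TT] != 0.
Proof. by apply: contraNneq => /polyT_inj ->. Qed.

Lemma FF_inj (y : FF) : ev (val y) = 0 -> y = 0.
Proof.
move=> h; apply: val_inj; rewrite rmorph0; have [p [q [q0 e]]] := FF_P y.
have /polyT_inj p0 : ev (map_poly js p).[TT] = 0 by rewrite -e rmorphM /= h mulr0.
have [z hz] := B_unit (ev_polyT q0).
by rewrite -[val y]mul1r -hz mulrAC e p0 rmorph0 horner0 mul0r.
Qed.

Lemma FF_inv (y : FF) : y != 0 -> exists z, y * z = 1.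
Proof.
move=> y0; have [|z hz] := @B_unit (val y).
  by apply: contraNneq y0 => /FF_inj ->.
have [p [q [q0 e]]] := FF_P y.
have [|w hw] := @FFP_in z; last by exists w; apply: val_inj; rewrite rmorphM rmorph1 /= hw.
exists q, p; split; last by rewrite -e -mulrA hz mulr1.
apply: contraNneq (ev_polyT q0) => p0; apply/eqP.
have -> : (map_poly js q).[TT] = (map_poly js q).[TT] * val y * z by rewrite -mulrA hz mulr1.
by rewrite e p0 rmorph0 horner0 mul0r rmorph0.
Qed.

(** * Integrality over that field and completeness of provable equality *)

Definition jF : {rmorphism FF -> B} := val.
Notation integral := (integralOver jF).

Lemma monic_dec (p : {poly FF}) : p \is monic -> size p != 1%N ->
  exists p', exists c, [/\ p' \is monic, p = p' * 'X + c%:P & (size p = (size p').+1)%N].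
Proof.
move=> mp sp; exists (\poly_(i < (size p).-1) p`_i.+1), p`_0.
have s0 : size p != 0%N by rewrite size_poly_eq0 monic_neq0.
have e : p = \poly_(i < (size p).-1) p`_i.+1 * 'X + (p`_0)%:P.
  apply/polyP => -[|i]; rewrite coefD coefMX coefC /= ?add0r // addr0 coef_poly.
  by case: ltnP => // h; rewrite nth_default //; lia.
have s1 : size (\poly_(i < (size p).-1) p`_i.+1) = (size p).-1.
  apply: size_poly_eq; have -> : ((size p).-1.-1.+1 = (size p).-1)%N by lia.
  by rewrite -lead_coefE (monicP mp) oner_eq0.
split=> //; last by rewrite s1; lia.
rewrite monicE lead_coefE s1 coef_poly.
have -> : ((size p).-1.-1 < (size p).-1)%N by lia.
have -> : ((size p).-1.-1.+1 = (size p).-1)%N by lia.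
by rewrite -lead_coefE -monicE.
Qed.

Lemma monic_size1 (p : {poly FF}) : p \is monic -> size p = 1%N -> p = 1.
Proof.
move=> mp sp; have e := size1_polyC (eq_leq sp).
by move: mp; rewrite e monicE lead_coefC => /eqP ->.
Qed.

Lemma horner_monic_dec (p' : {poly FF}) c (x : B) :
  (map_poly jF (p' * 'X + c%:P)).[x] = (map_poly jF p').[x] * x + jF c.
Proof.
have e1 : map_poly jF 'X = 'X by rewrite map_polyX.
have e2 : map_poly jF c%:P = (jF c)%:P by rewrite map_polyC.
have e3 : map_poly jF (p' * 'X) = map_poly jF p' * 'X by rewrite rmorphM /= e1.
have e4 : map_poly jF (p' * 'X + c%:P) = map_poly jF p' * 'X + (jF c)%:P by rewrite rmorphD /= e3 e2.
by rewrite e4 hornerD hornerMX hornerC.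
Qed.

(** Consider relations [q(x) * x ^ k = 0] with [q] monic. If the constant term of [q] is 0, a factor
    [x] moves to the power; if not, [q(x)] is a unit, since [x] has value 0. Either way a power of
    [x] is 0 in the end, and the ring is reduced. *)
Lemma integral_inj x : integral x -> ev x = 0 -> x = 0.
Proof.
move=> [p mp /rootP px] x0.
suff H n k (q : {poly FF}) : (size q <= n)%N -> q \is monic -> (map_poly jF q).[x] * x ^+ k = 0 -> x = 0.
  by apply: (H _ 0%N p (leqnn _)) => //; rewrite px mul0r.
elim: n k q => [|n IH] k q hq mq.
  by move: (monic_neq0 mq); rewrite -size_poly_eq0; move: hq; rewrite leqn0 => ->.
case: (eqVneq (size q) 1%N) => [/(monic_size1 mq) ->|/(monic_dec mq) [q' [c [mq' e sq]]]].
  by rewrite rmorph1 hornerC mul1r => /B_reducedX.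
rewrite e horner_monic_dec; case: (eqVneq c 0) => [->|c0].
  by rewrite rmorph0 addr0 -mulrA -exprS; apply: IH => //; lia.
have [|y hy] := @B_unit ((map_poly jF q').[x] * x + jF c).
  by rewrite rmorphD rmorphM /= x0 mulr0 add0r; apply: contraNneq c0 => /FF_inj ->.
by move=> /(congr1 ( *%R^~ y)); rewrite mulrAC hy mul1r mul0r => /B_reducedX.
Qed.

(** From [q'(x) * x + c = 0] with [c] nonzero, the inverse is [- q'(x) / c]; a zero constant term is
    removed beforehand by cancelling [x]. *)
Lemma integral_inverse x y : integral x -> x * y = 1 -> integral y.
Proof.
move=> ix; have [p mp /rootP px] := ix; move=> xy.
suff H n (q : {poly FF}) : (size q <= n)%N -> q \is monic -> (map_poly jF q).[x] = 0 -> integral y.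
  exact: (H _ p (leqnn _)).
elim: n q => [|n IH] q hq mq.
  by move: (monic_neq0 mq); rewrite -size_poly_eq0; move: hq; rewrite leqn0 => ->.
case: (eqVneq (size q) 1%N) => [/(monic_size1 mq) ->|/(monic_dec mq) [q' [c [mq' e sq]]]].
  by rewrite rmorph1 hornerC => /eqP; rewrite oner_eq0.
rewrite e horner_monic_dec; case: (eqVneq c 0) => [->|c0].
  rewrite rmorph0 addr0 => h; apply: (IH q') => //; first by lia.
  by rewrite -[LHS]mulr1 -xy mulrA h mul0r.
have [d cd] := FF_inv c0; have {}cd : jF c * jF d = 1 by rewrite -rmorphM cd rmorph1.
move=> h; have -> : y = jF (- d) * (map_poly jF q').[x].
  have e1 : jF c = - ((map_poly jF q').[x] * x) by apply/eqP; rewrite -addr_eq0 addrC h.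
  rewrite rmorphN; move: (jF d) (jF c) ((map_poly jF q').[x]) cd e1 => D C Q cd e1.
  have -> : y = C * D * y by rewrite cd mul1r.
  have -> : C * D * y = - D * Q * (x * y) by rewrite e1; ring.
  by rewrite xy mulr1.
apply: integral_mul; first exact: integral_id.
apply: integral_horner => //; apply/integral_poly => i; rewrite coef_map; exact: integral_id.
Qed.

(** The leading coefficient is integral and nonzero, so its value is nonzero by [integral_inj]; it
    is a unit with integral inverse, and the polynomial can be made monic. *)
Lemma integral_coef_root (p : {poly B}) x : p != 0 -> (forall i, integral p`_i) -> root p x -> integral x.
Proof.
move=> p0 hp /rootP px.
have [|y hy] := @B_unit (lead_coef p).
  apply: contraNneq p0 => h; rewrite -lead_coef_eq0; apply/eqP; exact: (integral_inj (hp _) h).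
apply: (@integral_root_monic _ _ _ x (y *: p)).
- rewrite monicE lead_coef_lreg; first by rewrite mulrC hy.
  by move=> a b /(congr1 ( *%R (lead_coef p))); rewrite !mulrA hy !mul1r.
- by apply/rootP; rewrite hornerZ px mulr0.
- apply/integral_poly => i; rewrite coefZ; apply: integral_mul => //.
  exact: integral_inverse (hp _) hy.
Qed.

Lemma integral_all i : (valid i -> integral (mk i)) /\ forall e, sml hn i e -> forall k, integral (clist i)`_k.
Proof.
elim: i => [n|i [IHi _] j [IHj _]|i [IHi _] j [IHj _]|l [_ IHl]|c [IHc _] l [_ IHl]]; split;
  try by move=> e _ k; rewrite nth_default //; exact: integral0.
- move=> _; have [y <-] : exists y : FF, jF y = mk (NS n); last exact: integral_id.
  apply: FFP_in; case: n => [|s].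
    by exists 'X, 1; rewrite oner_eq0 rmorph1 map_polyX hornerX hornerC mul1r.
  have [y hy] : exists y : SR, val y = nu s by apply: subRP; apply/(nb_im hn); exists s.
  exists y%:P, 1; rewrite oner_eq0 rmorph1 map_polyC !hornerC mul1r; split=> //.
  exact/esym/js_eq.
- move=> [u [v /clos_ainv [hi hj]]]; rewrite mkA //; exact: (integral_add (IHi hi) (IHj hj)).
- move=> [u [v /clos_ainv [hi hj]]]; rewrite mkM //; exact: (integral_mul (IHi hi) (IHj hj)).
- move=> vF; have [u [v /clos_ainv hl]] := vF; have hc := IHl _ hl.
  have vw := validF hl; have [_ e2] := mk_hnm vw hl.
  (* The coefficient of degree 1 has value below 1, so the polynomial minus ['X], of which the fixed
     point is a root, is not zero. *)
  have e3 : ev (clist l)`_1 < 1.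
    have : smalls [seq ev x | x <- clist l] (1 / 8).
      have := smlP hl; rewrite nu_q8; congr smalls.
      suff : forall e, sml hn l e -> pl hn l = [seq ev x | x <- clist l].
        by move/(_ q8); apply.
      elim: (l) => //= c _ l' IH e /valid_sml [vc /IH h].
      by rewrite /pl /= ev_mk // -h.
    case: (clist l) => [|a [|b s]] /=; rewrite ?nth_default ?rmorph0 ?ltr01 //=.
    by move=> [_ []]; rewrite ler_norml => /andP [_ h] _; lra.
  apply: (@integral_coef_root (Poly (clist l) - 'X)).
  - apply/eqP => /(congr1 (fun p : {poly B} => ev p`_1)); rewrite coefB coef_Poly coefX coef0 rmorphB rmorph1 rmorph0 /=.
    lra.
  - move=> i; rewrite coefB coef_Poly coefX; apply: integral_sub => //; exact: integral_nat.
  - by apply/rootP; rewrite !hornerE -e2 -mk_F // subrr.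
- by move=> [u [v /clos_ainv]].
- move=> e /valid_sml [vc hl] [|k] /=; [exact: IHc | exact: IHl hl k].
Qed.

(** Two names of one real differ, in the ring of names, by an integral element of value 0. *)
Lemma peq_complete i j : valid i -> valid j -> nv i = nv j -> peq i j.
Proof.
move=> vi vj e; apply/mkP => //; apply/eqP; rewrite -subr_eq0; apply/eqP; apply: integral_inj.
  by apply: integral_sub; apply: (integral_all _).1.
by rewrite rmorphB /= !ev_mk // e subrr.
Qed.
End EqNames.

Lemma RE_enum {T} {cT : cod T} (P : T -> Prop) x0 : RE P -> P x0 ->
  exists2 e : nat -> T, computable e & (forall n, P (e n)) /\ forall x, P x -> exists n, e n = x.
Proof.
move=> [Q hQ QP] h0.
pose D : nat -> T * nat := @dec _ (@cod_pair T nat cT cod_nat).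
have hD : computable D by apply: comp_dec; apply: comp_id.
exists (fun n => if `[< Q (D n).1 (D n).2 >] then (D n).1 else x0).
  by apply: comp_if; ctac.
split=> [n|x /QP [m hm]].
  by case: asboolP => // h; apply/QP; exists (D n).2.
by exists (@enc _ (@cod_pair T nat cT cod_nat) (x, m)); rewrite /D encK; case: asboolP.
Qed.

(** A false sum or product is refuted by exhibiting the true one and a strict inequality; the
    failure of [<] is confirmed by equality, read as the addition of zero, or by the opposite
    inequality. *)
Lemma numbered_of_RE S nu : racl S -> (forall r, S r <-> exists x, nu x = r) ->
  RE (fun y : nat * nat * nat => addV nu y.1.1 y.1.2 y.2) ->
  RE (fun y : nat * nat * nat => mulV nu y.1.1 y.1.2 y.2) ->
  RE (fun y : nat * nat => ltV nu y.1 y.2) -> numbered S nu.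
Proof.
move=> hS im ha hm hl; have [z hz] := (im 0).1 (racl0 hS).
have inS x : S (nu x) by apply/im; exists x.
split=> //; apply: decid_of_RE => //.
- apply: (RE_ext (P := fun y : nat * nat * nat => exists d, addV nu y.1.1 y.1.2 d /\ (ltV nu d y.2 \/ ltV nu y.2 d))); last by ctac.
  move=> [[a b] c] /=; rewrite /addV /ltV; split=> [[d [e h]] e'|h].
    by move: h; rewrite -e' e ltxx => -[].
  have [d hd] := (im _).1 (raclD hS (inS a) (inS b)); exists d; split=> //; rewrite hd.
  by case: (ltgtP (nu a + nu b) (nu c)) => // e; [left|right].
- apply: (RE_ext (P := fun y : nat * nat * nat => exists d, mulV nu y.1.1 y.1.2 d /\ (ltV nu d y.2 \/ ltV nu y.2 d))); last by ctac.
  move=> [[a b] c] /=; rewrite /mulV /ltV; split=> [[d [e h]] e'|h].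
    by move: h; rewrite -e' e ltxx => -[].
  have [d hd] := (im _).1 (raclM hS (inS a) (inS b)); exists d; split=> //; rewrite hd.
  by case: (ltgtP (nu a * nu b) (nu c)) => // e; [left|right].
- apply: (RE_ext (P := fun y : nat * nat => addV nu y.1 z y.2 \/ ltV nu y.2 y.1)); last first.
    by apply: RE_or; [apply: (RE_app3 (P := addV nu)) | apply: (RE_app2 (P := ltV nu))]; ctac.
  move=> [a b] /=; rewrite /addV /ltV hz addr0; case: (ltgtP (nu a) (nu b)) => h.
  + by split=> [[]|] //; move=> e; rewrite e ltxx in h.
  + by split=> // _; right.
  + by split=> // _; left.
Qed.

Lemma nderiv_near (p : {poly RR}) n x eps : 0 < eps -> exists2 d, 0 < d &
  forall q, `|q - x| < d -> forall i, (i < n)%N -> `|p^`N(i).[q] - p^`N(i).[x]| < eps.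
Proof.
move=> e0; elim: n => [|n [d d0 H]]; first by exists 1.
have [d' d0' H'] := horner_rec_near p^`N(n) x e0.
have [d1 d1p [l1 l2]] := min_pos d0 d0'; exists d1 => // q hq i.
rewrite ltnS leq_eqVlt => /orP [/eqP ->|h]; last by apply: H => //; lra.
by apply: H' => // [j _|]; rewrite ?subrr ?normr0 //; lra.
Qed.

(** * The extension is relatively closed and computable *)

Section Ext.
Variables (S : RR -> Prop) (nu : nat -> RR) (hn : numbered S nu).
Notation nv := (nval hn).
Notation valid := (valid hn).
Notation zS := (zS hn).

Definition Cset r := exists2 i, valid i & nv i = r.

Lemma Cset_S r : S r -> Cset r.
Proof. by move=> /(nb_im hn) [s <-]; exists (NS s.+1); [exact: validS|]. Qed.
Lemma Cset_tau : Cset (tau hn).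
Proof. by exists (NS 0); [exact: validS|]. Qed.

Lemma Cset_subf : subf Cset.
Proof.
split.
- by exists (oneS hn); [exact: validS | exact: nval_oneS].
- move=> _ _ [i vi <-] [j vj <-]; exists (NA i (NM (moneS hn) j)).
    by apply: validA => //; apply: validM => //; apply: validS.
  by rewrite nvalA nvalM nval_moneS mulN1r.
- by move=> _ _ [i vi <-] [j vj <-]; exists (NM i j); [exact: validM | exact: nvalM].
- move=> _ [i vi <-]; case: (eqVneq (nv i) 0) => [->|i0].
    by rewrite invr0; exists zS; [exact: validS | exact: nval_zS].
  have [|y hy] := @B_unit _ _ hn (mk hn i); first by rewrite ev_mk.
  exists (rp y); first exact: rp_valid.
  have := congr1 (@ev _ _ hn) hy; rewrite evM ev_mk // -/(ev y) (ev_mult hn).1.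
  by move=> h; apply: (mulfI i0); rewrite h divff.
Qed.

Lemma subf_sum (C : RR -> Prop) : subf C -> forall (x : RR) n, C x -> C (x *+ n).
Proof.
move=> [h1 hB _ _] x n hx; elim: n => [|n IH]; first by rewrite mulr0n -(subrr 1); apply: (hB _ _).
have h0 : C 0 by rewrite -(subrr 1); apply: (hB _ _).
by rewrite mulrS -[x *+ n]opprK; apply: (hB _ _) => //; rewrite -sub0r; apply: (hB _ _).
Qed.

Lemma subf_horner (C : RR -> Prop) (p : {poly RR}) x : subf C -> (forall i, C p`_i) -> C x -> C p.[x].
Proof.
move=> hC hp hx; have [y e] := subRP hC hx.
have [|q hq] := @poly_lift _ (val : {rmorphism subR hC -> RR}) p.
  by move=> i; apply: subRP.
by rewrite -hq -e horner_map; exact: subR_in.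
Qed.

(** As long as the root is multiple, the polynomial is replaced by its derivative. *)
Lemma simple_root (C : RR -> Prop) (p : {poly RR}) x : subf C -> (forall i, C p`_i) -> p != 0 -> root p x ->
  exists q : {poly RR}, [/\ forall i, C q`_i, root q x & q^`().[x] != 0].
Proof.
move=> hC; elim: {p}(size p) {-2}p (leqnn (size p)) => [|n IH] p hp cp p0 rp.
  by move: p0; rewrite -size_poly_eq0; move: hp; rewrite leqn0 => ->.
case: (eqVneq p^`().[x] 0) => [e|]; last by exists p.
have d0 : p^`() != 0.
  apply: contraTneq rp => d0; have e1 : p = (p`_0)%:P.
    apply/polyP => -[|i]; rewrite coefC //=; have /eqP := congr1 (fun q : {poly RR} => q`_i) d0.
    by rewrite coef_deriv coef0 mulrn_eq0 /= => /eqP.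
  by rewrite e1 rootC; apply: contraNneq p0 => e2; rewrite e1 e2.
apply: (IH p^`()) => //; last by apply/rootP.
  by have := lt_size_deriv p0; lia.
by move=> i; rewrite coef_deriv; apply: subf_sum.
Qed.

Lemma max_list (s : seq RR) : exists2 M, 0 < M & forall x, x \in s -> `|x| < M.
Proof.
elim: s => [|a s [M M0 IH]]; first by exists 1.
exists (M + `|a| + 1); first by have := normr_ge0 a; lra.
by move=> x; rewrite inE => /orP [/eqP ->|/IH]; have := normr_ge0 a; lra.
Qed.

(* A simple root [x] of [p] is [q + r z] with [z] the fixed point of the Newton-like map
   [z |-> z - p (q + r z) / (r p' (q))], for [q] close to [x] and [r] small. *)
Lemma Cset_racl : racl Cset.
Proof.
have hC := Cset_subf; have [h1 hB hM hV] := hC.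
split=> // p cp p0 x rp; have {p p0 cp rp} [p [cp /rootP px c0]] := simple_root hC cp p0 rp.
set c := p^`().[x] in c0.
(* Large enough for Taylor's formula, and at least 2, so that degrees 0 and 1 can be split off the
   sums. *)
pose n := (size p).+2.
have [M M0 HM] := max_list [seq p^`N(i).[x] | i <- iota 0 n].
have c1 : 0 < `|c| by rewrite normr_gt0.
(* The constants are chosen for the bound on [a i]: degree 0 is controlled by [p.[q]], hence by
   [e1]; degree 1 cancels; higher degrees carry a factor [r]. *)
have [r r0 [rl1 rl2]] : exists2 r, 0 < r & r <= 1 / 16 /\ r <= `|c| / (2048 * (M + 1)).
  by apply: min_pos; [lra | apply: divr_gt0 => //; lra].
have [r' /andP [r0' rl]] := nu_between hn r0.
have {rl1} rl1 : nu r' < 1 / 16 by lra.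
have {rl2} rl2 : nu r' < `|c| / (2048 * (M + 1)) by lra.
have {rl2} rl2 : 2048 * (M + 1) * nu r' < `|c| by move: rl2; rewrite ltr_pdivlMr; [lra | lra].
have [e1 e10 [el1 el2]] : exists2 e, 0 < e & e <= 1 /\ e <= nu r' * `|c| / 32.
  by apply: min_pos => //; rewrite divr_gt0 // mulr_gt0.
have {el2} [el2 el3] : e1 <= nu r' * `|c| / 32 /\ e1 <= `|c| / 2 by split=> //; nra.
have [d d0 Hd] := nderiv_near p n x e10.
have [d' d0' [dl1 dl2]] := min_pos d0 r0'.
have [q' hq'] := nu_dense hn x d0'.
(* From here on [r] and [q] are reals in [Cset], and their names are forgotten. *)
move: {d0 r0 d0' rl} (nu r') (nu q') (Cset_S ((nb_im hn _).2 (ex_intro _ r' erefl))) (Cset_S ((nb_im hn _).2 (ex_intro _ q' erefl))) r0' rl1 rl2 el2 dl2 hq' => {r q' r'}r q cr cq r0 rl1 rl2 el2 dl2 hq.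
have {Hd} Hd i : (i < n)%N -> `|p^`N(i).[q] - p^`N(i).[x]| < e1 by apply: Hd; lra.
have p0q : `|p.[q]| < e1 by have := Hd 0%N isT; rewrite poly.nderivn0 px subr0.
have p1q : `|c| / 2 < `|p^`().[q]|.
  have := Hd 1%N isT; rewrite poly.nderivn1 -/c => h.
  by have := lerB_dist c p^`().[q]; rewrite distrC in h; lra.
have piq i : (i < n)%N -> `|p^`N(i).[q]| < M + 1.
  move=> hi; have h2 := Hd i hi; have : `|p^`N(i).[x]| < M by apply: HM; apply/mapP; exists i; rewrite ?mem_iota.
  by have := ler_normD (p^`N(i).[q] - p^`N(i).[x]) p^`N(i).[x]; rewrite subrK; lra.
have q1 : p^`().[q] != 0 by rewrite -normr_gt0; lra.
have r1 : r != 0 by rewrite gt_eqF.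
pose a i := (i == 1%N)%:R - p^`N(i).[q] * r ^+ i / (r * p^`().[q]).
have ca i : Cset (a i).
  have cN j : Cset p^`N(j).[q].
    by apply: subf_horner => // k; rewrite coef_nderivn; apply: subf_sum.
  have cX j : Cset (r ^+ j) by elim: j => [|j IH]; rewrite ?expr0 // exprS; apply: (hM _ _).
  apply: (hB _ _); first by apply: subf_sum.
  by apply: (hM _ _); [apply: (hM _ _) | apply: (hV _); apply: (hM _ _) => //; rewrite -poly.nderivn1].
have ba i : (i < n)%N -> `|a i| * 8 ^+ i < 1 / 8.
  case: i => [|[|i]] hi; rewrite /a.
  - rewrite poly.nderivn0 !expr0 !mulr1 sub0r normrN normrM normfV normrM (gtr0_norm r0).
    rewrite ltr_pdivrMr; last by rewrite mulr_gt0 // normr_gt0.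
    apply: lt_le_trans p0q _; nra.
  - rewrite poly.nderivn1 expr1 [p^`().[q] * r]mulrC divff ?mulf_neq0 // subrr normr0 mul0r; lra.
  - have -> : (i.+2 == 1%N)%:R - p^`N(i.+2).[q] * r ^+ i.+2 / (r * p^`().[q]) =
      - (p^`N(i.+2).[q] * r * r ^+ i / p^`().[q]).
      by rewrite /= sub0r !exprS; congr (- _); field; rewrite q1 r1.
    rewrite normrN !normrM normfV (gtr0_norm r0) (ger0_norm (exprn_ge0 _ (ltW r0))).
    rewrite mulrAC ltr_pdivrMr ?normr_gt0 //.
    have -> : `|p^`N(i.+2).[q]| * r * r ^+ i * 8 ^+ i.+2 = `|p^`N(i.+2).[q]| * 64 * r * (r * 8) ^+ i.
      by rewrite exprMn !exprS; ring.
    have h1' : (r * 8) ^+ i <= 1 by apply: exprn_ile1; lra.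
    have h2 := piq _ hi; have h3 := normr_ge0 p^`N(i.+2).[q].
    apply: (@le_lt_trans _ _ (`|p^`N(i.+2).[q]| * 64 * r)).
      by apply: ler_piMr => //; apply: mulr_ge0; [lra|lra].
    apply: (@le_lt_trans _ _ ((M + 1) * 64 * r)); first by rewrite ler_pM2r //; lra.
    lra.
have /choice [f hf] : forall i, exists j, valid j /\ nv j = a i.
  by move=> i; have [j vj ej] := ca i; exists j.
pose cs := mkseq f n.
have scs : size cs = n by rewrite size_mkseq.
have hs : sml hn (mkl cs) (q8 hn).
  apply: smallsl => i; rewrite scs => hi; rewrite nth_mkseq //; have [v1 e] := hf i.
  by split=> //; rewrite e nu_q8; apply: ba.
pose z := (x - q) / r.
have hz : `|z| <= 1 by rewrite normrM normfV (gtr0_norm r0) ler_pdivrMr // mul1r distrC; lra.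
have epl : pl hn (mkl cs) = mkseq a n.
  by rewrite pl_mkl -map_comp; apply: eq_map => i /=; case: (hf i).
(* By Taylor's formula at [q] the left side is [z - p(x) / (r * p'(q))], and [p(x) = 0]. *)
have ez : horner_rec (mkseq a n) z = z.
  have -> : horner_rec (mkseq a n) z = \sum_(i < n) a i * z ^+ i.
    rewrite -horner_Poly -horner_poly; congr (_.[_]); apply/polyP => i.
    rewrite coef_Poly coef_poly; case: ltnP => h; first by rewrite nth_mkseq.
    by rewrite nth_default // size_mkseq.
  have -> : \sum_(i < n) a i * z ^+ i = \sum_(i < n) ((i == 1%N :> nat)%:R * z ^+ i) -
     (\sum_(i < n) p^`N(i).[q] * (r * z) ^+ i) / (r * p^`().[q]).
    rewrite mulr_suml -sumrB; apply: eq_bigr => i _; by rewrite /a [(r * z) ^+ i]exprMn mulrBl; congr (_ - _); rewrite mulrAC mulrA.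
  have sn : (size p <= n)%N by rewrite /n -addn2 leq_addr.
  rewrite -(@nderiv_taylor_wide _ n p q (r * z) (mulrC q (r * z)) sn).
  have -> : q + r * z = x by rewrite /z mulrC divfK // addrC subrK.
  rewrite px mul0r subr0 /n !big_ord_recl /= mul0r add0r mul1r expr1 big1 ?addr0 // => i _.
  by rewrite mul0r.
have ezf : nv (NF (mkl cs)) = z.
  rewrite -[LHS]/(fixp (pl hn (mkl cs))) epl; apply/esym; apply: fixp_uniq => //.
  by rewrite -epl; have := smlP hs; rewrite nu_q8.
have cz : Cset z by exists (NF (mkl cs)) => //; exact: validF.
have v4 : Cset (r * z) by exact: (hM _ _).
have -> : x = q + r * z by rewrite /z mulrC divfK // addrC subrK.
by rewrite -[r * z]opprK; apply: (hB _ _) => //; rewrite -sub0r; apply: (hB _ _) => //; rewrite -(subrr 1); apply: (hB _ _).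
Qed.

(** The numbering enumerates the valid names. Equality of values is enumerable as [peq], and strict
    order through bounds that separate the values; [numbered_of_RE] turns this into decidability. *)
Theorem extension : exists C nuC, [/\ numbered C nuC, (forall r, S r -> C r), (exists2 r, C r & ~ S r) &
  RE (fun y : nat * nat => nu y.1 = nuC y.2)].
Proof.
have v0 : valid zS by exact: validS.
have [e he [ev esurj]] := RE_enum (RE_valid hn) v0.
pose nuC n := nv (e n).
have heq := RE_peq hn; have hap := RE_appr hn; have hlt := nb_lt hn.
have eqP' i j : valid i -> valid j -> peq hn i j <-> nv i = nv j.
  by move=> vi vj; split; [exact: peq_sound | exact: peq_complete].
have im r : Cset r <-> exists x, nuC x = r.
  split=> [[i /esurj [n <-] <-]|[n <-]]; [by exists n | by exists (e n)].
exists Cset, nuC; split; first apply: numbered_of_RE => //.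
- exact: Cset_racl.
- apply: (RE_ext (P := fun y : nat * nat * nat => peq hn (NA (e y.1.1) (e y.1.2)) (e y.2))).
    by move=> [[a b] c] /=; rewrite eqP' //; apply: validA.
  by apply: (RE_app2 (P := peq hn)); ctac.
- apply: (RE_ext (P := fun y : nat * nat * nat => peq hn (NM (e y.1.1) (e y.1.2)) (e y.2))).
    by move=> [[a b] c] /=; rewrite eqP' //; apply: validM.
  by apply: (RE_app2 (P := peq hn)); ctac.
- apply: (RE_ext (P := fun y : nat * nat => exists u, exists v, exists u', exists v',
     (appr hn (e y.1) u v /\ appr hn (e y.2) u' v') /\ ~ ltV nu u' v)); last first.
    by ctac; apply: (RE_app3 (P := appr hn)); ctac.
  move=> [a b] /=; rewrite /ltV /nuC; split.
    move=> [u [v [u' [v' [[/apprP [_ h1] /apprP [h2 _]] /negP]]]]]; rewrite -leNgt => h.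
    by apply: lt_trans h1 _; apply: le_lt_trans h _.
  move=> h; pose m := (nv (e a) + nv (e b)) / 2.
  have [||u [v [h1 h2 h3]]] := validP (ev a) (a := nv (e a) - 1) (b := m); rewrite /m; [lra|lra|].
  have [||u' [v' [h1' h2' h3']]] := validP (ev b) (a := m) (b := nv (e b) + 1); rewrite /m; [lra|lra|].
  by exists u, v, u', v'; split=> //; apply/negP; rewrite -leNgt; rewrite /m in h3 h2'; lra.
- exact: Cset_S.
- by exists (tau hn); [exact: Cset_tau | exact: tau_notin].
- apply: (RE_ext (P := fun y : nat * nat => peq hn (NS y.1.+1) (e y.2))); last first.
    by apply: (RE_app2 (P := peq hn)); ctac.
  by move=> [s n]; apply: eqP' => //; exact: validS.
Qed.
End Ext.

(** * Algebraic closure and independence *)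

(** The closure is an intersection, so a property of its elements is obtained by showing that some
    relatively closed set has it; [algD_racl] supplies concrete such sets. *)
Definition acl (s : seq RR) (r : RR) := forall A, racl A -> (forall x, x \in s -> A x) -> A r.

Lemma acl_racl s : racl (acl s).
Proof.
split; first split.
- by move=> A [[h _ _ _] _] _; apply: h.
- by move=> x y hx hy A hA h; apply: (raclB hA); [apply: hx | apply: hy].
- by move=> x y hx hy A hA h; apply: (raclM hA); [apply: hx | apply: hy].
- by move=> x hx A hA h; apply: (raclV hA); apply: hx.
- move=> p hp p0 x rx A hA h; have [_ hr] := hA; apply: (hr p) => // i; exact: (hp i).
Qed.

Lemma acl_in s x : x \in s -> acl s x.
Proof. by move=> h A _; apply. Qed.
Lemma acl_sub s s' r : (forall x, x \in s -> acl s' x) -> acl s r -> acl s' r.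
Proof. by move=> h; apply => //; apply: acl_racl. Qed.

Section AlgClosure.
Variables (D : RR -> Prop) (D1 : D 1) (DB : forall x y, D x -> D y -> D (x - y))
  (DM : forall x y, D x -> D y -> D (x * y)).

Definition fracD r := exists a b, [/\ D a, D b, b != 0 & r = a / b].
Lemma fracD_subf : subf fracD.
Proof.
split.
- by exists 1, 1; rewrite oner_eq0 divr1.
- move=> _ _ [a [b [ha hb b0 ->]]] [c [d [hc hd d0 ->]]]; exists (a * d - c * b), (b * d).
  by split; rewrite ?mulf_neq0 //; [apply: DB; apply: DM | apply: DM | field; rewrite b0 d0].
- move=> _ _ [a [b [ha hb b0 ->]]] [c [d [hc hd d0 ->]]]; exists (a * c), (b * d).
  by split; rewrite ?mulf_neq0 //; [apply: DM | apply: DM | field; rewrite b0 d0].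
- move=> _ [a [b [ha hb b0 ->]]]; case: (eqVneq a 0) => [->|a0].
    by exists 0, 1; rewrite mul0r invr0 oner_eq0 mul0r -(subrr 1); split=> //; apply: DB.
  by exists b, a; rewrite invfM invrK mulrC.
Qed.

Lemma clear_denominators (p : {poly RR}) : (forall i, fracD p`_i) ->
  exists2 d, d != 0 & forall i, D (d *: p)`_i.
Proof.
move=> hp; have D0 : D 0 by rewrite -(subrr 1); apply: DB.
suff [d [d0 _ hd]] : exists d, [/\ d != 0, D d & forall i, (i < size p)%N -> D (d * p`_i)].
  exists d => // i; rewrite coefZ; case: (ltnP i (size p)) => [/hd //|h].
  by rewrite nth_default // mulr0.
elim: (size p) => [|n [d [d0 hd h]]]; first by exists 1; rewrite oner_eq0.
have [a [b [ha hb b0 e]]] := hp n; exists (d * b); rewrite mulf_neq0 //; split=> //; first exact: DM.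
move=> i; rewrite ltnS leq_eqVlt => /orP [/eqP ->|/h hi]; last by rewrite mulrAC; apply: DM.
have -> : d * b * p`_n = d * a by rewrite e; field.
exact: DM.
Qed.

Definition algD y := exists2 p : {poly RR}, p != 0 & (forall i, D p`_i) /\ root p y.

Lemma algD_id x : D x -> algD x.
Proof.
move=> hx; exists ('X - x%:P); first by rewrite polyXsubC_eq0.
rewrite root_XsubC eqxx; split=> // i; rewrite coefB coefX coefC.
have D0 : D 0 by rewrite -(subrr 1); apply: DB.
by apply: DB; [case: eqP | case: eqP].
Qed.

(** By clearing denominators, algebraic over the ring [D] and over its field of fractions are the
    same, and for a field the closure properties of algebraic and integral elements are
    available. *)
Lemma algD_racl : racl algD.
Proof.
have [F [j hj]] := subf_type fracD_subf.
have inF x : D x -> exists z, j z = x.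
  by move=> hx; apply/hj; exists x, 1; rewrite oner_eq0 divr1.
have E y : algD y <-> algebraicOver j y.
  split=> [[p p0 [hp ry]]|[p p0 ry]].
    have [|q hq] := @poly_lift _ j p; first by move=> i; apply: inF.
    by exists q; rewrite ?hq //; apply: contraNneq p0 => e; rewrite -hq e rmorph0.
  have [|d d0 hd] := @clear_denominators (map_poly j p).
    by move=> i; apply/hj; exists p`_i; rewrite coef_map.
  exists (d *: map_poly j p); last by split=> //; rewrite rootZ.
  by rewrite scaler_eq0 negb_or d0 map_poly_eq0.
split; first split.
- by apply: algD_id.
- by move=> x y /E hx /E hy; apply/E; apply: algebraic_sub.
- by move=> x y /E hx /E hy; apply/E; apply: algebraic_mul.
- by move=> x /E hx; apply/E; apply: algebraic_inv.
- move=> p hp p0 x rx; apply/E/integral_algebraic/(integral_root p0 rx)/integral_poly => i.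
  by apply/integral_algebraic/E.
Qed.
End AlgClosure.

(** Steinitz exchange. [y] is a root of a polynomial whose coefficients are values at [x] of
    polynomials over the closure of [s]. Reordering the double sum by powers of [x] gives a
    polynomial for [x] with coefficients in the closure of [y :: s]; were it zero, then, [y] being
    outside the closure of [s], all inner coefficients would vanish. *)
Lemma exchange s x y : acl (x :: s) y -> ~ acl s y -> acl (y :: s) x.
Proof.
move=> hy ny; have hF := acl_racl s; have hFs := proj1 hF; have hY := acl_racl (y :: s).
pose D r := exists2 P : {poly RR}, (forall i, acl s P`_i) & r = P.[x].
have D1 : D 1 by exists 1; rewrite ?hornerC // => i; rewrite coef1; case: eqP => _; [exact: (racl1 hF) | exact: (racl0 hF)].
have DB u v : D u -> D v -> D (u - v).
  move=> [P hP ->] [Q hQ ->]; exists (P - Q); rewrite ?hornerE // => i.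
  by rewrite coefB; apply: (raclB hF).
have DM u v : D u -> D v -> D (u * v).
  move=> [P hP ->] [Q hQ ->]; exists (P * Q); rewrite ?hornerE // => i.
  rewrite coefM; elim/big_ind: _ => [|a b|k _]; [exact: (racl0 hF) | exact: (raclD hF) | exact: (raclM hF)].
have [p p0 [hp ry]] : algD D y.
  apply: hy; first exact: algD_racl.
  move=> z; rewrite inE => /orP [/eqP ->|hz]; apply: algD_id => //.
    by exists 'X; rewrite ?hornerX // => i; rewrite coefX; case: eqP => _; [exact: (racl1 hF) | exact: (racl0 hF)].
  by exists z%:P; rewrite ?hornerC // => i; rewrite coefC; case: eqP => _; [exact: acl_in | exact: (racl0 hF)].
have /choice [P hP] : forall i, exists P : {poly RR}, (forall k, acl s P`_k) /\ p`_i = P.[x].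
  by move=> i; have [Pi h e] := hp i; exists Pi.
pose N := \max_(i < size p) size (P i).
have szP (i : 'I_(size p)) : (size (P i) <= N)%N by apply: (leq_bigmax (F := fun i : 'I__ => size (P i))).
pose col k := \poly_(i < size p) (P i)`_k.
pose q := \poly_(k < N) (col k).[y].
have qx : q.[x] = 0.
  rewrite horner_poly; under eq_bigr do rewrite horner_poly mulr_suml.
  rewrite exchange_big /=; move/rootP: ry; rewrite horner_coef => e; rewrite -[RHS]e.
  apply: eq_bigr => i _; have [_ ->] := hP i; rewrite (horner_coef_wide x (szP i)) mulr_suml.
  by apply: eq_bigr => k _; rewrite mulrAC.
have colS k i : acl s (col k)`_i.
  by rewrite coef_poly; case: ifP => _; [case: (hP i) | exact: (racl0 hF)].
case: hY => _; apply; last by apply/rootP; exact: qx.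
  move=> k; rewrite coef_poly; case: ifP => _; last exact: (racl0 (acl_racl _)).
  apply: (@subf_horner (acl (y :: s))); first by case: (acl_racl (y :: s)).
    by move=> i; apply: acl_sub (colS k i) => z hz; apply: acl_in; rewrite inE hz orbT.
  by apply: acl_in; rewrite inE eqxx.
apply: contraNneq p0 => q0.
have c0 k : (k < N)%N -> col k = 0.
  move=> hk; apply/eqP; case: eqP => // /eqP nk; exfalso; apply: ny.
  have [_ hr] := hF; apply: (hr _ (colS k) nk); apply/rootP.
  by have := congr1 (fun r : {poly RR} => r`_k) q0; rewrite coef_poly coef0 hk.
rewrite -size_poly_eq0; case sp: (size p) => [|m] //; exfalso.
have hm : (m < size p)%N by rewrite sp.
have /eqP : lead_coef p = 0.
  rewrite lead_coefE sp /=; have [_ ->] := hP m; rewrite (horner_coef_wide x (szP (Ordinal hm))).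
  rewrite big1 // => k _; have := congr1 (fun r : {poly RR} => r`_m) (c0 k (ltn_ord k)).
  by rewrite coef_poly hm coef0 => ->; rewrite mul0r.
by rewrite lead_coef_eq0 -size_poly_eq0 sp.
Qed.

(** * Independent lists and their size *)

Fixpoint indep_over (B t : seq RR) := if t is y :: t' then ~ acl (t' ++ B) y /\ indep_over B t' else True.
Definition indep := indep_over [::].

(** If an entry becomes dependent when [x] joins the base, it is dropped, and by [exchange] [x] lies
    in the closure of the old list. The inclusion of closures keeps the entries in front independent
    during the induction. *)
Lemma indep_add B x t : indep_over B t -> indep_over (x :: B) t \/
  exists t', [/\ size t = (size t').+1, indep_over (x :: B) t', {subset t' <= t} &
    forall r, acl (t' ++ x :: B) r -> acl (t ++ B) r].
Proof.
elim: t => [|y t IH] /=; first by left.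
move=> [hy /IH [ht|[t' [e1 e2 e4 e3]]]].
  case: (pselect (acl (t ++ x :: B) y)) => h; last by left.
  right; exists t; split=> // [z hz|r]; first by rewrite inE hz orbT.
  have hx : acl (y :: t ++ B) x.
    apply: exchange hy; apply: acl_sub h => z; rewrite mem_cat inE => hz; apply: acl_in.
    by rewrite inE mem_cat orbCA.
  apply: acl_sub => z; rewrite mem_cat inE => /or3P [hz|/eqP -> //|hz];
    by apply: acl_in; rewrite inE mem_cat hz ?orbT.
right; exists (y :: t'); split=> //=; first by rewrite e1.
- by split=> // /e3.
- by move=> z; rewrite !inE => /orP [->//|/e4 ->]; rewrite orbT.
move=> r; apply: acl_sub => z; rewrite inE => /orP [/eqP ->|hz].
  by apply: acl_in; rewrite inE eqxx.
have /e3 : acl (t' ++ x :: B) z by apply: acl_in.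
by apply: acl_sub => w hw; apply: acl_in; rewrite inE hw orbT.
Qed.

(** The generators in [s] are moved to the base one by one; each move costs at most one entry of
    [t]. *)
Lemma indep_size B s t : indep_over B t -> (forall y, y \in t -> acl (s ++ B) y) -> (size t <= size s)%N.
Proof.
elim: s B t => [|x s IH] B t ht hs.
  case: t ht hs => //= y t [hy _] /(_ y); rewrite inE eqxx => /(_ isT) h; exfalso; apply: hy.
  by apply: acl_sub h => z hz; apply: acl_in; rewrite mem_cat hz orbT.
have hs' y : y \in t -> acl (s ++ x :: B) y.
  move=> /hs; apply: acl_sub => z hz; apply: acl_in.
  by move: hz; rewrite /= !(inE, mem_cat) orbCA.
have [h|[t' [-> h2 h3 _]]] := indep_add x ht; first by apply: leq_trans (IH _ _ h hs') _.
by rewrite ltnS; apply: (IH (x :: B)) => // y /h3 /hs'.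
Qed.

(** The last index comes first: the head of the list is then the last variable, which is the one
    singled out by [muni]. *)
Fixpoint rseq {T : Type} (x : nat -> T) n := if n is n'.+1 then x n' :: rseq x n' else [::].
Lemma size_rseq T (x : nat -> T) n : size (rseq x n) = n.
Proof. by elim: n => //= n ->. Qed.
Lemma mem_rseq (x : nat -> RR) n i : (i < n)%N -> x i \in rseq x n.
Proof.
elim: n => // n IH; rewrite ltnS leq_eqVlt inE => /orP [/eqP ->|/IH ->]; rewrite ?eqxx ?orbT //.
Qed.
Lemma rseqP (x : nat -> RR) n r : r \in rseq x n -> exists2 i, (i < n)%N & r = x i.
Proof.
elim: n => // n IH; rewrite inE => /orP [/eqP ->|/IH [i hi e]]; first by exists n.
by exists i => //; apply: ltnW.
Qed.

(** * Comparison with algebraic independence by polynomials *)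

Section AlgIndep.
Variable x : nat -> RR.
Definition pev n (p : {mpoly rat[n]}) : RR := mmap ratr (fun i : 'I_n => x i) p.
HB.instance Definition _ n := GRing.RMorphism.copy (@pev n) (mmap (ratr : rat -> RR) (fun i : 'I_n => x i)).

Lemma pev_acl n p : acl (rseq x n) (@pev n p).
Proof.
have hF := acl_racl (rseq x n).
rewrite /pev /mmap; elim/big_ind: _ => [|a b|m _]; [exact: (racl0 hF) | exact: (raclD hF) | ].
apply: (raclM hF); first exact: E_rat.
rewrite /mmap1; elim/big_ind: _ => [|a b|i _]; [exact: (racl1 hF) | exact: (raclM hF) | ].
have hi : acl (rseq x n) (x i) by apply: acl_in; apply: mem_rseq.
by elim: (m i) => [|k IH]; rewrite ?expr0 ?exprS; [exact: (racl1 hF) | exact: (raclM hF)].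
Qed.

Lemma pevX n (m : 'X_{1..n}) : @pev n 'X_[m] = \prod_(i < n) x i ^+ m i.
Proof. by rewrite /pev mmapX. Qed.
Lemma pevZ n c (p : {mpoly rat[n]}) : pev (c *: p) = ratr c * pev p.
Proof. by rewrite /pev mmapZ. Qed.

Lemma pev_muni n (p : {mpoly rat[n.+1]}) : pev p = (map_poly (@pev n) (muni p)).[x n].
Proof.
rewrite muniE rmorph_sum /= horner_sum; apply: eq_bigr => m _.
rewrite !map_polyZ /= map_polyXn !hornerZ hornerXn pevZ pevX /mmap1 big_ord_recr /= mulrA.
by congr (_ * _ * _); apply: eq_bigr => i _; rewrite mnmE.
Qed.

Lemma muniX n (m : 'X_{1..n.+1}) :
  muni ('X_[m] : {mpoly rat[n.+1]}) = 'X_[[multinom (m (widen_ord (leqnSn n) i)) | i < n]] *: 'X^(m ord_max).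
Proof. by rewrite muniE msuppX big_seq1 mcoeffX eqxx scale1r. Qed.

Lemma muni_mwiden n (c : {mpoly rat[n]}) : muni (mwiden c) = c%:P.
Proof.
rewrite (mwidenE (leqnn (msize c))) rmorph_sum /= [X in _ = X%:P](mpolywE (leqnn (msize c))) rmorph_sum /=.
apply: eq_bigr => m _; rewrite muniZ muniX mnmwiden_ordmax expr0 -!mul_polyC mulr1.
rewrite -polyCM mul_mpolyC; congr (_ *: _)%:P; congr 'X_[_]; apply/mnmP => i.
by rewrite mnmE mnmwiden_widen.
Qed.

Lemma muni_mmulti n (q : {poly {mpoly rat[n]}}) : muni (mmulti q) = q.
Proof.
rewrite /mmulti rmorph_sum /= -[RHS]coefK poly_def; apply: eq_bigr => i _.
rewrite rmorphM rmorphXn /= muni_mwiden muniX mnm1E eqxx expr1 -mul_polyC; congr (_ * _).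
have -> : [multinom (U_(ord_max)%MM (widen_ord (leqnSn n) k)) | k < n] = 0%MM.
  by apply/mnmP => k; rewrite mnmE mnm1E mnm0E -val_eqE /= gtn_eqF.
by rewrite mpolyX0 scale1r.
Qed.

(** All coefficients of [p] can be read off [muni p], which shows that [muni] has trivial kernel. *)
Lemma muni_coef n (p : {mpoly rat[n.+1]}) (m : 'X_{1..n.+1}) :
  ((muni p)`_(m ord_max))@_[multinom (m (widen_ord (leqnSn n) i)) | i < n] = p@_m.
Proof.
rewrite muniE coef_sum raddf_sum /= (eq_bigr (fun k => p@_k * (k == m)%:R)).
  case: (boolP (m \in msupp p)) => hm; last first.
    rewrite (memN_msupp_eq0 hm) big1_seq // => k /andP [_ hk].
    by case: eqP hm => [<-|_ _]; rewrite ?hk // mulr0.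
  rewrite (bigD1_seq m) ?msupp_uniq //= eqxx mulr1 big1 ?addr0 // => k /negbTE ->.
  by rewrite mulr0.
move=> k _; rewrite coefZ coefXn.
case: (eqVneq k m) => [->|km]; first by rewrite eqxx mulr1 mcoeffZ mcoeffX eqxx mulr1.
case: eqP => e; last by rewrite mulr0 mcoeff0 mulr0.
rewrite mulr1 mcoeffZ mcoeffX; case: eqP => // e'; case/eqP: km; apply/mnmP => i.
case: (unliftP ord_max i) => [j ->|->] //.
have := congr1 (fun q : 'X_{1..n} => q j) e'; rewrite !mnmE; congr (_ = _); congr (fun_of_multinom _ _);
  by apply: val_inj; rewrite /= /bump leqNgt ltn_ord.
Qed.

(** Induction on the number of variables, through polynomials in the last variable over those in the
    others. A dependence of [x n] on the earlier reals becomes a polynomial relation because, by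
    [algD_racl], their closure consists of reals algebraic over their polynomial values. *)
Lemma alg_indepP n : alg_indep (fun i : 'I_n => x i) <-> indep (rseq x n).
Proof.
elim: n => [|n IH].
  split=> // _ p; rewrite -[mmap _ _ p]/(pev p) => h.
  apply/mpolyP => m; have e k : k = 0%MM :> 'X_{1..0} by apply/mnmP => -[].
  have : p = (p@_0)%:MP.
    by apply/mpolyP => k; rewrite (e k) mcoeffC eqxx mulr1.
  move=> ep; move: h; rewrite ep /pev mmapC => /eqP; rewrite fmorph_eq0 => /eqP ->.
  by rewrite mpolyC0.
rewrite /indep /= -/indep cats0 -IH; split.
  move=> h; split; last first.
    move=> p hp; apply: inj_mwiden; rewrite mwiden0; apply: h.
    by rewrite -[LHS]/(pev (mwiden p)) pev_muni muni_mwiden map_polyC hornerC.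
  pose D r := exists p : {mpoly rat[n]}, pev p = r.
  have D1 : D 1 by exists 1; rewrite rmorph1.
  have DB u v : D u -> D v -> D (u - v) by move=> [p <-] [q <-]; exists (p - q); rewrite rmorphB.
  have DM u v : D u -> D v -> D (u * v) by move=> [p <-] [q <-]; exists (p * q); rewrite rmorphM.
  move=> /(_ _ (algD_racl D1 DB DM)) [|q q0 [hq rq]].
    move=> _ /rseqP [i hi ->]; apply: algD_id => //; exists 'X_(Ordinal hi).
    by rewrite /pev mmapX mmap1U.
  have [P hP] := @poly_lift _ (@pev n) q hq.
  have : mmulti P = 0.
    apply: h; rewrite -[LHS]/(pev (mmulti P)) pev_muni muni_mmulti.
    by apply/rootP; rewrite hP.
  move=> /(congr1 (@muni _ _)); rewrite muni_mmulti muni0 => P0.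
  by move: q0; rewrite -hP P0 rmorph0 eqxx.
move=> [hx hn] p; rewrite -[mmap _ _ p]/(pev p) pev_muni => hp.
suff : muni p = 0.
  by move=> m0; apply/mpolyP => m; rewrite -muni_coef m0 coef0 !mcoeff0.
apply/polyP => i; rewrite coef0; apply: hn.
have q0 : map_poly (@pev n) (muni p) = 0.
  apply/eqP; case: eqP => // /eqP q0; exfalso; apply: hx.
  have [_ hr] := acl_racl (rseq x n); apply: (hr _ _ q0); last by apply/rootP.
  by move=> k; rewrite coef_map; apply: pev_acl.
by have := congr1 (fun q : {poly RR} => q`_i) q0; rewrite coef_map coef0.
Qed.
End AlgIndep.

Lemma alg_indep_embed (R : rcfType) (j : {rmorphism R -> RR}) n (y : nat -> R) :
  alg_indep (fun i : 'I_n => y i) <-> indep (rseq (j \o y) n).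
Proof.
rewrite -alg_indepP; suff E (p : {mpoly rat[n]}) :
    mmap ratr (fun i : 'I_n => j (y i)) p = j (mmap ratr (fun i : 'I_n => y i) p).
  split=> h p hp; apply: h; first by apply: (fmorph_inj j); rewrite -E rmorph0.
  by rewrite E hp rmorph0.
rewrite /mmap rmorph_sum; apply: eq_bigr => m _; rewrite rmorphM fmorph_rat; congr (_ * _).
by rewrite /mmap1 rmorph_prod; apply: eq_bigr => i _; rewrite rmorphXn.
Qed.

Lemma rseq_eq (u v : nat -> RR) n : (forall i, (i < n)%N -> u i = v i) -> rseq u n = rseq v n.
Proof. by elim: n => //= n IH h; rewrite h // IH // => i hi; apply: h; apply: ltnW. Qed.

Lemma rseq_surj (t : seq RR) : exists u, rseq u (size t) = t.
Proof.
elim: t => [|y t [u hu]]; first by exists (fun=> 0).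
exists (fun i => if i == size t then y else u i); rewrite /= eqxx; congr (_ :: _).
by rewrite -[RHS]hu; apply: rseq_eq => i hi; rewrite ltn_eqF.
Qed.

Lemma indep_embed (R : rcfType) (j : {rmorphism R -> RR}) n :
  (exists x : 'I_n -> R, alg_indep x) <->
  exists t : seq RR, [/\ size t = n, (forall r, r \in t -> exists y, j y = r) & indep t].
Proof.
split=> [[x hx]|[t [<- ht it]]].
  pose y i := oapp x 0 (insub i); exists (rseq (j \o y) n); rewrite size_rseq; split=> //.
    by move=> _ /rseqP [i _ ->]; exists (y i).
  apply/alg_indep_embed; suff -> : (fun i : 'I_n => y i) = x by [].
  by apply: funext => i; rewrite /y valK.
have [u hu] := rseq_surj t.
have /choice [z hz] : forall i, exists z, (i < size t)%N -> j z = u i.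
  move=> i; case: (ltnP i (size t)) => h; last by exists 0.
  by have [|z hz] := ht (u i); [rewrite -hu mem_rseq | exists z].
exists (fun i => z i); apply/alg_indep_embed; rewrite (@rseq_eq _ u) ?hu // => i hi; exact: hz.
Qed.

(** * Relations enumerable uniformly in the index *)

Local Close Scope ring_scope.
Definition lit (a : nat) (l : literal) := phi a (literal_code l) 1.
Definition DomA a x := lit a (LPos (AEq (TC x) (TC x))).
Definition ZeroA a x := lit a (LPos (AEq (TC x) T0)).
Definition NzA a x := lit a (LNeg (AEq (TC x) T0)).
Definition OneA a x := lit a (LPos (AEq (TC x) T1)).
Definition AddA a x y z := lit a (LPos (AEq (TAdd (TC x) (TC y)) (TC z))).
Definition MulA a x y z := lit a (LPos (AEq (TMul (TC x) (TC y)) (TC z))).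
Definition LtA a x y := lit a (LNeg (ALe (TC y) (TC x))).
(** Comparison with the rational [(r - q) / p], written with natural numerals only; [q] accounts for
    negative rationals. *)
Definition cut_lit x p q r := ALe (TAdd (TMul (num p) (TC x)) (num q)) (num r).
Definition CutA a x p q r := lit a (LPos (cut_lit x p q r)).
Definition NcutA a x p q r := lit a (LNeg (cut_lit x p q r)).
Definition DiffA a x a' x' := exists p, exists q, exists r,
  (CutA a x p q r /\ NcutA a' x' p q r) \/ (NcutA a x p q r /\ CutA a' x' p q r).

Section TermComp.
Variables (T : Type) (cT : cod T).
Lemma comp_tTC (f : T -> nat) : computable f -> computable (fun y => tstr (TC (f y))).
Proof. by move=> hf; apply: (comp_app (g := fun n => tstr (TC n))); ctac. Qed.
Lemma comp_tnum (f : T -> nat) : computable f -> computable (fun y => tstr (num (f y))).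
Proof. by move=> hf; apply: (comp_app (g := fun n => tstr (num n))); ctac. Qed.
Lemma comp_node2 k (v w : T -> seq nat) : computable v -> computable w -> computable (fun y => node k (v y ++ w y)).
Proof. by move=> hv hw; ctac. Qed.
Lemma RE_litcode b k (v w : T -> seq nat) (f : T -> nat) : computable f -> computable v -> computable w ->
  RE (fun y => phi (f y) (litcode b k (v y) (w y)) 1).
Proof.
move=> hf hv hw; have h := RE_phi; apply: (RE_app3 (P := phi)) => //; last exact: comp_const.
by rewrite /litcode /atstr; ctac.
Qed.
Lemma comp_tadd (t u : T -> term) : computable (fun y => tstr (t y)) -> computable (fun y => tstr (u y)) ->
  computable (fun y => tstr (TAdd (t y) (u y))).
Proof.
move=> ht hu; apply: (comp_ext (f := fun y => node 3 (tstr (t y) ++ tstr (u y)))); last exact: comp_node2.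
by move=> y; rewrite [RHS]tstrE.
Qed.
Lemma comp_tmul (t u : T -> term) : computable (fun y => tstr (t y)) -> computable (fun y => tstr (u y)) ->
  computable (fun y => tstr (TMul (t y) (u y))).
Proof.
move=> ht hu; apply: (comp_ext (f := fun y => node 4 (tstr (t y) ++ tstr (u y)))); last exact: comp_node2.
by move=> y; rewrite [RHS]tstrE.
Qed.
Lemma RE_litE (t u : T -> term) (f : T -> nat) : computable f ->
  computable (fun y => tstr (t y)) -> computable (fun y => tstr (u y)) ->
  RE (fun y => lit (f y) (LPos (AEq (t y) (u y)))).
Proof.
move=> hf ht hu; apply: RE_ext (RE_litcode 0 0 hf ht hu) => y.
by rewrite /lit literal_codeE.
Qed.
Lemma RE_litLe (t u : T -> term) (f : T -> nat) : computable f ->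
  computable (fun y => tstr (t y)) -> computable (fun y => tstr (u y)) ->
  RE (fun y => lit (f y) (LPos (ALe (t y) (u y)))).
Proof.
move=> hf ht hu; apply: RE_ext (RE_litcode 0 1 hf ht hu) => y.
by rewrite /lit literal_codeE.
Qed.
Lemma RE_litNE (t u : T -> term) (f : T -> nat) : computable f ->
  computable (fun y => tstr (t y)) -> computable (fun y => tstr (u y)) ->
  RE (fun y => lit (f y) (LNeg (AEq (t y) (u y)))).
Proof.
move=> hf ht hu; apply: RE_ext (RE_litcode 1 0 hf ht hu) => y.
by rewrite /lit literal_codeE.
Qed.
Lemma RE_litNLe (t u : T -> term) (f : T -> nat) : computable f ->
  computable (fun y => tstr (t y)) -> computable (fun y => tstr (u y)) ->
  RE (fun y => lit (f y) (LNeg (ALe (t y) (u y)))).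
Proof.
move=> hf ht hu; apply: RE_ext (RE_litcode 1 1 hf ht hu) => y.
by rewrite /lit literal_codeE.
Qed.
End TermComp.

Ltac term_step := cbv beta; lazymatch goal with
  | |- computable (fun y => tstr (TC (@?f y))) => apply: (comp_tTC (f := f)); by ctac
  | |- computable (fun y => tstr (num (@?f y))) => apply: (comp_tnum (f := f)); by ctac
  | |- computable (fun y => tstr (TAdd (@?t y) (@?u y))) => apply: (comp_tadd (t := t) (u := u))
  | |- computable (fun y => tstr (TMul (@?t y) (@?u y))) => apply: (comp_tmul (t := t) (u := u))
  | |- computable (fun y => tstr T0) => exact: (comp_const (tstr T0))
  | |- computable (fun y => tstr T1) => exact: (comp_const (tstr T1))
  end.
Ltac lit_solve := lazymatch goal with
  | |- RE (fun y => lit (@?f y) (LPos (AEq (@?t y) (@?u y)))) => apply: (RE_litE (t := t) (u := u) (f := f))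
  | |- RE (fun y => lit (@?f y) (LPos (ALe (@?t y) (@?u y)))) => apply: (RE_litLe (t := t) (u := u) (f := f))
  | |- RE (fun y => lit (@?f y) (LNeg (AEq (@?t y) (@?u y)))) => apply: (RE_litNE (t := t) (u := u) (f := f))
  | |- RE (fun y => lit (@?f y) (LNeg (ALe (@?t y) (@?u y)))) => apply: (RE_litNLe (t := t) (u := u) (f := f))
  end; [by ctac | repeat term_step | repeat term_step].

Lemma RE_DomA : RE (fun y : nat * nat => DomA y.1 y.2).
Proof. rewrite /DomA; lit_solve. Qed.
Lemma RE_ZeroA : RE (fun y : nat * nat => ZeroA y.1 y.2).
Proof. rewrite /ZeroA; lit_solve. Qed.
Lemma RE_NzA : RE (fun y : nat * nat => NzA y.1 y.2).
Proof. rewrite /NzA; lit_solve. Qed.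
Lemma RE_OneA : RE (fun y : nat * nat => OneA y.1 y.2).
Proof. rewrite /OneA; lit_solve. Qed.
Lemma RE_LtA : RE (fun y : nat * nat * nat => LtA y.1.1 y.1.2 y.2).
Proof. rewrite /LtA; lit_solve. Qed.
Lemma RE_AddA : RE (fun y : nat * nat * nat * nat => AddA y.1.1.1 y.1.1.2 y.1.2 y.2).
Proof. rewrite /AddA; lit_solve. Qed.
Lemma RE_MulA : RE (fun y : nat * nat * nat * nat => MulA y.1.1.1 y.1.1.2 y.1.2 y.2).
Proof. rewrite /MulA; lit_solve. Qed.
Lemma RE_DiffA : RE (fun y : nat * nat * nat * nat => DiffA y.1.1.1 y.1.1.2 y.1.2 y.2).
Proof.
have h1 : RE (fun y : nat * nat * nat * nat * nat => CutA y.1.1.1.1 y.1.1.1.2 y.1.1.2 y.1.2 y.2).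
  rewrite /CutA /cut_lit; lit_solve.
have h2 : RE (fun y : nat * nat * nat * nat * nat => NcutA y.1.1.1.1 y.1.1.1.2 y.1.1.2 y.1.2 y.2).
  rewrite /NcutA /cut_lit; lit_solve.
have g1 (T : Type) (cT : cod T) (f g h k l : T -> nat) : computable f -> computable g -> computable h ->
    computable k -> computable l -> RE (fun y => CutA (f y) (g y) (h y) (k y) (l y)).
  by move=> *; apply: (RE_app1 (f := fun y => (f y, g y, h y, k y, l y)) h1); ctac.
have g2 (T : Type) (cT : cod T) (f g h k l : T -> nat) : computable f -> computable g -> computable h ->
    computable k -> computable l -> RE (fun y => NcutA (f y) (g y) (h y) (k y) (l y)).
  by move=> *; apply: (RE_app1 (f := fun y => (f y, g y, h y, k y, l y)) h2); ctac.
rewrite /DiffA; do 3!apply: RE_ex.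
by apply: RE_or; [apply: RE_and; [apply: g1|apply: g2] | apply: RE_and; [apply: g2|apply: g1]]; ctac.
Qed.

(** * Meaning of these relations on a presentation *)

Section IndexSem.
Local Open Scope ring_scope.
Variables (S : RR -> Prop) (a : nat) (M : nstruct) (f : nat -> RR).
Hypotheses (wM : wf_struct M) (iM : index_of a M) (hM : isoS M S f).

Lemma litP l : lit a l <-> literal_consts_in M l /\ literal_holds M l.
Proof.
have [h1 h2] := iM (literal_code l); split=> [h|h]; last by apply: h1; exists l.
case: (pselect (diagram M (literal_code l))) => [[l' [/literal_code_inj -> //]]|/h2 h'].
by have := phi_det h h'.
Qed.

Lemma teval_in_dom t : term_consts_in M t -> ndom M (teval M t).
Proof.
have [w0 [w1 [wA [wM' wN]]]] := wM.
by elim: t => //= [t IHt u IHu|t IHt u IHu|t IHt] => [[/IHt ht /IHu hu]|[/IHt ht /IHu hu]|/IHt];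
  [apply: wA | apply: wM' | apply: wN].
Qed.

Lemma DomAP x : DomA a x <-> ndom M x.
Proof. by rewrite /DomA litP /=; tauto. Qed.
Lemma ZeroAP x : ZeroA a x <-> ndom M x /\ f x = 0.
Proof.
have [w0 _] := wM; rewrite /ZeroA litP /= -(isoS_0 hM); split=> [[[h _] ->]|[h /(isoS_inj hM) e]] //.
by split=> //; apply: e.
Qed.
Lemma NzAP x : NzA a x <-> ndom M x /\ f x <> 0.
Proof.
have [w0 _] := wM; rewrite /NzA litP /= -(isoS_0 hM); split=> [[[h _] h']|[h h']]; split=> //.
  by move=> /(isoS_inj hM) e; apply: h'; apply: e.
by move=> e; apply: h'; rewrite e.
Qed.
Lemma OneAP x : OneA a x <-> ndom M x /\ f x = 1.
Proof.
have [_ [w1 _]] := wM; rewrite /OneA litP /= -(isoS_1 hM); split=> [[[h _] ->]|[h /(isoS_inj hM) e]] //.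
by split=> //; apply: e.
Qed.
Lemma AddAP x y z : AddA a x y z <-> [/\ ndom M x, ndom M y, ndom M z & f x + f y = f z].
Proof.
have [_ [_ [wA _]]] := wM; rewrite /AddA litP /=; split=> [[[[hx hy] hz] <-]|[hx hy hz]].
  by split=> //; [apply: wA | rewrite (isoS_D hM)].
by rewrite -(isoS_D hM) // => /(isoS_inj hM) e; split=> //; apply: e => //; apply: wA.
Qed.
Lemma MulAP x y z : MulA a x y z <-> [/\ ndom M x, ndom M y, ndom M z & f x * f y = f z].
Proof.
have [_ [_ [_ [wA _]]]] := wM; rewrite /MulA litP /=; split=> [[[[hx hy] hz] <-]|[hx hy hz]].
  by split=> //; [apply: wA | rewrite (isoS_M hM)].
by rewrite -(isoS_M hM) // => /(isoS_inj hM) e; split=> //; apply: e => //; apply: wA.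
Qed.
Lemma LtAP x y : LtA a x y <-> [/\ ndom M x, ndom M y & f x < f y].
Proof.
rewrite /LtA litP /=; split=> [[[hy hx] h]|[hx hy h]].
  by split=> //; rewrite ltNge; apply/negP => /(isoS_le hM hy hx).
by split=> // /(isoS_le hM hy hx); rewrite leNgt h.
Qed.

Lemma numP k : term_consts_in M (num k) /\ f (teval M (num k)) = k%:R.
Proof.
elim: k => [|k [h1 h2]] /=; first by rewrite (isoS_0 hM).
have [_ [w1 _]] := wM; split=> //.
by rewrite (isoS_D hM) ?h2 ?(isoS_1 hM) ?mulrS //; apply: teval_in_dom.
Qed.

Lemma cut_litP x p q r : ndom M x ->
  [/\ term_consts_in M (TAdd (TMul (num p) (TC x)) (num q)), term_consts_in M (num r) &
   atom_holds M (cut_lit x p q r) <-> p%:R * f x + q%:R <= r%:R].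
Proof.
move=> hx; have [p1 p2] := numP p; have [q1 q2] := numP q; have [r1 r2] := numP r.
have t1 : term_consts_in M (TMul (num p) (TC x)) by [].
have t2 : term_consts_in M (TAdd (TMul (num p) (TC x)) (num q)) by [].
split=> //; rewrite -[atom_holds _ _]/(nle M (teval M (TAdd (TMul (num p) (TC x)) (num q))) (teval M (num r))).
rewrite (isoS_le hM) ?r2; try exact: teval_in_dom.
rewrite -[teval M (TAdd _ _)]/(nadd M (teval M (TMul (num p) (TC x))) (teval M (num q))).
rewrite (isoS_D hM) ?q2; try exact: teval_in_dom.
rewrite -[teval M (TMul _ _)]/(nmul M (teval M (num p)) x) (isoS_M hM) ?p2 //; exact: teval_in_dom.
Qed.
Lemma CutAP x p q r : ndom M x -> CutA a x p q r <-> p%:R * f x + q%:R <= r%:R.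
Proof.
move=> hx; have [h1 h2 h3] := cut_litP p q r hx; rewrite /CutA litP.
by rewrite -[literal_holds _ _]/(atom_holds M (cut_lit x p q r)) h3; split=> [[]|].
Qed.
Lemma NcutAP x p q r : ndom M x -> NcutA a x p q r <-> ~ (p%:R * f x + q%:R <= r%:R).
Proof.
move=> hx; have [h1 h2 h3] := cut_litP p q r hx; rewrite /NcutA litP.
by rewrite -[literal_holds _ _]/(~ atom_holds M (cut_lit x p q r)) h3; split=> [[]|].
Qed.
End IndexSem.

Lemma cut_separate (u v : RR) : (u < v)%R -> exists p q r : nat,
  (p%:R * u + q%:R <= r%:R /\ ~ (p%:R * v + q%:R <= r%:R))%R.
Proof.
move=> /rat_in_itvoo [c]; rewrite in_itv /= => /andP [h1 h2].
have d0 : (0 < (`|denq c|%N)%:R :> RR)%R by rewrite ltr0n absz_gt0 denq_neq0.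
have [q [r e]] : exists q r : nat, (ratr c * (`|denq c|%N)%:R + q%:R = r%:R :> RR)%R.
  have e : (ratr c * (`|denq c|%N)%:R = (numq c)%:~R :> RR)%R.
    by rewrite [X in (_ * X)%R]pmulrn absz_denq /ratr mulrVK // unitfE intr_eq0 denq_neq0.
  rewrite e; case: (numq c) => n; first by exists 0, n; rewrite addr0.
  by exists n.+1, 0; rewrite NegzE mulrNz addNr.
exists `|denq c|%N, q, r; rewrite -e; split.
  by rewrite lerD2r mulrC ler_pM2r // ltW.
by apply/negP; rewrite -ltNge ltrD2r mulrC ltr_pM2l // mulrC ltr_pM2r.
Qed.

Lemma DiffAP S a M f S' a' M' f' x x' :
  wf_struct M -> index_of a M -> isoS M S f -> wf_struct M' -> index_of a' M' -> isoS M' S' f' ->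
  ndom M x -> ndom M' x' -> DiffA a x a' x' <-> f x <> f' x'.
Proof.
move=> w i h w' i' h' hx hx'; split.
  move=> [p [q [r [[]|[]]]]].
    by move=> /(CutAP w i h _ _ _ hx) h1 /(NcutAP w' i' h' _ _ _ hx') h2 e; rewrite e in h1.
  by move=> /(NcutAP w i h _ _ _ hx) h2 /(CutAP w' i' h' _ _ _ hx') h1 e; rewrite e in h2.
move=> /eqP; rewrite neq_lt => /orP [] /cut_separate [p [q [r [h1 h2]]]]; exists p, q, r; [left|right]; split.
- exact/(CutAP w i h).
- exact/(NcutAP w' i' h').
- exact/(NcutAP w i h).
- exact/(CutAP w' i' h').
Qed.
Opaque DomA ZeroA NzA OneA AddA MulA LtA DiffA.

(** The universe and the rational cuts of its elements are determined by the index, so one index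
    cannot present two sets of reals. *)
Lemma idxS_uniq S S' a : idxS S a -> idxS S' a -> forall r, S r -> S' r.
Proof.
move=> [M [f [w i h]]] [M' [f' [w' i' h']]] r /(isoS_onto h) [x [hx <-]].
have hx' : ndom M' x by apply/(DomAP i'); apply/(DomAP i).
suff -> : f x = f' x by apply: (isoS_in h').
by apply: contrapT => /(DiffAP w i h w' i' h' hx hx') /(DiffAP w i h w i h hx hx).
Qed.

Lemma numbered_of_index S a M f : racl S -> wf_struct M -> index_of a M -> isoS M S f ->
  exists e, [/\ computable e, (forall n, ndom M (e n)), (forall x, ndom M x -> exists n, e n = x) &
    numbered S (fun n => f (e n))].
Proof.
move=> hS w i h; have [w0 _] := w.
have h1 := RE_DomA; have h2 := RE_AddA; have h3 := RE_MulA; have h4 := RE_LtA.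
have [||e he [ed eo]] := RE_enum (P := fun x => DomA a x) (x0 := nzero M).
- by apply: (RE_app2 (P := DomA)); ctac.
- exact/(DomAP i).
have ed' n : ndom M (e n) by apply/(DomAP i).
exists e; split=> //; first by move=> x /(DomAP i) /eo.
apply: numbered_of_RE => //.
- move=> r; split=> [/(isoS_onto h) [x [/(DomAP i)/eo [n <-] <-]]|[n <-]]; first by exists n.
  exact: (isoS_in h).
- apply: (RE_ext (P := fun y : nat * nat * nat => AddA a (e y.1.1) (e y.1.2) (e y.2))).
    by move=> [[x y] z] /=; rewrite (AddAP w i h); split=> [[]|].
  by apply: (RE_app4 (P := AddA)); ctac.
- apply: (RE_ext (P := fun y : nat * nat * nat => MulA a (e y.1.1) (e y.1.2) (e y.2))).
    by move=> [[x y] z] /=; rewrite (MulAP w i h); split=> [[]|].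
  by apply: (RE_app4 (P := MulA)); ctac.
- apply: (RE_ext (P := fun y : nat * nat => LtA a (e y.1) (e y.2))).
    by move=> [x y] /=; rewrite (LtAP i h); split=> [[]|].
  by apply: (RE_app3 (P := LtA)); ctac.
Qed.

(* Judgements: (0, y, 0) for [y] in the closure, and (1, y, v), resp. (2, y, v), for [v] being
   the value at [y] of a polynomial, resp. of a nonzero polynomial, over the closure. *)
Definition cj := (nat * nat * nat)%type.
Definition cax (e : nat * seq nat) (j : cj) :=
  (exists i, is_true (i < size e.2) /\ j = (0, nth 0 e.2 i, 0)) \/
  (exists z, (ZeroA e.1 z \/ OneA e.1 z) /\ j = (0, z, 0)) \/
  (exists y, exists z, (DomA e.1 y /\ ZeroA e.1 z) /\ j = (1, y, z)).
(** The first clause gives differences and products. The second is a Horner step [v * y + c], with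
    tag 2 once a nonzero coefficient has been used; a value 0 with tag 2 thus shows, in the third,
    that [y] is a root of a nonzero polynomial. *)
Definition crule (e : nat * seq nat) (j a b : cj) :=
  (exists x, exists y, exists z, (a = (0, x, 0) /\ b = (0, y, 0)) /\
     ((AddA e.1 z y x \/ MulA e.1 x y z) /\ j = (0, z, 0))) \/
  (exists y, exists v, exists c, exists u, exists w,
     ((a = (1, y, v) \/ a = (2, y, v)) /\ b = (0, c, 0)) /\
     ((MulA e.1 v y u /\ AddA e.1 u c w) /\
      (j = (a.1.1, y, w) \/ (NzA e.1 c /\ j = (2, y, w))))) \/
  (exists y, exists z, a = (2, y, z) /\ (ZeroA e.1 z /\ j = (0, y, 0))).
Definition AclA a xs y := clos (cax (a, xs)) (crule (a, xs)) (0, y, 0).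

Lemma RE_AclA : RE (fun y : nat * seq nat * nat => AclA y.1.1 y.1.2 y.2).
Proof.
have h1 := RE_DomA; have h2 := RE_AddA; have h3 := RE_MulA; have h4 := RE_ZeroA; have h5 := RE_OneA; have h6 := RE_NzA.
have h : RE (fun y : nat * seq nat * cj => clos (cax y.1) (crule y.1) y.2).
  by apply: RE_clos; [rewrite /cax | rewrite /crule]; ctac.
apply: (RE_ext (P := fun y : nat * seq nat * nat => clos (cax y.1) (crule y.1) (0, y.2, 0))).
  by move=> [[a xs] y].
by apply: (RE_app1 (f := fun y : nat * seq nat * nat => (y.1, (0, y.2, 0))) h); ctac.
Qed.

Section AclSem.
Local Open Scope ring_scope.
Variables (S : RR -> Prop) (a : nat) (M : nstruct) (f : nat -> RR).
Hypotheses (hS : racl S) (wM : wf_struct M) (iM : index_of a M) (hM : isoS M S f).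
Variable xs : seq nat.
Hypothesis hxs : forall x, x \in xs -> ndom M x.

Definition csem (A : RR -> Prop) (j : cj) := let: (k, y, v) := j in
  if k is k'.+1 then [/\ ndom M y, ndom M v & exists P : {poly RR}, [/\ forall i, A P`_i, P.[f y] = f v &
    (if k' is 0%N then true else P != 0)]] else ndom M y /\ A (f y).

Lemma MXaddC_eq0 (P : {poly RR}) c : (P * 'X + c%:P == 0) = (P == 0) && (c == 0).
Proof.
apply/eqP/andP => [e|[/eqP -> /eqP ->]]; last by rewrite mul0r addr0.
have c0 : c = 0 by have := congr1 (fun q : {poly RR} => q`_0) e; rewrite coefD coefMX coefC /= add0r coef0.
split; last by rewrite c0.
by move: e; rewrite c0 addr0 => /eqP; rewrite mulf_eq0 polyX_eq0 orbF.
Qed.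

Lemma clos_csem A j : racl A -> (forall x, x \in xs -> A (f x)) ->
  clos (cax (a, xs)) (crule (a, xs)) j -> csem A j.
Proof.
move=> hA hx; elim=> {j} [j|j b c h _ IHb _ IHc].
  case=> [[i [hi ->]]|[[z [h ->]]|[y [z [[/(DomAP iM) h1 /(ZeroAP wM iM hM) [h2 h3]] ->]]]]] /=.
  - by split; [apply: hxs; apply: mem_nth | apply: hx; apply: mem_nth].
  - case: h => [/(ZeroAP wM iM hM)|/(OneAP wM iM hM)] [h1 ->]; split=> //.
      exact: (racl0 hA).
    exact: (racl1 hA).
  - by split=> //; exists 0; rewrite horner0 h3; split=> // i; rewrite coef0; exact: (racl0 hA).
case: h => [[x [y [z [[eb ec] [h ->]]]]]|[[y [v [d [u [w [[eb ec] [[/(MulAP wM iM hM) [hv hy hu eu] /(AddAP wM iM hM) [_ hd hw ew]] hj]]]]]]]|[y [z [eb [/(ZeroAP wM iM hM) [h1 h2] ->]]]]]].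
- move: IHb IHc; rewrite eb ec /= => -[hx1 hx2] [hy1 hy2].
  case: h => [/(AddAP wM iM hM) [h1 _ _ e]|/(MulAP wM iM hM) [_ _ h1 e]]; split=> //.
    by have -> : f z = f x - f y by [rewrite -e addrK]; exact: (raclB hA).
  by rewrite -e; exact: (raclM hA).
- have [_ Ad] : ndom M d /\ A (f d) by move: IHc; rewrite ec.
  have [k ek [P [hP Py Pk]]] : exists2 k, b = (k.+1, y, v)%N & exists P : {poly RR}, [/\ forall i, A P`_i, P.[f y] = f v &
    (if k is 0%N then true else P != 0)].
    by case: eb IHb => -> /= [_ _ [P hP]]; [exists 0%N | exists 1%N] => //; exists P.
  have Q1 i : A (P * 'X + (f d)%:P)`_i.
    rewrite coefD coefMX coefC; apply: (raclD hA); first by case: ifP => _ //; exact: (racl0 hA).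
    by case: ifP => _ //; exact: (racl0 hA).
  have Q2 : (P * 'X + (f d)%:P).[f y] = f w by rewrite !hornerE Py -ew -eu.
  case: hj => [->|[/(NzAP wM iM hM) [_ /eqP nd] ->]].
    rewrite ek /=; split=> //; exists (P * 'X + (f d)%:P); split=> //.
    by case: (k) Pk => // ?; rewrite MXaddC_eq0 => /negbTE ->.
  by split=> //; exists (P * 'X + (f d)%:P); split=> //; rewrite MXaddC_eq0 (negbTE nd) andbF.
- move: IHb; rewrite eb /= => -[hy _ [P [h3 h4 h5]]]; split=> //.
  by case: hA => _ hr; apply: (hr P) => //; apply/rootP; rewrite h4.
Qed.

(** Every relatively closed set containing the values of [xs] respects the rules. Conversely the
    values of derivable names form such a set: [S] is relatively closed, so the roots concerned are
    in [S] and have names. *)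
Lemma AclAP y : AclA a xs y <-> ndom M y /\ acl (map f xs) (f y).
Proof.
split=> [h|[hy h]].
  split; first by have [|//] := clos_csem hS _ h => x /hxs; exact: (isoS_in hM).
  move=> A hA hx; have [|//] := clos_csem hA _ h.
  by move=> x hx'; apply: hx; apply: map_f.
pose A r := exists z, [/\ ndom M z, f z = r & AclA a xs z].
have AS r : A r -> S r by move=> [z [hz <- _]]; exact: (isoS_in hM).
have onto r : S r -> exists2 z, ndom M z & f z = r by move=> /(isoS_onto hM) [z [? ?]]; exists z.
have A0 : A 0.
  have [z h1 h2] := onto _ (racl0 hS); exists z; split=> //; apply: clos_ax; right; left; exists z.
  by split=> //; left; apply/(ZeroAP wM iM hM).
have A1 : A 1.
  have [z h1 h2] := onto _ (racl1 hS); exists z; split=> //; apply: clos_ax; right; left; exists z.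
  by split=> //; right; apply/(OneAP wM iM hM).
have AB u v : A u -> A v -> A (u - v).
  move=> Au Av; have [z h1 h2] := onto _ (raclB hS (AS _ Au) (AS _ Av)).
  case: Au Av h2 => [x [x1 <- x3]] [x' [y1 <- y3]] h2; exists z; split=> //.
  apply: (clos_r _ x3 y3); left; exists x, x', z; split=> //; split=> //; left.
  by apply/(AddAP wM iM hM); split=> //; rewrite h2 subrK.
have AM u v : A u -> A v -> A (u * v).
  move=> Au Av; have [z h1 h2] := onto _ (raclM hS (AS _ Au) (AS _ Av)).
  case: Au Av h2 => [x [x1 <- x3]] [x' [y1 <- y3]] h2; exists z; split=> //.
  apply: (clos_r _ x3 y3); left; exists x, x', z; split=> //; split=> //; right.
  by apply/(MulAP wM iM hM).
have Aroot (p : {poly RR}) r : (forall i, A p`_i) -> p != 0 -> root p r -> A r.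
  move=> hp p0 rr; have Sr : S r by case: hS => _ hr; apply: (hr p) => // i; apply: AS.
  have [x h1 h2] := onto _ Sr.
  suff H (q : {poly RR}) : (forall i, A q`_i) -> exists v k, [/\ ndom M v, f v = q.[r],
      clos (cax (a, xs)) (crule (a, xs)) (k, x, v), k = 1%N \/ k = 2%N & q != 0 -> k = 2%N].
    have [v [k [v1 v2 v3 _ /(_ p0) ek]]] := H _ hp; rewrite ek in v3.
    exists x; split=> //; apply: (clos_r _ v3 v3); right; right; exists x, v; split=> //; split=> //.
    by apply/(ZeroAP wM iM hM); rewrite v2 (rootP rr).
  elim/poly_ind: q => [|q c IH] hq.
    have [z z1 z2] := onto _ (racl0 hS); exists z, 1%N; rewrite horner0; split=> //; [|by left|by rewrite eqxx].
    apply: clos_ax; do 2!right; exists x, z; split=> //.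
    by split; [apply/(DomAP iM) | apply/(ZeroAP wM iM hM)].
  have Ac : A c by have := hq 0%N; rewrite coefD coefMX coefC /= add0r.
  have [|v [k [v1 v2 v3 ek nk]]] := IH.
    by move=> i; have := hq i.+1; rewrite coefD coefMX coefC /= addr0.
  have Sv : S (f v) by exact: (isoS_in hM).
  have [u u1 u2] := onto _ (raclM hS Sv Sr).
  have [w w1 w2] := onto _ (raclD hS (raclM hS Sv Sr) (AS _ Ac)).
  have [d [d1 d2 d3]] := Ac.
  have e1 : MulA a v x u by apply/(MulAP wM iM hM); rewrite h2.
  have e2 : AddA a u d w by apply/(AddAP wM iM hM); rewrite u2 d2.
  have ew : f w = (q * 'X + c%:P).[r] by rewrite w2 !hornerE v2.
  have ra : (k, x, v) = (1, x, v)%N \/ (k, x, v) = (2, x, v)%N by case: ek => ->; [left|right].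
  case: (eqVneq c 0) => [c0|c0].
    exists w, k; split=> //; last by rewrite MXaddC_eq0 c0 eqxx andbT.
    apply: (clos_r _ v3 d3); right; left; exists x, v, d, u, w.
    exact: (conj (conj ra erefl) (conj (conj e1 e2) (or_introl erefl))).
  exists w, 2%N; split=> //; last by right.
  have e3 : NzA a d by apply/(NzAP wM iM hM); split=> //; apply/eqP; rewrite d2.
  apply: (clos_r _ v3 d3); right; left; exists x, v, d, u, w.
  exact: (conj (conj ra erefl) (conj (conj e1 e2) (or_intror (conj e3 erefl)))).
have hA : racl A.
  split=> [|p hp p0 x]; last exact: Aroot.
  (* Inverses are obtained as roots of [x *: 'X - 1]. *)
  split=> // x Ax; case: (eqVneq x 0) => [->|x0]; first by rewrite invr0.
  apply: (@Aroot (x *: 'X - 1)).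
  - move=> i; rewrite coefB coefZ coefX coef1; apply: (AB _ _); last by case: eqP.
    by apply: (AM _ _) => //; case: eqP.
  - apply: contraTneq x0 => /(congr1 (fun q : {poly RR} => q`_1)).
    by rewrite coefB coefZ coefX coef1 coef0 /= mulr1 subr0 => ->; rewrite eqxx.
  - by apply/rootP; rewrite !hornerE mulfV // subrr.
have [z [z1 z2 z3]] : A (f y).
  apply: h => // _ /mapP [x hx ->]; exists x; split=> //; first exact: hxs.
  apply: clos_ax; left; exists (index x xs); rewrite index_mem; split=> //.
  by rewrite nth_index.
by rewrite -(isoS_inj hM z1 hy z2).
Qed.
End AclSem.

(** * Upper and lower bounds *)

Lemma idxS_ext S S' a : (forall r, S r <-> S' r) -> idxS S a -> idxS S' a.
Proof. by move=> e; have -> : S = S' by apply/funext => r; apply/propext. Qed.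

Lemma indep_drop t : indep t <-> forall i, i < size t -> ~ acl (drop i.+1 t) (nth 0%R t i).
Proof.
elim: t => [|y t IH] //; rewrite /indep /= -/indep cats0; split=> [[h1 /IH h2] [|i]|h].
- by rewrite /= drop0.
- by rewrite ltnS /=; apply: h2.
- split; first by have := h 0 isT; rewrite /= drop0.
  by apply/IH => i hi; exact: (h i.+1 hi).
Qed.

(** An element of [S] outside the closure could be put in front of [t]. *)
Lemma acl_of_maximal S t : racl S -> (forall r, r \in t -> S r) -> indep t ->
  ~ (exists t', [/\ size t' = (size t).+1, forall r, r \in t' -> S r & indep t']) ->
  forall r, S r <-> acl t r.
Proof.
move=> hS ht it h r; split=> [Sr|]; last by move=> /(_ _ hS ht).
apply: contrapT => nr; apply: h; exists (r :: t); split=> //.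
  by move=> z; rewrite inE => /orP [/eqP -> //|/ht].
by rewrite /indep /= cats0.
Qed.

Lemma names_of S M f (t : seq RR) : isoS M S f -> (forall r, r \in t -> S r) ->
  exists2 xs : seq nat, map f xs = t & forall x, x \in xs -> ndom M x.
Proof.
move=> h; elim: t => [|r t IH] ht; first by exists [::].
have [x [hx e]] := isoS_onto h (ht r (mem_head r t)).
have [|xs e1 e2] := IH; first by move=> z hz; apply: ht; rewrite inE hz orbT.
by exists (x :: xs) => /= [|y]; rewrite ?e ?e1 // inE => /orP [/eqP ->|/e2].
Qed.

(** * Upper bounds *)

Section Upper.
Variables (S : RR -> Prop) (a0 : nat).
Hypotheses (hS : racl S) (ha0 : idxS S a0).

Lemma upper_infinite : exists Rs : nat -> Prop, Pi0 3 Rs /\ forall a, idxS S a <-> Rs a /\ IK a.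
Proof.
have h1 := RE_DomA; have h2 := RE_DiffA.
(* [DomA a x] stands under the negation, so that any [x'] serves for an [x] outside the universe.
   The matrix is then an enumerable and a co-enumerable condition, hence Sigma2 after the quantifier
   on [x']. *)
pose A a x := exists x', DomA a0 x' /\ ~ (DomA a x /\ DiffA a x a0 x').
pose B a x := exists x', DomA a x' /\ ~ (DomA a0 x /\ DiffA a0 x a x').
exists (fun a => forall x, A a x /\ B a x); split.
  apply/Sig3P; apply: Sig3_of_Sig2; apply: Sig2_and; apply: Sig2_ex; apply: Sig2_and.
  - by apply: Sig2_RE; apply: (RE_app2 (P := DomA)); ctac.
  - by apply: Sig2_coRE; apply: RE_and; [apply: (RE_app2 (P := DomA)) | apply: (RE_app4 (P := DiffA))]; ctac.
  - by apply: Sig2_RE; apply: (RE_app2 (P := DomA)); ctac.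
  - by apply: Sig2_coRE; apply: RE_and; [apply: (RE_app2 (P := DomA)) | apply: (RE_app4 (P := DiffA))]; ctac.
have [M0 [f0 [w0 i0 j0]]] := ha0; have [z0 _] := w0.
move=> a; split=> [ha|[HR /IKP [S' hS' ha]]].
  split; last by apply/IKP; exists S.
  have [M [f [w i j]]] := ha; have [z _] := w; move=> x; split.
  - case: (pselect (ndom M x)) => hx; last first.
      by exists (nzero M0); split; [apply/(DomAP i0) | move=> [/(DomAP i) /hx]].
    have [x' [hx' e]] := isoS_onto j0 (isoS_in j hx); exists x'; split; first by apply/(DomAP i0).
    by move=> [_ /(DiffAP w i j w0 i0 j0 hx hx')]; rewrite e.
  - case: (pselect (ndom M0 x)) => hx; last first.
      by exists (nzero M); split; [apply/(DomAP i) | move=> [/(DomAP i0) /hx]].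
    have [x' [hx' e]] := isoS_onto j (isoS_in j0 hx); exists x'; split; first by apply/(DomAP i).
    by move=> [_ /(DiffAP w0 i0 j0 w i j hx hx')]; rewrite e.
apply: (idxS_ext _ ha); have [M [f [w i j]]] := ha; move=> r; split.
  move=> /(isoS_onto j) [x [hx <-]]; have [[x' [/(DomAP i0) hx' h]] _] := HR x.
  suff -> : f x = f0 x' by apply: (isoS_in j0).
  by apply: contrapT => /(DiffAP w i j w0 i0 j0 hx hx') d; apply: h; split=> //; apply/(DomAP i).
move=> /(isoS_onto j0) [x [hx <-]]; have [_ [x' [/(DomAP i) hx' h]]] := HR x.
suff -> : f0 x = f x' by apply: (isoS_in j).
by apply: contrapT => /(DiffAP w0 i0 j0 w i j hx hx') d; apply: h; split=> //; apply/(DomAP i0).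
Qed.

Variable (t : seq RR).
Hypotheses (ht : forall r, r \in t -> S r) (it : indep t).
Hypothesis tmax : ~ (exists t', [/\ size t' = (size t).+1, forall r, r \in t' -> S r & indep t']).

(** A field of the class that contains the values of [t] and has no larger independent tuple is the
    closure of [t], as [S] is. The clause for empty [t] is what turns a difference of Sigma2 sets
    into a Pi2 set in degree 0. *)
Lemma upper_finite : exists P1 P2 : nat -> Prop, [/\ Sigma0 2 P1, Sigma0 2 P2, t = [::] -> forall a, IK a -> P1 a &
  forall a, idxS S a <-> (P1 a /\ ~ P2 a) /\ IK a].
Proof.
have h1 := RE_DomA; have h2 := RE_DiffA; have h3 := RE_AclA.
have [M0 [f0 [w0 i0 j0]]] := ha0; have [xs0 ex0 dx0] := names_of j0 ht.
have sx0 : size xs0 = size t by rewrite -ex0 size_map.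
pose n := size t.
pose P1 a := exists ys : seq nat, (size ys = n /\ forall i, i < n -> DomA a (nth 0 ys i)) /\
  ~ (exists i, is_true (i < n) /\ DiffA a0 (nth 0 xs0 i) a (nth 0 ys i)).
pose P2 a := exists zs : seq nat, (size zs = n.+1 /\ forall i, i < n.+1 -> DomA a (nth 0 zs i)) /\
  ~ (exists i, is_true (i < n.+1) /\ AclA a (drop i.+1 zs) (nth 0 zs i)).
have P1P a S' M f : wf_struct M -> index_of a M -> isoS M S' f -> (P1 a <-> forall r, r \in t -> S' r).
  move=> w i j; split.
    move=> [ys [[sy dy] h]] r; rewrite -ex0 => /mapP [x hx ->].
    have hi : index x xs0 < n by rewrite /n -sx0 index_mem.
    have hy := (DomAP i _).1 (dy _ hi); suff -> : f0 x = f (nth 0 ys (index x xs0)) by apply: (isoS_in j).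
    apply: contrapT => /(DiffAP w0 i0 j0 w i j (dx0 _ hx) hy) d; apply: h.
    by exists (index x xs0); rewrite nth_index.
  move=> hr.
  have [ys ey dy] := names_of j hr.
  have sy : size ys = n by rewrite /n -ey size_map.
  exists ys; split; first by split=> // k hk; apply/(DomAP i); apply: dy; apply: mem_nth; rewrite sy.
  move=> [k [hk]]; have d1 : ndom M0 (nth 0 xs0 k) by apply: dx0; apply: mem_nth; rewrite sx0.
  have d2 : ndom M (nth 0 ys k) by apply: dy; apply: mem_nth; rewrite sy.
  move=> /(DiffAP w0 i0 j0 w i j d1 d2); apply.
  by rewrite -(nth_map 0 0%R f0) ?sx0 // -(nth_map 0 0%R f) ?sy // ex0 ey.
have P2P a S' M f : racl S' -> wf_struct M -> index_of a M -> isoS M S' f ->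
    (P2 a <-> exists t', [/\ size t' = n.+1, forall r, r \in t' -> S' r & indep t']).
  move=> hS' w i j; split.
    move=> [zs [[sz dz] h]]; have dz' x : x \in zs -> ndom M x.
      by move=> /(nthP 0) [k hk <-]; apply/(DomAP i); apply: dz; rewrite -sz.
    exists (map f zs); rewrite size_map; split=> //.
      by move=> _ /mapP [x /dz' hx ->]; apply: (isoS_in j).
    apply/indep_drop => k; rewrite size_map => hk; rewrite (nth_map 0) // -map_drop => hacl.
    apply: h; exists k; rewrite -sz; split=> //; apply/(AclAP hS' w i j).
      by move=> x /mem_drop /dz'.
    by split=> //; apply: dz'; apply: mem_nth.
  move=> [t' [st' ht' /indep_drop it']].
  have [zs ez dz] := names_of j ht'.
  have sz : size zs = n.+1 by rewrite -st' -ez size_map.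
  exists zs; split; first by split=> // k hk; apply/(DomAP i); apply: dz; apply: mem_nth; rewrite sz.
  move=> [k [hk /(AclAP hS' w i j)]]; case; first by move=> x /mem_drop /dz.
  move=> dk; rewrite map_drop -(nth_map 0 0%R f) ?sz // ez; apply: it'; by rewrite st'.
exists P1, P2; split.
- apply/Sig2P; apply: Sig2_ex; apply: Sig2_and; first by apply: Sig2_RE; apply: RE_and; ctac.
  by apply: Sig2_coRE; apply: RE_ex; apply: RE_and; [by ctac | apply: (RE_app4 (P := DiffA)); ctac].
- apply/Sig2P; apply: Sig2_ex; apply: Sig2_and; first by apply: Sig2_RE; apply: RE_and; ctac.
  by apply: Sig2_coRE; apply: RE_ex; apply: RE_and; [by ctac | apply: (RE_app3 (P := AclA)); ctac; apply: comp_drop; ctac].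
- move=> e a /IKP [S' _ [M [f [w i j]]]]; apply/(P1P _ _ _ _ w i j); by rewrite e.
move=> a; split=> [ha|[[p1 p2] /IKP [S' hS' ha]]].
  have [M [f [w i j]]] := ha; split; last by apply/IKP; exists S.
  by split; [apply/(P1P _ _ _ _ w i j) | move=> /(P2P _ _ _ _ hS w i j)].
apply: (idxS_ext _ ha); have [M [f [w i j]]] := ha.
have e1 := acl_of_maximal hS ht it tmax.
have e2 : forall r, S' r <-> acl t r.
  apply: acl_of_maximal => //; first by apply/(P1P _ _ _ _ w i j).
  by move=> /(P2P _ _ _ _ hS' w i j).
by move=> r; rewrite e1 e2.
Qed.
End Upper.

Lemma chain_index C nu (Fs : nat -> RR -> Prop) (T : nat -> nat -> Prop) : numbered C nu ->
  (forall k, racl (Fs k)) -> (forall k r, Fs k r -> Fs k.+1 r) -> (forall k r, Fs k r -> C r) ->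
  RE (fun y : nat * nat => Fs y.1 (nu y.2)) -> Sig2 (fun y : nat * nat => T y.1 y.2) ->
  exists2 f, computable_fun f & forall n, idxS (Bset Fs T n) (f n) /\ IK (f n).
Proof.
move=> hn hF hmono hC [Q hQ QP] [P hP PP].
have [||||f hf h] := chain (nb_add hn) (nb_mul hn) (nb_lt hn) (Q := fun k x m => Q (k, x) m) (Fs := Fs)
  _ hF hmono _ (T := T) (P := fun n k u v => P (n, k) u v).
- by ctac.
- move=> k r; split=> [Fr|[x [<- [m hm]]]]; last by apply/(QP (k, x)); exists m.
  by have [x e] := (nb_im hn r).1 (hC _ _ Fr); exists x; split=> //; apply/(QP (k, x)); rewrite /= e.
- by ctac.
- by move=> n k; exact: (PP (n, k)).
exists f => // n; split=> //; apply/IKP; exists (Bset Fs T n) => //.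
exact: Bset_racl.
Qed.

(** * Lower bounds *)

Section Lower.
Variables (S : RR -> Prop) (a0 : nat).
Hypotheses (hS : racl S) (ha0 : idxS S a0).

Lemma lower_infinite : (forall n, exists t, [/\ size t = n, forall r, r \in t -> S r & indep t]) ->
  forall X, Pi0 3 X -> exists f, computable_fun f /\ (forall n, IK (f n)) /\ forall n, X n <-> idxS S (f n).
Proof.
move=> hinf X /Sig3P [Q hQ QP]; have [M [g [w i j]]] := ha0.
have [e [he ed eo hn]] := numbered_of_index hS w i j.
(* The first [k] elements of an enumeration of the universe, independent or not: only their number
   will count. *)
pose Fs k := acl (rseq (fun n => g (e n)) k).
have Fmono k r : Fs k r -> Fs k.+1 r.
  by apply: acl_sub => x hx; apply: acl_in; rewrite /= inE hx orbT.
have FS k r : Fs k r -> S r.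
  by apply=> // _ /rseqP [m _ ->]; apply: (isoS_in j).
(* The complement of [X] is Sigma3 with matrix [Q], so [X n] means that [T n k] holds for all
   [k]. *)
pose T n k := exists u, forall v, ~ Q n k u v.
have [|||f hf h] := chain_index (Fs := Fs) (T := T) hn _ Fmono FS.
- by move=> k; apply: acl_racl.
- apply: (RE_ext (P := fun y : nat * nat => AclA a0 (rseq e y.1) (e y.2))).
    move=> [k x] /=; rewrite (AclAP hS w i j); last first.
      by elim: k => //= k IH z; rewrite inE => /orP [/eqP ->|/IH].
    have -> : map g (rseq e k) = rseq (fun n => g (e n)) k by elim: k => //= k ->.
    by split=> [[]|].
  have hr : computable (fun k => rseq e k).
    apply: (comp_ext (f := fun k => iteri k (fun i s => e i :: s) [::])); last by ctac.
    by elim=> //= k ->.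
  by have h3 := RE_AclA; apply: (RE_app3 (P := AclA)); ctac; apply: (comp_app (g := fun k => rseq e k)); ctac.
- by exists (fun y u v => ~ Q y.1 y.2 u v); first by ctac.
exists f; split=> //; split=> [n|n]; first by case: (h n).
have [hb _] := h n; split=> [Xn|ha].
  apply: idxS_ext hb => r; split=> [[k [_ /FS]] //|].
  move=> /(isoS_onto j) [x [/eo [m <-] <-]]; exists m.+1; split.
    move=> k _; apply: contrapT => nT; apply: ((QP n).2 _) Xn; exists k => u.
    by apply: contrapT => nv; apply: nT; exists u => v hv; apply: nv; exists v.
  by apply: acl_in; apply: (mem_rseq (fun n => g (e n))).
(* When [T n k] fails, the presented set is contained in the closure of [k] elements, which has no
   room for [k + 1] independent ones. *)
apply: contrapT => nX; have [k hk] := (QP n).1 nX.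
have [t [st tS ti]] := hinf k.+1.
suff : size t <= size (rseq (fun n => g (e n)) k) by rewrite st size_rseq ltnn.
apply: (indep_size ti) => y /tS Sy.
rewrite cats0; have [m [hm Fm]] := idxS_uniq ha hb Sy.
have mk : m <= k.
  by rewrite leqNgt; apply/negP => /hm [u hu]; have [v hv] := hk u; apply: hu hv.
exact: (Fs_leq Fmono mk Fm).
Qed.

Lemma lower_finite t : (forall r, r \in t -> S r) -> indep t ->
  forall X1 X2, Sigma0 2 X1 -> Sigma0 2 X2 -> (t = [::] -> forall n, X1 n) ->
  exists f, computable_fun f /\ (forall n, IK (f n)) /\ forall n, (X1 n /\ ~ X2 n) <-> idxS S (f n).
Proof.
move=> ht it X1 X2 /Sig2P [Q1 hQ1 QP1] /Sig2P [Q2 hQ2 QP2] X1t; have [M [g [w i j]]] := ha0.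
have [e [he ed eo hn]] := numbered_of_index hS w i j.
have [C [nuC [hnC SC [r1 Cr1 Sr1] hSC]]] := extension hn.
(* One basis element is dropped. For empty [t] there is none, and the hypothesis on [X1] prevents
   the construction from staying at level 0. *)
pose t1 := behead t.
have t1S r : r \in t1 -> S r by move=> /mem_behead /ht.
have [xs exs dxs] := names_of j t1S.
pose Fs k := match k with 0 => acl t1 | 1 => S | _ => C end.
have F0S r : acl t1 r -> S r by apply=> //.
have Fmono k r : Fs k r -> Fs k.+1 r by case: k => [|[|k]] //=; [apply: F0S | apply: SC].
have FC k r : Fs k r -> C r by case: k => [|[|k]] //= => [/F0S|]; apply: SC.
pose T n k := if k is 0 then X1 n else X2 n.
have [|||f hf h] := chain_index (Fs := Fs) (T := T) hnC _ Fmono FC.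
- by case=> [|[|k]]; [apply: acl_racl | | apply: (nb_racl hnC)].
(* Names here are those of [C]; an element is recognised as lying in [S] by finding a name of [S]
   with the same value. *)
- apply: (RE_ext (P := fun y : nat * nat => (y.1 = 0 /\ exists s, g (e s) = nuC y.2 /\ AclA a0 xs (e s)) \/
    ((y.1 = 1 /\ exists s, g (e s) = nuC y.2) \/ is_true (1 < y.1)))).
    move=> [[|[|k]] x] /=; split.
    + by case=> [[_ [s [<- /(AclAP hS w i j dxs) [_]]]]|[[]|]] //; rewrite exs.
    + move=> hx; left; split=> //; have [s hs] := (nb_im hn _).1 (F0S _ hx); exists s; split=> //.
      by apply/(AclAP hS w i j dxs); rewrite exs hs.
    + by case=> [[]|[[_ [s <-]]|]] //; apply/(nb_im hn); exists s.
    + by move=> /(nb_im hn) [s hs]; right; left; split=> //; exists s.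
    + by move=> _; apply/(nb_im hnC); exists x.
    + by move=> _; right; right.
  have h3 := RE_AclA.
  have g1 (U : Type) (cU : cod U) (u v : U -> nat) : computable u -> computable v ->
      RE (fun y => g (e (u y)) = nuC (v y)).
    by move=> hu hv; apply: (RE_app1 (f := fun y => (u y, v y)) hSC); ctac.
  apply: RE_or; first apply: RE_and; first by ctac.
    apply: RE_ex; apply: RE_and; first by apply: g1; ctac.
    by apply: (RE_app3 (P := AclA)); ctac.
  apply: RE_or; last by ctac.
  by apply: RE_and; [by ctac | apply: RE_ex; apply: g1; ctac].
- exists (fun y u v => (y.2 = 0 /\ Q1 y.1 u v) \/ (y.2 <> 0 /\ Q2 y.1 u v)); first by ctac.
  move=> [n [|k]] /=; rewrite ?QP1 ?QP2; split=> -[u hu]; exists u => v.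
  - by left.
  - by case: (hu v) => [[]|[]].
  - by right.
  - by case: (hu v) => [[]|[]].
exists f; split=> //; split=> [n|n]; first by case: (h n).
have [hb _] := h n; split=> [[x1 x2]|ha].
  apply: idxS_ext hb => r; split=> [[[|[|k]] [hk Fr]]|Sr].
  - exact: F0S.
  - exact: Fr.
  - by have := hk 1 isT.
  - by exists 1; split=> // -[|].
(* Otherwise the presented set is [acl t1], which misses the first element of [t] by
   independence. *)
have x1 : X1 n.
  apply: contrapT => x1; case et: t it ht X1t => [|y t'] /=; first by move=> _ _ /(_ erefl n).
  rewrite /indep /= cats0 => -[hy _] /(_ y (mem_head y t')) Sy _; apply: hy.
  have [[|k] [hk]] := idxS_uniq ha hb Sy; first by rewrite /Fs /t1 et.
  by have := hk 0 isT.
(* With both conditions true all of [C] would be presented, including [r1] outside [S]. *)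
split=> // x2; apply: Sr1; apply: (idxS_uniq hb ha); exists 2; split=> //.
by case=> [|[|]].
Qed.
End Lower.

Theorem theorem4p2 (R : rcfType) (Rarch : archimedean R) (Rcomp : exists a, Iset R a) :
  (trdeg_eq R 0 -> m_complete_within (Pi0 2) (Iset R) IK) /\
  ((exists n, 0 < n /\ trdeg_eq R n) -> m_complete_within dSigma2 (Iset R) IK) /\
  (trdeg_infinite R -> m_complete_within (Pi0 3) (Iset R) IK).
Proof.
have [j jle] := arch_embed Rarch; pose S x := exists y, j y = x.
have hS : racl S by exact: range_racl.
have [a0 /(Iset_embed _ jle) ha0] := Rcomp.
have -> : Iset R = idxS S by apply/funext => a; apply/propext; exact: Iset_embed.
have fin n : trdeg_eq R n -> exists t, [/\ size t = n, forall r, r \in t -> S r, indep t &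
    ~ (exists t', [/\ size t' = (size t).+1, forall r, r \in t' -> S r & indep t'])].
  move=> [/(indep_embed j) [t [st ht it]] hmax]; exists t; split=> //; rewrite st => h; apply: hmax.
  exact/(indep_embed j).
split; [|split].
- move=> /fin [t [/size0nil t0 ht it tmax]].
  have [P1 [P2 [s1 s2 p1 hP]]] := upper_finite hS ha0 ht it tmax; split.
    exists (fun a => ~ P2 a); split; last first.
      by move=> a; rewrite hP; split=> [[[]]|[h1 h2]] //; do 2!split=> //; apply: p1.
    by apply/Sig2P; move/Sig2P: s2; apply: Sig2_ext => a; split=> [h|/contrapT].
  move=> X hX.
  (* A Pi2 set is the difference of the set of all numbers and its own Sigma2 complement. *)
  have hT : Sigma0 2 (fun=> True) by apply/Sig2P; apply: Sig2_RE; ctac.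
  have [//|f [h1 [h2 h3]]] := lower_finite hS ha0 ht it hT hX.
  exists f; split=> //; split=> // n; by rewrite -h3; split=> [h|[_ /contrapT]] //; split.
- move=> [n [n0 /fin [t [st ht it tmax]]]].
  have [P1 [P2 [s1 s2 _ hP]]] := upper_finite hS ha0 ht it tmax; split.
    by exists (fun a => P1 a /\ ~ P2 a); split=> //; exists P1, P2.
  move=> X [X1 [X2 [hX1 [hX2 hX]]]].
  have [|f [h1 [h2 h3]]] := lower_finite hS ha0 ht it hX1 hX2.
    by move=> t0; move: n0; rewrite -st t0.
  by exists f; split=> //; split=> // k; rewrite -h3.
- move=> hinf; split; first exact: upper_infinite hS ha0.
  apply: (lower_infinite hS ha0) => n; have [x hx] := hinf n.
  by apply/(indep_embed j); exists x.
Qed.
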